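(* Let $\lambda>1$, let $n\ge2$ be an integer, and let $1\le K\le n-1$ be an integer. Then $$b_n(\lambda)=\frac{\Gamma\left(n+\frac12\right)(\lambda-1)^{2n+1}}{\left(2\pi(\lambda-\log\lambda-1)\right)^{\frac12}(\lambda-\log\lambda-1)^n}\left(\sum_{k=0}^{K-1}(-1)^k(\lambda-\log\lambda-1)^ka_{2k}\frac{\Gamma\left(n-k+\frac12\right)}{\Gamma\left(n+\frac12\right)}+A_K(n,\lambda)\right),$$ where $$|A_K(n,\lambda)|\le(\lambda-\log\lambda-1)^K|a_{2K}|\frac{\Gamma\left(n-K+\frac12\right)}{\Gamma\left(n+\frac12\right)}+(\lambda-\log\lambda-1)^{K+1}|a_{2K+2}|\frac{\Gamma\left(n-K-\frac12\right)}{\Gamma\left(n+\frac12\right)}.$$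
   Context: The coefficients are $$b_n(\lambda)=(-1)^n(\lambda-1)^n\left[\frac{d^n}{dt^n}\left(\frac{(\lambda-1)t}{\lambda e^t-t-\lambda}\right)^{n+1}\right]_{t=0},\qquad a_n=\frac{1}{2^{n/2}\Gamma(\frac n2+1)}\left[\frac{d^n}{dt^n}\left(\frac12\frac{t^2}{e^t-t-1}\right)^{\frac{n+1}2}\right]_{t=0},$$ where the power in the second formula is the branch equal to $1$ at $t=0$ (both functions being differentiated have removable singularities at $t=0$ with value $1$). *)

(* Defs.v *)
From Stdlib Require Import Reals.
From Coquelicot Require Import Coquelicot.
Open Scope R_scope.

(** Euler's integral; [RInt_gen] is total, and this is the Gamma function for
    [0 < x] only. *)
Definition Gamma (x : R) : R :=
  RInt_gen (fun t : R => Rpower t (x - 1) * exp (- t))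
           (at_right 0) (Rbar_locally p_infty).

(** The denominator vanishes at [t = 0], where the singularity is removable
    (for [lambda <> 1]) with value [1].  Its other zeros are irrelevant: only
    derivatives at [0] are taken. *)
Definition b_base (lambda t : R) : R :=
  if Req_EM_T t 0 then 1
  else (lambda - 1) * t / (lambda * exp t - t - lambda).

Definition b (n : nat) (lambda : R) : R :=
  (-1) ^ n * (lambda - 1) ^ n *
  Derive_n (fun t : R => b_base lambda t ^ (n + 1)) n 0.

(** The singularity at [t = 0] is removable, with value [1]. *)
Definition a_base (t : R) : R :=
  if Req_EM_T t 0 then 1
  else / 2 * (t ^ 2 / (exp t - t - 1)).

(** [a_base] is positive on the whole real line, so [Rpower] gives the branch
    of the power that equals [1] at [t = 0]. *)
Definition a (n : nat) : R :=
  / (Rpower 2 (INR n / 2) * Gamma (INR n / 2 + 1)) *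
  Derive_n (fun t : R => Rpower (a_base t) ((INR n + 1) / 2)) n 0.

(* Main.v *)
Require Import Defs.
From Stdlib Require Import Reals Ranalysis5 List Factorial Lra Lia Psatz ClassicalEpsilon FunctionalExtensionality.
From Coquelicot Require Import Coquelicot.
Open Scope R_scope.

(** Write [c = lambda - ln lambda - 1] and let [mu] be Binet's function, the remainder in
    Stirling's formula for the logarithm of the Gamma function.  The proof rests on the
    exact formula [b_Phi_moment],
    [b n lambda = (lambda - 1)^(2n+1) sqrt (2 / PI) *
       int_0^oo x^(2n) exp (- mu (x^2)) exp (- c x^2) dx],
    and on the fact that the numbers [a (2k)] are the coefficients of Stirling's series:
    [exp (- mu z)] has the asymptotic expansion [sum_k (-1)^k a (2k) / z^k].  Integrating the
    first [K] terms gives the sum in the theorem, because the Gaussian moments are values of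
    the Gamma function at half integers.  The error bound is the integral of the bound
    [stirling_bound]: the error of a partial sum of the expansion of [exp (- mu z)] is at
    most the sum of the absolute values of the first two omitted terms, for every [z > 0].

    For that bound, [exp (mu z) - 1] is the Laplace transform of the smooth function
    [rk = k + k * k / 2! + k * k * k / 3! + ...] (convolution powers), where [k] is Binet's
    density, and [1 - exp (- mu z)] that of [v |-> rk (- v)].  The even part of [rk] and
    the derivative of its odd part are positive definite ([rs_pd], [rc_der_pd]): their
    cosine transforms, damped by [exp (- x v)], are [sinh C * cos S] and
    [s * sinh C * sin S], where [C - i S] is the transform of [k] at [x + i s],
    and there [C >= 0] and [0 <= S <= PI / 2].  That [C >= 0] comes from the partial
    fractions of [coth], in a finite form.  The even derivatives of a positive definite
    function are largest at the origin, so Taylor's formula with remainder bounds each of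
    the two parts by its first omitted term.

    The coefficients are identified through [binet]: the integral of
    [exp (- z (exp t - t - 1))] over the line equals [sqrt (2 PI / z) * exp (mu z)], since
    both sides satisfy the recurrence of the Gamma function and their quotient tends
    to [1].  Its expansion at the saddle point has as coefficients the derivatives of the
    inverse of [t |-> (2 (exp t - t - 1))^(1/2)], the root taken with the sign of [t], which [lagrange_inversion] turns into those
    that define [a (2k)].

    For the exact formula, [lagrange_inversion] turns [b n lambda] into a derivative of the
    inverse [T] of [t |-> lambda (exp t - 1) - t], and [T' u = 1 / (lambda exp (T u) - 1)].  It
    remains to know that [1 / (lambda - 1)] is the Laplace transform of
    [z^z exp (- z) / Gamma (z + 1)] at [lambda - 1 - ln lambda] ([L_value]).  This is the
    limit of the sum of Rothe's binomial series ([rothe]), whose terms are, up to vanishing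
    errors, the values of the integrand at the points of a mesh ([rothe_term_bounds]);
    the integrand is monotone, so that the sums converge to the integral. *)


(** * Integrals of continuous functions *)

(* [ring] reads the carrier off the left-hand side, which for a bare [RInt] is
   not syntactically [R]. *)
Ltac rring := apply Rminus_diag_uniq; ring.

Definition cont (f : R -> R) : Prop := forall x, continuous f x.

Lemma cont_const c : cont (fun _ => c).
Proof. intros x; apply continuous_const. Qed.
Lemma cont_id : cont (fun x => x).
Proof. intros x; apply continuous_id. Qed.
Lemma cont_plus f g : cont f -> cont g -> cont (fun x => f x + g x).
Proof. intros Hf Hg x; apply (continuous_plus f g x); auto. Qed.
Lemma cont_opp f : cont f -> cont (fun x => - f x).
Proof. intros Hf x; apply (continuous_opp f x); auto. Qed.
Lemma cont_minus f g : cont f -> cont g -> cont (fun x => f x - g x).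
Proof. intros Hf Hg x; apply (continuous_minus f g x); auto. Qed.
Lemma cont_mult f g : cont f -> cont g -> cont (fun x => f x * g x).
Proof. intros Hf Hg x; apply (continuous_mult f g x); auto. Qed.
Lemma cont_comp f g : cont f -> cont g -> cont (fun x => g (f x)).
Proof. intros Hf Hg x; apply (continuous_comp f g x); auto. Qed.
Lemma cont_der f : (forall x, ex_derive f x) -> cont f.
Proof. intros Hf x; apply (ex_derive_continuous f x); auto. Qed.
Lemma cont_exp f : cont f -> cont (fun x => exp (f x)).
Proof.
  intros Hf; apply (cont_comp f exp); auto.
  apply cont_der; intros x; auto_derive; auto.
Qed.
Lemma cont_cos f : cont f -> cont (fun x => cos (f x)).
Proof.
  intros Hf; apply (cont_comp f cos); auto.
  apply cont_der; intros x; auto_derive; auto.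
Qed.
Lemma cont_sin f : cont f -> cont (fun x => sin (f x)).
Proof.
  intros Hf; apply (cont_comp f sin); auto.
  apply cont_der; intros x; auto_derive; auto.
Qed.
Lemma cont_pow f n : cont f -> cont (fun x => f x ^ n).
Proof.
  intros Hf; apply (cont_comp f (fun y => y ^ n)); auto.
  apply cont_der; intros x; auto_derive; auto.
Qed.
Lemma cont_abs f : cont f -> cont (fun x => Rabs (f x)).
Proof.
  intros Hf; apply (cont_comp f Rabs); auto.
  intros x; apply (continuous_Rabs x).
Qed.
Lemma cont_inv f : cont f -> (forall x, f x <> 0) -> cont (fun x => / f x).
Proof.
  intros Hf Hn x. apply (continuous_comp f Rinv x); auto.
  apply (ex_derive_continuous Rinv (f x)). auto_derive; auto.
Qed.
Lemma cont_div f g : cont f -> cont g -> (forall x, g x <> 0) ->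
  cont (fun x => f x / g x).
Proof. intros; apply cont_mult; auto; now apply cont_inv. Qed.
Lemma cont_affine a b f : cont f -> cont (fun x => f (a * x + b)).
Proof.
  intros Hf; apply (cont_comp (fun x => a * x + b) f); auto.
  apply cont_plus; [apply cont_mult|]; auto using cont_const, cont_id.
Qed.
Lemma cont_neg f : cont f -> cont (fun x => f (- x)).
Proof. intros Hf; apply (cont_comp (fun x => - x) f); auto using cont_opp, cont_id. Qed.
Lemma cont_refl f : cont f -> forall a, cont (fun x => f (a - x)).
Proof.
  intros Hf a; apply (cont_comp (fun x => a - x) f); auto using cont_minus, cont_const, cont_id.
Qed.

Ltac ct := repeat match goal with
  | _ => assumption
  | |- cont (fun _ => ?c) => exact (cont_const c)
  | |- cont (fun x => x) => exact cont_id
  | |- cont (fun x => @?f x + @?g x) => apply (cont_plus f g)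
  | |- cont (fun x => @?f x - @?g x) => apply (cont_minus f g)
  | |- cont (fun x => - @?f x) => apply (cont_opp f)
  | |- cont (fun x => @?f x * @?g x) => apply (cont_mult f g)
  | |- cont (fun x => @?f x / @?g x) => apply (cont_div f g)
  | |- cont (fun x => / @?f x) => apply (cont_inv f)
  | |- cont exp => exact (cont_exp (fun x => x) cont_id)
  | |- cont (fun x => exp (@?f x)) => apply (cont_exp f)
  | |- cont (fun x => cos (@?f x)) => apply (cont_cos f)
  | |- cont (fun x => sin (@?f x)) => apply (cont_sin f)
  | |- cont (fun x => @?f x ^ ?n) => apply (cont_pow f n)
  | |- cont (fun x => Rabs (@?f x)) => apply (cont_abs f)
  | H : cont ?f |- cont (fun x => ?f (@?g x)) => apply (cont_comp g f); [|exact H]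
  | H : forall y, cont (@?f y) |- cont _ => solve [apply H]
  end.

Lemma exR f a b : cont f -> ex_RInt f a b.
Proof. intros Hf; apply (ex_RInt_continuous f); auto. Qed.

Section Finite.
Variables (f g : R -> R).
Hypotheses (Hf : cont f) (Hg : cont g).

Lemma RI_plus a b : RInt (fun x => f x + g x) a b = RInt f a b + RInt g a b :> R.
Proof. apply (RInt_plus f g a b); now apply exR. Qed.
Lemma RI_minus a b : RInt (fun x => f x - g x) a b = RInt f a b - RInt g a b :> R.
Proof. apply (RInt_minus f g a b); now apply exR. Qed.
Lemma RI_scal c a b : RInt (fun x => c * f x) a b = c * RInt f a b :> R.
Proof. apply (RInt_scal f a b c); now apply exR. Qed.
Lemma RI_opp a b : RInt (fun x => - f x) a b = - RInt f a b :> R.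
Proof. apply (RInt_opp f a b); now apply exR. Qed.
Lemma RI_chasles a b c : RInt f a b + RInt f b c = RInt f a c :> R.
Proof. apply (RInt_Chasles f a b c); now apply exR. Qed.
Lemma RI_swap a b : RInt f b a = - RInt f a b :> R.
Proof.
  generalize (RI_chasles a b a); rewrite RInt_point.
  change (@zero R_CompleteNormedModule) with 0. intros H; lra.
Qed.
Lemma RI_le a b : a <= b -> (forall x, a < x < b -> f x <= g x) ->
  RInt f a b <= RInt g a b.
Proof. intros Hab H; apply RInt_le; auto using exR.  Qed.
Lemma RI_pos a b : a <= b -> (forall x, a < x < b -> 0 <= f x) -> 0 <= RInt f a b.
Proof. intros Hab H; apply RInt_ge_0; auto using exR.  Qed.
Lemma RI_abs a b : a <= b -> (forall x, a < x < b -> Rabs (f x) <= g x) ->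
  Rabs (RInt f a b) <= RInt g a b.
Proof.
  intros Hab H. eapply Rle_trans; [apply abs_RInt_le; auto using exR|].
  apply RInt_le; auto using exR.
  apply exR. now apply cont_abs.
Qed.
Lemma RI_ext a b : (forall x, f x = g x) -> RInt f a b = RInt g a b :> R.
Proof. intros H; apply RInt_ext; auto. Qed.
Lemma RI_ext2 a b : a <= b -> (forall x, a < x < b -> f x = g x) -> RInt f a b = RInt g a b :> R.
Proof.
  intros Hab H; apply RInt_ext. rewrite Rmin_left, Rmax_right by lra; auto.
Qed.
Lemma RI_derive x : is_derive (fun y => RInt f 0 y) x (f x).
Proof.
  apply (is_derive_RInt f (fun y => RInt f 0 y) 0 x); auto.
  exists (mkposreal 1 Rlt_0_1); intros y _. apply (RInt_correct f 0 y); now apply exR.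
Qed.
End Finite.

Lemma RI_const c a b : RInt (fun _ => c) a b = c * (b - a) :> R.
Proof. rewrite RInt_const; unfold scal; simpl; unfold mult; simpl; ring. Qed.

Lemma RI_absc f M a b : cont f -> a <= b -> (forall x, a < x < b -> Rabs (f x) <= M) ->
  Rabs (RInt f a b) <= M * (b - a).
Proof.
  intros Hf Hab H. rewrite <- RI_const. apply RI_abs; auto using cont_const.
Qed.

Lemma RI_ftc F f a b : (forall x, is_derive F x (f x)) -> cont f ->
  RInt f a b = F b - F a :> R.
Proof.
  intros HF Hf. apply is_RInt_unique.
  apply (is_RInt_derive F f a b); auto.
Qed.

Lemma RI_subst f g dg a b : cont f -> cont dg -> (forall x, is_derive g x (dg x)) ->
  RInt (fun y => dg y * f (g y)) a b = RInt f (g a) (g b) :> R.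
Proof.
  intros Hf Hdg Hg. apply (RInt_comp f g dg a b); auto.
Qed.

Lemma RI_dil_shift f c d a b : cont f ->
  c * RInt (fun y => f (c * y + d)) a b = RInt f (c * a + d) (c * b + d) :> R.
Proof.
  intros Hf.
  assert (H : RInt (fun y => c * f (c * y + d)) a b = RInt f (c * a + d) (c * b + d)).
  { apply (RI_subst f (fun y => c * y + d) (fun _ => c)); auto using cont_const.
    intros x; auto_derive; auto; ring. }
  rewrite <- H. symmetry. apply RI_scal. now apply cont_affine.
Qed.
Lemma RI_shift f c a b : cont f -> RInt (fun y => f (y + c)) a b = RInt f (a + c) (b + c) :> R.
Proof.
  intros Hf. generalize (RI_dil_shift f 1 c a b Hf). rewrite !Rmult_1_l. intros <-.
  apply RI_ext; intros; now rewrite Rmult_1_l.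
Qed.
Lemma RI_refl f c a b : cont f -> RInt (fun y => f (c - y)) a b = RInt f (c - b) (c - a) :> R.
Proof.
  intros Hf. rewrite (RI_swap f Hf (c - a) (c - b)).
  replace (c - a) with ((-1) * a + c) by ring. replace (c - b) with ((-1) * b + c) by ring.
  rewrite <- (RI_dil_shift f (-1) c a b Hf).
  rewrite (RI_ext (fun y => f (c - y)) (fun y => f (-1 * y + c))).
  - rring.
  - intros x; f_equal; ring.
Qed.
Lemma RI_neg f a b : cont f -> RInt (fun y => f (- y)) a b = RInt f (- b) (- a) :> R.
Proof.
  intros Hf. generalize (RI_refl f 0 a b Hf).
  replace (0 - b) with (- b) by ring; replace (0 - a) with (- a) by ring.
  intros <-. apply RI_ext; intros; f_equal; ring.
Qed.

(** ** Improper integrals over the positive half line *)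

Definition isI (f : R -> R) (l : R) : Prop :=
  filterlim (fun b => RInt f 0 b) (Rbar_locally p_infty) (locally l).

Lemma isI_eps f l : isI f l <->
  forall eps, 0 < eps -> exists B, 0 <= B /\ forall b, B <= b -> Rabs (RInt f 0 b - l) < eps.
Proof.
  split.
  - intros H eps He.
    destruct (H (fun y => Rabs (y - l) < eps)) as [M HM].
    + exists (mkposreal eps He). intros y Hy; exact Hy.
    + exists (Rmax 0 (M + 1)). split; [apply Rmax_l|]. intros b Hb. apply HM.
      generalize (Rmax_r 0 (M+1)); lra.
  - intros H P [eps HP].
    destruct (H eps (cond_pos eps)) as (B & HB0 & HB).
    exists B. intros b Hb. apply HP. apply HB; lra.
Qed.

Lemma isI_unique f l l' : isI f l -> isI f l' -> l = l'.
Proof.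
  intros H1 H2. apply (filterlim_locally_unique (fun b => RInt f 0 b) l l' H1 H2).
Qed.
Lemma isI_ext f g l : (forall x, 0 < x -> f x = g x) -> isI f l -> isI g l.
Proof.
  intros H Hf. apply isI_eps; intros eps He.
  destruct (proj1 (isI_eps f l) Hf eps He) as (B & HB0 & HB).
  exists B; split; auto. intros b Hb.
  rewrite <- (RI_ext2 f g 0 b); auto; try lra. intros x Hx; apply H; lra.
Qed.
Lemma isI_plus f g l m : cont f -> cont g -> isI f l -> isI g m ->
  isI (fun x => f x + g x) (l + m).
Proof.
  intros Cf Cg Hf Hg.
  apply filterlim_ext with (fun b => plus (RInt f 0 b) (RInt g 0 b)).
  - intros b. symmetry. apply RI_plus; auto.
  - eapply filterlim_comp_2; [exact Hf|exact Hg|]. apply (filterlim_plus l m).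
Qed.
Lemma isI_scal c f l : cont f -> isI f l -> isI (fun x => c * f x) (c * l).
Proof.
  intros Cf Hf.
  apply filterlim_ext with (fun b => scal c (RInt f 0 b)).
  - intros b. symmetry. apply RI_scal; auto.
  - eapply filterlim_comp; [exact Hf|]. apply (filterlim_scal_r c l).
Qed.
Lemma isI_minus f g l m : cont f -> cont g -> isI f l -> isI g m ->
  isI (fun x => f x - g x) (l - m).
Proof.
  intros Cf Cg Hf Hg.
  apply isI_ext with (fun x => f x + (-1) * g x); [intros; ring|].
  replace (l - m) with (l + (-1) * m) by ring.
  apply isI_plus; auto. ct. apply isI_scal; auto.
Qed.
Lemma isI_zero : isI (fun _ => 0) 0.
Proof.
  apply isI_eps; intros eps He; exists 0; split; [lra|]; intros b Hb.
  rewrite RI_const. replace (0 * (b - 0) - 0) with 0 by ring. rewrite Rabs_R0; auto.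
Qed.
Lemma isI_le f g l m : cont f -> cont g -> (forall x, 0 < x -> f x <= g x) ->
  isI f l -> isI g m -> l <= m.
Proof.
  intros Cf Cg H Hf Hg.
  apply Rnot_lt_le; intros Hlt.
  destruct (proj1 (isI_eps f l) Hf ((l - m)/2)) as (B & HB0 & HB); [lra|].
  destruct (proj1 (isI_eps g m) Hg ((l - m)/2)) as (B' & HB0' & HB'); [lra|].
  set (b := Rmax B B').
  assert (Hb : 0 <= b) by (generalize (Rmax_l B B'); unfold b; lra).
  generalize (HB b (Rmax_l _ _)) (HB' b (Rmax_r _ _)).
  generalize (RI_le f g Cf Cg 0 b Hb (fun x Hx => H x (proj1 Hx))).
  intros H1 H2 H3. apply Rabs_lt_between in H2. apply Rabs_lt_between in H3. lra.
Qed.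
Lemma isI_pos f l : cont f -> (forall x, 0 < x -> 0 <= f x) -> isI f l -> 0 <= l.
Proof. intros Cf H Hf; apply (isI_le (fun _ => 0) f); auto using isI_zero, cont_const. Qed.
Lemma isI_part f l b : cont f -> (forall x, 0 < x -> 0 <= f x) -> isI f l ->
  0 <= b -> RInt f 0 b <= l.
Proof.
  intros Cf H Hf Hb.
  apply Rnot_lt_le; intros Hlt.
  destruct (proj1 (isI_eps f l) Hf (RInt f 0 b - l)) as (B & HB0 & HB); [lra|].
  generalize (HB (Rmax b B) (Rmax_r _ _)).
  generalize (RI_chasles f Cf 0 b (Rmax b B)) (Rmax_l b B).
  intros H1 H2.
  assert (H3 : 0 <= RInt f b (Rmax b B)).
  { apply RI_pos; auto. intros; apply H; lra. }
  intros H4; apply Rabs_lt_between in H4. lra.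
Qed.
Lemma isI_antider F f L : (forall x, is_derive F x (f x)) -> cont f ->
  filterlim F (Rbar_locally p_infty) (locally L) -> isI f (L - F 0).
Proof.
  intros HF Cf HL.
  apply filterlim_ext with (fun b => minus (F b) (F 0)).
  - intros b. symmetry; apply RI_ftc; auto.
  - unfold minus. eapply filterlim_comp_2; [exact HL|apply filterlim_const|].
    apply (filterlim_plus L (opp (F 0))).
Qed.
(** A nonnegative integrand with bounded partial integrals is integrable:
    the partial integrals increase to their supremum. *)
Lemma isI_bounded f M : cont f -> (forall x, 0 < x -> 0 <= f x) ->
  (forall b, 0 <= b -> RInt f 0 b <= M) -> exists l, isI f l.
Proof.
  intros Cf Hp HM.
  destruct (completeness (fun y => exists b, 0 <= b /\ y = RInt f 0 b)) as [l [Hl1 Hl2]].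
  - exists M. intros y (b & Hb & ->); auto.
  - exists (RInt f 0 0); exists 0; split; auto; lra.
  - exists l. apply isI_eps. intros eps He.
    destruct (classic (exists b, 0 <= b /\ l - eps < RInt f 0 b)) as [(B & HB0 & HB)|Hn].
    + exists B; split; auto. intros b Hb.
      generalize (RI_chasles f Cf 0 B b).
      assert (H3 : 0 <= RInt f B b) by (apply RI_pos; auto; intros; apply Hp; lra).
      assert (H4 : RInt f 0 b <= l) by (apply Hl1; exists b; split; auto; lra).
      intros H5. apply Rabs_lt_between; lra.
    + exfalso. assert (l <= l - eps); [|lra].
      apply Hl2. intros y (b & Hb & ->). apply Rnot_lt_le. intros Hc. apply Hn; eauto.
Qed.
Lemma isI_dom f g m : cont f -> cont g -> (forall x, 0 < x -> Rabs (f x) <= g x) ->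
  isI g m -> exists l, isI f l /\ Rabs l <= m.
Proof.
  intros Cf Cg H Hg.
  assert (H' : forall x, 0 < x -> - g x <= f x <= g x).
  { intros x Hx. apply Rabs_le_between. auto. }
  destruct (isI_bounded (fun x => f x + g x) (2 * m)) as [l Hl].
  - ct.
  - intros x Hx; specialize (H' x Hx); lra.
  - intros b Hb. rewrite RI_plus by auto.
    assert (RInt f 0 b <= RInt g 0 b).
    { apply RI_le; auto. intros x Hx. apply H'; lra. }
    assert (RInt g 0 b <= m).
    { apply isI_part; auto. intros x Hx. specialize (H' x Hx); lra. }
    lra.
  - assert (Hf : isI f (l - m)).
    { apply isI_ext with (fun x => (f x + g x) - g x); [intros; ring|].
      apply isI_minus; auto; ct. }
    exists (l - m); split; auto.
    apply Rabs_le; split.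
    + apply (isI_le (fun x => (-1) * g x) f); auto; [ct| |].
      * intros x Hx; specialize (H' x Hx); lra.
      * replace (- m) with ((-1) * m) by ring. apply isI_scal; auto.
    + apply (isI_le f g); auto. intros x Hx; apply H'; auto.
Qed.
(** Domination on the whole half line also controls the tail. *)
Lemma isI_tail f g l m b : cont f -> cont g -> (forall x, 0 < x -> Rabs (f x) <= g x) ->
  isI f l -> isI g m -> 0 <= b -> Rabs (l - RInt f 0 b) <= m - RInt g 0 b.
Proof.
  intros Cf Cg H Hf Hg Hb.
  apply Rnot_lt_le; intros Hlt.
  set (e := (Rabs (l - RInt f 0 b) - (m - RInt g 0 b)) / 2).
  assert (He : 0 < e) by (unfold e; lra).
  destruct (proj1 (isI_eps f l) Hf e He) as (B & HB0 & HB).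
  destruct (proj1 (isI_eps g m) Hg e He) as (B' & HB0' & HB').
  set (c := Rmax b (Rmax B B')).
  assert (c1 : b <= c) by apply Rmax_l.
  assert (c2 : B <= c) by (eapply Rle_trans; [apply (Rmax_l B B')|apply Rmax_r]).
  assert (c3 : B' <= c) by (eapply Rle_trans; [apply (Rmax_r B B')|apply Rmax_r]).
  generalize (HB c c2) (HB' c c3).
  assert (Rabs (RInt f b c) <= RInt g b c).
  { apply RI_abs; auto. intros; apply H; lra. }
  rewrite <- (RI_chasles f Cf 0 b c), <- (RI_chasles g Cg 0 b c).
  intros H1 H2. apply Rabs_lt_between in H2.
  assert (Rabs (l - RInt f 0 b) < e + RInt g b c).
  { replace (l - RInt f 0 b) with
      (RInt f b c - (RInt f 0 b + RInt f b c - l)) by ring.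
    eapply Rle_lt_trans; [apply Rabs_triang|]. rewrite Rabs_Ropp. lra. }
  unfold e in *; lra.
Qed.

Lemma lim_exp_decay x : 0 < x ->
  filterlim (fun b => exp (- (x * b))) (Rbar_locally p_infty) (locally 0).
Proof.
  intros Hx P [eps HP].
  exists (/ (x * eps)). intros b Hb. apply HP.
  assert (He := cond_pos eps).
  assert (0 < / (x * eps)) by (apply Rinv_0_lt_compat, Rmult_lt_0_compat; auto).
  assert (1 / eps < x * b).
  { apply Rmult_lt_compat_l with (r := x) in Hb; auto.
    replace (x * / (x * eps)) with (1 / eps) in Hb by (field; lra). auto. }
  unfold ball; simpl; unfold AbsRing_ball, abs, minus, plus, opp; simpl.
  replace (exp (- (x * b)) + - 0) with (exp (-(x*b))) by ring.
  rewrite Rabs_right by (left; apply exp_pos).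
  rewrite exp_Ropp. generalize (exp_ineq1_le (x * b)); intros H1.
  replace (pos eps) with (/ (1 / eps)) by (field; lra).
  apply Rinv_lt_contravar; [|lra].
  apply Rmult_lt_0_compat; [|apply exp_pos]. unfold Rdiv; apply Rmult_lt_0_compat; [lra|].
  now apply Rinv_0_lt_compat.
Qed.

Lemma isI_exp x : 0 < x -> isI (fun v => exp (- (x * v))) (/ x).
Proof.
  intros Hx.
  replace (/ x) with (0 * - / x - (- / x * exp (- (x * 0)))).
  - apply (isI_antider (fun v => - / x * exp (- (x * v)))).
    + intros v. auto_derive; auto. field; lra.
    + ct.
    + replace (0 * - / x) with (scal (- / x) 0) by (unfold scal; simpl; unfold mult; simpl; ring).
      apply (filterlim_comp _ _ _ (fun b => exp (- (x * b))) (fun y => scal (- / x) y) _ (locally 0)).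
      * now apply lim_exp_decay.
      * apply (filterlim_scal_r (- / x) 0).
  - replace (- (x * 0)) with 0 by ring. rewrite exp_0. field; lra.
Qed.

(** The form in which domination is used throughout: exponential decay. *)
Definition expdec (f : R -> R) (M b : R) : Prop :=
  forall v, 0 <= v -> Rabs (f v) <= M * exp (- (b * v)).

Lemma isI_expdec f M b : cont f -> 0 < b -> expdec f M b ->
  exists l, isI f l /\ Rabs l <= M / b.
Proof.
  intros Cf Hb H.
  apply (isI_dom f (fun v => M * exp (- (b * v)))); auto.
  - ct.
  - intros v Hv; apply H; lra.
  - apply isI_scal; [ct|]. now apply isI_exp.
Qed.
Lemma expdec_tail f M b l V : cont f -> 0 < b -> expdec f M b -> isI f l -> 0 <= V ->
  Rabs (l - RInt f 0 V) <= M / b * exp (- (b * V)).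
Proof.
  intros Cf Hb H Hl HV.
  eapply Rle_trans.
  - apply (isI_tail f (fun v => M * exp (- (b * v))) l (M * / b) V); auto; [ct| |].
    { intros v Hv0; apply H; lra. }
    apply isI_scal; [ct|]. now apply isI_exp.
  - rewrite (RI_ftc (fun v => - (M / b) * exp (- (b * v)))).
    + replace (- (b * 0)) with 0 by ring. rewrite exp_0. right; field; lra.
    + intros v; auto_derive; auto. field; lra.
    + ct.
Qed.

Definition I (f : R -> R) : R := epsilon (inhabits 0) (isI f).
Lemma I_unique f l : isI f l -> I f = l.
Proof.
  intros H. apply (isI_unique f); auto. unfold I. apply epsilon_spec. eauto.
Qed.
Lemma I_spec f l : isI f l -> isI f (I f).
Proof. intros H; now rewrite (I_unique f l H). Qed.
(** * Functions with derivatives of every order *)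

(** [Cn D n f]: the function [f] is [n] times continuously differentiable at
    the points of [D].  Handing out the derivative as a witness makes every
    closure property a direct induction on [n]. *)
Fixpoint Cn (D : R -> Prop) (n : nat) (f : R -> R) : Prop :=
  match n with
  | O => forall x, D x -> continuous f x
  | S n => exists f', (forall x, D x -> is_derive f x (f' x)) /\ Cn D n f'
  end.

Definition smooth (D : R -> Prop) (f : R -> R) : Prop := forall n, Cn D n f.

Definition openD (D : R -> Prop) : Prop := forall x, D x -> locally x D.

Definition full : R -> Prop := fun _ => True.
Lemma open_full : openD full.
Proof. intros x _; exists (mkposreal 1 Rlt_0_1); intros; exact Logic.I. Qed.

Lemma der_id (x : R) : is_derive (fun x => x) x 1.
Proof. apply (is_derive_id x). Qed.
Lemma der_eq (f : R -> R) (x l l' : R) : is_derive f x l -> l = l' -> is_derive f x l'.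
Proof. now intros H <-. Qed.
Lemma der_plus (f g : R -> R) (x a b : R) : is_derive f x a -> is_derive g x b ->
  is_derive (fun x => f x + g x) x (a + b).
Proof. apply (is_derive_plus f g). Qed.
Lemma der_mult (f g : R -> R) (x a b : R) : is_derive f x a -> is_derive g x b ->
  is_derive (fun x => f x * g x) x (a * g x + f x * b).
Proof. intros Hf Hg; apply (is_derive_mult f g x a b Hf Hg Rmult_comm). Qed.
Lemma der_comp (f g : R -> R) (x a b : R) : is_derive f x a -> is_derive g (f x) b ->
  is_derive (fun x => g (f x)) x (b * a).
Proof.
  intros Hf Hg. eapply der_eq; [apply (is_derive_comp g f x b a Hg Hf)|].
  unfold scal; simpl; unfold mult; simpl; ring.
Qed.
Lemma der_cont (f : R -> R) (x a : R) : is_derive f x a -> continuous f x.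
Proof. intros H; apply (ex_derive_continuous f x). now exists a. Qed.

Lemma Cn_le D n f : Cn D (S n) f -> Cn D n f.
Proof.
  revert f; induction n as [|n IH]; intros f (f' & H & H').
  - intros x Hx; eapply der_cont; apply H; auto.
  - exists f'; split; auto.
Qed.
Lemma Cn_sub (D E : R -> Prop) n f : (forall x, D x -> E x) -> Cn E n f -> Cn D n f.
Proof.
  intros HD; revert f; induction n as [|n IH]; intros f H.
  - intros x Hx; auto.
  - destruct H as (f' & H & H'). exists f'; split; auto.
Qed.
Lemma Cn_ext D n f g : openD D -> (forall x, D x -> f x = g x) -> Cn D n f -> Cn D n g.
Proof.
  intros HD; revert f g; destruct n as [|n]; intros f g E H.
  - intros x Hx. apply (continuous_ext_loc g f x); [|now apply H].
    apply (filter_imp D); auto.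
  - destruct H as (f' & H & H'). exists f'; split; auto.
    intros x Hx. apply (is_derive_ext_loc f g); auto. apply (filter_imp D); auto.
Qed.
Lemma Cn_const D n c : Cn D n (fun _ => c).
Proof.
  revert c; induction n as [|n IH]; intros c.
  - intros x _; apply continuous_const.
  - exists (fun _ => 0); split; auto. intros x _; apply (is_derive_const c x).
Qed.
Lemma Cn_id D n : Cn D n (fun x => x).
Proof.
  destruct n as [|n].
  - intros x _; apply continuous_id.
  - exists (fun _ => 1); split; [|apply Cn_const]. intros x _; apply (is_derive_id x).
Qed.
Lemma Cn_plus D n f g : Cn D n f -> Cn D n g -> Cn D n (fun x => f x + g x).
Proof.
  revert f g; induction n as [|n IH]; intros f g Hf Hg.
  - intros x Hx; apply (continuous_plus f g x); auto.
  - destruct Hf as (f' & Hf & Hf'), Hg as (g' & Hg & Hg').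
    exists (fun x => f' x + g' x); split; auto.
    intros x Hx; apply der_plus; auto.
Qed.
Lemma Cn_mult D n f g : Cn D n f -> Cn D n g -> Cn D n (fun x => f x * g x).
Proof.
  revert f g; induction n as [|n IH]; intros f g Hf Hg.
  - intros x Hx; apply (continuous_mult f g x); auto.
  - generalize (Cn_le _ _ _ Hf) (Cn_le _ _ _ Hg); intros Hf0 Hg0.
    destruct Hf as (f' & Hf & Hf'), Hg as (g' & Hg & Hg').
    exists (fun x => f' x * g x + f x * g' x); split; [|apply Cn_plus; auto].
    intros x Hx; apply der_mult; auto.
Qed.
Lemma Cn_comp (D E : R -> Prop) n f g : (forall x, D x -> E (f x)) -> Cn D n f -> Cn E n g ->
  Cn D n (fun x => g (f x)).
Proof.
  intros HE. revert f g HE; induction n as [|n IH]; intros f g HE Hf Hg.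
  - intros x Hx; apply (continuous_comp f g x); auto.
  - generalize (Cn_le _ _ _ Hf); intros Hf0.
    destruct Hf as (f' & Hf & Hf'), Hg as (g' & Hg & Hg').
    exists (fun x => g' (f x) * f' x); split; [|apply Cn_mult; auto].
    intros x Hx; apply der_comp; auto.
Qed.
Lemma Cn_opp D n f : Cn D n f -> Cn D n (fun x => - f x).
Proof.
  intros H. replace (fun x => - f x) with (fun x => (-1) * f x).
  - apply Cn_mult; auto using Cn_const.
  - apply functional_extensionality; intros; ring.
Qed.
Lemma Cn_minus D n f g : Cn D n f -> Cn D n g -> Cn D n (fun x => f x - g x).
Proof. intros Hf Hg; apply Cn_plus; auto using Cn_opp. Qed.
Lemma Cn_Rinv n : Cn (fun x => x <> 0) n Rinv.
Proof.
  induction n as [|n IH].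
  - intros x Hx. apply (ex_derive_continuous Rinv x). auto_derive; auto.
  - exists (fun x => - (/ x * / x)); split.
    + intros x Hx. auto_derive; auto. field; auto.
    + apply Cn_opp, Cn_mult; auto.
Qed.
Lemma Cn_inv D n f : Cn D n f -> (forall x, D x -> f x <> 0) -> Cn D n (fun x => / f x).
Proof. intros H H0; apply (Cn_comp D (fun x => x <> 0)); auto using Cn_Rinv. Qed.
Lemma Cn_div D n f g : Cn D n f -> Cn D n g -> (forall x, D x -> g x <> 0) ->
  Cn D n (fun x => f x / g x).
Proof. intros; apply Cn_mult; auto using Cn_inv. Qed.
Lemma Cn_exp D n f : Cn D n f -> Cn D n (fun x => exp (f x)).
Proof.
  intros H; apply (Cn_comp D full); auto; [now intros|]. clear.
  induction n as [|n IH].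
  - intros x _; apply (ex_derive_continuous exp x). auto_derive; auto.
  - exists exp; split; auto. intros x _; auto_derive; auto; ring.
Qed.
Lemma Cn_ln D n f : Cn D n f -> (forall x, D x -> 0 < f x) -> Cn D n (fun x => ln (f x)).
Proof.
  intros H Hp; apply (Cn_comp D (fun x => 0 < x)); auto. clear.
  destruct n as [|n].
  - intros x Hx; apply (ex_derive_continuous ln x). auto_derive; auto.
  - exists Rinv; split.
    + intros x Hx; auto_derive; auto; field; lra.
    + apply (Cn_sub _ (fun x => x <> 0)); [intros; lra|apply Cn_Rinv].
Qed.
Lemma Cn_Rpower D n f a : Cn D n f -> (forall x, D x -> 0 < f x) ->
  Cn D n (fun x => Rpower (f x) a).
Proof. intros H Hp. apply Cn_exp, Cn_mult; auto using Cn_const, Cn_ln. Qed.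
Lemma Cn_pow D n f m : Cn D n f -> Cn D n (fun x => f x ^ m).
Proof.
  intros H; induction m as [|m IH]; simpl; auto using Cn_const, Cn_mult.
Qed.

Lemma Cn_Derive D n f : openD D -> Cn D (S n) f ->
  (forall x, D x -> is_derive f x (Derive f x)) /\ Cn D n (Derive f).
Proof.
  intros HD (f' & H & H').
  assert (E : forall x, D x -> f' x = Derive f x).
  { intros x Hx; symmetry; apply is_derive_unique; auto. }
  split.
  - intros x Hx; rewrite <- E; auto.
  - apply (Cn_ext D n f'); auto.
Qed.
Lemma smooth_Derive D f : openD D -> smooth D f -> smooth D (Derive f).
Proof. intros HD H n; apply (Cn_Derive D n f); auto. Qed.
Lemma smooth_der D f x : openD D -> smooth D f -> D x -> is_derive f x (Derive f x).
Proof. intros HD H; apply (Cn_Derive D 0 f); auto. Qed.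
Lemma smooth_Dn D f n : openD D -> smooth D f -> smooth D (Derive_n f n).
Proof. intros HD H; induction n; simpl; auto. now apply smooth_Derive. Qed.
Lemma smooth_Dn_der D f n x : openD D -> smooth D f -> D x ->
  is_derive (Derive_n f n) x (Derive_n f (S n) x).
Proof. intros HD H Hx; apply (smooth_der D); auto. now apply smooth_Dn. Qed.
Lemma smooth_ex D f n x : openD D -> smooth D f -> D x -> ex_derive_n f n x.
Proof.
  intros HD H Hx; destruct n as [|n]; simpl; auto.
  exists (Derive_n f (S n) x). apply (smooth_Dn_der D); auto.
Qed.
Lemma smooth_full_cont f : smooth full f -> cont f.
Proof. intros H x; apply (H O); exact Logic.I. Qed.

Lemma Dn_ext_open D f g n x : openD D -> D x -> (forall y, D y -> f y = g y) ->
  Derive_n f n x = Derive_n g n x.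
Proof.
  intros HD Hx H. apply Derive_n_ext_loc. apply (filter_imp D); auto.
Qed.
Lemma Dn_shift f n x : Derive_n f (S n) x = Derive_n (Derive f) n x.
Proof.
  change (Derive f) with (Derive_n f 1). rewrite Derive_n_comp. now rewrite Nat.add_1_r.
Qed.
Lemma Dn_lin D f g a b n x : openD D -> smooth D f -> smooth D g -> D x ->
  Derive_n (fun x => a * f x + b * g x) n x = a * Derive_n f n x + b * Derive_n g n x.
Proof.
  intros HD Hf Hg; revert x; induction n as [|n IH]; intros x Hx; [reflexivity|].
  simpl. rewrite (Derive_ext_loc _ (fun x => a * Derive_n f n x + b * Derive_n g n x)).
  - apply is_derive_unique. apply der_plus; apply is_derive_scal; apply (smooth_Dn_der D); auto.
  - apply (filter_imp D); auto.
Qed.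
(** Leibniz rule against the identity. *)
Lemma Dn_id_mult D g m x : openD D -> smooth D g -> D x ->
  Derive_n (fun u => u * g u) (S m) x
  = x * Derive_n g (S m) x + INR (S m) * Derive_n g m x.
Proof.
  intros HD Hg; revert x; induction m as [|m IH]; intros x Hx.
  - change (Derive (fun u => u * g u) x = x * Derive g x + 1 * g x).
    apply is_derive_unique. eapply der_eq.
    + apply der_mult; [apply der_id|]. apply (smooth_der D); auto.
    + cbv beta; ring.
  - change (Derive_n (fun u => u * g u) (S (S m)) x)
      with (Derive (Derive_n (fun u => u * g u) (S m)) x).
    rewrite (Derive_ext_loc _
      (fun x => x * Derive_n g (S m) x + INR (S m) * Derive_n g m x)).
    + apply is_derive_unique. eapply der_eq.
      * apply der_plus.
        -- apply der_mult; [apply der_id|]. apply (smooth_Dn_der D); auto.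
        -- apply is_derive_scal. apply (smooth_Dn_der D); auto.
      * rewrite (S_INR (S m)). cbv beta; ring.
    + apply (filter_imp D); auto.
Qed.

(** ** Division by the variable *)

Definition starD (D : R -> Prop) : Prop := forall x t, D x -> 0 <= t <= 1 -> D (x * t).

(** For [j = 0] and [g = q'] this is [q t / t] when [q 0 = 0]; differentiation raises [j]. *)
Definition mean (j : nat) (g : R -> R) (t : R) : R := RInt (fun s => s ^ j * g (t * s)) 0 1.

Lemma mean_ex D j g t : starD D -> Cn D 0 g -> D t ->
  ex_RInt (fun s => s ^ j * g (t * s)) 0 1.
Proof.
  intros HS Hg Ht. apply (ex_RInt_continuous (fun s => s ^ j * g (t * s))).
  rewrite Rmin_left, Rmax_right by lra. intros s Hs.
  apply (continuous_mult (fun s => s ^ j) (fun s => g (t * s))).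
  - apply (cont_pow (fun s => s)), cont_id.
  - apply (continuous_comp (fun s => t * s) g).
    + apply (cont_mult (fun _ => t) (fun s => s)); auto using cont_const, cont_id.
    + apply Hg. apply HS; auto.
Qed.

Lemma mean_der D j g g' t : openD D -> starD D ->
  (forall x, D x -> is_derive g x (g' x)) -> Cn D 0 g' -> D t ->
  is_derive (mean j g) t (mean (S j) g' t).
Proof.
  intros HD HS Hg Hg' Ht.
  assert (Dg : forall u s, D (u * s) ->
     is_derive (fun z => s ^ j * g (z * s)) u (s ^ S j * g' (u * s))).
  { intros u s Hus. eapply der_eq.
    - apply is_derive_scal. apply (der_comp (fun z => z * s) g u s); [|apply Hg; auto].
      auto_derive; auto; ring.
    - simpl; ring. }
  unfold mean at 2. rewrite (RInt_ext _ (fun s => Derive (fun z => s ^ j * g (z * s)) t)).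
  - apply (is_derive_RInt_param (fun z s => s ^ j * g (z * s)) 0 1 t).
    + apply (filter_imp D); auto. intros u Hu s. rewrite Rmin_left, Rmax_right by lra.
      intros Hs. eexists; apply Dg; auto.
    + intros s. rewrite Rmin_left, Rmax_right by lra. intros Hs.
      apply continuity_2d_pt_ext_loc with (fun u v => v ^ S j * g' (u * v)).
      * assert (HL : locally (t, s) (fun z : R * R => D (fst z * snd z))).
        { assert (C : continuity_2d_pt (fun u v => u * v) t s).
          { apply continuity_2d_pt_mult; [apply continuity_2d_pt_id1|apply continuity_2d_pt_id2]. }
          apply continuity_2d_pt_filterlim in C. apply (C D). apply HD; apply HS; auto. }
        apply locally_2d_locally. apply (filter_imp (fun z : R * R => D (fst z * snd z))); auto.
        intros [u v] H; simpl in *. symmetry; apply is_derive_unique. now apply Dg.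
      * apply continuity_2d_pt_mult.
        -- apply (continuity_1d_2d_pt_comp (fun v => v ^ S j) (fun _ v => v)); [|apply continuity_2d_pt_id2].
           apply continuity_pt_filterlim. apply (cont_pow (fun v => v)), cont_id.
        -- apply (continuity_1d_2d_pt_comp g' (fun u v => u * v)).
           ++ apply continuity_pt_filterlim. apply Hg'. apply HS; auto.
           ++ apply continuity_2d_pt_mult; [apply continuity_2d_pt_id1|apply continuity_2d_pt_id2].
    + apply (filter_imp D); auto. intros u Hu. apply (mean_ex D); auto.
      apply (Cn_le D 0 g). exists g'; auto.
  - rewrite Rmin_left, Rmax_right by lra. intros s Hs. symmetry; apply is_derive_unique, Dg.
    apply HS; auto; lra.
Qed.

Lemma mean_Cn D j n g : openD D -> starD D -> Cn D (S n) g -> Cn D n (mean j g).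
Proof.
  intros HD HS; revert j g; induction n as [|n IH]; intros j g (g' & Hg & Hg').
  - intros x Hx. eapply der_cont, (mean_der D); eauto.
  - exists (mean (S j) g'); split; auto.
    intros x Hx; apply (mean_der D); auto. clear -Hg'.
    induction n as [|n IH]; [now apply Cn_le|apply IH; now apply Cn_le].
Qed.

(** Hadamard: a smooth function vanishing at the origin is divisible by the
    variable among smooth functions. *)
Lemma hadamard D q : openD D -> starD D -> D 0 -> smooth D q -> q 0 = 0 ->
  exists A, smooth D A /\ forall t, D t -> q t = t * A t.
Proof.
  intros HD HS H0 Hq Hq0. exists (mean 0 (Derive q)). split.
  - intros n. apply mean_Cn; auto. apply smooth_Derive; auto.
  - intros t Ht. unfold mean.
    assert (E : is_RInt (fun s => scal t (1 * Derive q (t * s))) 0 1 (minus (q (t * 1)) (q (t * 0)))).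
    { apply (is_RInt_derive (fun s => q (t * s))); rewrite Rmin_left, Rmax_right by lra; intros s Hs.
      - eapply der_eq; [apply (der_comp (fun s => t * s) q s t)|].
        + auto_derive; auto; ring.
        + apply (smooth_der D); auto.
        + unfold scal; simpl; unfold mult; simpl; ring.
      - apply (continuous_scal_r t (fun s => 1 * Derive q (t * s))).
        apply (continuous_mult (fun _ => 1) (fun s => Derive q (t * s))); [apply continuous_const|].
        apply (continuous_comp (fun s => t * s) (Derive q)).
        + apply (cont_mult (fun _ => t) (fun s => s)); auto using cont_const, cont_id.
        + apply (smooth_Derive D q HD Hq O); auto. }
    assert (E' : RInt (fun s => scal t (1 * Derive q (t * s))) 0 1 = q (t * 1) - q (t * 0) :> R)
      by (apply is_RInt_unique; exact E).
    rewrite Rmult_0_r, Hq0, Rmult_1_r in E'.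
    transitivity (q t - 0); [ring|]. rewrite <- E'.
    apply (RInt_scal (fun s => 1 * Derive q (t * s)) 0 1 t).
    apply (mean_ex D 0 (Derive q) t); auto. apply (smooth_Derive D q HD Hq O).
Qed.

(** * Lagrange inversion for smooth functions *)

(** If [T u = u * psi (T u)], the Taylor coefficients of [H (T u) * T' u] at
    the origin are those of [H * psi ^ (m + 1)].  With [f t = t / psi t], the
    function inverse to [T], write [H = c * f' + f * H1]: the first summand
    contributes a constant on the left and, [f' psi^(m+1)] being
    [psi^m - t (psi^m)' / m], nothing on the right; the second one carries a
    factor [u] and drops the order by one. *)
Theorem lagrange_inversion (D D' : R -> Prop) psi T :
  openD D -> starD D -> D 0 -> openD D' -> D' 0 ->
  smooth D psi -> (forall t, D t -> psi t <> 0) -> smooth D' T ->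
  (forall u, D' u -> D (T u) /\ T u = u * psi (T u)) ->
  forall m H, smooth D H ->
  Derive_n (fun u => H (T u) * Derive T u) m 0 = Derive_n (fun t => H t * psi t ^ (m + 1)) m 0.
Proof.
  intros HD HS H0 HD' H0' Hpsi Npsi HT HTe.
  assert (T0 : T 0 = 0).
  { destruct (HTe 0 H0') as [_ ->]; ring. }
  assert (T1 : Derive T 0 = psi 0).
  { rewrite (Derive_ext_loc T (fun u => u * psi (T u))).
    - apply is_derive_unique. eapply der_eq.
      + apply der_mult; [apply der_id|].
        apply (der_comp T psi 0 (Derive T 0) (Derive psi (T 0))).
        * apply (smooth_der D'); auto.
        * apply (smooth_der D); auto. rewrite T0; auto.
      + cbv beta. rewrite T0. ring.
    - apply (filter_imp D'); auto. intros u Hu. apply HTe; auto. }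
  pose (f' := fun t => (psi t - t * Derive psi t) / psi t ^ 2).
  assert (Df : forall t, D t -> is_derive (fun t => t / psi t) t (f' t)).
  { intros t Ht. eapply der_eq.
    - apply der_mult; [apply der_id|]. apply is_derive_inv.
      + apply (smooth_der D); auto.
      + apply Npsi; auto.
    - unfold f'. field. apply Npsi; auto. }
  assert (Sf' : smooth D f').
  { intros n. apply Cn_div; auto using Cn_pow.
    - apply Cn_minus; auto. apply Cn_mult; auto using Cn_id. apply smooth_Derive; auto.
    - intros t Ht; apply pow_nonzero; auto. }
  intros m; induction m as [|m IH]; intros H HH.
  { simpl. rewrite T0, T1; ring. }
  pose (c := H 0 * psi 0).
  destruct (hadamard D (fun t => H t - c * f' t)) as (A & HA & EA); auto.
  { intros n; apply Cn_minus; auto. apply Cn_mult; auto using Cn_const. }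
  { unfold c, f'. field. apply Npsi; auto. }
  pose (H1 := fun t => psi t * A t).
  assert (SH1 : smooth D H1) by (intros n; apply Cn_mult; auto).
  assert (EH : forall t, D t -> H t = c * f' t + t / psi t * H1 t).
  { intros t Ht. generalize (EA t Ht) (Npsi t Ht). unfold H1. intros E N.
    replace (t / psi t * (psi t * A t)) with (t * A t) by (field; auto).
    rewrite <- E; ring. }
  (* the constant [c] is killed, and the factor [u] lowers the order by one *)
  assert (SL : smooth D' (fun u => H1 (T u) * Derive T u)).
  { intros n; apply Cn_mult; [apply (Cn_comp D' D); auto; intros; apply HTe; auto|].
    apply smooth_Derive; auto. }
  rewrite (Dn_ext_open D' _ (fun u => c * 1 + 1 * (u * (H1 (T u) * Derive T u)))); auto.
  2: { intros u Hu. destruct (HTe u Hu) as [Du Eu]. rewrite (EH (T u)) by auto.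
       assert (N := Npsi _ Du).
       assert (E1 : T u / psi (T u) = u) by (rewrite Eu at 1; field; auto).
       rewrite E1.
       assert (E2 : f' (T u) * Derive T u = 1).
       { assert (K : is_derive (fun u => T u / psi (T u)) u (f' (T u) * Derive T u)).
         { apply (der_comp T (fun t => t / psi t)); [apply (smooth_der D'); auto|apply Df; auto]. }
         apply is_derive_unique in K. rewrite <- K.
         rewrite (Derive_ext_loc _ (fun u => u)); [apply Derive_id|].
         apply (filter_imp D'); auto. intros w Hw. destruct (HTe w Hw) as [Dw Ew].
         rewrite Ew at 1. field. apply Npsi; auto. }
       transitivity (c * (f' (T u) * Derive T u) + u * (H1 (T u) * Derive T u)); [ring|].
       rewrite E2; ring. }
  rewrite (Dn_lin D' (fun _ => 1) (fun u => u * (H1 (T u) * Derive T u))); auto.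
  2: intros n; apply Cn_const.
  2: intros n; apply Cn_mult; auto using Cn_id.
  rewrite (Dn_id_mult D') by auto. rewrite Derive_n_const, IH, (Rmult_0_l (Derive_n _ _ _)) by auto.
  (* [f' psi^(m+2) = P - t P' / (m+1)], whose derivative of order [m + 1] vanishes at [0] *)
  pose (P := fun t => psi t ^ (m + 1)).
  assert (SP : smooth D P) by (intros n; apply Cn_pow; auto).
  assert (NS : INR (S m) <> 0) by (apply not_0_INR; lia).
  assert (EP : forall t, D t -> Derive P t = INR (S m) * Derive psi t * psi t ^ m).
  { intros t Ht. apply is_derive_unique. unfold P.
    eapply der_eq; [apply is_derive_pow, (smooth_der D); auto|].
    rewrite Nat.add_1_r; reflexivity. }
  rewrite (Dn_ext_open D (fun t => H t * psi t ^ (S m + 1)) (fun t => c * (1 * P t + (- / INR (S m)) * (t * Derive P t))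
                                     + 1 * (t * (H1 t * psi t ^ (m + 1))))); auto.
  2: { intros t Ht. cbv beta. rewrite (EP t Ht), (EH t Ht). unfold P, f'.
       replace (S m + 1)%nat with (S (S m)) by lia. rewrite Nat.add_1_r. simpl pow.
       assert (N := Npsi t Ht). field. split; auto. }
  assert (SdP : smooth D (Derive P)) by (apply smooth_Derive; auto).
  rewrite (Dn_lin D (fun t => 1 * P t + (- / INR (S m)) * (t * Derive P t))
                    (fun t => t * (H1 t * psi t ^ (m + 1)))); auto.
  2: { intros n; apply Cn_plus; repeat (apply Cn_mult; auto using Cn_const, Cn_id). }
  2: { intros n; repeat (apply Cn_mult; auto using Cn_id, Cn_pow). }
  rewrite (Dn_lin D P (fun t => t * Derive P t)); auto.
  2: { intros n; apply Cn_mult; auto using Cn_id. }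
  rewrite !(Dn_id_mult D); auto.
  2: { intros n; apply Cn_mult; auto using Cn_pow. }
  rewrite <- (Dn_shift P m). field. auto.
Qed.
(** * The kernel of Binet's integral *)

(** Laplace transforms over the unit interval: smooth in [t], with sign and size
    read off the weight. *)
Definition wexp (w : R -> R) (t : R) : R := RInt (fun s => w s * exp (t * s)) 0 1.

Lemma wexp_cont w t : cont w -> cont (fun s => w s * exp (t * s)).
Proof. intros; ct. Qed.

Lemma wexp_der w t : cont w -> is_derive (wexp w) t (wexp (fun s => s * w s) t).
Proof.
  intros Hw.
  assert (Dg : forall u s, is_derive (fun z => w s * exp (z * s)) u (s * w s * exp (u * s))).
  { intros u s. auto_derive; auto. ring. }
  unfold wexp at 2. rewrite (RI_ext _ (fun s => Derive (fun z => w s * exp (z * s)) t)).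
  - apply (is_derive_RInt_param (fun z s => w s * exp (z * s)) 0 1 t).
    + exists (mkposreal 1 Rlt_0_1). intros u _ s _. eexists; apply Dg.
    + intros s _. apply continuity_2d_pt_ext with (fun u v => v * w v * exp (u * v)).
      { intros u v. symmetry; apply is_derive_unique, Dg. }
      apply continuity_2d_pt_mult.
      * apply (continuity_1d_2d_pt_comp (fun v => v * w v) (fun _ v => v)); [|apply continuity_2d_pt_id2].
        apply continuity_pt_filterlim. assert (cont (fun v => v * w v)) by ct. apply H.
      * apply (continuity_1d_2d_pt_comp exp (fun u v => u * v)).
        -- apply continuity_pt_filterlim. apply (cont_exp (fun x => x) cont_id).
        -- apply continuity_2d_pt_mult; [apply continuity_2d_pt_id1|apply continuity_2d_pt_id2].
    + exists (mkposreal 1 Rlt_0_1). intros u _. apply exR. now apply wexp_cont.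
  - intros s. symmetry; apply is_derive_unique, Dg.
Qed.
Lemma wexp_smooth w : cont w -> smooth full (wexp w).
Proof.
  intros Hw n; revert w Hw; induction n as [|n IH]; intros w Hw.
  - intros x _. eapply der_cont, wexp_der; auto.
  - exists (wexp (fun s => s * w s)); split.
    + intros x _; now apply wexp_der.
    + apply IH. ct.
Qed.
Lemma wexp_le w w' t : cont w -> cont w' -> (forall s, 0 < s < 1 -> w s <= w' s) ->
  wexp w t <= wexp w' t.
Proof.
  intros Hw Hw' H. apply RI_le; auto using wexp_cont; try lra.
  intros s Hs. apply Rmult_le_compat_r; [left; apply exp_pos|auto].
Qed.
Lemma wexp_pos w t : cont w -> (forall s, 0 < s < 1 -> 0 < w s) -> 0 < wexp w t.
Proof.
  intros Hw H. apply RInt_gt_0; try lra.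
  - intros s Hs. apply Rmult_lt_0_compat; [apply H; lra|apply exp_pos].
  - intros s _. now apply wexp_cont.
Qed.
Lemma wexp_scal c w t : cont w -> wexp (fun s => c * w s) t = c * wexp w t.
Proof.
  intros Hw. unfold wexp.
  transitivity (RInt (fun s => c * (w s * exp (t * s))) 0 1).
  - apply RI_ext; intros; ring.
  - apply RI_scal. now apply wexp_cont.
Qed.
Lemma wexp_neg w t : cont w -> wexp w (- t) = exp (- t) * wexp (fun s => w (1 - s)) t.
Proof.
  intros Hw. unfold wexp.
  rewrite <- (RI_scal (fun s => w (1 - s) * exp (t * s))) by (apply wexp_cont; now apply cont_refl).
  transitivity (RInt (fun s => w (1 - s) * exp (- t * (1 - s))) 0 1).
  - generalize (RI_refl (fun s => w s * exp (- t * s)) 1 0 1 (wexp_cont w (- t) Hw)).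
    replace (1 - 1) with 0 by ring; replace (1 - 0) with 1 by ring. intros <-. reflexivity.
  - apply RI_ext; intros s.
    replace (- t * (1 - s)) with (- t + t * s) by ring. rewrite exp_plus; ring.
Qed.

(** The entire functions [(e^t-1)/t], [(e^t-t-1)/t^2] and
    [(t(e^t+1)-2(e^t-1))/t^3]; as integrals they are smooth at [0]. *)
Definition E1 := wexp (fun _ => 1).
Definition E2 := wexp (fun s => 1 - s).
Definition E3 := wexp (fun s => s * (1 - s)).

Lemma cont_weight1 : cont (fun _ => 1). Proof. ct. Qed.
Lemma cont_weight2 : cont (fun s => 1 - s). Proof. ct. Qed.
Lemma cont_weight3 : cont (fun s => s * (1 - s)). Proof. ct. Qed.

Lemma E1_pos t : 0 < E1 t.
Proof. apply wexp_pos; [apply cont_weight1|intros; lra]. Qed.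
Lemma E1_0 : E1 0 = 1.
Proof.
  unfold E1, wexp. rewrite (RI_ext _ (fun _ => 1)) by (intros; rewrite Rmult_0_l, exp_0; ring). rewrite RI_const; ring.
Qed.
Lemma E2_pos t : 0 < E2 t.
Proof. apply wexp_pos; [apply cont_weight2|intros; lra]. Qed.
Lemma E3_pos t : 0 < E3 t.
Proof. apply wexp_pos; [apply cont_weight3|intros; nra]. Qed.

Lemma E1_eq t : t * E1 t = exp t - 1.
Proof.
  unfold E1, wexp. rewrite <- RI_scal by (apply (wexp_cont (fun _ => 1)), cont_weight1).
  rewrite (RI_ftc (fun s => exp (t * s))).
  - rewrite Rmult_1_r, Rmult_0_r, exp_0; reflexivity.
  - intros s; auto_derive; auto; ring.
  - ct.
Qed.
Lemma E2_eq t : t ^ 2 * E2 t = exp t - t - 1.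
Proof.
  unfold E2, wexp. rewrite <- RI_scal by (apply (wexp_cont (fun s => 1 - s)), cont_weight2).
  rewrite (RI_ftc (fun s => t * (1 - s) * exp (t * s) + exp (t * s))).
  - rewrite Rmult_1_r, Rmult_0_r, exp_0; ring.
  - intros s; auto_derive; auto; ring.
  - ct.
Qed.
Lemma E3_eq t : t ^ 3 * E3 t = t * (exp t + 1) - 2 * (exp t - 1).
Proof.
  unfold E3, wexp. rewrite <- RI_scal by (apply (wexp_cont (fun s => s * (1 - s))), cont_weight3).
  rewrite (RI_ftc (fun s => t ^ 2 * (s * (1 - s)) * exp (t * s) - t * (1 - 2 * s) * exp (t * s)
     - 2 * exp (t * s))).
  - rewrite Rmult_1_r, Rmult_0_r, exp_0; ring.
  - intros s; auto_derive; auto; ring.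
  - ct.
Qed.

(** The density of Binet's function, [v * k v = 1 / 2 + 1 / (exp v - 1) - 1 / v] for
    [v > 0]; written as a quotient of integrals it is smooth at the origin. *)
Definition k (v : R) : R := E3 v / (2 * E1 v).

Lemma k_smooth : smooth full k.
Proof.
  intros n. apply Cn_div.
  - apply wexp_smooth, cont_weight3.
  - apply Cn_mult; [apply Cn_const|apply wexp_smooth, cont_weight1].
  - intros x _. generalize (E1_pos x); lra.
Qed.
Lemma k_cont : cont k.
Proof. apply smooth_full_cont, k_smooth. Qed.
Lemma k_pos v : 0 < k v.
Proof.
  unfold k. generalize (E1_pos v) (E3_pos v). intros.
  apply Rmult_lt_0_compat; auto. apply Rinv_0_lt_compat; lra.
Qed.
Lemma k_le v : k v <= 1 / 8.
Proof.
  unfold k. generalize (E1_pos v). intros.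
  assert (E3 v <= 1/4 * E1 v).
  { unfold E3, E1. rewrite <- wexp_scal by apply cont_weight1. apply wexp_le; [apply cont_weight3|ct|]. intros s _; generalize (pow2_ge_0 (s - 1/2)); lra. }
  apply Rmult_le_reg_r with (2 * E1 v); [lra|]. field_simplify; lra.
Qed.
Lemma k_der_bound v : Rabs (Derive k v) <= 1 / 2.
Proof.
  set (e1 := wexp (fun s => s * 1) v). set (e3 := wexp (fun s => s * (s * (1 - s))) v).
  assert (H1 : is_derive E1 v e1) by apply (wexp_der _ v cont_weight1).
  assert (H3 : is_derive E3 v e3) by apply (wexp_der _ v cont_weight3).
  assert (P1 := E1_pos v). assert (P3 := E3_pos v).
  assert (D : Derive k v = (e3 * E1 v - E3 v * e1) / (2 * E1 v ^ 2)).
  { apply is_derive_unique. unfold k.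
    eapply der_eq.
    - apply der_mult; [apply H3|]. apply is_derive_inv; [|lra].
      apply is_derive_scal. apply H1.
    - cbv beta; field. lra. }
  assert (A1 : 0 <= e1 <= E1 v).
  { split.
    - left; apply wexp_pos; [ct|intros; lra].
    - apply wexp_le; [ct|ct|intros; lra]. }
  assert (w3_pos : forall s, 0 < s < 1 -> 0 < s * (s * (1 - s))).
  { intros s Hs; repeat apply Rmult_lt_0_compat; lra. }
  assert (w3_le : forall s, 0 < s < 1 -> s * (s * (1 - s)) <= s * (1 - s)).
  { intros s Hs. rewrite <- (Rmult_1_l (s * (1 - s))) at 2.
    apply Rmult_le_compat_r; [apply Rmult_le_pos|]; lra. }
  assert (A3 : 0 <= e3 <= E3 v).
  { split.
    - left; apply wexp_pos; [ct|intros s Hs; apply w3_pos, Hs].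
    - apply wexp_le; [ct|ct|intros s Hs; apply w3_le, Hs]. }
  assert (B : E3 v <= E1 v).
  { apply wexp_le; [ct|ct|intros; nra]. }
  rewrite D. apply Rabs_le.
  assert (0 < 2 * E1 v ^ 2) by nra.
  split.
  - apply Rmult_le_reg_r with (2 * E1 v ^ 2); auto. field_simplify; [nra|lra].
  - apply Rmult_le_reg_r with (2 * E1 v ^ 2); auto. field_simplify; [nra|lra].
Qed.
Lemma k_even v : k (- v) = k v.
Proof.
  unfold k, E3, E1. rewrite (wexp_neg _ v cont_weight3), (wexp_neg _ v cont_weight1).
  assert (E : wexp (fun s => (1 - s) * (1 - (1 - s))) v = E3 v).
  { unfold E3, wexp. apply RI_ext. intros s; ring. }
  rewrite E. fold E1. generalize (E1_pos v) (exp_pos (- v)); intros.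
  fold (E3 v). field. split; lra.
Qed.
Lemma exp_gt1 v : 0 < v -> v < exp v - 1.
Proof. intros Hv; generalize (exp_ineq1 v); lra. Qed.
Lemma k_eq v : 0 < v -> v * k v = 1 / 2 + / (exp v - 1) - / v.
Proof.
  intros Hv. unfold k. assert (P1 := E1_pos v).
  assert (Hg := exp_gt1 v Hv).
  replace (E1 v) with ((exp v - 1) / v) by (rewrite <- E1_eq; field; lra).
  replace (E3 v) with ((v * (exp v + 1) - 2 * (exp v - 1)) / v ^ 3) by (rewrite <- E3_eq; field; lra).
  field. lra.
Qed.
(** [/ (exp v - 1) <= / v]. *)
Lemma k_half v : 0 < v -> v * k v <= 1 / 2.
Proof.
  intros Hv. rewrite k_eq by auto. generalize (exp_gt1 v Hv); intros H.
  assert (/ (exp v - 1) <= / v) by (apply Rinv_le_contravar; lra). lra.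
Qed.

(** ** Approximation by Cauchy kernels *)

(** The partial fraction expansion of [coth] is replaced by its finite
    versions: [coth (2^n x)] is a rational function of [tanh x] whose poles are
    imaginary.  The step [n -> n + 1] is the substitution
    [T -> 2 T / (1 + T^2)]. *)
Definition pfrac (l : list (R * R)) (T : R) : R :=
  List.fold_right (fun p acc => fst p / (T ^ 2 + snd p) + acc) 0 l.
Definition admissible (l : list (R * R)) : Prop :=
  List.Forall (fun p => 0 <= fst p /\ 0 < snd p) l.


Lemma pfrac_subst l : admissible l -> exists l', admissible l' /\ forall T, 0 < T ->
  2 * T / (1 + T ^ 2) * pfrac l (2 * T / (1 + T ^ 2)) = T * pfrac l' T.
Proof.
  induction 1 as [|[w c] l [Hw Hc] Hl (l' & Hl' & IH)].
  - exists nil; split; [constructor|]. intros; simpl; ring.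
  - simpl in Hw, Hc. set (m := 1 + 2 / c). set (r := sqrt (m ^ 2 - 1)).
    assert (Hm : 1 < m) by (unfold m; assert (0 < 2 / c) by (apply Rdiv_lt_0_compat; lra); lra).
    assert (Hr : 0 < r) by (apply sqrt_lt_R0; nra).
    assert (Hr2 : r * r = m ^ 2 - 1) by (apply sqrt_sqrt; nra).
    set (p := m - r). set (q := m + r).
    assert (Hp : 0 < p) by (unfold p; nra).
    assert (Hq : 0 < q) by (unfold q; nra).
    assert (Epq : p * q = 1) by (unfold p, q; nra).
    assert (Spq : p + q = 2 + 4 / c) by (unfold p, q, m; field; lra).
    exists ((2 * w / c * (p / (1 + p)), p) :: (2 * w / c * (q / (1 + q)), q) :: l')%list.
    assert (W : 0 <= 2 * w / c) by (apply Rmult_le_pos; [lra|left; apply Rinv_0_lt_compat; lra]).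
    split.
    + constructor; [|constructor; auto]; simpl; split; auto; apply Rmult_le_pos; auto;
        apply Rmult_le_pos; try lra; left; apply Rinv_0_lt_compat; lra.
    + intros T HT. simpl. rewrite Rmult_plus_distr_l, IH by auto.
      assert (Eq : q = / p) by (apply Rmult_eq_reg_l with p; [rewrite Epq; field|]; lra).
      assert (Ec : c = 4 * p / (1 - p) ^ 2).
      { assert (4 / c = p + q - 2) by lra.
        assert (p <> 1) by (intros ->; rewrite Rinv_1 in Eq; assert (0 < 4 / c) by (apply Rdiv_lt_0_compat; lra); lra).
        rewrite Eq in H. replace c with (4 / (4 / c)) by (field; lra). rewrite H.
        assert (1 - p <> 0) by lra. replace (p + / p - 2) with ((1 - p) ^ 2 / p) by (field; lra).
        field. split; [|lra]. auto. }
      assert (p <> 1) by (intros H; rewrite H, Rinv_1 in Eq; assert (0 < 4 / c) by (apply Rdiv_lt_0_compat; lra); lra).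
      assert (1 - p <> 0) by lra.
      assert (0 < T ^ 2) by nra.
      assert (0 < (1 - p) ^ 2) by (apply pow2_gt_0; auto).
      assert (N1 : T ^ 2 + p <> 0) by nra.
      assert (N2 : T ^ 2 * p + 1 <> 0) by nra.
      rewrite Eq, Ec. field_simplify_eq.
      * ring.
      * repeat split; try lra; try nra.
Qed.

Definition cothh (v : R) : R := (exp v + 1) / (exp v - 1).

Lemma cothh_double v : 0 < v -> / cothh v = 2 * / cothh (v / 2) / (1 + (/ cothh (v / 2)) ^ 2).
Proof.
  intros Hv. unfold cothh. assert (H := exp_gt1 (v / 2)).
  replace (exp v) with (exp (v / 2) * exp (v / 2)) by (rewrite <- exp_plus; f_equal; lra).
  set (e := exp (v / 2)) in *. assert (1 < e) by lra. field.
  repeat split; nra.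
Qed.
Lemma cothh_pos v : 0 < v -> 0 < cothh v.
Proof.
  intros Hv. assert (H := exp_gt1 v Hv). unfold cothh.
  apply Rdiv_lt_0_compat; lra.
Qed.

Lemma coth_pfrac n : exists b l, 0 <= b /\ admissible l /\ forall v, 0 < v ->
  let T := / cothh (v / 2 ^ n) in
  cothh v = / 2 ^ n / T + T * (b + pfrac l T).
Proof.
  induction n as [|n (b & l & Hb & Hl & IH)].
  - exists 0, nil; split; [lra|]; split; [constructor|]. intros v Hv; simpl.
    rewrite Rdiv_1_r. field. generalize (cothh_pos v Hv); lra.
  - destruct (pfrac_subst ((b, 0 + 1) :: nil)%list) as (l1 & Hl1 & _).
    { constructor; [simpl; lra|constructor]. }
    destruct (pfrac_subst l Hl) as (l' & Hl' & E).
    assert (H2n : 0 < 2 ^ n) by (apply pow_lt; lra).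
    exists (/ 2 ^ S n), ((2 * b, 1) :: l')%list. split; [|split].
    + left; apply Rinv_0_lt_compat, pow_lt; lra.
    + constructor; [simpl; lra|auto].
    + intros v Hv T.
      assert (Hvn : 0 < v / 2 ^ n) by (apply Rdiv_lt_0_compat; auto).
      assert (HT : 0 < T).
      { apply Rinv_0_lt_compat, cothh_pos. apply Rdiv_lt_0_compat; auto. apply pow_lt; lra. }
      specialize (IH v Hv); cbv zeta in IH.
      assert (ET : / cothh (v / 2 ^ n) = 2 * T / (1 + T ^ 2)).
      { rewrite cothh_double by auto. unfold T. do 2 f_equal;
        replace (v / 2 ^ n / 2) with (v / 2 ^ S n); auto; simpl; field; lra. }
      rewrite ET in IH. rewrite IH, Rmult_plus_distr_l, E by auto. simpl.
      field. repeat split; nra.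
Qed.

Lemma artanh_bounds t : 0 <= t <= 1 / 2 ->
  t <= 1 / 2 * ln ((1 + t) / (1 - t)) <= t + t ^ 3.
Proof.
  intros Ht.
  set (g := fun t => 1 / 2 * ln ((1 + t) / (1 - t))).
  assert (Dg : forall s, 0 <= s <= 1 / 2 -> is_derive g s (/ (1 - s ^ 2))).
  { intros s Hs. unfold g. auto_derive.
    - split; [|split]; auto; [lra|]. apply Rdiv_lt_0_compat; lra.
    - field. repeat split; nra. }
  assert (g0 : g 0 = 0) by (unfold g; replace ((1 + 0) / (1 - 0)) with 1 by field; rewrite ln_1; ring).
  assert (P : forall s, 0 <= s <= 1 / 2 -> 1 <= / (1 - s ^ 2) <= 1 + 3 * s ^ 2).
  { intros s Hs. assert (0 < 1 - s ^ 2) by nra. split.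
    - rewrite <- Rinv_1. apply Rinv_le_contravar; nra.
    - apply Rmult_le_reg_r with (1 - s ^ 2); auto. rewrite Rinv_l by lra.
      assert (0 <= s ^ 2 <= 1/4) by nra. nra. }
  change (t <= g t <= t + t ^ 3).
  destruct (Req_dec t 0) as [->|Hn]; [rewrite g0; lra|].
  split.
  - assert (Hd : forall s, 0 <= s <= t -> derivable_pt_lim (fun s => g s - s) s (/ (1 - s ^ 2) - 1)).
    { intros s Hs. apply is_derive_Reals. apply (is_derive_minus g (fun s => s) s).
      apply Dg; lra. apply der_id. }
    destruct (MVT_cor2 (fun s => g s - s) (fun s => / (1 - s ^ 2) - 1) 0 t ltac:(lra) Hd) as (c & E & Hc).
    assert (Pc := P c ltac:(lra)). rewrite g0 in E. nra.
  - assert (Hd : forall s, 0 <= s <= t -> derivable_pt_lim (fun s => g s - (s + s ^ 3)) s (/ (1 - s ^ 2) - (1 + 3 * s ^ 2))).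
    { intros s Hs. apply is_derive_Reals. apply (is_derive_minus g (fun s => s + s ^ 3) s).
      apply Dg; lra. auto_derive; auto; ring. }
    destruct (MVT_cor2 (fun s => g s - (s + s ^ 3)) (fun s => / (1 - s ^ 2) - (1 + 3 * s ^ 2)) 0 t ltac:(lra) Hd) as (c & E & Hc).
    assert (Pc := P c ltac:(lra)). rewrite g0 in E. nra.
Qed.

(** Linearizing [tanh] in the finite expansion approximates [k] from below by
    positive combinations of Cauchy kernels. *)
Lemma k_approx n : exists b l, 0 <= b /\ admissible l /\ forall v, 0 < v <= 2 ^ n ->
  0 <= k v - (b + pfrac l v) <= (1 + v) / 4 ^ S n.
Proof.
  destruct (coth_pfrac n) as (b & l & Hb & Hl & E).
  set (M := 2 ^ S n). assert (HM : 0 < M) by (apply pow_lt; lra).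
  exists (b / (2 * M)), (List.map (fun p => (fst p * M / 2, snd p * M ^ 2)) l).
  split; [|split].
  { apply Rmult_le_pos; auto. left; apply Rinv_0_lt_compat; lra. }
  { clear E; induction Hl as [|[w c] l [Hw Hc] Hl IH]; simpl; constructor; auto; simpl in *.
    split; [unfold Rdiv; nra|]. apply Rmult_lt_0_compat; nra. }
  intros v [Hv Hv2].
  set (t := v / M).
  assert (HvM : 2 * v <= M) by (unfold M; simpl; lra).
  assert (Ht : 0 < t <= 1 / 2).
  { unfold t; split; [apply Rdiv_lt_0_compat; auto|].
    apply Rmult_le_reg_r with M; auto. field_simplify; lra. }
  destruct (artanh_bounds t ltac:(lra)) as [A1 A2].
  set (v' := M * (1 / 2 * ln ((1 + t) / (1 - t)))).
  assert (V1 : v <= v').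
  { unfold v'. replace v with (M * t) by (unfold t; field; lra). apply Rmult_le_compat_l; lra. }
  assert (V2 : v' - v <= v ^ 3 / M ^ 2).
  { unfold v'. replace v with (M * t) by (unfold t; field; lra).
    replace ((M * t) ^ 3 / M ^ 2) with (M * t ^ 3) by (field; lra). nra. }
  assert (ET : / cothh (v' / 2 ^ n) = t).
  { unfold cothh, v'. replace (M * _ / 2 ^ n) with (ln ((1 + t) / (1 - t))).
    - rewrite exp_ln by (apply Rdiv_lt_0_compat; lra). field. lra.
    - unfold M; simpl. field. apply pow_nonzero; lra. }
  assert (Ep : forall l, pfrac (List.map (fun p => (fst p * M / 2, snd p * M ^ 2)) l) v = pfrac l t / (2 * M)
     \/ ~ admissible l).
  { clear -Hv HM. intros l; induction l as [|[w c] l IH]; simpl.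
    - left; field; lra.
    - destruct (classic (0 < c)) as [Hc|Hc].
      + destruct IH as [IH|IH].
        * left. simpl in IH; rewrite IH. unfold t. field. repeat split; try lra; nra.
        * right; intros H; inversion H; auto.
      + right; intros H; inversion H; simpl in *; lra. }
  assert (E' := E v' ltac:(lra)). cbv zeta in E'. rewrite ET in E'.
  destruct (Ep l) as [Ep'|]; [|contradiction]. rewrite Ep'.
  assert (Ek : k v = (cothh v - 2 / v) / (2 * v)).
  { apply Rmult_eq_reg_l with v; [|lra]. rewrite k_eq by auto. unfold cothh. field.
    generalize (exp_gt1 v Hv); lra. }
  assert (El : b / (2 * M) + pfrac l t / (2 * M) = (cothh v' - 2 / v) / (2 * v)).
  { rewrite E'. set (P := pfrac l t).
    replace (/ 2 ^ n) with (2 / M) by (unfold M; simpl; field; apply pow_nonzero; lra).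
    unfold t. field. lra. }
  rewrite El, Ek.
  replace ((cothh v - 2 / v) / (2 * v) - (cothh v' - 2 / v) / (2 * v))
    with ((cothh v - cothh v') / (2 * v)) by (field; lra).
  assert (G := exp_gt1 v Hv). assert (G' := exp_gt1 v' ltac:(lra)).
  assert (Ec : cothh v - cothh v' = 2 * (exp v' - exp v) / ((exp v - 1) * (exp v' - 1))).
  { unfold cothh. field. lra. }
  assert (M1 : exp v <= exp v') by (destruct V1 as [V|<-]; [left; apply exp_increasing; auto|lra]).
  assert (M2 : exp v' - exp v <= (v' - v) * exp v').
  { assert (H := exp_ineq1_le (v - v')).
    replace (exp v) with (exp v' * exp (v - v')) by (rewrite <- exp_plus; f_equal; ring).
    generalize (exp_pos v'); nra. }
  rewrite Ec. assert (P : 0 < (exp v - 1) * (exp v' - 1)) by (apply Rmult_lt_0_compat; lra).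
  split.
  - apply Rmult_le_pos; [|left; apply Rinv_0_lt_compat; lra].
    apply Rmult_le_pos; [lra|left; apply Rinv_0_lt_compat; auto].
  - assert (I1 : / (exp v - 1) <= / v) by (apply Rinv_le_contravar; lra).
    assert (I2 : / (exp v' - 1) <= / v) by (apply Rinv_le_contravar; lra).
    assert (I3 : exp v' / (exp v' - 1) <= 1 + / v).
    { replace (exp v' / (exp v' - 1)) with (1 + / (exp v' - 1)) by (field; lra). lra. }
    assert (J : (exp v' - exp v) / ((exp v - 1) * (exp v' - 1)) <= (v' - v) * ((1 + / v) * / v)).
    { apply Rle_trans with ((v' - v) * exp v' / ((exp v - 1) * (exp v' - 1))).
      - apply Rmult_le_compat_r; auto. left; apply Rinv_0_lt_compat; auto.
      - replace ((v' - v) * exp v' / ((exp v - 1) * (exp v' - 1)))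
          with ((v' - v) * ((exp v' / (exp v' - 1)) * / (exp v - 1))) by (field; lra).
        apply Rmult_le_compat_l; [lra|]. apply Rmult_le_compat; auto.
        + left; apply Rdiv_lt_0_compat; lra.
        + left; apply Rinv_0_lt_compat; lra. }
    replace (2 * (exp v' - exp v) / ((exp v - 1) * (exp v' - 1)) / (2 * v))
      with ((exp v' - exp v) / ((exp v - 1) * (exp v' - 1)) * / v) by (field; lra).
    assert (Hi : 0 < / v) by (apply Rinv_0_lt_compat; auto).
    apply Rle_trans with ((v ^ 3 / M ^ 2) * ((1 + / v) * / v) * / v).
    + apply Rmult_le_compat_r; [lra|]. eapply Rle_trans; [exact J|].
      apply Rmult_le_compat_r; auto. nra.
    + replace (4 ^ S n) with (M ^ 2).
      * right; field. lra.
      * unfold M. rewrite <- pow_mult, Nat.mul_comm, pow_mult. f_equal; ring.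
Qed.

Lemma pfrac_decr l u v : admissible l -> 0 < u <= v -> pfrac l v <= pfrac l u.
Proof.
  intros Hl Huv; induction Hl as [|[w c] l [Hw Hc] Hl IH]; simpl in *; [lra|].
  apply Rplus_le_compat; auto. apply Rmult_le_compat_l; auto.
  apply Rinv_le_contravar; nra.
Qed.

Lemma pow4_small x eps : 0 < eps -> exists n0, forall n, (n0 <= n)%nat -> x / 4 ^ S n < eps.
Proof.
  intros He. destruct (INR_unbounded (x / eps)) as [N HN]. exists N. intros n Hn.
  assert (H4 : INR n <= 4 ^ S n).
  { clear. induction n as [|n IH]; [simpl; lra|]. rewrite S_INR. simpl in *. 
    assert (0 < 4 ^ n) by (apply pow_lt; lra).
    assert (1 <= 4 ^ n) by (apply pow_R1_Rle; lra). lra. }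
  assert (INR N <= INR n) by (apply le_INR; auto).
  assert (0 < 4 ^ S n) by (apply pow_lt; lra).
  apply Rmult_lt_reg_r with (4 ^ S n); auto. unfold Rdiv. rewrite Rmult_assoc, Rinv_l by lra.
  rewrite Rmult_1_r. assert (x / eps < 4 ^ S n) by lra.
  apply Rmult_lt_compat_r with (r := eps) in H1; auto.
  replace (x / eps * eps) with x in H1 by (field; lra). lra.
Qed.

Lemma pow2_large v : exists n0, forall n, (n0 <= n)%nat -> v <= 2 ^ n.
Proof.
  destruct (INR_unbounded v) as [N HN]. exists N. intros n Hn.
  assert (INR N <= INR n) by (apply le_INR; auto).
  assert (INR n <= 2 ^ n).
  { clear. induction n as [|n IH]; [simpl; lra|]. rewrite S_INR. simpl in *. 
    assert (1 <= 2 ^ n) by (apply pow_R1_Rle; lra). lra. }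
  lra.
Qed.

(** Each Cauchy kernel decreases, and so does the limit of their combinations. *)
Lemma k_decr u v : 0 < u <= v -> k v <= k u.
Proof.
  intros Huv. apply Rnot_lt_le; intros Hlt.
  destruct (pow4_small (1 + v) (k v - k u)) as [n0 H0]; [lra|].
  destruct (pow2_large v) as [n1 H1].
  set (n := max n0 n1).
  destruct (k_approx n) as (b & l & Hb & Hl & E).
  assert (E1 := E v ltac:(specialize (H1 n ltac:(lia)); lra)).
  assert (E2 := E u ltac:(specialize (H1 n ltac:(lia)); lra)).
  assert (E3 := pfrac_decr l u v Hl Huv).
  specialize (H0 n ltac:(lia)). lra.
Qed.
Lemma k_der_neg v : 0 <= v -> Derive k v <= 0.
Proof.
  assert (P : forall v, 0 < v -> Derive k v <= 0).
  { clear v; intros v Hv. apply Rnot_lt_le; intros Hlt.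
    assert (D : is_derive k v (Derive k v)) by (apply (smooth_der full); auto using open_full, k_smooth; exact Logic.I).
    apply is_derive_Reals in D.
    destruct (D (Derive k v) Hlt) as [del Hd].
    set (h := del / 2). assert (Hh : 0 < h < del) by (unfold h; generalize (cond_pos del); lra).
    specialize (Hd h ltac:(lra)). rewrite (Rabs_right h) in Hd by lra. specialize (Hd ltac:(lra)).
    apply Rabs_lt_between in Hd. destruct Hd as [Hd _].
    assert (k (v + h) <= k v) by (apply k_decr; lra).
    assert ((k (v + h) - k v) / h <= 0); [|lra].
    assert (0 < / h) by (apply Rinv_0_lt_compat; lra). unfold Rdiv; nra. }
  intros [Hv|<-]; auto.
  apply Rnot_lt_le; intros Hlt.
  assert (C : continuous (Derive k) 0) by (apply (smooth_Derive full k open_full k_smooth O); exact Logic.I).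
  destruct (C (fun y => 0 < y)) as [del Hd].
  { exists (mkposreal _ Hlt). intros y Hy. unfold ball in Hy; simpl in Hy; unfold AbsRing_ball, abs, minus, plus, opp in Hy; simpl in Hy.
    apply Rabs_lt_between in Hy. lra. }
  set (h := del / 2). assert (Hh : 0 < h < del) by (unfold h; generalize (cond_pos del); lra).
  assert (0 < Derive k h).
  { apply Hd. unfold ball; simpl; unfold AbsRing_ball, abs, minus, plus, opp; simpl.
    apply Rabs_lt_between. lra. }
  generalize (P h ltac:(lra)); lra.
Qed.
(** * Positive cosine transforms *)

Definition cont2 (g : R -> R -> R) : Prop := forall s v, continuity_2d_pt g s v.

Lemma cont2_fst f : cont f -> cont2 (fun s _ => f s).
Proof.
  intros Hf s v. apply (continuity_1d_2d_pt_comp f (fun s _ => s)); [|apply continuity_2d_pt_id1].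
  apply continuity_pt_filterlim, Hf.
Qed.
Lemma cont2_snd f : cont f -> cont2 (fun _ v => f v).
Proof.
  intros Hf s v. apply (continuity_1d_2d_pt_comp f (fun _ v => v)); [|apply continuity_2d_pt_id2].
  apply continuity_pt_filterlim, Hf.
Qed.
Lemma cont2_comp f g : cont f -> cont2 g -> cont2 (fun s v => f (g s v)).
Proof.
  intros Hf Hg s v. apply (continuity_1d_2d_pt_comp f g); auto.
  apply continuity_pt_filterlim, Hf.
Qed.
Lemma cont2_mult f g : cont2 f -> cont2 g -> cont2 (fun s v => f s v * g s v).
Proof. intros Hf Hg s v; now apply continuity_2d_pt_mult. Qed.
Lemma cont2_minus f g : cont2 f -> cont2 g -> cont2 (fun s v => f s v - g s v).
Proof. intros Hf Hg s v; now apply continuity_2d_pt_minus. Qed.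
Lemma cont2_1 : cont2 (fun s _ => s).
Proof. intros s v; apply continuity_2d_pt_id1. Qed.
Lemma cont2_2 : cont2 (fun _ v => v).
Proof. intros s v; apply continuity_2d_pt_id2. Qed.
Lemma cos_cont : cont cos.
Proof. apply (cont_cos (fun x => x)), cont_id. Qed.
Lemma sin_cont : cont sin.
Proof. apply (cont_sin (fun x => x)), cont_id. Qed.

Lemma param_der (g g' : R -> R -> R) a b s :
  (forall s v, is_derive (fun s => g s v) s (g' s v)) -> cont2 g' ->
  (forall s, cont (g s)) ->
  is_derive (fun s => RInt (g s) a b) s (RInt (g' s) a b).
Proof.
  intros Hg Hg' Hc.
  rewrite (RI_ext (g' s) (fun v => Derive (fun s => g s v) s)).
  - apply (is_derive_RInt_param g a b s).
    + exists (mkposreal 1 Rlt_0_1). intros u _ v _. eexists; apply Hg.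
    + intros v _. apply continuity_2d_pt_ext with g'; [|apply Hg'].
      intros u w. symmetry; apply is_derive_unique, Hg.
    + exists (mkposreal 1 Rlt_0_1). intros u _. now apply exR.
  - intros v. symmetry; apply is_derive_unique, Hg.
Qed.

Lemma cosint_cont phi V : cont phi -> cont (fun s => RInt (fun v => phi v * cos (s * v)) 0 V).
Proof.
  intros Hp s. eapply der_cont.
  apply (param_der (fun s v => phi v * cos (s * v)) (fun s v => phi v * v * (- sin (s * v)))).
  - intros u v. auto_derive; auto. ring.
  - apply cont2_mult; [apply cont2_snd; ct|].
    apply (cont2_comp (fun x => - sin x) (fun s v => s * v)); [apply (cont_opp sin sin_cont)|].
    apply cont2_mult; [apply cont2_1|apply cont2_2].
  - intros u; ct.
Qed.

(** Both sides vanish at [S = 0] and have the same derivative in [S]. *)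
Lemma fubini_cos al phi S V : cont al -> cont phi ->
  RInt (fun s => al s * RInt (fun v => phi v * cos (s * v)) 0 V) 0 S =
  RInt (fun v => phi v * RInt (fun s => al s * cos (s * v)) 0 S) 0 V :> R.
Proof.
  intros Ha Hp.
  rewrite (RI_ftc (fun S => RInt (fun v => phi v * RInt (fun s => al s * cos (s * v)) 0 S) 0 V)).
  - rewrite (RI_ext (fun v => phi v * RInt (fun s => al s * cos (s * v)) 0 0) (fun _ => 0)).
    + rewrite RI_const. ring.
    + intros v. rewrite RInt_point. unfold zero; simpl; ring.
  - intros s.
    eapply der_eq.
    + apply (param_der (fun S v => phi v * RInt (fun s => al s * cos (s * v)) 0 S)
               (fun s v => phi v * (al s * cos (s * v)))).
      * intros u v. apply is_derive_scal.
        apply (RI_derive (fun s => al s * cos (s * v))). ct.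
      * apply cont2_mult; [now apply cont2_snd|]. apply cont2_mult; [now apply cont2_fst|].
        apply (cont2_comp cos); [apply cos_cont|].
        apply cont2_mult; [apply cont2_1|apply cont2_2].
      * intros u. apply cont_mult; auto.
        intros v. apply (continuous_ext (fun v => RInt (fun s => al s * cos (v * s)) 0 u)).
        -- intros w. apply RI_ext; intros t; f_equal; f_equal; ring.
        -- apply (cosint_cont al u Ha).
    + rewrite <- RI_scal by ct. apply RI_ext. intros v; ring.
  - apply cont_mult; auto. now apply cosint_cont.
Qed.

(** ** Finite combinations of point evaluations *)

(** The list [(c_1, w_1), ..., (c_n, w_n)] stands for the functional
    [r |-> c_1 r (w_1) + ... + c_n r (w_n)]. *)
Definition ev (l : list (R * R)) (r : R -> R) : R :=
  List.fold_right (fun p acc => fst p * r (snd p) + acc) 0 l.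
Definition norm1 (l : list (R * R)) : R :=
  List.fold_right (fun p acc => Rabs (fst p) + acc) 0 l.
(** The functional is nonnegative on every cosine, hence on every mixture of
    cosines. *)
Definition cos_pos (l : list (R * R)) : Prop :=
  forall s, 0 <= s -> 0 <= ev l (fun w => cos (s * w)).

Lemma ev_ext l r r' : (forall w, r w = r' w) -> ev l r = ev l r'.
Proof. intros H; induction l as [|p l IH]; simpl; auto. now rewrite H, IH. Qed.
Lemma ev_scal l a r : ev l (fun w => a * r w) = a * ev l r.
Proof. induction l as [|p l IH]; simpl; [ring|]. rewrite IH; ring. Qed.
Lemma ev_zero l : ev l (fun _ => 0) = 0.
Proof. induction l as [|p l IH]; simpl; [ring|]. rewrite IH; ring. Qed.
Lemma norm1_pos l : 0 <= norm1 l.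
Proof. induction l as [|p l IH]; simpl; [lra|]. generalize (Rabs_pos (fst p)); lra. Qed.
Lemma ev_close l r r' e : (forall w, List.In w (List.map snd l) -> Rabs (r w - r' w) <= e) ->
  Rabs (ev l r - ev l r') <= norm1 l * e.
Proof.
  induction l as [|p l IH]; simpl; intros H.
  - rewrite Rminus_diag, Rabs_R0; lra.
  - replace (fst p * r (snd p) + ev l r - (fst p * r' (snd p) + ev l r'))
      with (fst p * (r (snd p) - r' (snd p)) + (ev l r - ev l r')) by ring.
    eapply Rle_trans; [apply Rabs_triang|]. rewrite Rabs_mult, Rmult_plus_distr_r.
    apply Rplus_le_compat; [|apply IH; intros; apply H; auto].
    apply Rmult_le_compat_l; [apply Rabs_pos|apply H; auto].
Qed.
Lemma ev_bound l r e : (forall w, Rabs (r w) <= e) -> Rabs (ev l r) <= norm1 l * e.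
Proof.
  intros H. replace (ev l r) with (ev l r - ev l (fun _ => 0)).
  - apply ev_close. intros w _. rewrite Rminus_0_r; auto.
  - rewrite (ev_zero l); ring.
Qed.
Lemma ev_RInt l (F : R -> R -> R) a b : (forall w, cont (fun v => F v w)) ->
  RInt (fun v => ev l (F v)) a b = ev l (fun w => RInt (fun v => F v w) a b) :> R.
Proof.
  intros H; induction l as [|p l IH]; simpl.
  - rewrite RI_const; ring.
  - assert (cont (fun v => ev l (F v))).
    { clear IH; induction l as [|q l IH]; simpl; [ct|].
      apply cont_plus; auto. apply cont_mult; [ct|]; auto. }
    rewrite RI_plus; auto; [|apply cont_mult; [ct|]; auto].
    rewrite RI_scal by auto. now rewrite IH.
Qed.
Lemma ev_cont l (F : R -> R -> R) : (forall w, cont (fun v => F v w)) -> cont (fun v => ev l (F v)).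
Proof.
  intros H. induction l as [|q l IH]; simpl; [ct|].
  apply cont_plus; auto. apply cont_mult; [ct|]; auto.
Qed.

(** ** The Poisson kernel *)

Definition poisson (eps u : R) : R := eps / (eps ^ 2 + u ^ 2).
(** Both reflections are averaged, as the product of two cosines requires. *)
Definition poisson2 (eps v w : R) : R := (poisson eps (v + w) + poisson eps (v - w)) / 2.
(** The Poisson kernel cut off at the frequency [S]. *)
Definition poissonS (eps S u : R) : R :=
  (eps + exp (- (eps * S)) * (u * sin (S * u) - eps * cos (S * u))) / (eps ^ 2 + u ^ 2).

Lemma den_pos eps u : 0 < eps -> 0 < eps ^ 2 + u ^ 2.
Proof. intros; nra. Qed.

Lemma poissonS_eq eps S u : 0 < eps ->
  RInt (fun s => exp (- (eps * s)) * cos (s * u)) 0 S = poissonS eps S u :> R.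
Proof.
  intros He. assert (D := den_pos eps u He).
  rewrite (RI_ftc (fun s => exp (- (eps * s)) * (u * sin (s * u) - eps * cos (s * u)) / (eps ^ 2 + u ^ 2))).
  - unfold poissonS. rewrite Rmult_0_r, Rmult_0_l, Ropp_0, exp_0, sin_0, cos_0. field; lra.
  - intros s. auto_derive; [lra|]. field. lra.
  - ct.
Qed.
Lemma poissonS_close eps S u : 0 < eps ->
  Rabs (poissonS eps S u - poisson eps u) <= 2 / eps * exp (- (eps * S)).
Proof.
  intros He. assert (D := den_pos eps u He). unfold poissonS, poisson.
  replace (_ - _) with (exp (- (eps * S)) * ((u * sin (S * u) - eps * cos (S * u)) / (eps ^ 2 + u ^ 2)))
    by (field; lra).
  rewrite Rabs_mult, (Rabs_right (exp _)) by (left; apply exp_pos).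
  rewrite Rmult_comm. apply Rmult_le_compat_r; [left; apply exp_pos|].
  unfold Rdiv. rewrite Rabs_mult, (Rabs_right (/ _)) by (left; apply Rinv_0_lt_compat; auto).
  apply Rmult_le_reg_r with (eps ^ 2 + u ^ 2); auto.
  rewrite Rmult_assoc, Rinv_l, Rmult_1_r by lra.
  apply Rle_trans with (Rabs u + eps).
  - eapply Rle_trans; [apply Rabs_triang|]. rewrite Rabs_Ropp, !Rabs_mult, (Rabs_right eps) by lra.
    assert (Rabs (sin (S * u)) <= 1) by (apply Rabs_le; generalize (SIN_bound (S * u)); lra).
    assert (Rabs (cos (S * u)) <= 1) by (apply Rabs_le; generalize (COS_bound (S * u)); lra).
    generalize (Rabs_pos u); intros; nra.
  - replace (2 * / eps * (eps ^ 2 + u ^ 2)) with (2 * eps + 2 * (u ^ 2 / eps)) by (field; lra).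
    rewrite <- (pow2_abs u). set (y := Rabs u).
    assert (y <= eps + y ^ 2 / eps).
    { apply Rmult_le_reg_r with eps; auto. field_simplify; [|lra]. generalize (pow2_ge_0 (y - eps/2)); nra. }
    assert (0 <= y ^ 2 / eps) by (apply Rdiv_le_0_compat; [apply pow2_ge_0|auto]).
    lra.
Qed.
Lemma poisson_cont eps w : 0 < eps -> cont (fun v => poisson eps (v + w)).
Proof.
  intros He. unfold poisson. ct. intros x; generalize (den_pos eps (x + w) He); lra.
Qed.
Lemma poisson2_cont eps w : 0 < eps -> cont (fun v => poisson2 eps v w).
Proof.
  intros He. unfold poisson2. ct; [| |intros; lra].
  - now apply poisson_cont.
  - apply (poisson_cont eps (- w) He).
Qed.

Lemma cos_product eps S v w : 0 < eps ->
  RInt (fun s => exp (- (eps * s)) * cos (s * w) * cos (s * v)) 0 S =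
  (poissonS eps S (v + w) + poissonS eps S (v - w)) / 2 :> R.
Proof.
  intros He. rewrite <- !poissonS_eq by auto.
  rewrite <- RI_plus by ct. unfold Rdiv. rewrite Rmult_comm, <- RI_scal by ct.
  apply RI_ext. intros s.
  replace (s * (v + w)) with (s * v + s * w) by ring.
  replace (s * (v - w)) with (s * v - s * w) by ring.
  rewrite cos_plus, cos_minus. field.
Qed.

Lemma small_exp b c e : 0 < b -> 0 < e -> exists B, 0 <= B /\ forall x, B <= x -> Rabs c * exp (- (b * x)) <= e.
Proof.
  intros Hb He.
  destruct (lim_exp_decay b Hb (fun y => Rabs y < e / (Rabs c + 1))) as [B HB].
  - assert (0 < e / (Rabs c + 1)) by (apply Rdiv_lt_0_compat; [|generalize (Rabs_pos c)]; lra).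
    exists (mkposreal _ H). intros y Hy. unfold ball in Hy; simpl in Hy; unfold AbsRing_ball, abs, minus, plus, opp in Hy; simpl in Hy.
    rewrite Ropp_0, Rplus_0_r in Hy; exact Hy.
  - exists (Rmax 0 (B + 1)); split; [apply Rmax_l|]. intros x Hx.
    assert (H := HB x ltac:(generalize (Rmax_r 0 (B + 1)); lra)).
    rewrite Rabs_right in H by (left; apply exp_pos).
    assert (Hc := Rabs_pos c). apply Rmult_lt_compat_l with (r := Rabs c + 1) in H; [|lra].
    replace ((Rabs c + 1) * (e / (Rabs c + 1))) with e in H by (field; lra).
    generalize (exp_pos (- (b * x))); intros; nra.
Qed.

Lemma le_limit (x y : R) : (forall e, 0 < e -> x - e <= y) -> x <= y.
Proof.
  intros H. apply Rnot_lt_le; intros Hlt. specialize (H ((x - y) / 2) ltac:(lra)). lra.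
Qed.

Section PositiveTransform.
Variables (phi : R -> R) (M b : R).
Hypotheses (Cphi : cont phi) (Hb : 0 < b) (Hdec : expdec phi M b).
Hypothesis (Hpos : forall s l, 0 <= s -> isI (fun v => phi v * cos (s * v)) l -> 0 <= l).

Lemma M_pos : 0 <= M.
Proof.
  generalize (Hdec 0 (Rle_refl 0)) (Rabs_pos (phi 0)). rewrite Rmult_0_r, Ropp_0, exp_0; lra.
Qed.

Lemma cosint_lower s V : 0 <= s -> 0 <= V ->
  - (M / b * exp (- (b * V))) <= RInt (fun v => phi v * cos (s * v)) 0 V.
Proof.
  intros Hs HV.
  assert (Cf : cont (fun v => phi v * cos (s * v))) by ct.
  assert (Hd : expdec (fun v => phi v * cos (s * v)) M b).
  { intros v Hv. rewrite Rabs_mult.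
    assert (Rabs (cos (s * v)) <= 1) by (apply Rabs_le; generalize (COS_bound (s * v)); lra).
    generalize (Hdec v Hv) (Rabs_pos (phi v)); nra. }
  destruct (isI_expdec _ _ _ Cf Hb Hd) as (l & Hl & _).
  assert (T := expdec_tail _ _ _ l V Cf Hb Hd Hl HV).
  assert (P := Hpos s l Hs Hl).
  apply Rabs_le_between in T. lra.
Qed.

(** Integrating the nonnegative quantity [T(s) e^(-eps s)] times the cosine
    transform over [s] and exchanging the integrals. *)
Lemma poisson_positive l eps V : cos_pos l -> 0 < eps -> 0 <= V ->
  - (norm1 l * (M / b) / eps * exp (- (b * V)))
  <= ev l (fun w => RInt (fun v => phi v * poisson2 eps v w) 0 V).
Proof.
  intros Hl He HV.
  set (al := fun w s => exp (- (eps * s)) * cos (s * w)).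
  set (Phi := fun s => RInt (fun v => phi v * cos (s * v)) 0 V).
  assert (CPhi : cont Phi) by now apply cosint_cont.
  assert (Cal : forall w, cont (al w)) by (intros w; unfold al; ct).
  set (m := M / b * exp (- (b * V))).
  assert (Hm : 0 <= m).
  { apply Rmult_le_pos; [|left; apply exp_pos].
    apply Rdiv_le_0_compat; auto using M_pos. }
  assert (Lower : forall S, 0 <= S ->
     - (norm1 l * m / eps) <= ev l (fun w => RInt (fun s => al w s * Phi s) 0 S)).
  { intros S HS.
    rewrite <- (ev_RInt l (fun s w => al w s * Phi s)) by (intros w; apply cont_mult; auto).
    apply Rle_trans with (RInt (fun s => - (norm1 l * m) * exp (- (eps * s))) 0 S).
    - rewrite RI_scal by ct.
      rewrite (RI_ftc (fun s => - / eps * exp (- (eps * s)))).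
      + rewrite Rmult_0_r, Ropp_0, exp_0.
        assert (0 <= norm1 l * m / eps).
        { apply Rdiv_le_0_compat; auto. apply Rmult_le_pos; auto using norm1_pos. }
        replace (- (norm1 l * m) * (- / eps * exp (- (eps * S)) - - / eps * 1))
          with (- (norm1 l * m / eps) + norm1 l * m / eps * exp (- (eps * S))) by (field; lra).
        generalize (exp_pos (- (eps * S))); nra.
      + intros s; auto_derive; auto. field; lra.
      + ct.
    - apply RI_le; auto; [ct|apply (ev_cont l (fun s w => al w s * Phi s)); intros w; apply cont_mult; auto|].
      intros s [Hs _].
      rewrite (ev_ext l _ (fun w => exp (- (eps * s)) * Phi s * cos (s * w))) by (intros; unfold al; ring).
      rewrite ev_scal.
      assert (T := Hl s ltac:(lra)).
      assert (T2 : ev l (fun w => cos (s * w)) <= norm1 l).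
      { generalize (ev_bound l (fun w => cos (s * w)) 1). intros B.
        assert (forall w, Rabs (cos (s * w)) <= 1) by (intros w; apply Rabs_le; generalize (COS_bound (s * w)); lra).
        specialize (B H). apply Rabs_le_between in B. lra. }
      assert (P : - m <= Phi s) by (apply cosint_lower; lra).
      assert (X := exp_pos (- (eps * s))).
      replace (- (norm1 l * m) * exp (- (eps * s))) with (exp (- (eps * s)) * (- (norm1 l * m))) by ring.
      rewrite Rmult_assoc. apply Rmult_le_compat_l; [lra|].
      set (x := ev l (fun w => cos (s * w))) in *. nra. }
  assert (BP : exists B, 0 <= B /\ forall v, 0 <= v -> Rabs (phi v) <= B).
  { exists M. split; [apply M_pos|]. intros v Hv. eapply Rle_trans; [apply Hdec; auto|].
    assert (exp (- (b * v)) <= 1) by (rewrite <- exp_0; 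
      destruct (Req_dec (b * v) 0) as [E|E]; [rewrite E, Ropp_0; lra|left; apply exp_increasing; nra]).
    generalize M_pos (exp_pos (- (b * v))); nra. }
  destruct BP as (B & HB & BP).
  replace (norm1 l * (M / b) / eps * exp (- (b * V))) with (norm1 l * m / eps) by (unfold m; field; lra).
  apply le_limit. intros e Hee.
  destruct (small_exp eps (norm1 l * (B * (2 / eps) * V)) e He Hee) as (S & HS & HSe).
  assert (Cl : Rabs (ev l (fun w => RInt (fun s => al w s * Phi s) 0 S)
     - ev l (fun w => RInt (fun v => phi v * poisson2 eps v w) 0 V))
     <= norm1 l * (B * (2 / eps * exp (- (eps * S))) * (V - 0))).
  { apply ev_close. intros w _. unfold Phi. rewrite fubini_cos by auto.
    rewrite <- RI_minus.
    - apply RI_absc; auto.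
      + apply cont_minus; apply cont_mult; auto; [|now apply poisson2_cont].
        intros v. apply (continuous_ext (fun v => RInt (fun s => al w s * cos (v * s)) 0 S)).
        * intros u. apply RI_ext; intros t; f_equal; f_equal; ring.
        * apply (cosint_cont (al w) S (Cal w)).
      + intros v [Hv _]. unfold al. rewrite cos_product by auto. unfold poisson2.
        rewrite <- Rmult_minus_distr_l, Rabs_mult.
        apply Rmult_le_compat; auto using Rabs_pos; [apply BP; lra|].
        assert (Q1 := poissonS_close eps S (v + w) He). assert (Q2 := poissonS_close eps S (v - w) He).
        apply Rabs_le_between in Q1. apply Rabs_le_between in Q2. apply Rabs_le. lra.
    - apply cont_mult; auto.
      intros v. apply (continuous_ext (fun v => RInt (fun s => al w s * cos (v * s)) 0 S)).
      + intros u. apply RI_ext; intros t; f_equal; f_equal; ring.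
      + apply (cosint_cont (al w) S (Cal w)).
    - apply cont_mult; auto. now apply poisson2_cont. }
  specialize (Lower S HS). specialize (HSe S (Rle_refl S)).
  replace (norm1 l * (B * (2 / eps * exp (- (eps * S))) * (V - 0)))
    with (norm1 l * (B * (2 / eps) * V) * exp (- (eps * S))) in Cl by ring.
  generalize (Rle_abs (norm1 l * (B * (2 / eps) * V))) (exp_pos (- (eps * S))).
  apply Rabs_le_between in Cl. intros. nra.
Qed.

Lemma poisson_positive_limit eps l : 0 < eps -> isI (fun v => phi v * poisson eps v) l -> 0 <= l.
Proof.
  intros He Hl.
  assert (Hc : cos_pos ((1, 0) :: nil)%list).
  { intros s _. simpl. rewrite Rmult_0_r, cos_0. lra. }
  apply le_limit. intros e Hee.
  destruct (proj1 (isI_eps _ l) Hl (e / 2)) as (B & HB & HBe); [lra|].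
  destruct (small_exp b (1 * (M / b) / eps) (e / 2) Hb) as (B' & HB' & HBe'); [lra|].
  set (V := Rmax B B').
  assert (HV : 0 <= V) by (unfold V; eapply Rle_trans; [exact HB|apply Rmax_l]).
  assert (P := poisson_positive _ eps V Hc He HV). simpl in P.
  specialize (HBe V (Rmax_l _ _)). specialize (HBe' V (Rmax_r _ _)).
  apply Rabs_lt_between in HBe.
  rewrite (RI_ext (fun v => phi v * poisson2 eps v 0) (fun v => phi v * poisson eps v)) in P.
  2: { intros v. unfold poisson2. rewrite Rplus_0_r, Rminus_0_r. field. }
  rewrite Rabs_R1 in P.
  generalize (Rle_abs (1 * (M / b) / eps)) (exp_pos (- (b * V))). intros.
  replace ((1 + 0) * (M / b) / eps) with (1 * (M / b) / eps) in P by (rewrite Rplus_0_r; reflexivity).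
  nra.
Qed.

End PositiveTransform.

Lemma atan_near y : 0 < y -> PI / 2 - / y <= atan y < PI / 2.
Proof.
  intros Hy. split; [|apply atan_bound].
  assert (Hi : 0 < / y) by (apply Rinv_0_lt_compat; auto).
  generalize (atan_inv y Hy). intros E.
  destruct (MVT_cor2 atan (fun c => / (1 + c ^ 2)) 0 (/ y) Hi) as (c & E' & Hc).
  { intros c _. apply derivable_pt_lim_atan. }
  rewrite atan_0, !Rminus_0_r in E'.
  assert (0 < c ^ 2) by nra.
  assert (/ (1 + c ^ 2) < 1) by (rewrite <- Rinv_1; apply Rinv_lt_contravar; lra). nra.
Qed.

(** The Poisson kernel is an approximate identity.  The oscillation of [psi] is
    bounded by a small constant plus a multiple of [(v - w)^2], against which
    the kernel is bounded by [eps]. *)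
Lemma poisson_limit psi a w b : cont psi -> a < w < b -> forall eta, 0 < eta ->
  exists e0, 0 < e0 /\ forall eps, 0 < eps < e0 ->
  Rabs (RInt (fun v => psi v * poisson eps (v - w)) a b - PI * psi w) < eta.
Proof.
  intros Hc Hw eta Heta.
  assert (HPI := PI_RGT_0).
  destruct (continuity_ab_maj (fun v => Rabs (psi v)) a b) as (mx & Hmx & _); [lra| |].
  { intros c _. apply continuity_pt_filterlim. apply (cont_abs psi Hc). }
  set (B := Rabs (psi mx)). fold B in Hmx.
  assert (HB : 0 <= B) by apply Rabs_pos.
  set (e1 := eta / (4 * PI)).
  assert (He1 : 0 < e1) by (apply Rdiv_lt_0_compat; lra).
  destruct (Hc w (fun y => Rabs (y - psi w) < e1)) as [del Hdel].
  { exists (mkposreal _ He1). intros y Hy. exact Hy. }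
  assert (Hd := cond_pos del).
  set (Q := 2 * B / del ^ 2).
  assert (HQ : 0 <= Q) by (apply Rdiv_le_0_compat; [lra|nra]).
  assert (Osc : forall v, a <= v <= b -> Rabs (psi v - psi w) <= e1 + Q * (v - w) ^ 2).
  { intros v Hv. destruct (Rlt_le_dec (Rabs (v - w)) del) as [H|H].
    - assert (H' := Hdel v H). cbv beta in H'. generalize (pow2_ge_0 (v - w)); intros; nra.
    - assert (del ^ 2 <= (v - w) ^ 2) by (rewrite <- (pow2_abs (v - w)); nra).
      assert (2 * B <= Q * (v - w) ^ 2).
      { unfold Q, Rdiv. rewrite Rmult_assoc. rewrite <- (Rmult_1_r (2 * B)) at 1.
        apply Rmult_le_compat_l; [lra|]. apply Rmult_le_reg_l with (del ^ 2); [nra|].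
        rewrite <- Rmult_assoc, Rinv_r by nra. lra. }
      assert (Rabs (psi v - psi w) <= 2 * B); [|lra].
      eapply Rle_trans; [apply Rabs_triang|]. rewrite Rabs_Ropp.
      generalize (Hmx v Hv) (Hmx w ltac:(lra)); lra. }
  set (A := Rabs (psi w) + e1).
  set (C := Q * (b - a) + A * (/ (b - w) + / (w - a))).
  assert (I1 : 0 < / (b - w)) by (apply Rinv_0_lt_compat; lra).
  assert (I2 : 0 < / (w - a)) by (apply Rinv_0_lt_compat; lra).
  assert (HA : 0 <= A) by (unfold A; generalize (Rabs_pos (psi w)); lra).
  assert (HC : 0 <= C).
  { unfold C. apply Rplus_le_le_0_compat; apply Rmult_le_pos; lra. }
  exists (eta / (4 * (C + 1))). split; [apply Rdiv_lt_0_compat; lra|].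
  intros eps [Heps Hlt].
  assert (HCe : C * eps < eta / 4).
  { apply Rmult_lt_compat_r with (r := C + 1) in Hlt; [|lra].
    replace (eta / (4 * (C + 1)) * (C + 1)) with (eta / 4) in Hlt by (field; lra).
    rewrite Rmult_plus_distr_l, Rmult_1_r, (Rmult_comm eps) in Hlt. lra. }
  assert (CP : cont (fun v => poisson eps (v - w))) by apply (poisson_cont eps (- w) Heps).
  assert (PP : forall v, 0 < poisson eps (v - w)).
  { intros v. apply Rdiv_lt_0_compat; auto. now apply den_pos. }
  assert (Mass : RInt (fun v => poisson eps (v - w)) a b = atan ((b - w) / eps) + atan ((w - a) / eps) :> R).
  { rewrite (RI_ftc (fun v => atan ((v - w) / eps))); auto.
    - replace ((a - w) / eps) with (- ((w - a) / eps)) by (field; lra). rewrite atan_opp. ring.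
    - intros v. auto_derive; auto. unfold poisson. generalize (den_pos eps (v - w) Heps). intros Dn.
      field. repeat split; try lra; apply Rgt_not_eq; nra. }
  assert (N1 := atan_near ((b - w) / eps) ltac:(apply Rdiv_lt_0_compat; lra)).
  assert (N2 := atan_near ((w - a) / eps) ltac:(apply Rdiv_lt_0_compat; lra)).
  replace (/ ((b - w) / eps)) with (eps * / (b - w)) in N1 by (field; lra).
  replace (/ ((w - a) / eps)) with (eps * / (w - a)) in N2 by (field; lra).
  set (m := RInt (fun v => poisson eps (v - w)) a b) in *.
  assert (Hm : Rabs (m - PI) <= eps * (/ (b - w) + / (w - a))).
  { rewrite Mass. apply Rabs_le. nra. }
  assert (Hm2 : m <= PI) by (rewrite Mass; lra).
  assert (Main : Rabs (RInt (fun v => (psi v - psi w) * poisson eps (v - w)) a b)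
            <= e1 * m + Q * eps * (b - a)).
  { apply Rle_trans with (RInt (fun v => e1 * poisson eps (v - w) + Q * eps) a b).
    - apply RI_abs; try lra; [ct|ct|].
      intros v Hv. rewrite Rabs_mult, (Rabs_right (poisson _ _)) by (left; apply PP).
      apply Rle_trans with ((e1 + Q * (v - w) ^ 2) * poisson eps (v - w)).
      + apply Rmult_le_compat_r; [left; apply PP|apply Osc; lra].
      + rewrite Rmult_plus_distr_r. apply Rplus_le_compat_l. rewrite Rmult_assoc.
        apply Rmult_le_compat_l; auto. unfold poisson.
        generalize (den_pos eps (v - w) Heps); intros D.
        apply Rmult_le_reg_r with (eps ^ 2 + (v - w) ^ 2); auto.
        replace ((v - w) ^ 2 * (eps / (eps ^ 2 + (v - w) ^ 2)) * (eps ^ 2 + (v - w) ^ 2))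
          with (eps * (v - w) ^ 2) by (field; lra). nra.
    - rewrite RI_plus, RI_scal, RI_const by ct. fold m. lra. }
  replace (RInt (fun v => psi v * poisson eps (v - w)) a b - PI * psi w)
    with (RInt (fun v => (psi v - psi w) * poisson eps (v - w)) a b + psi w * (m - PI)).
  - eapply Rle_lt_trans; [apply Rabs_triang|]. rewrite Rabs_mult.
    assert (e1 * m <= eta / 4).
    { apply Rle_trans with (e1 * PI); [apply Rmult_le_compat_l; lra|]. unfold e1. right; field; lra. }
    assert (Rabs (psi w) * Rabs (m - PI) <= A * (eps * (/ (b - w) + / (w - a)))).
    { apply Rmult_le_compat; auto using Rabs_pos. unfold A; lra. }
    unfold C in HCe. nra.
  - rewrite (RI_ext (fun v => (psi v - psi w) * poisson eps (v - w))
      (fun v => psi v * poisson eps (v - w) - psi w * poisson eps (v - w))) by (intros; ring).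
    rewrite RI_minus, RI_scal by ct. fold m. ring.
Qed.

Lemma cont_even phi : cont phi -> cont (fun v => phi (Rabs v)).
Proof. intros H; apply (cont_comp Rabs phi); auto. apply (cont_abs (fun x => x)), cont_id. Qed.

Lemma even_fold phi eps w V : cont phi -> 0 < eps -> 0 <= V ->
  RInt (fun v => phi v * poisson2 eps v w) 0 V =
  / 2 * RInt (fun v => phi (Rabs v) * poisson eps (v - w)) (- V) V :> R.
Proof.
  intros Hc He HV. assert (CE := cont_even phi Hc).
  assert (CP : forall w, cont (fun v => poisson eps (v - w))) by (intros u; apply (poisson_cont eps (- u) He)).
  assert (CP' : forall w, cont (fun v => poisson eps (v + w))) by (intros u; apply (poisson_cont eps u He)).
  rewrite <- (RI_chasles (fun v => phi (Rabs v) * poisson eps (v - w)) ltac:(ct) (- V) 0 V).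
  generalize (RI_neg (fun v => phi (Rabs v) * poisson eps (v - w)) 0 V ltac:(ct)).
  rewrite Ropp_0. intros <-.
  rewrite <- RI_plus.
  - rewrite <- RI_scal.
    + apply RI_ext2; auto. intros v Hv. rewrite Rabs_Ropp, Rabs_right by lra.
      unfold poisson2, poisson. replace ((- v - w) ^ 2) with ((v + w) ^ 2) by ring. field.
      generalize (den_pos eps (v + w) He) (den_pos eps (v - w) He); lra.
    + apply cont_plus; [|ct]. apply (cont_neg (fun v => phi (Rabs v) * poisson eps (v - w))). ct.
  - apply (cont_neg (fun v => phi (Rabs v) * poisson eps (v - w))). ct.
  - ct.
Qed.

(** Positive definiteness, tested on all functionals that are nonnegative on the cosines;
    these, unlike the quadratic forms of the usual definition, are closed under second
    differences. *)
Definition pd (r : R -> R) : Prop := forall l, cos_pos l -> 0 <= ev l r.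

(** The easy half of Bochner's theorem.  Smoothing [phi] with the Poisson kernel gives a
    mixture of cosines with nonnegative weights, and the smoothing is then removed. *)
Theorem pd_of_transform phi M b : cont phi -> 0 < b -> expdec phi M b ->
  (forall s l, 0 <= s -> isI (fun v => phi v * cos (s * v)) l -> 0 <= l) ->
  pd (fun w => phi (Rabs w)).
Proof.
  intros Hc Hb Hd Hp l Hl.
  assert (HM : 0 <= M) by (eapply M_pos; eauto).
  assert (HPI := PI_RGT_0).
  assert (Hmax : exists W, 0 <= W /\ forall w, In w (map snd l) -> Rabs w <= W).
  { clear. induction l as [|p l (W & H0 & H)]; simpl.
    - exists 0; split; [lra|tauto].
    - exists (Rmax (Rabs (snd p)) W). split; [eapply Rle_trans; [exact H0|apply Rmax_r]|].
      intros w [<-|Hw]; [apply Rmax_l|]. eapply Rle_trans; [apply H; auto|apply Rmax_r]. }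
  destruct Hmax as (W & HW0 & HW).
  set (V := W + 1).
  (* the kernel is at most [eps] beyond [V], so the positivity of the full
     integral passes to [[0, V]] up to a multiple of [eps] *)
  assert (Low : forall eps, 0 < eps ->
     - (norm1 l * (M / b) * eps) <= ev l (fun w => RInt (fun v => phi v * poisson2 eps v w) 0 V)).
  { intros eps He. apply le_limit. intros e Hee.
    destruct (small_exp b (norm1 l * (M / b) / eps) e Hb Hee) as (B & HB & HBe).
    set (V' := Rmax B V).
    assert (HV' : V <= V') by apply Rmax_r.
    assert (P := poisson_positive phi M b Hc Hb Hd Hp l eps V' Hl He ltac:(unfold V in *; lra)).
    specialize (HBe V' (Rmax_l _ _)).
    assert (Cl : Rabs (ev l (fun w => RInt (fun v => phi v * poisson2 eps v w) 0 V')
        - ev l (fun w => RInt (fun v => phi v * poisson2 eps v w) 0 V)) <= norm1 l * (M / b * eps)).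
    { apply ev_close. intros w Hw. assert (Hw' := HW w Hw). apply Rabs_le_between in Hw'.
      assert (Cw : cont (fun v => phi v * poisson2 eps v w)) by (apply cont_mult; auto; now apply poisson2_cont).
      replace (RInt (fun v => phi v * poisson2 eps v w) 0 V' - RInt (fun v => phi v * poisson2 eps v w) 0 V)
        with (RInt (fun v => phi v * poisson2 eps v w) V V')
        by (rewrite <- (RI_chasles _ Cw 0 V V'); rring).
      apply Rle_trans with (RInt (fun v => M * eps * exp (- (b * v))) V V').
      - apply RI_abs; auto; [ct|].
        intros v Hv. unfold V in Hv. rewrite Rabs_mult.
        assert (Hk : 0 <= poisson2 eps v w <= eps).
        { assert (K : forall u, 1 <= u ^ 2 -> 0 <= poisson eps u <= eps).
          { intros u Hu. unfold poisson. generalize (den_pos eps u He); intros D. split.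
            - left; apply Rdiv_lt_0_compat; auto.
            - apply Rmult_le_reg_r with (eps ^ 2 + u ^ 2); auto.
              unfold Rdiv; rewrite Rmult_assoc, Rinv_l by lra. nra. }
          unfold poisson2. generalize (K (v + w) ltac:(nra)) (K (v - w) ltac:(nra)). lra. }
        rewrite (Rabs_right (poisson2 eps v w)) by lra.
        rewrite (Rmult_comm M eps), Rmult_assoc, (Rmult_comm eps).
        apply Rmult_le_compat; try lra; auto using Rabs_pos. apply Hd; lra.
      - rewrite RI_scal by ct. rewrite (RI_ftc (fun v => - / b * exp (- (b * v)))).
        + assert (exp (- (b * V)) <= 1).
          { rewrite <- exp_0. left; apply exp_increasing. unfold V; nra. }
          generalize (exp_pos (- (b * V'))); intros.
          replace (M / b * eps) with (M * eps * (/ b)) by (unfold Rdiv; ring).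
          apply Rmult_le_compat_l; [nra|].
          assert (0 < / b) by (apply Rinv_0_lt_compat; auto). nra.
        + intros v; auto_derive; auto. field; lra.
        + ct. }
    apply Rabs_le_between in Cl.
    generalize (Rle_abs (norm1 l * (M / b) / eps)) (exp_pos (- (b * V'))); intros. nra. }
  assert (Close : forall eta, 0 < eta -> exists e0, 0 < e0 /\ forall eps, 0 < eps < e0 ->
     Rabs (ev l (fun w => RInt (fun v => phi v * poisson2 eps v w) 0 V)
           - ev l (fun w => / 2 * (PI * phi (Rabs w)))) <= norm1 l * eta).
  { intros eta Heta.
    assert (All : exists e0, 0 < e0 /\ forall eps, 0 < eps < e0 -> forall w, In w (map snd l) ->
       Rabs (RInt (fun v => phi v * poisson2 eps v w) 0 V - / 2 * (PI * phi (Rabs w))) <= eta).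
    { clear Low Hl. induction l as [|p l' IH]; simpl.
      - exists 1; split; [lra|tauto].
      - destruct IH as (e0 & H0 & H); [intros; apply HW; simpl; auto|].
        assert (Hp0 := HW (snd p) (or_introl eq_refl)). apply Rabs_le_between in Hp0.
        destruct (poisson_limit (fun v => phi (Rabs v)) (- V) (snd p) V (cont_even phi Hc)
           ltac:(unfold V; lra) eta Heta) as (e1 & H1 & H1').
        exists (Rmin e0 e1). split; [apply Rmin_pos; auto|].
        intros eps [He1 He2] w [<-|Hw].
        + rewrite even_fold by (auto; unfold V; lra).
          rewrite <- Rmult_minus_distr_l, Rabs_mult, Rabs_right by lra.
          specialize (H1' eps). generalize (Rmin_r e0 e1); intros.
          specialize (H1' ltac:(lra)). generalize (Rabs_pos (RInt (fun v => phi (Rabs v) * poisson eps (v - snd p)) (- V) V - PI * phi (Rabs (snd p)))). lra.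
        + apply H; auto. generalize (Rmin_l e0 e1); lra. }
    destruct All as (e0 & H0 & H). exists e0; split; auto. intros eps He.
    apply ev_close. intros w Hw. now apply H. }
  rewrite (ev_ext l _ (fun w => 2 / PI * (/ 2 * (PI * phi (Rabs w))))) by (intros; field; lra).
  rewrite ev_scal. apply Rmult_le_pos; [left; apply Rdiv_lt_0_compat; lra|].
  apply le_limit. intros e He.
  assert (N := norm1_pos l).
  set (D := norm1 l * (M / b)).
  assert (HD : 0 <= D) by (apply Rmult_le_pos; auto; apply Rdiv_le_0_compat; auto).
  destruct (Close (e / (2 * (norm1 l + 1)))) as (e0 & H0 & H).
  { apply Rdiv_lt_0_compat; lra. }
  set (eps := Rmin (e0 / 2) (e / (2 * (D + 1)))).
  assert (E1 : eps <= e0 / 2) by apply Rmin_l.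
  assert (E2 : eps <= e / (2 * (D + 1))) by apply Rmin_r.
  assert (E3 : 0 < eps) by (apply Rmin_pos; [lra|apply Rdiv_lt_0_compat; lra]).
  specialize (Low eps E3). specialize (H eps ltac:(lra)). fold D in Low.
  apply Rabs_le_between in H.
  assert (norm1 l * (e / (2 * (norm1 l + 1))) <= e / 2).
  { apply Rmult_le_reg_r with (2 * (norm1 l + 1)); [lra|]. field_simplify; nra. }
  assert (D * eps <= e / 2).
  { apply Rle_trans with (D * (e / (2 * (D + 1)))); [apply Rmult_le_compat_l; auto|].
    apply Rmult_le_reg_r with (2 * (D + 1)); [lra|]. field_simplify; nra. }
  lra.
Qed.
(** * The Laplace transform of the kernel in the right half plane *)

Lemma exp_le a b : a <= b -> exp a <= exp b.
Proof. intros [H|<-]; [left; now apply exp_increasing|lra]. Qed.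
Lemma exp_neg_le1 a : 0 <= a -> exp (- a) <= 1.
Proof. intros H. rewrite <- exp_0. apply exp_le; lra. Qed.
Lemma Rabs_cos x : Rabs (cos x) <= 1.
Proof. apply Rabs_le; generalize (COS_bound x); lra. Qed.
Lemma Rabs_sin x : Rabs (sin x) <= 1.
Proof. apply Rabs_le; generalize (SIN_bound x); lra. Qed.

Lemma der_expm x v : is_derive (fun v => exp (- (x * v))) v (- x * exp (- (x * v))).
Proof. auto_derive; auto. ring. Qed.
Lemma pow_le_exp n y : 0 <= y -> y ^ n <= INR (fact n) * exp y.
Proof.
  revert y; induction n as [|n IH]; intros y Hy.
  - simpl. generalize (exp_ineq1_le y); lra.
  - assert (E : RInt (fun t => INR (S n) * t ^ n) 0 y = y ^ S n :> R).
    { rewrite (RI_ftc (fun t => t ^ S n)).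
      - simpl; ring.
      - intros t. eapply der_eq; [apply is_derive_pow, der_id|]. cbn [pred]; ring.
      - ct. }
    rewrite <- E.
    apply Rle_trans with (RInt (fun t => INR (S n) * INR (fact n) * exp t) 0 y).
    + apply RI_le; auto; [ct|ct|]. intros t Ht. rewrite Rmult_assoc.
      apply Rmult_le_compat_l; [apply pos_INR|apply IH; lra].
    + rewrite RI_scal by ct. rewrite (RI_ftc exp).
      * rewrite exp_0, <- mult_INR. change (S n * fact n)%nat with (fact (S n)).
        apply Rmult_le_compat_l; [apply pos_INR|lra].
      * intros t; auto_derive; auto; ring.
      * ct.
Qed.
Lemma pow_exp_dec n x v : 0 < x -> 0 <= v ->
  v ^ n * exp (- (x * v)) <= INR (fact n) * (2 / x) ^ n * exp (- (x / 2 * v)).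
Proof.
  intros Hx Hv.
  replace (exp (- (x * v))) with (exp (- (x / 2 * v)) * exp (- (x / 2 * v)))
    by (rewrite <- exp_plus; f_equal; field).
  rewrite <- Rmult_assoc. apply Rmult_le_compat_r; [left; apply exp_pos|].
  assert (H := pow_le_exp n (x / 2 * v) ltac:(nra)).
  rewrite Rpow_mult_distr in H. rewrite exp_Ropp.
  assert (E := exp_pos (x / 2 * v)).
  apply Rmult_le_reg_r with (exp (x / 2 * v) * (x / 2) ^ n).
  { apply Rmult_lt_0_compat; auto. apply pow_lt; lra. }
  replace (v ^ n * / exp (x / 2 * v) * (exp (x / 2 * v) * (x / 2) ^ n)) with ((x / 2) ^ n * v ^ n) by (field; lra).
  replace (INR (fact n) * (2 / x) ^ n * (exp (x / 2 * v) * (x / 2) ^ n))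
    with (INR (fact n) * exp (x / 2 * v) * ((2 / x) ^ n * (x / 2) ^ n)) by ring.
  rewrite <- (Rpow_mult_distr (2 / x)). replace (2 / x * (x / 2)) with 1 by (field; lra). rewrite pow1. lra.
Qed.
Lemma isI_powexp n x : 0 < x -> isI (fun v => v ^ n * exp (- (x * v))) (INR (fact n) / x ^ S n).
Proof.
  intros Hx. induction n as [|n IH].
  - simpl. replace (1 / (x * 1)) with (/ x) by (field; lra).
    apply isI_ext with (fun v => exp (- (x * v))); [intros; ring|now apply isI_exp].
  - set (F := fun v => - / x * (v ^ S n * exp (- (x * v)))).
    assert (IF : isI (fun v => v ^ S n * exp (- (x * v)) - INR (S n) / x * (v ^ n * exp (- (x * v)))) (0 - F 0)).
    { apply isI_antider.
      - intros v. unfold F. eapply der_eq.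
        + apply is_derive_scal, der_mult; [apply is_derive_pow, der_id|apply der_expm].
        + cbn [pred]. cbv beta. field. lra.
      - ct.
      - apply filterlim_locally. intros eps.
        set (A := INR (fact (S n)) * (2 / x) ^ S n / x).
        destruct (small_exp (x / 2) A (eps / 2)) as (B & HB & H); [lra|generalize (cond_pos eps); lra|].
        exists (Rmax 0 B). intros v Hv. unfold ball; simpl; unfold AbsRing_ball, abs, minus, plus, opp; simpl.
        rewrite Ropp_0, Rplus_0_r.
        assert (Hv0 : 0 < v) by (generalize (Rmax_l 0 B); lra).
        unfold F. rewrite Rabs_mult, Rabs_Ropp, !Rabs_right.
        + specialize (H v ltac:(generalize (Rmax_r 0 B); lra)).
          assert (D := pow_exp_dec (S n) x v Hx ltac:(lra)).
          apply Rmult_le_compat_l with (r := / x) in D; [|left; apply Rinv_0_lt_compat; auto].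
          replace (/ x * (INR (fact (S n)) * (2 / x) ^ S n * exp (- (x / 2 * v))))
            with (A * exp (- (x / 2 * v))) in D by (unfold A, Rdiv; ring).
          generalize (Rle_abs A) (exp_pos (- (x / 2 * v))) (cond_pos eps); intros. nra.
        + apply Rle_ge, Rmult_le_pos; [apply pow_le; lra|left; apply exp_pos].
        + left; apply Rinv_0_lt_compat; auto. }
    apply (isI_scal (INR (S n) / x)) in IH; [|ct].
    replace (INR (fact (S n)) / x ^ S (S n)) with (0 - F 0 + INR (S n) / x * (INR (fact n) / x ^ S n)).
    + apply isI_ext with (fun v => v ^ S n * exp (- (x * v)) - INR (S n) / x * (v ^ n * exp (- (x * v)))
          + INR (S n) / x * (v ^ n * exp (- (x * v)))); [intros; ring|].
      apply isI_plus; auto; ct.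
    + unfold F. rewrite pow_i by lia. change (fact (S n)) with (S n * fact n)%nat. rewrite mult_INR.
      simpl. field. split; [apply pow_nonzero|]; lra.
Qed.

Lemma isI_expcos x u : 0 < x -> isI (fun v => exp (- (x * v)) * cos (u * v)) (poisson x u).
Proof.
  intros Hx. apply isI_eps. intros e He.
  destruct (small_exp x (2 / x) (e / 2) Hx) as (B & HB & H); [lra|].
  exists B; split; auto. intros b Hb.
  rewrite (RI_ext _ (fun v => exp (- (x * v)) * cos (v * u))) by (intros; do 2 f_equal; ring).
  rewrite poissonS_eq by auto.
  eapply Rle_lt_trans; [apply poissonS_close; auto|].
  specialize (H b Hb). generalize (Rle_abs (2 / x)) (exp_pos (- (x * b))). nra.
Qed.

Lemma expdec_mult f g M b : expdec f M b -> (forall v, 0 <= v -> Rabs (g v) <= 1) ->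
  expdec (fun v => f v * g v) M b.
Proof.
  intros Hf Hg v Hv. rewrite Rabs_mult.
  generalize (Hf v Hv) (Hg v Hv) (Rabs_pos (f v)) (Rabs_pos (g v)); nra.
Qed.
Lemma expdec_exp x : expdec (fun v => exp (- (x * v))) 1 x.
Proof. intros v _. rewrite Rabs_right by (left; apply exp_pos). lra. Qed.

(** A Cauchy kernel is a Poisson kernel, and the cosine transform of
    [exp (- x v) * cos (s v)] is a mean of two Poisson kernels. *)
Lemma cauchy_transform x s c l : 0 < x -> 0 < c ->
  isI (fun v => exp (- (x * v)) * cos (s * v) * / (v ^ 2 + c)) l -> 0 <= l.
Proof.
  intros Hx Hc Hl.
  assert (Hq : 0 < sqrt c) by (apply sqrt_lt_R0; auto).
  assert (Cv : cont (fun v => exp (- (x * v)) * cos (s * v))) by ct.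
  assert (0 <= sqrt c * l).
  { apply (poisson_positive_limit (fun v => exp (- (x * v)) * cos (s * v)) 1 x) with (eps := sqrt c); auto.
    - apply expdec_mult; [apply expdec_exp|]. intros; apply Rabs_cos.
    - intros sg m Hsg Hm.
      rewrite (isI_unique _ m ((poisson x (s + sg) + poisson x (s - sg)) / 2) Hm).
      + assert (P : forall u, 0 < poisson x u).
        { intros u; apply Rdiv_lt_0_compat; auto. now apply den_pos. }
        generalize (P (s + sg)) (P (s - sg)); lra.
      + apply isI_ext with (fun v => / 2 * (exp (- (x * v)) * cos ((s + sg) * v) + exp (- (x * v)) * cos ((s - sg) * v))).
        * intros v _. replace ((s + sg) * v) with (s * v + sg * v) by ring.
          replace ((s - sg) * v) with (s * v - sg * v) by ring. rewrite cos_plus, cos_minus. field.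
        * unfold Rdiv. rewrite Rmult_comm. apply isI_scal; [ct|].
          apply isI_plus; try ct; now apply isI_expcos.
    - apply isI_ext with (fun v => sqrt c * (exp (- (x * v)) * cos (s * v) * / (v ^ 2 + c))).
      + intros v _. unfold poisson. rewrite pow2_sqrt by lra. rewrite (Rplus_comm c). field. nra.
      + apply isI_scal; auto. ct. intros v; nra. }
  nra.
Qed.

Definition ker (x v : R) : R := k v * exp (- (x * v)).
Lemma ker_cont x : cont (ker x).
Proof. assert (H := k_cont). unfold ker; ct. Qed.
Lemma ker_dec x : expdec (ker x) (1 / 8) x.
Proof.
  intros v _. unfold ker. rewrite Rabs_mult, !Rabs_right by (left; (apply exp_pos || apply k_pos)).
  apply Rmult_le_compat_r; [left; apply exp_pos|apply k_le].
Qed.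

Lemma pfrac_cont l : admissible l -> cont (pfrac l).
Proof.
  intros Hl; induction Hl as [|[w c] l [Hw Hc] Hl IH]; [apply cont_const|].
  apply (cont_plus (fun T => w / (T * (T * 1) + c)) (pfrac l)); auto. ct. simpl in Hc; intros v; apply Rgt_not_eq; nra.
Qed.
Lemma pfrac_transform l x s : admissible l -> 0 < x -> exists m, 0 <= m /\
  isI (fun v => exp (- (x * v)) * cos (s * v) * pfrac l v) m.
Proof.
  intros Hl Hx. induction Hl as [|[w c] l [Hw Hc] Hl (m & Hm & IH)].
  - exists 0; split; [lra|]. apply isI_ext with (fun _ => 0); [intros; simpl; ring|apply isI_zero].
  - simpl in Hw, Hc. assert (C : cont (fun v => exp (- (x * v)) * cos (s * v) * / (v ^ 2 + c))) by (ct; intros; nra).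
    destruct (isI_expdec (fun v => exp (- (x * v)) * cos (s * v) * / (v ^ 2 + c)) (/ c) x) as (m' & Hm' & _); auto.
    { intros v Hv. rewrite !Rabs_mult, Rmult_comm, (Rabs_right (exp _)) by (left; apply exp_pos).
      rewrite (Rabs_right (/ _)) by (left; apply Rinv_0_lt_compat; nra).
      apply Rmult_le_compat.
      - left; apply Rinv_0_lt_compat; nra.
      - apply Rmult_le_pos; [left; apply exp_pos|apply Rabs_pos].
      - apply Rinv_le_contravar; nra.
      - rewrite <- (Rmult_1_r (exp (- (x * v)))) at 2. apply Rmult_le_compat_l; [left; apply exp_pos|apply Rabs_cos]. }
    assert (P := cauchy_transform x s c m' Hx Hc Hm').
    exists (w * m' + m). split; [nra|].
    apply isI_ext with (fun v => w * (exp (- (x * v)) * cos (s * v) * / (v ^ 2 + c)) + exp (- (x * v)) * cos (s * v) * pfrac l v).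
    + intros v _. simpl. field. nra.
    + apply isI_plus; auto; [ct| |now apply isI_scal].
      assert (X := pfrac_cont l Hl). ct.
Qed.

Lemma k_approx_unif n : exists b l, 0 <= b /\ admissible l /\ forall v, 0 < v ->
  Rabs (k v - (b + pfrac l v)) <= (1 + v) / 2 ^ n.
Proof.
  destruct (k_approx n) as (b & l & Hb & Hl & E). exists b, l. do 2 (split; auto).
  intros v Hv. assert (H1 : 1 <= 2 ^ n) by (apply pow_R1_Rle; lra).
  assert (P : 0 <= pfrac l v).
  { clear -Hl Hv. induction Hl as [|[w c] l [Hw Hc] Hl IH]; simpl in *; [lra|].
    apply Rplus_le_le_0_compat; auto. apply Rdiv_le_0_compat; auto; nra. }
  destruct (Rle_lt_dec v (2 ^ n)) as [H|H].
  - specialize (E v (conj Hv H)). rewrite Rabs_right by lra.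
    eapply Rle_trans; [apply E|]. apply Rmult_le_compat_l; [lra|].
    apply Rinv_le_contravar; [lra|]. apply Rle_trans with (2 ^ S n); [simpl; lra|].
    apply pow_incr; lra.
  - specialize (E 1 ltac:(lra)). assert (D := pfrac_decr l 1 v Hl ltac:(lra)).
    assert (K1 := k_le 1). assert (K2 := k_le v). assert (K3 := k_pos v).
    assert (1 <= (1 + v) / 2 ^ n).
    { apply Rmult_le_reg_r with (2 ^ n); [lra|]. unfold Rdiv; rewrite Rmult_assoc, Rinv_l by lra. lra. }
    apply Rabs_le. lra.
Qed.

(** The kernel [k] is a limit of positive combinations of Cauchy kernels and constants. *)
Lemma ker_cos_pos x s l : 0 < x -> isI (fun v => ker x v * cos (s * v)) l -> 0 <= l.
Proof.
  intros Hx Hl. apply le_limit. intros e He.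
  set (D := / x + / x ^ 2).
  assert (HD : 0 < D) by (unfold D; generalize (Rinv_0_lt_compat x Hx) (Rinv_0_lt_compat (x ^ 2) ltac:(nra)); lra).
  destruct (pow2_large (D / e)) as [n Hn]. specialize (Hn n (Nat.le_refl n)).
  destruct (k_approx_unif n) as (b & lp & Hb & Hlp & E).
  destruct (pfrac_transform lp x s Hlp Hx) as (m & Hm & Im).
  assert (CP := pfrac_cont lp Hlp). assert (CK := ker_cont x).
  set (f := fun v => b * (exp (- (x * v)) * cos (s * v)) + exp (- (x * v)) * cos (s * v) * pfrac lp v).
  assert (Cf : cont f) by (unfold f; ct).
  assert (If : isI f (b * poisson x s + m)).
  { apply isI_plus; [ct|ct| |exact Im].
    apply isI_scal; [ct|]. now apply isI_expcos. }
  assert (P : 0 < poisson x s) by (apply Rdiv_lt_0_compat; auto; now apply den_pos).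
  assert (Ig : isI (fun v => / 2 ^ n * ((1 + v) * exp (- (x * v)))) (/ 2 ^ n * D)).
  { apply isI_scal; [ct|].
    apply isI_ext with (fun v => v ^ 0 * exp (- (x * v)) + v ^ 1 * exp (- (x * v))); [intros; ring|].
    replace D with (INR (fact 0) / x ^ 1 + INR (fact 1) / x ^ 2) by (unfold D; simpl; field; lra).
    apply isI_plus; try ct; now apply isI_powexp. }
  destruct (isI_dom (fun v => ker x v * cos (s * v) - f v) (fun v => / 2 ^ n * ((1 + v) * exp (- (x * v)))) (/ 2 ^ n * D))
    as (d & Id & Hd); auto.
  { ct. } { ct. }
  { intros v Hv. unfold f, ker.
    replace (_ - _) with ((k v - (b + pfrac lp v)) * (exp (- (x * v)) * cos (s * v))) by ring.
    rewrite !Rabs_mult, (Rabs_right (exp _)) by (left; apply exp_pos).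
    apply Rle_trans with (Rabs (k v - (b + pfrac lp v)) * (exp (- (x * v)) * 1)).
    - apply Rmult_le_compat_l; [apply Rabs_pos|].
      apply Rmult_le_compat_l; [left; apply exp_pos|apply Rabs_cos].
    - replace (/ 2 ^ n * ((1 + v) * exp (- (x * v)))) with ((1 + v) / 2 ^ n * (exp (- (x * v)) * 1))
        by (unfold Rdiv; ring).
      apply Rmult_le_compat_r; [rewrite Rmult_1_r; left; apply exp_pos|auto]. }
  assert (l = d + (b * poisson x s + m)).
  { apply (isI_unique (fun v => ker x v * cos (s * v))); auto.
    apply isI_ext with (fun v => (ker x v * cos (s * v) - f v) + f v); [intros; ring|].
    apply isI_plus; auto. ct. }
  assert (H2 : 0 < 2 ^ n) by (apply pow_lt; lra).
  assert (/ 2 ^ n * D <= e).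
  { apply Rmult_le_reg_l with (2 ^ n); auto. rewrite <- Rmult_assoc, Rinv_r, Rmult_1_l by lra.
    apply Rmult_le_compat_r with (r := e) in Hn; [|lra]. replace (D / e * e) with D in Hn by (field; lra). auto. }
  apply Rabs_le_between in Hd. assert (0 <= b * poisson x s) by (apply Rmult_le_pos; lra). lra.
Qed.

(** ** The sine transform *)

(** Integration by parts with the nonnegative primitive [(1 - cos (s v)) / s]. *)
Lemma decr_sin_pos f f' s V : cont f -> cont f' -> (forall v, is_derive f v (f' v)) ->
  (forall v, 0 <= v -> 0 <= f v) -> (forall v, 0 <= v -> f' v <= 0) -> 0 < s -> 0 <= V ->
  0 <= RInt (fun v => f v * sin (s * v)) 0 V.
Proof.
  intros Cf Cf' Df Pf Nf Hs HV.
  assert (E : RInt (fun v => f' v * ((1 - cos (s * v)) / s) + f v * sin (s * v)) 0 V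
    = f V * ((1 - cos (s * V)) / s) - f 0 * ((1 - cos (s * 0)) / s) :> R).
  { apply (RI_ftc (fun v => f v * ((1 - cos (s * v)) / s))).
    - intros v. apply (der_mult f (fun v => (1 - cos (s * v)) / s) v (f' v) (sin (s * v))); [apply Df|].
      auto_derive; auto. field. lra.
    - ct; intros; lra. }
  rewrite Rmult_0_r, cos_0 in E. rewrite RI_plus in E by (ct; intros; lra).
  assert (A : RInt (fun v => f' v * ((1 - cos (s * v)) / s)) 0 V <= RInt (fun _ => 0) 0 V).
  { apply RI_le; auto; [ct; intros; lra|ct|]. intros v Hv.
    assert (0 <= (1 - cos (s * v)) / s) by (apply Rdiv_le_0_compat; [generalize (COS_bound (s * v))|]; lra).
    specialize (Nf v ltac:(lra)). nra. }
  rewrite RI_const in A.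
  assert (0 <= f V * ((1 - cos (s * V)) / s)).
  { apply Rmult_le_pos; auto. apply Rdiv_le_0_compat; [generalize (COS_bound (s * V))|]; lra. }
  lra.
Qed.

Definition ker' (x v : R) : R := Derive k v * exp (- (x * v)) - x * ker x v.
Lemma ker_der x v : is_derive (ker x) v (ker' x v).
Proof.
  unfold ker'. eapply der_eq; [apply der_mult|].
  - apply (smooth_der full); auto using open_full, k_smooth; exact Logic.I.
  - apply der_expm.
  - unfold ker. cbv beta. ring.
Qed.
Lemma dk_cont : cont (Derive k).
Proof. apply smooth_full_cont, smooth_Derive; auto using open_full, k_smooth. Qed.
Lemma ker'_cont x : cont (ker' x).
Proof. assert (H := dk_cont). assert (H' := ker_cont x). unfold ker'; ct. Qed.
Lemma ker_pos x v : 0 < ker x v.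
Proof. apply Rmult_lt_0_compat; [apply k_pos|apply exp_pos]. Qed.
Lemma ker'_neg x v : 0 < x -> 0 <= v -> ker' x v <= 0.
Proof.
  intros Hx Hv. unfold ker'. generalize (ker_pos x v) (k_der_neg v Hv) (exp_pos (- (x * v))). intros; nra.
Qed.

(** The bound [PI / 2] comes from the first half wave, where
    [k v * sin (s v) <= s / 2]; the remaining waves contribute negatively. *)
Lemma ker_sin_bounds x s l : 0 < x -> 0 <= s -> isI (fun v => ker x v * sin (s * v)) l ->
  0 <= l <= PI / 2.
Proof.
  intros Hx [Hs|<-] Hl.
  2: { rewrite (isI_unique _ l 0 Hl); [generalize PI_RGT_0; lra|].
       apply isI_ext with (fun _ => 0); [intros; rewrite Rmult_0_l, sin_0; ring|apply isI_zero]. }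
  assert (CK := ker_cont x). assert (CK' := ker'_cont x).
  assert (HPI := PI_RGT_0).
  set (p := PI / s). assert (Hp : 0 < p) by (apply Rdiv_lt_0_compat; auto).
  assert (Lo : forall V, 0 <= V -> 0 <= RInt (fun v => ker x v * sin (s * v)) 0 V).
  { intros V HV. apply (decr_sin_pos (ker x) (ker' x)); auto.
    - intros; apply ker_der.
    - intros; left; apply ker_pos.
    - intros; apply ker'_neg; auto. }
  assert (Hi : forall V, p <= V -> RInt (fun v => ker x v * sin (s * v)) 0 V <= PI / 2).
  { intros V HV.
    rewrite <- (RI_chasles (fun v => ker x v * sin (s * v)) ltac:(ct) 0 p V).
    assert (A : RInt (fun v => ker x v * sin (s * v)) 0 p <= s / 2 * (p - 0)).
    { rewrite <- RI_const. apply RI_le; [ct|ct|lra|]. intros v [Hv Hvp].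
      assert (B : s * v < PI).
      { unfold p in Hvp. apply Rmult_lt_compat_l with (r := s) in Hvp; auto.
        replace (s * (PI / s)) with PI in Hvp by (field; lra). auto. }
      assert (0 < sin (s * v)) by (apply sin_gt_0; nra).
      assert (sin (s * v) < s * v) by (apply sin_lt_x; nra).
      assert (H2 := k_half v Hv). assert (H3 := k_pos v).
      assert (H4 := exp_neg_le1 (x * v) ltac:(nra)). assert (H5 := exp_pos (- (x * v))).
      unfold ker.
      assert (k v * exp (- (x * v)) <= k v) by nra.
      assert (k v * exp (- (x * v)) * sin (s * v) <= k v * (s * v)).
      { apply Rmult_le_compat; try lra. nra. }
      nra. }
    assert (A' : s / 2 * (p - 0) = PI / 2) by (unfold p; field; lra).
    assert (B : RInt (fun v => ker x v * sin (s * v)) p V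
       = - RInt (fun v => ker x (v + p) * sin (s * v)) 0 (V - p) :> R).
    { generalize (RI_shift (fun v => ker x v * sin (s * v)) p 0 (V - p) ltac:(ct)).
      rewrite Rplus_0_l. replace (V - p + p) with V by ring. intros <-.
      rewrite <- RI_opp.
      - apply RI_ext. intros v. replace (s * (v + p)) with (s * v + PI) by (unfold p; field; lra).
        rewrite neg_sin. ring.
      - ct. }
    assert (0 <= RInt (fun v => ker x (v + p) * sin (s * v)) 0 (V - p)); [|lra].
    apply (decr_sin_pos (fun v => ker x (v + p)) (fun v => ker' x (v + p))); try lra; [ct|ct| | |].
    - intros v. eapply der_eq; [apply (der_comp (fun v => v + p) (ker x) v 1); [auto_derive; auto; ring|apply ker_der]|]. ring.
    - intros; left; apply ker_pos.
    - intros; apply ker'_neg; auto; lra. }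
  split; apply le_limit; intros e He;
    destruct (proj1 (isI_eps _ l) Hl e He) as (B & HB & H);
    specialize (H (Rmax B p) (Rmax_l _ _)); apply Rabs_lt_between in H.
  - assert (0 <= Rmax B p) by (eapply Rle_trans; [exact HB|apply Rmax_l]).
    specialize (Lo _ H0). lra.
  - specialize (Hi (Rmax B p) (Rmax_r _ _)). lra.
Qed.
(** * The exponential of a kernel for one-sided convolution *)

Definition conv (f g : R -> R) (v : R) : R := RInt (fun t => f t * g (v - t)) 0 v.

Lemma conv_der f g g' v : cont f -> (forall x, is_derive g x (g' x)) -> cont g' ->
  is_derive (conv f g) v (f v * g 0 + conv f g' v).
Proof.
  intros Cf Dg Cg'.
  assert (Cg : cont g) by (intros x; eapply der_cont, Dg).
  assert (D : forall u t, is_derive (fun u => f t * g (u - t)) u (f t * g' (u - t))).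
  { intros u t. apply is_derive_scal. eapply der_eq.
    - apply (der_comp (fun u => u - t) g u 1); [auto_derive; auto; ring|apply Dg].
    - ring. }
  assert (C2 : forall x t, continuity_2d_pt (fun u w => Derive (fun z => f w * g (z - w)) u) x t).
  { intros x t. apply continuity_2d_pt_ext with (fun u w => f w * g' (u - w)).
    - intros u w. symmetry; apply is_derive_unique, D.
    - apply (cont2_mult (fun _ w => f w) (fun u w => g' (u - w))); [now apply cont2_snd|].
      apply (cont2_comp g' (fun u w => u - w)); auto. apply cont2_minus; [apply cont2_1|apply cont2_2]. }
  assert (Ct : forall u, cont (fun t => f t * g (u - t))).
  { intros u. apply cont_mult; auto. now apply cont_refl. }
  assert (H := is_derive_RInt_param_bound_comp (fun u t => f t * g (u - t)) (fun _ => 0) (fun u => u) v 0 1).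
  eapply der_eq.
  - apply H.
    + exists (mkposreal 1 Rlt_0_1); intros; now apply exR.
    + exists (mkposreal 1 Rlt_0_1), (mkposreal 1 Rlt_0_1); intros; now apply exR.
    + exists (mkposreal 1 Rlt_0_1), (mkposreal 1 Rlt_0_1); intros; now apply exR.
    + apply (is_derive_const 0 v).
    + apply der_id.
    + exists (mkposreal 1 Rlt_0_1), (mkposreal 1 Rlt_0_1); intros u _ t _. eexists; apply D.
    + intros t _; apply C2.
    + exists (mkposreal 1 Rlt_0_1); intros; apply C2.
    + exists (mkposreal 1 Rlt_0_1); intros; apply C2.
    + apply continuity_pt_filterlim, Ct.
    + apply continuity_pt_filterlim, Ct.
  - rewrite Rminus_diag. unfold conv.
    rewrite (RI_ext (fun t => Derive (fun u => f t * g (u - t)) v) (fun t => f t * g' (v - t))).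
    + ring.
    + intros t. apply is_derive_unique, D.
Qed.
Lemma conv_cont f g g' : cont f -> (forall x, is_derive g x (g' x)) -> cont g' -> cont (conv f g).
Proof. intros Cf Dg Cg' v. eapply der_cont, conv_der; eauto. Qed.
(** A derivative of [conv f g] falls on [g] and leaves a boundary term in [f], so one order
    of smoothness is gained over [f]. *)
Lemma conv_Cn n : forall f g, Cn full n f -> smooth full g -> Cn full (S n) (conv f g).
Proof.
  induction n as [|n IH]; intros f g Hf Hg.
  - exists (fun v => f v * g 0 + conv f (Derive g) v).
    assert (Cf : cont f) by (intros x; apply Hf; exact Logic.I).
    assert (Sg := smooth_Derive full g open_full Hg).
    assert (D : forall g, smooth full g -> forall x, is_derive g x (Derive g x)).
    { intros h Sh x. apply (smooth_der full); auto using open_full. exact Logic.I. }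
    split.
    + intros x _. apply conv_der; auto. now apply smooth_full_cont.
    + intros x _. apply (cont_plus (fun v => f v * g 0) (conv f (Derive g))); [ct|].
      apply (conv_cont f (Derive g) (Derive (Derive g))); auto.
      apply smooth_full_cont, smooth_Derive; auto using open_full.
  - assert (Sg := smooth_Derive full g open_full Hg).
    exists (fun v => f v * g 0 + conv f (Derive g) v).
    assert (Cf : cont f).
    { intros x. destruct Hf as (f' & Hf & _). eapply der_cont, Hf. exact Logic.I. }
    split.
    + intros x _. apply conv_der; auto.
      * intros y. apply (smooth_der full); auto using open_full. exact Logic.I.
      * now apply smooth_full_cont.
    + apply Cn_plus; [apply Cn_mult; auto using Cn_const|].
      apply IH; auto. now apply Cn_le.
Qed.

(** Convolution theorem. *)
Lemma conv_isI f g g' M N b lf lg : cont f -> (forall x, is_derive g x (g' x)) -> cont g' ->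
  0 < b -> expdec f M b -> expdec g N b -> isI f lf -> isI g lg -> isI (conv f g) (lf * lg).
Proof.
  intros Cf Dg Cg' Hb Hf Hg If Ig.
  assert (Cg : cont g) by (intros x; eapply der_cont, Dg).
  set (G := fun y => RInt g 0 y).
  assert (DG : forall x, is_derive G x (g x)) by (intros; now apply RI_derive).
  assert (CG : cont G) by (intros x; eapply der_cont, DG).
  assert (HM : 0 <= M) by (eapply M_pos; eauto).
  assert (HN : 0 <= N) by (eapply M_pos; eauto).
  assert (E : forall V, RInt (conv f g) 0 V = conv f G V :> R).
  { intros V. rewrite (RI_ftc (conv f G)).
    - unfold conv at 2. rewrite RInt_point. unfold zero; simpl; ring.
    - intros v. eapply der_eq; [apply (conv_der f G g); auto|].
      unfold G at 1. rewrite RInt_point. unfold zero; simpl; ring.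
    - now apply (conv_cont f g g'). }
  apply isI_eps. intros e He.
  destruct (proj1 (isI_eps f lf) If (e / (2 * (Rabs lg + 1)))) as (B & HB & H).
  { apply Rdiv_lt_0_compat; [lra|]. generalize (Rabs_pos lg); lra. }
  destruct (small_exp (b / 2) (M * N / b * (2 / b)) (e / 4)) as (B' & HB' & H'); [lra|lra|].
  exists (Rmax B B'). split; [eapply Rle_trans; [exact HB|apply Rmax_l]|].
  intros V HV. assert (V1 : B <= V) by (eapply Rle_trans; [apply Rmax_l|exact HV]).
  assert (V2 : B' <= V) by (eapply Rle_trans; [apply Rmax_r|exact HV]).
  assert (V0 : 0 <= V) by lra.
  rewrite E.
  assert (A : Rabs (conv f G V - lg * RInt f 0 V) <= M * N / b * V * exp (- (b * V))).
  { unfold conv. rewrite <- RI_scal by auto.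
    assert (CGr : cont (fun t => G (V - t))) by now apply cont_refl.
    rewrite <- RI_minus by ct.
    replace (M * N / b * V * exp (- (b * V))) with (M * N / b * exp (- (b * V)) * (V - 0)) by ring.
    apply RI_absc; auto; [ct|].
    intros t Ht. replace (f t * G (V - t) - lg * f t) with (f t * (G (V - t) - lg)) by ring.
    rewrite Rabs_mult.
    assert (T := expdec_tail g N b lg (V - t) Cg Hb Hg Ig ltac:(lra)).
    rewrite Rabs_minus_sym in T. fold (G (V - t)) in T.
    specialize (Hf t ltac:(lra)).
    apply Rle_trans with (M * exp (- (b * t)) * (N / b * exp (- (b * (V - t))))).
    - apply Rmult_le_compat; auto using Rabs_pos.
    - replace (- (b * V)) with (- (b * t) + - (b * (V - t))) by ring. rewrite exp_plus.
      right; field; lra. }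
  specialize (H V V1). specialize (H' V V2).
  assert (P := pow_exp_dec 1 b V Hb V0). simpl fact in P. rewrite !pow_1 in P. simpl INR in P.
  assert (K0 : 0 <= M * N / b) by (apply Rdiv_le_0_compat; [apply Rmult_le_pos|]; auto).
  assert (K : M * N / b * V * exp (- (b * V)) <= e / 4).
  { rewrite Rmult_assoc. eapply Rle_trans; [apply Rmult_le_compat_l; [auto|exact P]|].
    eapply Rle_trans; [|exact H']. rewrite Rabs_right; [right; ring|].
    apply Rle_ge, Rmult_le_pos; auto. left; apply Rdiv_lt_0_compat; lra. }
  replace (conv f G V - lf * lg) with ((conv f G V - lg * RInt f 0 V) + lg * (RInt f 0 V - lf)) by ring.
  eapply Rle_lt_trans; [apply Rabs_triang|]. rewrite Rabs_mult.
  assert (Rabs lg * Rabs (RInt f 0 V - lf) <= e / 2).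
  { assert (Q := Rabs_pos lg). apply Rle_trans with ((Rabs lg + 1) * (e / (2 * (Rabs lg + 1)))).
    - apply Rmult_le_compat; auto using Rabs_pos; lra.
    - right; field; lra. }
  lra.
Qed.

(** ** The complex exponential series, in real and imaginary parts *)

(** [(c - i s)^j = fst (cpow c s j) - i snd (cpow c s j)]. *)
Fixpoint cpow (c s : R) (j : nat) : R * R :=
  match j with
  | O => (1, 0)
  | S j => (fst (cpow c s j) * c - snd (cpow c s j) * s, fst (cpow c s j) * s + snd (cpow c s j) * c)
  end.
Definition cexp_re c s n t : R := sum_f_R0 (fun j => fst (cpow c s j) / INR (fact j) * t ^ j) n.
Definition cexp_im c s n t : R := sum_f_R0 (fun j => snd (cpow c s j) / INR (fact j) * t ^ j) n.

Lemma cpow_bound c s j : Rabs (fst (cpow c s j)) <= (Rabs c + Rabs s) ^ j /\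
  Rabs (snd (cpow c s j)) <= (Rabs c + Rabs s) ^ j.
Proof.
  induction j as [|j [IH1 IH2]]; simpl.
  - rewrite Rabs_R1, Rabs_R0; lra.
  - assert (A := Rabs_pos c). assert (A' := Rabs_pos s). set (X := fst (cpow c s j)) in *. set (Y := snd (cpow c s j)) in *.
    split; (eapply Rle_trans; [apply Rabs_triang|]); rewrite ?Rabs_Ropp, !Rabs_mult;
      rewrite Rmult_plus_distr_r; [|rewrite Rplus_comm]; apply Rplus_le_compat;
      rewrite Rmult_comm; apply Rmult_le_compat_l; auto.
Qed.

Lemma fact_pos n : 0 < INR (fact n).
Proof. apply lt_0_INR, lt_O_fact. Qed.
Lemma fact_S n : INR (fact (S n)) = INR (S n) * INR (fact n).
Proof. change (fact (S n)) with (S n * fact n)%nat. apply mult_INR. Qed.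

Lemma cexp_der c s n t :
  is_derive (cexp_re c s (S n)) t (c * cexp_re c s n t - s * cexp_im c s n t) /\
  is_derive (cexp_im c s (S n)) t (s * cexp_re c s n t + c * cexp_im c s n t).
Proof.
  assert (T : forall (a : R) j, is_derive (fun t => a / INR (fact (S j)) * t ^ S j) t (a / INR (fact j) * t ^ j)).
  { intros a j. eapply der_eq; [apply is_derive_scal, is_derive_pow, der_id|].
    rewrite fact_S. cbn [pred]. field. split; [apply Rgt_not_eq, fact_pos|apply not_0_INR; lia]. }
  induction n as [|n [IH1 IH2]].
  - split.
    + unfold cexp_re, cexp_im; simpl sum_f_R0. eapply der_eq.
      * apply der_plus; [|apply (T (fst (cpow c s 1)) O)]. apply is_derive_scal.
        apply (is_derive_const 1 t).
      * simpl. unfold zero; simpl. field.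
    + unfold cexp_re, cexp_im; simpl sum_f_R0. eapply der_eq.
      * apply der_plus; [|apply (T (snd (cpow c s 1)) O)]. apply is_derive_scal.
        apply (is_derive_const 1 t).
      * simpl. unfold zero; simpl. field.
  - split.
    + eapply der_eq; [exact (der_plus _ _ _ _ _ IH1 (T (fst (cpow c s (S (S n)))) (S n)))|].
      unfold cexp_re, cexp_im. rewrite !tech5. 
      change (fst (cpow c s (S (S n)))) with (fst (cpow c s (S n)) * c - snd (cpow c s (S n)) * s).
      set (X := fst (cpow c s (S n))). set (Y := snd (cpow c s (S n))). field. apply Rgt_not_eq, fact_pos.
    + eapply der_eq; [exact (der_plus _ _ _ _ _ IH2 (T (snd (cpow c s (S (S n)))) (S n)))|].
      unfold cexp_re, cexp_im. rewrite !tech5. 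
      change (snd (cpow c s (S (S n)))) with (fst (cpow c s (S n)) * s + snd (cpow c s (S n)) * c).
      set (X := fst (cpow c s (S n))). set (Y := snd (cpow c s (S n))). field. apply Rgt_not_eq, fact_pos.
Qed.

Lemma pow_fact_small r n : 0 <= r -> r ^ n / INR (fact n) <= exp (2 * r) * (1 / 2) ^ n.
Proof.
  intros Hr. assert (H := pow_le_exp n (2 * r) ltac:(lra)). assert (F := fact_pos n).
  rewrite Rpow_mult_distr in H.
  apply Rmult_le_reg_r with (2 ^ n * INR (fact n)).
  { apply Rmult_lt_0_compat; auto. apply pow_lt; lra. }
  replace (r ^ n / INR (fact n) * (2 ^ n * INR (fact n))) with (2 ^ n * r ^ n) by (field; lra).
  replace (exp (2 * r) * (1 / 2) ^ n * (2 ^ n * INR (fact n)))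
    with (INR (fact n) * exp (2 * r) * ((1 / 2) ^ n * 2 ^ n)) by ring.
  rewrite <- (Rpow_mult_distr (1 / 2)). replace (1 / 2 * 2) with 1 by field. rewrite pow1. lra.
Qed.
Lemma half_pow_small D e : 0 < e -> exists n0, forall n, (n0 <= n)%nat -> D * (1 / 2) ^ n <= e.
Proof.
  intros He. destruct (pow2_large (D / e)) as [n0 H]. exists n0. intros n Hn. specialize (H n Hn).
  assert (H2 : 0 < 2 ^ n) by (apply pow_lt; lra).
  replace ((1 / 2) ^ n) with (/ 2 ^ n) by (rewrite <- pow_inv; f_equal; field).
  apply Rmult_le_reg_r with (2 ^ n); auto. rewrite Rmult_assoc, Rinv_l by lra.
  apply Rmult_le_compat_r with (r := e) in H; [|lra]. replace (D / e * e) with D in H by (field; lra). lra.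
Qed.

(** Variation of constants: [e^(-(c - i s) t)] times the partial sum has a
    derivative of the size of the last term of the series. *)
Lemma cexp_limit c s e : 0 < e -> exists n0, forall n, (n0 <= n)%nat ->
  Rabs (cexp_re c s n 1 - exp c * cos s) <= e /\ Rabs (cexp_im c s n 1 - exp c * sin s) <= e.
Proof.
  intros He. set (r := Rabs c + Rabs s).
  assert (Hr : 0 <= r) by (unfold r; generalize (Rabs_pos c) (Rabs_pos s); lra).
  set (D := exp c * (exp (Rabs c) * (4 * r) * exp (2 * r))).
  destruct (half_pow_small D e He) as [n0 H]. exists (S n0). intros n Hn.
  destruct n as [|n]; [lia|]. specialize (H n ltac:(lia)).
  set (P := cexp_re c s (S n)). set (Q := cexp_im c s (S n)).
  set (p := fun t => fst (cpow c s (S n)) / INR (fact (S n)) * t ^ S n).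
  set (q := fun t => snd (cpow c s (S n)) / INR (fact (S n)) * t ^ S n).
  assert (EP : forall t, cexp_re c s n t = P t - p t) by (intros; unfold P, cexp_re; rewrite tech5; unfold p; ring).
  assert (EQ : forall t, cexp_im c s n t = Q t - q t) by (intros; unfold Q, cexp_im; rewrite tech5; unfold q; ring).
  assert (DP : forall t, is_derive P t (c * (P t - p t) - s * (Q t - q t))).
  { intros t. rewrite <- EP, <- EQ. apply cexp_der. }
  assert (DQ : forall t, is_derive Q t (s * (P t - p t) + c * (Q t - q t))).
  { intros t. rewrite <- EP, <- EQ. apply cexp_der. }
  assert (De : forall t, is_derive (fun t => exp (- (c * t))) t (- c * exp (- (c * t)))) by (intros; apply der_expm).
  assert (Dc : forall t, is_derive (fun t => cos (s * t)) t (- s * sin (s * t))) by (intros; auto_derive; auto; ring).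
  assert (Ds : forall t, is_derive (fun t => sin (s * t)) t (s * cos (s * t))) by (intros; auto_derive; auto; ring).
  set (F := fun t => exp (- (c * t)) * (P t * cos (s * t) + Q t * sin (s * t))).
  set (G := fun t => exp (- (c * t)) * (P t * sin (s * t) + - 1 * (Q t * cos (s * t)))).
  assert (DF : forall t, is_derive F t (- exp (- (c * t)) * ((c * p t - s * q t) * cos (s * t) + (s * p t + c * q t) * sin (s * t)))).
  { intros t. eapply der_eq.
    - apply der_mult; [apply De|]. apply der_plus; apply der_mult; auto.
    - cbv beta; ring. }
  assert (DG : forall t, is_derive G t (- exp (- (c * t)) * ((c * p t - s * q t) * sin (s * t) - (s * p t + c * q t) * cos (s * t)))).
  { intros t. eapply der_eq.
    - apply der_mult; [apply De|]. apply der_plus; [apply der_mult; auto|].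
      apply is_derive_scal. apply der_mult; auto.
    - cbv beta; ring. }
  assert (Bpq : forall t, 0 <= t <= 1 -> Rabs (p t) <= exp (2 * r) * (1 / 2) ^ S n /\ Rabs (q t) <= exp (2 * r) * (1 / 2) ^ S n).
  { intros t Ht. assert (F' := fact_pos (S n)).
    assert (B1 : Rabs (t ^ S n) <= 1).
    { rewrite <- RPow_abs, Rabs_right by lra. rewrite <- (pow1 (S n)). apply pow_incr; lra. }
    assert (B2 := pow_fact_small r (S n) Hr).
    assert (K : forall a, Rabs a <= r ^ S n -> Rabs (a / INR (fact (S n)) * t ^ S n) <= exp (2 * r) * (1 / 2) ^ S n).
    { intros a Ha. unfold Rdiv at 1. rewrite !Rabs_mult, (Rabs_right (/ _)) by (left; apply Rinv_0_lt_compat; auto).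
      eapply Rle_trans; [|exact B2]. rewrite <- (Rmult_1_r (r ^ S n / _)).
      apply Rmult_le_compat; auto using Rabs_pos.
      - apply Rmult_le_pos; [apply Rabs_pos|left; apply Rinv_0_lt_compat; auto].
      - apply Rmult_le_compat_r; auto. left; apply Rinv_0_lt_compat; auto. }
    destruct (cpow_bound c s (S n)) as [C1 C2]. split; apply K; auto. }
  set (h := exp (2 * r) * (1 / 2) ^ S n) in *.
  assert (Bd : forall (K : R -> R) K', (forall t, is_derive K t (K' t)) ->
     (forall t, 0 <= t <= 1 -> Rabs (K' t) <= exp (Rabs c) * (4 * r * h)) ->
     Rabs (K 1 - K 0) <= exp (Rabs c) * (4 * r * h)).
  { intros K K' DK BK.
    destruct (MVT_cor2 K K' 0 1 ltac:(lra)) as (x & E & Hx).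
    { intros x _. apply is_derive_Reals, DK. }
    rewrite E, Rminus_0_r, Rmult_1_r. apply BK; lra. }
  assert (Bs : forall t a a', 0 <= t <= 1 -> Rabs a <= 1 -> Rabs a' <= 1 ->
     Rabs (- exp (- (c * t)) * ((c * p t - s * q t) * a + (s * p t + c * q t) * a')) <= exp (Rabs c) * (4 * r * h)).
  { intros t a a' Ht Ha Ha'. rewrite Rabs_mult, Rabs_Ropp, (Rabs_right (exp _)) by (left; apply exp_pos).
    destruct (Bpq t Ht) as [B1 B2].
    assert (Hh : 0 <= h) by (eapply Rle_trans; [apply Rabs_pos|exact B1]).
    apply Rmult_le_compat; auto using Rabs_pos.
    - left; apply exp_pos.
    - apply exp_le. eapply Rle_trans; [apply Rle_abs|]. rewrite Rabs_Ropp, Rabs_mult, (Rabs_right t) by lra.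
      generalize (Rabs_pos c); nra.
    - assert (X : forall u w, Rabs u <= r -> Rabs w <= r -> Rabs (u * p t + w * q t) <= 2 * r * h).
      { intros u w Hu Hw. eapply Rle_trans; [apply Rabs_triang|]. rewrite !Rabs_mult.
        assert (Rabs u * Rabs (p t) <= r * h) by (apply Rmult_le_compat; auto using Rabs_pos).
        assert (Rabs w * Rabs (q t) <= r * h) by (apply Rmult_le_compat; auto using Rabs_pos). lra. }
      assert (X1 := X c (- s)). assert (X2 := X s c). rewrite Rabs_Ropp in X1.
      unfold r in X1, X2 at 1 2. generalize (Rabs_pos c) (Rabs_pos s). intros.
      specialize (X1 ltac:(unfold r; lra) ltac:(unfold r; lra)). specialize (X2 ltac:(unfold r; lra) ltac:(unfold r; lra)).
      fold r in X1, X2.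
      replace (c * p t + - s * q t) with (c * p t - s * q t) in X1 by ring.
      eapply Rle_trans; [apply Rabs_triang|]. rewrite !Rabs_mult.
      assert (Y : forall y z, 0 <= y <= 2 * r * h -> 0 <= z <= 1 -> y * z <= 2 * r * h) by (intros; nra).
      generalize (Y _ _ (conj (Rabs_pos _) X1) (conj (Rabs_pos _) Ha)) (Y _ _ (conj (Rabs_pos _) X2) (conj (Rabs_pos _) Ha')). lra. }
  assert (BF : Rabs (F 1 - F 0) <= exp (Rabs c) * (4 * r * h)).
  { apply (Bd F _ DF). intros t Ht. apply Bs; auto using Rabs_cos, Rabs_sin. }
  assert (BG : Rabs (G 1 - G 0) <= exp (Rabs c) * (4 * r * h)).
  { apply (Bd G _ DG). intros t Ht.
    replace ((c * p t - s * q t) * sin (s * t) - (s * p t + c * q t) * cos (s * t))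
      with ((c * p t - s * q t) * sin (s * t) + (s * p t + c * q t) * (- cos (s * t))) by ring.
    apply Bs; auto using Rabs_sin. rewrite Rabs_Ropp; apply Rabs_cos. }
  assert (P0 : P 0 = 1 /\ Q 0 = 0).
  { clear. unfold P, Q, cexp_re, cexp_im. split.
    - induction (S n) as [|m IH]; [simpl; field|]. rewrite tech5, IH, pow_i by lia. ring.
    - induction (S n) as [|m IH]; [simpl; field|]. rewrite tech5, IH, pow_i by lia. ring. }
  destruct P0 as [P0 Q0].
  assert (F0 : F 0 = 1) by (unfold F; rewrite P0, Q0, !Rmult_0_r, Ropp_0, exp_0, cos_0, sin_0; ring).
  assert (G0 : G 0 = 0) by (unfold G; rewrite P0, Q0, !Rmult_0_r, Ropp_0, exp_0, cos_0, sin_0; ring).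
  rewrite F0 in BF. rewrite G0, Rminus_0_r in BG.
  assert (Sq := sin2_cos2 s). unfold Rsqr in Sq.
  assert (Ex : exp c * exp (- (c * 1)) = 1) by (rewrite <- exp_plus; replace (c + - (c * 1)) with 0 by ring; apply exp_0).
  assert (EP1 : P 1 = exp c * (F 1 * cos s + G 1 * sin s)).
  { unfold F, G. rewrite !Rmult_1_r.  rewrite Rmult_1_r in Ex.
    transitivity ((exp c * exp (- c)) * (P 1 * (sin s * sin s + cos s * cos s))); [rewrite Ex, Sq; ring|ring]. }
  assert (EQ1 : Q 1 = exp c * (F 1 * sin s - G 1 * cos s)).
  { unfold F, G. rewrite !Rmult_1_r.  rewrite Rmult_1_r in Ex.
    transitivity ((exp c * exp (- c)) * (Q 1 * (sin s * sin s + cos s * cos s))); [rewrite Ex, Sq; ring|ring]. }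
  set (m := exp (Rabs c) * (4 * r * h)) in *.
  assert (Fin : exp c * (2 * m) <= e).
  { eapply Rle_trans; [|exact H]. unfold D, m, h. simpl pow. right; field. }
  assert (X := exp_pos c). assert (RC := Rabs_cos s). assert (RS := Rabs_sin s).
  split.
  - rewrite EP1. replace (exp c * (F 1 * cos s + G 1 * sin s) - exp c * cos s)
      with (exp c * ((F 1 - 1) * cos s + G 1 * sin s)) by ring.
    rewrite Rabs_mult, (Rabs_right (exp c)) by lra. eapply Rle_trans; [|exact Fin].
    apply Rmult_le_compat_l; [lra|]. eapply Rle_trans; [apply Rabs_triang|]. rewrite !Rabs_mult.
    generalize (Rabs_pos (F 1 - 1)) (Rabs_pos (G 1)) (Rabs_pos (cos s)) (Rabs_pos (sin s)); intros; nra.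
  - rewrite EQ1. replace (exp c * (F 1 * sin s - G 1 * cos s) - exp c * sin s)
      with (exp c * ((F 1 - 1) * sin s + - (G 1 * cos s))) by ring.
    rewrite Rabs_mult, (Rabs_right (exp c)) by lra. eapply Rle_trans; [|exact Fin].
    apply Rmult_le_compat_l; [lra|]. eapply Rle_trans; [apply Rabs_triang|]. rewrite Rabs_Ropp, !Rabs_mult.
    generalize (Rabs_pos (F 1 - 1)) (Rabs_pos (G 1)) (Rabs_pos (cos s)) (Rabs_pos (sin s)); intros; nra.
Qed.
(** ** Convolution powers and their exponential series *)

Lemma conv_neg f g v : cont f -> cont g ->
  conv f g (- v) = - conv (fun x => f (- x)) (fun x => g (- x)) v.
Proof.
  intros Cf Cg. unfold conv.
  assert (Cr : cont (fun t => f t * g (- v - t))) by (apply cont_mult; auto; now apply cont_refl).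
  rewrite (RI_swap _ Cr (- v) 0).
  f_equal. generalize (RI_neg (fun t => f t * g (- v - t)) 0 v Cr). rewrite Ropp_0. intros <-.
  apply RI_ext. intros t. do 2 f_equal. ring.
Qed.

Lemma RI_absc0 f M v : cont f -> (forall t, Rabs t <= Rabs v -> Rabs (f t) <= M) ->
  Rabs (RInt f 0 v) <= M * Rabs v.
Proof.
  intros Cf H. destruct (Rle_lt_dec 0 v) as [Hv|Hv].
  - rewrite (Rabs_right v) in * by lra. rewrite <- (Rminus_0_r v) at 2.
    apply RI_absc; auto. intros t Ht. apply H. rewrite Rabs_right; lra.
  - rewrite (Rabs_left v) in * by lra. rewrite (RI_swap f Cf v 0), Rabs_Ropp.
    replace (- v) with (0 - v) by ring.
    apply RI_absc; auto; try lra. intros t Ht. apply H. rewrite Rabs_left; lra.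
Qed.

Lemma geo_series (a : nat -> R) D : (forall j, Rabs (a j) <= D * (1 / 2) ^ j) ->
  ex_series a /\ forall n, Rabs (Series a - sum_f_R0 a n) <= D * (1 / 2) ^ n.
Proof.
  intros H.
  assert (Eg : forall N, ex_series (fun j => D * (1 / 2) ^ (N + j))).
  { intros N. apply (ex_series_ext (fun j => (D * (1 / 2) ^ N) * (1 / 2) ^ j)).
    - intros j. rewrite pow_add. simpl. ring.
    - apply (ex_series_scal_l (D * (1 / 2) ^ N) (fun j => (1 / 2) ^ j)). apply ex_series_geom. rewrite Rabs_right; lra. }
  assert (Ea : ex_series (fun j => Rabs (a j))).
  { apply (ex_series_le (fun j => Rabs (a j)) (fun j => D * (1 / 2) ^ (0 + j))); auto.
    intros j. unfold norm; simpl; unfold abs; simpl. rewrite Rabs_Rabsolu. auto. }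
  assert (Ex := ex_series_Rabs a Ea).
  split; auto. intros n.
  rewrite (Series_incr_n a (S n)) by (auto; lia). simpl pred.
  replace (sum_f_R0 a n + Series (fun j => a (S n + j)%nat) - sum_f_R0 a n)
    with (Series (fun j => a (S n + j)%nat)) by ring.
  assert (Ea' : ex_series (fun j => Rabs (a (S n + j)%nat))).
  { apply (ex_series_le (fun j => Rabs (a (S n + j)%nat)) (fun j => D * (1 / 2) ^ (S n + j))); auto.
    intros j. unfold norm; simpl; unfold abs; simpl. rewrite Rabs_Rabsolu. apply (H (S n + j)%nat). }
  eapply Rle_trans; [apply Series_Rabs; auto|].
  eapply Rle_trans; [apply (Series_le _ (fun j => D * (1 / 2) ^ (S n + j)))|]; auto.
  - intros j. split; [apply Rabs_pos|apply H].
  - rewrite (Series_ext _ (fun j => (D * (1 / 2) ^ S n) * (1 / 2) ^ j)) by (intros; rewrite pow_add; ring).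
    rewrite Series_scal_l, Series_geom by (rewrite Rabs_right; lra). simpl. right; field.
Qed.

Lemma fact_mono n m : INR (fact n) <= INR (fact (n + m)).
Proof. apply le_INR, fact_le; lia. Qed.

Section ConvExp.
Variables (q : R -> R) (B B' : R).
Hypotheses (Sq : smooth full q) (Bq : forall v, Rabs (q v) <= B) (Bq' : forall v, Rabs (Derive q v) <= B').

Let Cq : cont q := smooth_full_cont q Sq.
Let Dq : forall x, is_derive q x (Derive q x).
Proof. intros x. apply (smooth_der full); auto using open_full. exact Logic.I. Qed.
Let Cq' : cont (Derive q) := smooth_full_cont _ (smooth_Derive full q open_full Sq).
Let HB : 0 <= B.
Proof. eapply Rle_trans; [apply Rabs_pos|apply (Bq 0)]. Qed.
Let HB' : 0 <= B'.
Proof. eapply Rle_trans; [apply Rabs_pos|apply (Bq' 0)]. Qed.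

(** The [(j + 1)]-st convolution power of [q]. *)
Fixpoint conv_pow (j : nat) : R -> R :=
  match j with
  | O => q
  | S j => conv (conv_pow j) q
  end.

Lemma conv_pow_cont j : cont (conv_pow j).
Proof. induction j as [|j IH]; simpl; auto. apply (conv_cont (conv_pow j) q (Derive q)); auto. Qed.

Lemma conv_pow_bound j v : Rabs (conv_pow j v) <= B * (B * Rabs v) ^ j / INR (fact j).
Proof.
  assert (P : forall v, 0 <= v -> Rabs (conv_pow j v) <= B * (B * v) ^ j / INR (fact j) /\
                Rabs (conv_pow j (- v)) <= B * (B * v) ^ j / INR (fact j)).
  { clear v. induction j as [|j IH]; intros v Hv.
    - simpl. unfold Rdiv. rewrite Rinv_1, !Rmult_1_r. auto.
    - assert (Ej : RInt (fun t => B * (B * (B * t) ^ j / INR (fact j))) 0 v = B * (B * v) ^ S j / INR (fact (S j)) :> R).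
      { assert (F := fact_pos j). assert (F2 : INR (S j) <> 0) by (apply not_0_INR; lia).
        rewrite (RI_ftc (fun t => B ^ S (S j) / INR (fact (S j)) * t ^ S j)).
        - rewrite (pow_i (S j)) by lia. rewrite Rpow_mult_distr. change (B ^ S (S j)) with (B * B ^ S j). field. apply Rgt_not_eq, fact_pos.
        - intros t. eapply der_eq; [apply is_derive_scal, is_derive_pow, der_id|].
          rewrite fact_S, Rpow_mult_distr. cbn [pred]. simpl (B ^ S (S j)). field. split; [lra|auto].
        - ct. intros; apply Rgt_not_eq, fact_pos. }
      rewrite <- Ej. assert (Ck := conv_pow_cont j).
      assert (Cb : cont (fun t => B * (B * (B * t) ^ j / INR (fact j)))).
      { ct. intros; apply Rgt_not_eq, fact_pos. }
      split.
      + simpl. unfold conv. apply RI_abs; auto.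
        * apply cont_mult; auto. now apply cont_refl.
        * intros t Ht. rewrite Rabs_mult, Rmult_comm. apply Rmult_le_compat; auto using Rabs_pos.
          apply IH; lra.
      + simpl. rewrite conv_neg, Rabs_Ropp by auto. unfold conv. apply RI_abs; auto.
        * apply cont_mult; [now apply cont_neg|]. apply (cont_refl (fun x => q (- x))). now apply cont_neg.
        * intros t Ht. rewrite Rabs_mult, Rmult_comm. apply Rmult_le_compat; auto using Rabs_pos.
          apply IH; lra. }
  destruct (Rle_lt_dec 0 v) as [Hv|Hv].
  - rewrite (Rabs_right v) by lra. apply P; auto.
  - rewrite (Rabs_left v) by lra. rewrite <- (Ropp_involutive v) at 1. apply P; lra.
Qed.

(** The exponential is the case [m = 0]; the shifted factorials close the family
    under the recursion [conv_exp_rec]. *)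
Definition conv_exp (m : nat) (v : R) : R := Series (fun j => conv_pow j v / INR (fact (j + 1 + m))).
Definition conv_exp_part (m n : nat) (v : R) : R := sum_f_R0 (fun j => conv_pow j v / INR (fact (j + 1 + m))) n.

Lemma conv_exp_term m j v X : 0 <= X -> Rabs (conv_pow j v) <= X ->
  Rabs (conv_pow j v / INR (fact (j + 1 + m))) <= X / INR (fact j) /\
  Rabs (conv_pow j v / INR (fact (j + 1 + m))) <= X.
Proof.
  intros HX H. unfold Rdiv. rewrite Rabs_mult.
  assert (F := fact_pos j). assert (F2 := fact_pos (j + 1 + m)).
  assert (F3 : INR (fact j) <= INR (fact (j + 1 + m))) by (rewrite <- Nat.add_assoc; apply fact_mono).
  assert (F4 : 1 <= INR (fact (j + 1 + m))) by (change 1 with (INR (fact 0)); apply (fact_mono 0)).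
  rewrite (Rabs_right (/ _)) by (left; apply Rinv_0_lt_compat; auto).
  assert (0 < / INR (fact (j + 1 + m))) by (apply Rinv_0_lt_compat; auto).
  split.
  - apply Rmult_le_compat; auto using Rabs_pos; [lra|]. apply Rinv_le_contravar; auto.
  - rewrite <- (Rmult_1_r X). apply Rmult_le_compat; auto using Rabs_pos; [lra|].
    rewrite <- Rinv_1. apply Rinv_le_contravar; lra.
Qed.

Lemma conv_exp_term_unif m j v V : Rabs v <= V ->
  Rabs (conv_pow j v / INR (fact (j + 1 + m))) <= B * exp (2 * (B * V)) * (1 / 2) ^ j.
Proof.
  intros Hv. assert (HV : 0 <= V) by (eapply Rle_trans; [apply Rabs_pos|exact Hv]).
  assert (HBV : 0 <= B * V) by (apply Rmult_le_pos; auto).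
  rewrite Rmult_assoc.
  apply conv_exp_term.
  - repeat apply Rmult_le_pos; auto; [left; apply exp_pos|apply pow_le; lra].
  - eapply Rle_trans; [apply conv_pow_bound|]. unfold Rdiv; rewrite Rmult_assoc.
    apply Rmult_le_compat_l; auto.
    eapply Rle_trans; [|apply (pow_fact_small (B * V) j HBV)].
    apply Rmult_le_compat_r; [left; apply Rinv_0_lt_compat, fact_pos|].
    apply pow_incr. split; [apply Rmult_le_pos; auto using Rabs_pos|]. apply Rmult_le_compat_l; auto.
Qed.
Lemma conv_exp_term_exp m j v y : 0 < y -> 0 <= v ->
  Rabs (conv_pow j v / INR (fact (j + 1 + m))) <= B * exp (2 * (B / y)) * exp (y * v) * (1 / 2) ^ j.
Proof.
  intros Hy Hv.
  assert (HBy : 0 <= B / y) by (apply Rdiv_le_0_compat; auto).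
  assert (K : Rabs (conv_pow j v) <= B * (B / y) ^ j * exp (y * v)).
  { eapply Rle_trans; [apply conv_pow_bound|]. rewrite (Rabs_right v) by lra. rewrite Rmult_assoc.
    unfold Rdiv at 1; rewrite Rmult_assoc. apply Rmult_le_compat_l; auto.
    assert (F := fact_pos j). assert (H := pow_le_exp j (y * v) ltac:(nra)).
    replace (B * v) with (B / y * (y * v)) by (field; lra). rewrite Rpow_mult_distr, Rmult_assoc.
    apply Rmult_le_compat_l; [apply pow_le; auto|].
    apply Rmult_le_reg_r with (INR (fact j)); auto. rewrite Rmult_assoc, Rinv_l by lra. lra. }
  destruct (conv_exp_term m j v (B * (B / y) ^ j * exp (y * v))) as [H _]; auto.
  { repeat apply Rmult_le_pos; auto; [apply pow_le; auto|left; apply exp_pos]. }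
  eapply Rle_trans; [exact H|].
  replace (B * (B / y) ^ j * exp (y * v) / INR (fact j)) with (B * exp (y * v) * ((B / y) ^ j / INR (fact j)))
    by (unfold Rdiv; ring).
  replace (B * exp (2 * (B / y)) * exp (y * v) * (1 / 2) ^ j)
    with (B * exp (y * v) * (exp (2 * (B / y)) * (1 / 2) ^ j)) by ring.
  apply Rmult_le_compat_l; [apply Rmult_le_pos; auto; left; apply exp_pos|].
  now apply pow_fact_small.
Qed.

Lemma conv_exp_close m n v V : Rabs v <= V ->
  Rabs (conv_exp m v - conv_exp_part m n v) <= B * exp (2 * (B * V)) * (1 / 2) ^ n.
Proof.
  intros Hv. apply (geo_series (fun j => conv_pow j v / INR (fact (j + 1 + m)))).
  intros j. now apply conv_exp_term_unif.
Qed.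
Lemma conv_exp_close_exp m n v y : 0 < y -> 0 <= v ->
  Rabs (conv_exp m v - conv_exp_part m n v) <= B * exp (2 * (B / y)) * exp (y * v) * (1 / 2) ^ n.
Proof.
  intros Hy Hv. apply (geo_series (fun j => conv_pow j v / INR (fact (j + 1 + m)))).
  intros j. now apply conv_exp_term_exp.
Qed.
Lemma conv_exp_part_cont m n : cont (conv_exp_part m n).
Proof.
  assert (F : forall j (x : R), INR (fact (j + 1 + m)) <> 0) by (intros; apply Rgt_not_eq, fact_pos).
  induction n as [|n IH]; unfold conv_exp_part; simpl.
  - apply (cont_div (conv_pow 0) (fun _ => INR (fact (0 + 1 + m)))); [apply conv_pow_cont|ct|apply F].
  - apply (cont_plus (conv_exp_part m n) (fun v => conv_pow (S n) v / INR (fact (S n + 1 + m)))); auto.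
    apply cont_div; [apply conv_pow_cont|ct|apply F].
Qed.
Lemma conv_exp_bound m y v : 0 < y -> 0 <= v ->
  Rabs (conv_exp m v) <= 2 * B * exp (2 * (B / y)) * exp (y * v).
Proof.
  intros Hy Hv. assert (H1 := conv_exp_close_exp m 0 v y Hy Hv). assert (H2 := conv_exp_term_exp m 0 v y Hy Hv).
  unfold conv_exp_part in H1. cbn [sum_f_R0] in H1. simpl pow in *.
  replace (conv_exp m v) with ((conv_exp m v - conv_pow 0 v / INR (fact (0 + 1 + m))) + conv_pow 0 v / INR (fact (0 + 1 + m))) by ring.
  eapply Rle_trans; [apply Rabs_triang|]. lra.
Qed.

Lemma conv_exp_cont m : cont (conv_exp m).
Proof.
  intros x. apply continuity_pt_filterlim. intros e He.
  set (V := Rabs x + 1).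
  destruct (half_pow_small (B * exp (2 * (B * V))) (e / 4)) as [n H]; [lra|].
  specialize (H n (Nat.le_refl n)).
  assert (C := conv_exp_part_cont m n x). apply continuity_pt_filterlim in C.
  destruct (C (e / 4)) as (d & Hd & HC); [lra|].
  exists (Rmin d 1). split; [apply Rmin_pos; lra|].
  intros y [Dy Hy]. simpl in *. unfold R_dist in *.
  assert (Hy1 : Rabs (y - x) < d) by (eapply Rlt_le_trans; [exact Hy|apply Rmin_l]).
  assert (Hy2 : Rabs (y - x) < 1) by (eapply Rlt_le_trans; [exact Hy|apply Rmin_r]).
  assert (X1 := conv_exp_close m n x V ltac:(unfold V; lra)).
  assert (Hyv : Rabs y <= V).
  { unfold V. replace y with ((y - x) + x) by ring. eapply Rle_trans; [apply Rabs_triang|]. lra. }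
  assert (X2 := conv_exp_close m n y V Hyv).
  specialize (HC y (conj Dy Hy1)).
  replace (conv_exp m y - conv_exp m x) with ((conv_exp m y - conv_exp_part m n y) + ((conv_exp_part m n y - conv_exp_part m n x) + - (conv_exp m x - conv_exp_part m n x))) by ring.
  eapply Rle_lt_trans; [apply Rabs_triang|].
  assert (Rabs ((conv_exp_part m n y - conv_exp_part m n x) + - (conv_exp m x - conv_exp_part m n x)) <= Rabs (conv_exp_part m n y - conv_exp_part m n x) + Rabs (conv_exp m x - conv_exp_part m n x)).
  { eapply Rle_trans; [apply Rabs_triang|]. rewrite Rabs_Ropp; lra. }
  lra.
Qed.

Lemma conv_exp_part_conv m n v : conv (conv_exp_part (S m) n) q v = sum_f_R0 (fun j => conv_pow (S j) v / INR (fact (S j + 1 + m))) n.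
Proof.
  assert (Cr : cont (fun t => q (v - t))) by now apply cont_refl.
  assert (T : forall j, conv (fun t => conv_pow j t / INR (fact (j + 1 + S m))) q v = conv_pow (S j) v / INR (fact (S j + 1 + m))).
  { intros j. replace (j + 1 + S m)%nat with (S j + 1 + m)%nat by lia. simpl conv_pow. unfold conv, Rdiv.
    assert (Ck := conv_pow_cont j).
    rewrite (Rmult_comm (RInt _ _ _)), <- RI_scal by ct. apply RI_ext; intros; ring. }
  induction n as [|n IH].
  - cbn [sum_f_R0]. rewrite <- T. reflexivity.
  - rewrite tech5, <- IH, <- T. unfold conv. rewrite <- RI_plus.
    + apply RI_ext. intros t. unfold conv_exp_part. rewrite tech5. ring.
    + apply cont_mult; auto. apply conv_exp_part_cont.
    + apply cont_mult; auto. apply cont_div; [apply conv_pow_cont|ct|]. intros; apply Rgt_not_eq, fact_pos.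
Qed.

(** The first term of the series is split off; the others contain a factor [q]. *)
Lemma conv_exp_rec m v : conv_exp m v = q v / INR (fact (m + 1)) + conv (conv_exp (S m)) q v.
Proof.
  set (V := Rabs v).
  assert (G := geo_series (fun j => conv_pow j v / INR (fact (j + 1 + m))) _ (fun j => conv_exp_term_unif m j v V (Rle_refl _))).
  assert (Cr : cont (fun t => q (v - t))) by now apply cont_refl.
  set (D := B * exp (2 * (B * V))).
  assert (K : forall n, Rabs (conv_exp m v - (q v / INR (fact (m + 1)) + conv (conv_exp (S m)) q v)) <= (D + D * B * V) * (1 / 2) ^ n).
  { intros n. destruct G as [_ G]. specialize (G (S n)). fold (conv_exp m v) in G.
    rewrite (decomp_sum _ (S n)) in G by lia. simpl pred in G. rewrite <- conv_exp_part_conv in G.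
    simpl (conv_pow 0) in G. rewrite (Nat.add_comm 0 1), Nat.add_0_r, (Nat.add_comm 1 m) in G.
    assert (A : Rabs (conv (conv_exp_part (S m) n) q v - conv (conv_exp (S m)) q v) <= D * (1 / 2) ^ n * B * V).
    { unfold conv. assert (C1 := conv_exp_part_cont (S m) n). assert (C2 := conv_exp_cont (S m)).
      rewrite <- RI_minus by ct. apply RI_absc0; [ct|].
      intros t Ht. rewrite <- Rmult_minus_distr_r, Rabs_mult, Rabs_minus_sym.
      apply Rmult_le_compat; auto using Rabs_pos. now apply conv_exp_close. }
    replace (conv_exp m v - (q v / INR (fact (m + 1)) + conv (conv_exp (S m)) q v))
      with ((conv_exp m v - (q v / INR (fact (m + 1)) + conv (conv_exp_part (S m) n) q v))
            + (conv (conv_exp_part (S m) n) q v - conv (conv_exp (S m)) q v)) by ring.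
    eapply Rle_trans; [apply Rabs_triang|].
    simpl pow in G. fold D in G.
    assert (0 <= D * (1 / 2) ^ n).
    { unfold D. repeat apply Rmult_le_pos; auto; [left; apply exp_pos|apply pow_le; lra]. }
    lra. }
  apply Rminus_diag_uniq. apply Rabs_eq_0. apply Rle_antisym; [|apply Rabs_pos].
  apply le_limit. intros e He.
  destruct (half_pow_small (D + D * B * V) e He) as [n Hn].
  specialize (Hn n (Nat.le_refl n)). specialize (K n). lra.
Qed.

(** The recursion and the smoothing of the convolution raise the order of smoothness of
    all members of the family at once. *)
Lemma conv_exp_smooth m : smooth full (conv_exp m).
Proof.
  intros n; revert m; induction n as [|n IH]; intros m.
  - intros x _; apply conv_exp_cont.
  - apply (Cn_ext full (S n) (fun v => q v * / INR (fact (m + 1)) + conv (conv_exp (S m)) q v)).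
    + apply open_full.
    + intros v _. symmetry. apply conv_exp_rec.
    + apply Cn_plus; [apply Cn_mult; auto using Cn_const|]. apply conv_Cn; auto.
Qed.

Lemma conv_exp_der_bound y : 0 < y -> exists M, forall v, 0 <= v -> Rabs (Derive (conv_exp 0) v) <= M * exp (y * v).
Proof.
  intros Hy. set (D := 2 * B * exp (2 * (B / y))).
  assert (HD : 0 <= D) by (unfold D; repeat apply Rmult_le_pos; auto; [lra|left; apply exp_pos]).
  exists (B' + D * B + B' * (D / y)). intros v Hv.
  assert (E : Derive (conv_exp 0) v = Derive q v + (conv_exp 1 v * q 0 + conv (conv_exp 1) (Derive q) v)).
  { apply is_derive_unique.
    apply (is_derive_ext (fun v => q v + conv (conv_exp 1) q v)).
    - intros t. rewrite (conv_exp_rec 0 t). simpl. field.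
    - apply der_plus; auto. apply conv_der; auto. apply conv_exp_cont. }
  assert (X : 1 <= exp (y * v)) by (rewrite <- exp_0; apply exp_le; nra).
  assert (R1 := conv_exp_bound 1 y v Hy Hv). fold D in R1.
  assert (A : Rabs (conv (conv_exp 1) (Derive q) v) <= B' * (D / y) * exp (y * v)).
  { unfold conv. assert (C1 := conv_exp_cont 1).
    assert (C2 : cont (fun t => Derive q (v - t))) by (apply (cont_refl (Derive q)); auto).
    apply Rle_trans with (RInt (fun t => B' * (D * exp (y * t))) 0 v).
    - apply RI_abs; [ct|ct|auto|]. intros t Ht. rewrite Rabs_mult, Rmult_comm.
      apply Rmult_le_compat; auto using Rabs_pos. apply conv_exp_bound; lra.
    - rewrite (RI_ftc (fun t => B' * (D / y) * exp (y * t))).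
      + rewrite Rmult_0_r, exp_0. assert (0 <= B' * (D / y)) by (apply Rmult_le_pos; auto; apply Rdiv_le_0_compat; auto). lra.
      + intros t; auto_derive; auto. field; lra.
      + ct. }
  rewrite E. eapply Rle_trans; [apply Rabs_triang|].
  assert (Rabs (conv_exp 1 v * q 0 + conv (conv_exp 1) (Derive q) v) <= D * exp (y * v) * B + B' * (D / y) * exp (y * v)).
  { eapply Rle_trans; [apply Rabs_triang|]. apply Rplus_le_compat; auto. rewrite Rabs_mult.
    apply Rmult_le_compat; auto using Rabs_pos. }
  assert (Rabs (Derive q v) <= B' * exp (y * v)).
  { eapply Rle_trans; [apply Bq'|]. rewrite <- (Rmult_1_r B') at 1. apply Rmult_le_compat_l; auto. }
  lra.
Qed.

Section Transform.
Variables (x s C S : R).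
Hypothesis Hx : 0 < x.
Hypotheses (HC : isI (fun v => q v * exp (- (x * v)) * cos (s * v)) C)
           (HS : isI (fun v => q v * exp (- (x * v)) * sin (s * v)) S).

Lemma conv_pow_expdec j : exists M, expdec (fun v => conv_pow j v * exp (- (x * v))) M (x / 2).
Proof.
  exists (B * B ^ j * (2 / x) ^ j). intros v Hv.
  rewrite Rabs_mult, (Rabs_right (exp _)) by (left; apply exp_pos).
  assert (K := conv_pow_bound j v). rewrite (Rabs_right v) in K by lra. rewrite Rpow_mult_distr in K.
  assert (P := pow_exp_dec j x v Hx Hv). assert (F := fact_pos j).
  eapply Rle_trans; [apply Rmult_le_compat_r; [left; apply exp_pos|exact K]|].
  replace (B * (B ^ j * v ^ j) / INR (fact j) * exp (- (x * v)))
    with (B * B ^ j / INR (fact j) * (v ^ j * exp (- (x * v)))) by (unfold Rdiv; ring).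
  replace (B * B ^ j * (2 / x) ^ j * exp (- (x / 2 * v)))
    with (B * B ^ j / INR (fact j) * (INR (fact j) * (2 / x) ^ j * exp (- (x / 2 * v)))) by (field; lra).
  apply Rmult_le_compat_l; auto. apply Rdiv_le_0_compat; auto. apply Rmult_le_pos; auto. apply pow_le; auto.
Qed.

Lemma conv_pow_transform j :
  isI (fun v => conv_pow j v * exp (- (x * v)) * cos (s * v)) (fst (cpow C S (Datatypes.S j))) /\
  isI (fun v => conv_pow j v * exp (- (x * v)) * sin (s * v)) (snd (cpow C S (Datatypes.S j))).
Proof.
  induction j as [|j [IH1 IH2]].
  - simpl. replace (1 * C - 0 * S) with C by ring. replace (1 * S + 0 * C) with S by ring. auto.
  - destruct (conv_pow_expdec j) as [M HM]. destruct (conv_pow_expdec 0) as [N HN]. simpl conv_pow in HN.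
    set (a := fun v => conv_pow j v * exp (- (x * v)) * cos (s * v)) in *.
    set (b := fun v => conv_pow j v * exp (- (x * v)) * sin (s * v)) in *.
    set (c := fun v => q v * exp (- (x * v)) * cos (s * v)) in *.
    set (d := fun v => q v * exp (- (x * v)) * sin (s * v)) in *.
    assert (Ck := conv_pow_cont j).
    assert (Ca : cont a) by (unfold a; ct). assert (Cb : cont b) by (unfold b; ct).
    assert (Da : expdec a M (x / 2)) by (apply expdec_mult; auto; intros; apply Rabs_cos).
    assert (Db : expdec b M (x / 2)) by (apply expdec_mult; auto; intros; apply Rabs_sin).
    assert (Dc : expdec c N (x / 2)) by (apply expdec_mult; auto; intros; apply Rabs_cos).
    assert (Dd : expdec d N (x / 2)) by (apply expdec_mult; auto; intros; apply Rabs_sin).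
    set (c' := fun v => (Derive q v * exp (- (x * v)) + q v * (- x * exp (- (x * v)))) * cos (s * v)
                   + q v * exp (- (x * v)) * (- s * sin (s * v))).
    set (d' := fun v => (Derive q v * exp (- (x * v)) + q v * (- x * exp (- (x * v)))) * sin (s * v)
                   + q v * exp (- (x * v)) * (s * cos (s * v))).
    assert (Hc' : forall v, is_derive c v (c' v)).
    { intros v. apply (der_mult (fun v => q v * exp (- (x * v))) (fun v => cos (s * v))).
      - apply (der_mult q (fun v => exp (- (x * v)))); auto using der_expm.
      - auto_derive; auto; ring. }
    assert (Hd' : forall v, is_derive d v (d' v)).
    { intros v. apply (der_mult (fun v => q v * exp (- (x * v))) (fun v => sin (s * v))).
      - apply (der_mult q (fun v => exp (- (x * v)))); auto using der_expm.
      - auto_derive; auto; ring. }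
    assert (Cc' : cont c') by (unfold c'; ct). assert (Cd' : cont d') by (unfold d'; ct).
    assert (Hx2 : 0 < x / 2) by lra.
    assert (Iac := conv_isI a c c' M N (x / 2) _ _ Ca Hc' Cc' Hx2 Da Dc IH1 HC).
    assert (Ibd := conv_isI b d d' M N (x / 2) _ _ Cb Hd' Cd' Hx2 Db Dd IH2 HS).
    assert (Iad := conv_isI a d d' M N (x / 2) _ _ Ca Hd' Cd' Hx2 Da Dd IH1 HS).
    assert (Ibc := conv_isI b c c' M N (x / 2) _ _ Cb Hc' Cc' Hx2 Db Dc IH2 HC).
    assert (Cc : cont c) by (unfold c; ct). assert (Cd : cont d) by (unfold d; ct).
    assert (Cac := conv_cont a c c' Ca Hc' Cc'). assert (Cbd := conv_cont b d d' Cb Hd' Cd').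
    assert (Cad := conv_cont a d d' Ca Hd' Cd'). assert (Cbc := conv_cont b c c' Cb Hc' Cc').
    assert (Cr : forall v, cont (fun t => q (v - t))) by (intros; now apply cont_refl).
    assert (Crc : forall v, cont (fun t => c (v - t))) by (intros; now apply (cont_refl c)).
    assert (Crd : forall v, cont (fun t => d (v - t))) by (intros; now apply (cont_refl d)).
    split.
    + change (fst (cpow C S (Datatypes.S (Datatypes.S j))))
        with (fst (cpow C S (Datatypes.S j)) * C - snd (cpow C S (Datatypes.S j)) * S).
      apply isI_ext with (fun v => conv a c v - conv b d v); [|apply isI_minus; auto].
      intros v _. simpl conv_pow. unfold conv. rewrite <- RI_minus by ct.
      rewrite (Rmult_assoc (RInt _ _ _)), (Rmult_comm (RInt _ _ _)), <- RI_scal by ct.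
      apply RI_ext. intros t. unfold a, b, c, d.
      replace (- (x * v)) with (- (x * t) + - (x * (v - t))) by ring.
      replace (s * v) with (s * t + s * (v - t)) by ring.
      rewrite exp_plus, cos_plus. ring.
    + change (snd (cpow C S (Datatypes.S (Datatypes.S j))))
        with (fst (cpow C S (Datatypes.S j)) * S + snd (cpow C S (Datatypes.S j)) * C).
      apply isI_ext with (fun v => conv a d v + conv b c v); [|apply isI_plus; auto].
      intros v _. simpl conv_pow. unfold conv. rewrite <- RI_plus by ct.
      rewrite (Rmult_assoc (RInt _ _ _)), (Rmult_comm (RInt _ _ _)), <- RI_scal by ct.
      apply RI_ext. intros t. unfold a, b, c, d.
      replace (- (x * v)) with (- (x * t) + - (x * (v - t))) by ring.
      replace (s * v) with (s * t + s * (v - t)) by ring.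
      rewrite exp_plus, sin_plus. ring.
Qed.

Lemma conv_exp_part_transform n :
  isI (fun v => conv_exp_part 0 n v * exp (- (x * v)) * cos (s * v)) (cexp_re C S (Datatypes.S n) 1 - 1) /\
  isI (fun v => conv_exp_part 0 n v * exp (- (x * v)) * sin (s * v)) (cexp_im C S (Datatypes.S n) 1).
Proof.
  assert (T : forall j, isI (fun v => conv_pow j v / INR (fact (j + 1 + 0)) * exp (- (x * v)) * cos (s * v))
                 (fst (cpow C S (Datatypes.S j)) / INR (fact (Datatypes.S j)) * 1 ^ (Datatypes.S j)) /\
               isI (fun v => conv_pow j v / INR (fact (j + 1 + 0)) * exp (- (x * v)) * sin (s * v))
                 (snd (cpow C S (Datatypes.S j)) / INR (fact (Datatypes.S j)) * 1 ^ (Datatypes.S j))).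
  { intros j. destruct (conv_pow_transform j) as [K1 K2]. assert (Ck := conv_pow_cont j).
    rewrite pow1, !Rmult_1_r. replace (j + 1 + 0)%nat with (Datatypes.S j) by lia.
    unfold Rdiv. rewrite !(Rmult_comm _ (/ INR (fact (Datatypes.S j)))).
    split.
    - apply isI_ext with (fun v => / INR (fact (Datatypes.S j)) * (conv_pow j v * exp (- (x * v)) * cos (s * v))).
      + intros; ring.
      + apply isI_scal; auto. ct.
    - apply isI_ext with (fun v => / INR (fact (Datatypes.S j)) * (conv_pow j v * exp (- (x * v)) * sin (s * v))).
      + intros; ring.
      + apply isI_scal; auto. ct. }
  assert (Ct : forall j, cont (fun v => conv_pow j v / INR (fact (j + 1 + 0)))).
  { intros j. apply cont_div; [apply conv_pow_cont|ct|]. intros; apply Rgt_not_eq, fact_pos. }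
  assert (CR := conv_exp_part_cont 0).
  induction n as [|n [IH1 IH2]].
  - destruct (T O) as [T1 T2]. split.
    + replace (cexp_re C S 1 1 - 1) with (fst (cpow C S 1) / INR (fact 1) * 1 ^ 1) by (unfold cexp_re; simpl; field). exact T1.
    + replace (cexp_im C S 1 1) with (snd (cpow C S 1) / INR (fact 1) * 1 ^ 1) by (unfold cexp_im; simpl; field). exact T2.
  - destruct (T (Datatypes.S n)) as [T1 T2]. split.
    + unfold cexp_re. rewrite tech5. fold (cexp_re C S (Datatypes.S n) 1).
      set (z := _ / _ * _) in *.
      replace (cexp_re C S (Datatypes.S n) 1 + z - 1) with ((cexp_re C S (Datatypes.S n) 1 - 1) + z) by ring.
      refine (isI_ext _ _ _ _ (isI_plus _ _ _ _ _ _ IH1 T1)).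
      * intros v _. unfold conv_exp_part. rewrite tech5. ring.
      * assert (C1 := CR n). ct.
      * assert (C1 := Ct (Datatypes.S n)). ct.
    + unfold cexp_im. rewrite tech5. fold (cexp_im C S (Datatypes.S n) 1).
      refine (isI_ext _ _ _ _ (isI_plus _ _ _ _ _ _ IH2 T2)).
      * intros v _. unfold conv_exp_part. rewrite tech5. ring.
      * assert (C1 := CR n). ct.
      * assert (C1 := Ct (Datatypes.S n)). ct.
Qed.

(** The Laplace transform turns the convolution exponential into the
    exponential of the transform, here at the complex point [x + i s]. *)
Theorem conv_exp_transform :
  isI (fun v => conv_exp 0 v * exp (- (x * v)) * cos (s * v)) (exp C * cos S - 1) /\
  isI (fun v => conv_exp 0 v * exp (- (x * v)) * sin (s * v)) (exp C * sin S).
Proof.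
  assert (Hy : 0 < x / 2) by lra.
  set (D := B * exp (2 * (B / (x / 2)))).
  assert (HD : 0 <= D) by (unfold D; apply Rmult_le_pos; auto; left; apply exp_pos).
  assert (CR := conv_exp_cont 0). assert (CP := conv_exp_part_cont 0).
  assert (Ex : forall v, exp (x / 2 * v) * exp (- (x * v)) = exp (- (x / 2 * v))).
  { intros v. rewrite <- exp_plus. f_equal. field. }
  assert (Main : forall (tr : R -> R) (f : nat -> R) L, cont tr -> (forall v, Rabs (tr v) <= 1) ->
     (forall n, isI (fun v => conv_exp_part 0 n v * exp (- (x * v)) * tr v) (f n)) ->
     (forall e, 0 < e -> exists n0, forall n, (n0 <= n)%nat -> Rabs (f n - L) <= e) ->
     isI (fun v => conv_exp 0 v * exp (- (x * v)) * tr v) L).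
  { intros tr f L Ctr Btr Hf HL.
    destruct (isI_expdec (fun v => conv_exp 0 v * exp (- (x * v)) * tr v) (2 * D) (x / 2)) as (l & Hl & _); auto; [ct| |].
    { apply expdec_mult; auto. intros v Hv. rewrite Rabs_mult, (Rabs_right (exp _)) by (left; apply exp_pos).
      rewrite <- Ex, <- Rmult_assoc. apply Rmult_le_compat_r; [left; apply exp_pos|].
      generalize (conv_exp_bound 0 (x / 2) v Hy Hv). unfold D. lra. }
    replace L with l; auto.
    apply Rminus_diag_uniq. apply Rabs_eq_0. apply Rle_antisym; [|apply Rabs_pos].
    apply le_limit. intros e He.
    destruct (HL (e / 2)) as [n0 H0]; [lra|].
    destruct (half_pow_small (D / (x / 2)) (e / 2)) as [n1 H1]; [lra|].
    set (n := max n0 n1). specialize (H0 n ltac:(lia)). specialize (H1 n ltac:(lia)).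
    destruct (isI_expdec (fun v => conv_exp 0 v * exp (- (x * v)) * tr v - conv_exp_part 0 n v * exp (- (x * v)) * tr v)
       (D * (1 / 2) ^ n) (x / 2)) as (d & Hd & Bd); auto.
    { assert (C1 := CP n). ct. }
    { intros v Hv. rewrite <- !Rmult_minus_distr_r, !Rabs_mult, (Rabs_right (exp _)) by (left; apply exp_pos).
      assert (K := conv_exp_close_exp 0 n v (x / 2) Hy Hv). fold D in K.
      rewrite <- (Ex v). rewrite <- (Rmult_1_r (D * _ * _)).
      apply Rmult_le_compat; auto using Rabs_pos.
      - apply Rmult_le_pos; [apply Rabs_pos|left; apply exp_pos].
      - rewrite <- Rmult_assoc. apply Rmult_le_compat_r; [left; apply exp_pos|]. lra. }
    assert (E : d = l - f n).
    { apply (isI_unique _ d _ Hd). apply isI_minus; auto; [ct|]. assert (C1 := CP n). ct. }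
    rewrite E in Bd.
    replace (l - L) with ((l - f n) + (f n - L)) by ring.
    replace (D * (1 / 2) ^ n / (x / 2)) with (D / (x / 2) * (1 / 2) ^ n) in Bd by (field; lra).
    assert (T := Rabs_triang (l - f n) (f n - L)). lra. }
  split.
  - apply (Main (fun v => cos (s * v)) (fun n => cexp_re C S (Datatypes.S n) 1 - 1)).
    + ct.
    + intros; apply Rabs_cos.
    + intros n. exact (proj1 (conv_exp_part_transform n)).
    + intros e He. destruct (cexp_limit C S e He) as [n0 H]. exists n0. intros n Hn.
      destruct (H (Datatypes.S n) ltac:(lia)) as [H1 _].
      replace (cexp_re C S (Datatypes.S n) 1 - 1 - (exp C * cos S - 1)) with (cexp_re C S (Datatypes.S n) 1 - exp C * cos S) by ring.
      auto.
  - apply (Main (fun v => sin (s * v)) (fun n => cexp_im C S (Datatypes.S n) 1)).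
    + ct.
    + intros; apply Rabs_sin.
    + intros n. exact (proj2 (conv_exp_part_transform n)).
    + intros e He. destruct (cexp_limit C S e He) as [n0 H]. exists n0. intros n Hn.
      apply (H (Datatypes.S n)). lia.
Qed.
End Transform.
End ConvExp.

(** Reflecting both factors of [conv] reflects it and changes its sign ([conv_neg]), so for an
    even kernel the [(j + 1)]-st power has the parity of [j]. *)
Lemma conv_exp_opp q B : smooth full q -> (forall v, Rabs (q v) <= B) -> (forall v, q (- v) = q v) ->
  forall v, conv_exp (fun v => - q v) 0 v = - conv_exp q 0 (- v).
Proof.
  intros Sq Bq Eq v.
  assert (Cq : cont q) by now apply smooth_full_cont.
  assert (Ck : forall j, cont (conv_pow q j)) by (intros j; eapply conv_pow_cont; eauto).
  assert (P : forall j v, conv_pow q j (- v) = (-1) ^ j * conv_pow q j v).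
  { induction j as [|j IH]; intros w; simpl; [rewrite Eq; ring|].
    rewrite conv_neg by auto. unfold conv.
    assert (Cr : cont (fun t => q (w - t))) by now apply cont_refl.
    assert (C1 := Ck j).
    rewrite <- RI_scal by ct. rewrite <- RI_opp.
    - apply RI_ext. intros t. rewrite IH, Eq. ring.
    - apply cont_mult; [apply (cont_neg (conv_pow q j)); auto|]. apply (cont_refl (fun x => q (- x))), (cont_neg q); auto. }
  assert (N : forall j v, conv_pow (fun v => - q v) j v = (-1) ^ S j * conv_pow q j v).
  { induction j as [|j IH]; intros w; simpl; [ring|].
    unfold conv. assert (Cr : cont (fun t => q (w - t))) by now apply cont_refl.
    assert (C1 := Ck j).
    rewrite <- RI_scal by ct. apply RI_ext. intros t. rewrite IH. simpl. ring. }
  unfold conv_exp. rewrite <- Series_opp. apply Series_ext. intros j. rewrite N, P. simpl. unfold Rdiv. ring.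
Qed.
(** * Positive definite functions and their Taylor expansions *)

(** [1 + cos] and [1 - cos] are nonnegative. *)
Lemma pd_bound r v : pd r -> Rabs (r v) <= r 0.
Proof.
  intros H.
  assert (H1 := H ((1, 0) :: (1, v) :: nil)%list). assert (H2 := H ((1, 0) :: (-1, v) :: nil)%list).
  simpl in H1, H2. apply Rabs_le. split.
  - assert (0 <= 1 * r 0 + (1 * r v + 0)); [|lra]. apply H1.
    intros s _. simpl. rewrite Rmult_0_r, cos_0. generalize (COS_bound (s * v)); lra.
  - assert (0 <= 1 * r 0 + (-1 * r v + 0)); [|lra]. apply H2.
    intros s _. simpl. rewrite Rmult_0_r, cos_0. generalize (COS_bound (s * v)); lra.
Qed.

Definition second_diff (h : R) (l : list (R * R)) : list (R * R) :=
  List.flat_map (fun p => ((2 * fst p, snd p) :: (- fst p, snd p + h) :: (- fst p, snd p - h) :: nil)%list) l.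

Lemma ev_second_diff h l r : ev (second_diff h l) r = ev l (fun w => 2 * r w - r (w + h) - r (w - h)).
Proof. induction l as [|p l IH]; simpl; auto. rewrite IH. ring. Qed.

(** On [cos (s w)] the second difference is multiplication by [2 (1 - cos (s h)) >= 0]. *)
Lemma second_diff_pos h l : cos_pos l -> cos_pos (second_diff h l).
Proof.
  intros H s Hs. rewrite ev_second_diff.
  rewrite (ev_ext l _ (fun w => (2 - 2 * cos (s * h)) * cos (s * w))).
  - rewrite ev_scal. apply Rmult_le_pos; auto. generalize (COS_bound (s * h)); lra.
  - intros w. replace (s * (w + h)) with (s * w + s * h) by ring.
    replace (s * (w - h)) with (s * w - s * h) by ring. rewrite cos_plus, cos_minus. ring.
Qed.

Lemma second_diff_limit r w e : smooth full r -> 0 < e -> exists d, 0 < d /\ forall h, 0 < h < d ->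
  Rabs ((2 * r w - r (w + h) - r (w - h)) / h ^ 2 - - Derive_n r 2 w) <= e.
Proof.
  intros Sr He.
  set (r1 := Derive r). set (r2 := Derive_n r 2).
  assert (D0 : forall x, is_derive r x (r1 x)) by (intros; apply (smooth_der full); auto using open_full; exact Logic.I).
  assert (D1 : forall x, is_derive r1 x (r2 x)).
  { intros x. apply (smooth_Dn_der full r 1 x); auto using open_full. exact Logic.I. }
  assert (C2 : cont r2) by (apply smooth_full_cont, (smooth_Dn full r 2); auto using open_full).
  destruct (C2 w (fun y => Rabs (y - r2 w) < e / 2)) as [d Hd].
  { assert (H : 0 < e / 2) by lra. exists (mkposreal _ H). intros y Hy; exact Hy. }
  exists d. split; [apply cond_pos|]. intros h Hh.
  set (K := fun t => r (w + t) + r (w - t) - 2 * r w - t ^ 2 * r2 w).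
  assert (DK : forall t, is_derive K t (r1 (w + t) - r1 (w - t) - 2 * t * r2 w)).
  { intros t. unfold K. eapply der_eq.
    - apply (is_derive_minus (fun t => r (w + t) + r (w - t) - 2 * r w) (fun t => t ^ 2 * r2 w)).
      + apply (is_derive_minus (fun t => r (w + t) + r (w - t)) (fun t => 2 * r w)).
        * apply der_plus.
          -- apply (der_comp (fun t => w + t) r t 1); [auto_derive; auto; ring|apply D0].
          -- apply (der_comp (fun t => w - t) r t (-1)); [auto_derive; auto; ring|apply D0].
        * apply (is_derive_const (2 * r w) t).
      + apply (der_mult (fun t => t ^ 2) (fun _ => r2 w) t (2 * t) 0); [auto_derive; auto; ring|].
        apply (is_derive_const (r2 w) t).
    - unfold minus, plus, opp, zero; simpl. ring. }
  destruct (MVT_cor2 K (fun t => r1 (w + t) - r1 (w - t) - 2 * t * r2 w) 0 h ltac:(lra)) as (c & Ec & Hc).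
  { intros t _. apply is_derive_Reals, DK. }
  destruct (MVT_cor2 r1 r2 (w - c) (w + c) ltac:(lra)) as (xi & Exi & Hxi).
  { intros t _. apply is_derive_Reals, D1. }
  assert (Hr : Rabs (r2 xi - r2 w) < e / 2).
  { apply Hd. unfold ball; simpl; unfold AbsRing_ball, abs, minus, plus, opp; simpl.
    apply Rabs_lt_between. lra. }
  assert (K0 : K 0 = 0) by (unfold K; rewrite Rplus_0_r, Rminus_0_r; ring).
  rewrite K0, Exi, !Rminus_0_r in Ec.
  assert (EK : K h = 2 * c * h * (r2 xi - r2 w)) by (rewrite Ec; ring).
  assert (Hh2 : 0 < h ^ 2) by nra.
  replace ((2 * r w - r (w + h) - r (w - h)) / h ^ 2 - - r2 w) with (- (K h / h ^ 2)) by (unfold K; field; lra).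
  rewrite Rabs_Ropp, EK. unfold Rdiv.
  rewrite Rabs_mult, (Rabs_right (/ _)) by (left; apply Rinv_0_lt_compat; auto).
  rewrite Rabs_mult, (Rabs_right (2 * c * h)) by (apply Rle_ge, Rmult_le_pos; lra).
  apply Rmult_le_reg_r with (h ^ 2); auto. rewrite Rmult_assoc, Rinv_l, Rmult_1_r by lra.
  apply Rle_trans with (2 * c * h * (e / 2)).
  - apply Rmult_le_compat_l; [apply Rmult_le_pos; lra|lra].
  - assert (c * h <= h ^ 2) by nra. nra.
Qed.

Lemma pd_second_derivative r : smooth full r -> pd r -> pd (fun v => - Derive_n r 2 v).
Proof.
  intros Sr Pr l Hl. apply le_limit. intros e He.
  assert (N := norm1_pos l).
  set (e1 := e / (norm1 l + 1)). assert (He1 : 0 < e1) by (apply Rdiv_lt_0_compat; lra).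
  assert (Hn : norm1 l * e1 <= e).
  { apply Rmult_le_reg_r with (norm1 l + 1); [lra|]. unfold e1. field_simplify; nra. }
  clearbody e1.
  assert (All : exists d, 0 < d /\ forall h, 0 < h < d -> forall w, In w (map snd l) ->
     Rabs ((2 * r w - r (w + h) - r (w - h)) / h ^ 2 - - Derive_n r 2 w) <= e1).
  { clear Hl N Hn. induction l as [|p l (d & Hd & IH)]; simpl.
    - exists 1; split; [lra|tauto].
    - destruct (second_diff_limit r (snd p) e1 Sr He1) as (d' & Hd' & H').
      exists (Rmin d d'). split; [apply Rmin_pos; auto|]. intros h Hh w [<-|Hw].
      + apply H'. generalize (Rmin_r d d'); lra.
      + apply IH; auto. generalize (Rmin_l d d'); lra. }
  destruct All as (d & Hd & All).
  set (h := d / 2). assert (Hh : 0 < h < d) by (unfold h; lra).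
  assert (C := ev_close l _ _ _ (All h Hh)).
  assert (P := Pr _ (second_diff_pos h l Hl)). rewrite ev_second_diff in P.
  rewrite (ev_ext l (fun w => (2 * r w - r (w + h) - r (w - h)) / h ^ 2)
     (fun w => / h ^ 2 * (2 * r w - r (w + h) - r (w - h)))) in C by (intros; unfold Rdiv; ring).
  rewrite ev_scal in C.
  assert (0 <= / h ^ 2 * ev l (fun w => 2 * r w - r (w + h) - r (w - h))).
  { apply Rmult_le_pos; auto. left; apply Rinv_0_lt_compat; nra. }
  apply Rabs_le_between in C.
  lra.
Qed.

Lemma pd_ext r r' : (forall v, r v = r' v) -> pd r -> pd r'.
Proof. intros E H l Hl. rewrite <- (ev_ext l r r' E). auto. Qed.

Lemma pd_derivatives r j : smooth full r -> pd r -> pd (fun v => (-1) ^ j * Derive_n r (2 * j) v).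
Proof.
  intros Sr Pr; induction j as [|j IH].
  - apply (pd_ext r); auto. intros; simpl; ring.
  - set (g := fun v => (-1) ^ j * Derive_n r (2 * j) v) in *.
    assert (S2 : smooth full (Derive_n r (2 * j))) by (apply smooth_Dn; auto using open_full).
    assert (Sg : smooth full g).
    { intros n. apply Cn_mult; auto using Cn_const. }
    apply (pd_ext (fun v => - Derive_n g 2 v)); [|now apply pd_second_derivative].
    intros v. unfold g. rewrite Derive_n_scal_l, Derive_n_comp.
    replace (2 + 2 * j)%nat with (2 * S j)%nat by lia. simpl. ring.
Qed.

Lemma pd_derivative_bound r j v : smooth full r -> pd r ->
  Rabs (Derive_n r (2 * j) v) <= Rabs (Derive_n r (2 * j) 0).
Proof.
  intros Sr Pr. assert (H := pd_bound _ v (pd_derivatives r j Sr Pr)). cbv beta in H.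
  rewrite Rabs_mult, pow_1_abs, Rmult_1_l in H.
  eapply Rle_trans; [exact H|]. eapply Rle_trans; [apply Rle_abs|].
  rewrite Rabs_mult, pow_1_abs. lra.
Qed.

(** The first [j] terms of the Taylor series at the origin. *)
Definition taylor (f : R -> R) (j : nat) (v : R) : R :=
  match j with
  | O => 0
  | S n => sum_f_R0 (fun i => Derive_n f i 0 / INR (fact i) * v ^ i) n
  end.

Lemma taylor_S f j v : taylor f (S j) v = taylor f j v + Derive_n f j 0 / INR (fact j) * v ^ j.
Proof. destruct j; [simpl; ring|reflexivity]. Qed.

Lemma taylor_bound f j v : smooth full f -> 0 <= v ->
  (forall t, Rabs (Derive_n f j t) <= Rabs (Derive_n f j 0)) ->
  Rabs (f v - taylor f j v) <= Rabs (Derive_n f j 0) / INR (fact j) * v ^ j.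
Proof.
  intros Sf Hv H. assert (F := fact_pos j).
  destruct j as [|n].
  - simpl. rewrite Rminus_0_r. unfold Rdiv. rewrite Rinv_1, !Rmult_1_r. apply H.
  - destruct Hv as [Hv|<-].
    + destruct (Taylor_Lagrange f n 0 v Hv) as (z & Hz & E).
      { intros t _ i _. apply (smooth_ex full); auto using open_full. exact Logic.I. }
      assert (E' : f v - taylor f (S n) v = v ^ S n / INR (fact (S n)) * Derive_n f (S n) z).
      { rewrite E. unfold taylor. rewrite !Rminus_0_r.
        rewrite (sum_eq _ (fun i => Derive_n f i 0 / INR (fact i) * v ^ i)).
        - simpl. ring.
        - intros i _. unfold Rdiv; ring. }
      rewrite E', Rabs_mult, Rabs_right.
      * replace (Rabs (Derive_n f (S n) 0) / INR (fact (S n)) * v ^ S n)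
          with (v ^ S n / INR (fact (S n)) * Rabs (Derive_n f (S n) 0)) by (unfold Rdiv; ring).
        apply Rmult_le_compat_l; auto. apply Rdiv_le_0_compat; auto. apply pow_le; lra.
      * apply Rle_ge, Rdiv_le_0_compat; auto. apply pow_le; lra.
    + replace (taylor f (S n) 0) with (f 0).
      * rewrite Rminus_diag, Rabs_R0, pow_i by lia. lra.
      * unfold taylor. clear. induction n as [|n IH]; [simpl; field|].
        rewrite tech5, <- IH, pow_i by lia. ring.
Qed.

(** * Binet's function and its exponential *)

Definition mu (z : R) : R := I (ker z).
Lemma mu_isI z : 0 < z -> isI (ker z) (mu z).
Proof.
  intros Hz. destruct (isI_expdec (ker z) (1 / 8) z) as (l & Hl & _); auto using ker_cont, ker_dec.
  unfold mu. eapply I_spec; eauto.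
Qed.

(** The density of [exp mu - 1]. *)
Definition rk : R -> R := conv_exp k 0.
Lemma k_bound v : Rabs (k v) <= 1 / 8.
Proof. rewrite Rabs_right; [apply k_le|left; apply k_pos]. Qed.
Lemma rk_smooth : smooth full rk.
Proof. apply (conv_exp_smooth k (1 / 8)); auto using k_smooth, k_bound. Qed.
Lemma rk_cont : cont rk.
Proof. apply smooth_full_cont, rk_smooth. Qed.

Definition nk (v : R) : R := - k v.
Lemma nk_smooth : smooth full nk.
Proof. intros n; apply Cn_opp, k_smooth. Qed.
Lemma nk_bound v : Rabs (nk v) <= 1 / 8.
Proof. unfold nk. rewrite Rabs_Ropp. apply k_bound. Qed.
Lemma conv_exp_nk v : conv_exp nk 0 v = - rk (- v).
Proof. apply (conv_exp_opp k (1 / 8)); auto using k_smooth, k_bound, k_even. Qed.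

Lemma rk_bound y : 0 < y -> exists M, forall v, 0 <= v ->
  Rabs (rk v) <= M * exp (y * v) /\ Rabs (rk (- v)) <= M * exp (y * v).
Proof.
  intros Hy. exists (2 * (1 / 8) * exp (2 * (1 / 8 / y))). intros v Hv. split.
  - apply (conv_exp_bound k (1 / 8)); auto using k_smooth, k_bound.
  - rewrite <- Rabs_Ropp, <- conv_exp_nk. apply (conv_exp_bound nk (1 / 8)); auto using nk_smooth, nk_bound.
Qed.
Lemma Derive_reflect f v : smooth full f -> Derive (fun v => f (- v)) v = - Derive f (- v).
Proof.
  intros Sf. apply is_derive_unique. eapply der_eq.
  - apply (der_comp (fun v => - v) f v (-1)); [auto_derive; auto; ring|].
    apply (smooth_der full); auto using open_full. exact Logic.I.
  - ring.
Qed.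
Lemma rk_der_bound y : 0 < y -> exists M, forall v, 0 <= v ->
  Rabs (Derive rk v) <= M * exp (y * v) /\ Rabs (Derive rk (- v)) <= M * exp (y * v).
Proof.
  intros Hy.
  destruct (conv_exp_der_bound k (1 / 8) (1 / 2) k_smooth k_bound k_der_bound y Hy) as [M HM].
  destruct (conv_exp_der_bound nk (1 / 8) (1 / 2) nk_smooth nk_bound) with (y := y) as [M' HM']; auto.
  { intros v. unfold nk. rewrite Derive_opp, Rabs_Ropp. apply k_der_bound. }
  exists (Rmax M M'). intros v Hv. assert (X := exp_pos (y * v)). split.
  - eapply Rle_trans; [apply HM; auto|]. apply Rmult_le_compat_r; [lra|apply Rmax_l].
  - assert (E : Derive (conv_exp nk 0) v = Derive rk (- v)).
    { rewrite (Derive_ext (conv_exp nk 0) (fun v => - rk (- v))) by (intros; apply conv_exp_nk).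
      rewrite Derive_opp, Derive_reflect by apply rk_smooth. ring. }
    rewrite <- E. eapply Rle_trans; [apply HM'; auto|]. apply Rmult_le_compat_r; [lra|apply Rmax_r].
Qed.

(** Even and odd parts: the densities of [sinh mu] and of [cosh mu - 1]. *)
Definition rs (v : R) : R := / 2 * rk v + / 2 * rk (- v).
Definition rc (v : R) : R := / 2 * rk v + - / 2 * rk (- v).

Lemma reflect_smooth f : smooth full f -> smooth full (fun v => f (- v)).
Proof.
  intros Sf n. apply (Cn_comp full full); [now intros|apply Cn_opp, Cn_id|apply Sf].
Qed.
Lemma rs_smooth : smooth full rs.
Proof.
  intros n; apply Cn_plus; apply Cn_mult; auto using Cn_const; [apply rk_smooth|apply (reflect_smooth rk rk_smooth)].
Qed.
Lemma rc_smooth : smooth full rc.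
Proof.
  intros n; apply Cn_plus; apply Cn_mult; auto using Cn_const; [apply rk_smooth|apply (reflect_smooth rk rk_smooth)].
Qed.

Lemma Dn_reflect f n v : smooth full f -> Derive_n (fun v => f (- v)) n v = (-1) ^ n * Derive_n f n (- v).
Proof.
  intros Sf. apply Derive_n_comp_opp. exists (mkposreal 1 Rlt_0_1). intros y _ j _.
  apply (smooth_ex full); auto using open_full. exact Logic.I.
Qed.
Lemma Dn_rs n v : Derive_n rs n v = / 2 * Derive_n rk n v + / 2 * ((-1) ^ n * Derive_n rk n (- v)).
Proof.
  unfold rs. rewrite (Dn_lin full rk (fun v => rk (- v))); auto using open_full, rk_smooth, reflect_smooth.
  - rewrite Dn_reflect; auto using rk_smooth.
  - exact Logic.I.
Qed.
Lemma Dn_rc n v : Derive_n rc n v = / 2 * Derive_n rk n v + - / 2 * ((-1) ^ n * Derive_n rk n (- v)).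
Proof.
  unfold rc. rewrite (Dn_lin full rk (fun v => rk (- v))); auto using open_full, rk_smooth, reflect_smooth.
  - rewrite Dn_reflect; auto using rk_smooth.
  - exact Logic.I.
Qed.

Lemma rs_even v : rs (- v) = rs v.
Proof. unfold rs. rewrite Ropp_involutive; ring. Qed.

Lemma even_abs (f : R -> R) v : (forall v, f (- v) = f v) -> f (Rabs v) = f v.
Proof. intros H. unfold Rabs. destruct (Rcase_abs v); auto. Qed.

(** At [z = x + i s] the transform of [k] is [C - i S] with [C >= 0] and [S] in the first
    quadrant. *)
Lemma rk_transform x s : 0 < x -> 0 <= s -> exists C S, 0 <= C /\ 0 <= S <= PI / 2 /\
  isI (fun v => rk v * exp (- (x * v)) * cos (s * v)) (exp C * cos S - 1) /\
  isI (fun v => rk v * exp (- (x * v)) * sin (s * v)) (exp C * sin S) /\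
  isI (fun v => rk (- v) * exp (- (x * v)) * cos (s * v)) (1 - exp (- C) * cos S) /\
  isI (fun v => rk (- v) * exp (- (x * v)) * sin (s * v)) (exp (- C) * sin S).
Proof.
  intros Hx Hs. assert (CK := ker_cont x).
  destruct (isI_expdec (fun v => ker x v * cos (s * v)) (1 / 8) x) as (C & HC & _); auto; [ct| |].
  { apply expdec_mult; [apply ker_dec|intros; apply Rabs_cos]. }
  destruct (isI_expdec (fun v => ker x v * sin (s * v)) (1 / 8) x) as (S & HS & _); auto; [ct| |].
  { apply expdec_mult; [apply ker_dec|intros; apply Rabs_sin]. }
  exists C, S. split; [eapply ker_cos_pos; eauto|]. split; [eapply ker_sin_bounds; eauto|].
  assert (HC' : isI (fun v => nk v * exp (- (x * v)) * cos (s * v)) (- C)).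
  { replace (- C) with ((-1) * C) by ring. apply isI_ext with (fun v => (-1) * (ker x v * cos (s * v))).
    - intros; unfold nk, ker; ring.
    - apply isI_scal; auto; ct. }
  assert (HS' : isI (fun v => nk v * exp (- (x * v)) * sin (s * v)) (- S)).
  { replace (- S) with ((-1) * S) by ring. apply isI_ext with (fun v => (-1) * (ker x v * sin (s * v))).
    - intros; unfold nk, ker; ring.
    - apply isI_scal; auto; ct. }
  destruct (conv_exp_transform k (1 / 8) k_smooth k_bound x s C S Hx HC HS) as [T1 T2].
  destruct (conv_exp_transform nk (1 / 8) nk_smooth nk_bound x s (- C) (- S) Hx HC' HS') as [T3 T4].
  assert (Cr : cont (conv_exp nk 0)) by (apply smooth_full_cont, (conv_exp_smooth nk (1 / 8)); auto using nk_smooth, nk_bound).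
  split; [exact T1|]. split; [exact T2|]. split.
  - replace (1 - exp (- C) * cos S) with ((-1) * (exp (- C) * cos (- S) - 1)) by (rewrite cos_neg; ring).
    apply isI_ext with (fun v => (-1) * (conv_exp nk 0 v * exp (- (x * v)) * cos (s * v))).
    + intros v _. rewrite conv_exp_nk; ring.
    + apply isI_scal; auto; ct.
  - replace (exp (- C) * sin S) with ((-1) * (exp (- C) * sin (- S))) by (rewrite sin_neg; ring).
    apply isI_ext with (fun v => (-1) * (conv_exp nk 0 v * exp (- (x * v)) * sin (s * v))).
    + intros v _. rewrite conv_exp_nk; ring.
    + apply isI_scal; auto; ct.
Qed.

Lemma limit_at_0 h : cont h -> (forall x, 0 < x -> 0 <= h x) -> 0 <= h 0.
Proof.
  intros Ch H. apply Rnot_lt_le; intros Hlt.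
  destruct (Ch 0 (fun y => y < 0)) as [d Hd].
  { assert (P : 0 < - h 0) by lra. exists (mkposreal _ P). intros y Hy. unfold ball in Hy; simpl in Hy; unfold AbsRing_ball, abs, minus, plus, opp in Hy; simpl in Hy.
    apply Rabs_lt_between in Hy. lra. }
  assert (D := cond_pos d).
  assert (h (d / 2) < 0); [|specialize (H (d / 2) ltac:(lra)); lra].
  apply Hd. unfold ball; simpl; unfold AbsRing_ball, abs, minus, plus, opp; simpl. apply Rabs_lt_between. lra.
Qed.

Lemma exp_merge x v : exp (x / 2 * v) * exp (- (x * v)) = exp (- (x / 2 * v)).
Proof. rewrite <- exp_plus. f_equal. field. Qed.

(** The cosine transform of [rs v * exp (- x v)] is [sinh C * cos S >= 0]; then [x]
    tends to [0]. *)
Lemma rs_pd : pd rs.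
Proof.
  apply (pd_ext (fun w => rs (Rabs w))); [intros; apply even_abs, rs_even|].
  intros l Hl.
  assert (Crs := smooth_full_cont rs rs_smooth).
  set (h := fun x => ev l (fun w => rs (Rabs w) * exp (- (x * Rabs w)))).
  assert (Ch : cont h) by (apply (ev_cont l (fun x w => rs (Rabs w) * exp (- (x * Rabs w)))); intros w; ct).
  assert (E : ev l (fun w => rs (Rabs w)) = h 0).
  { apply ev_ext. intros w. rewrite Rmult_0_l, Ropp_0, exp_0; ring. }
  rewrite E. apply limit_at_0; auto. intros x Hx. unfold h.
  assert (Hy : 0 < x / 2) by lra.
  destruct (rk_bound (x / 2) Hy) as [M HM].
  assert (CP : cont (fun v => rs v * exp (- (x * v)))) by ct.
  apply (pd_of_transform (fun v => rs v * exp (- (x * v))) M (x / 2) CP Hy); auto.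
  - intros v Hv. destruct (HM v Hv) as [H1 H2]. rewrite Rabs_mult, (Rabs_right (exp _)) by (left; apply exp_pos).
    rewrite <- exp_merge, <- Rmult_assoc. apply Rmult_le_compat_r; [left; apply exp_pos|].
    unfold rs. eapply Rle_trans; [apply Rabs_triang|]. rewrite !Rabs_mult, (Rabs_right (/ 2)) by lra. lra.
  - intros s m Hs Hm. destruct (rk_transform x s Hx Hs) as (C & S & HC & HS & T1 & _ & T3 & _).
    assert (Ck := rk_cont). assert (Ck' := cont_neg rk Ck).
    rewrite (isI_unique _ m (/ 2 * (exp C * cos S - 1) + / 2 * (1 - exp (- C) * cos S)) Hm).
    + assert (P1 : 0 <= cos S) by (apply cos_ge_0; lra).
      assert (P2 : exp (- C) <= exp C) by (apply exp_le; lra). nra.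
    + apply isI_ext with (fun v => / 2 * (rk v * exp (- (x * v)) * cos (s * v)) + / 2 * (rk (- v) * exp (- (x * v)) * cos (s * v))).
      * intros v _. unfold rs; ring.
      * apply isI_plus; try apply isI_scal; auto; ct.
Qed.

(** By parts, the cosine transform of the derivative of [rc v * exp (- x v)] is [s] times
    its sine transform [sinh C * sin S >= 0]; then [x] tends to [0]. *)
Lemma rc_der_pd : pd (Derive rc).
Proof.
  assert (Crc := smooth_full_cont rc rc_smooth).
  assert (Sd := smooth_Derive full rc open_full rc_smooth).
  assert (Cd := smooth_full_cont _ Sd).
  assert (Dd : forall v, is_derive rc v (Derive rc v)).
  { intros v; apply (smooth_der full); auto using open_full, rc_smooth. exact Logic.I. }
  assert (Ed : forall v, Derive rc v = / 2 * Derive rk v + / 2 * Derive rk (- v)).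
  { intros v. change (Derive rc v) with (Derive_n rc 1 v). rewrite Dn_rc.
    change (Derive_n rk 1) with (Derive rk). ring. }
  apply (pd_ext (fun w => Derive rc (Rabs w))).
  { intros v. apply (even_abs (Derive rc)). intros w. rewrite !Ed, Ropp_involutive. ring. }
  intros l Hl.
  set (h := fun x => ev l (fun w => (Derive rc (Rabs w) - x * rc (Rabs w)) * exp (- (x * Rabs w)))).
  assert (Ch : cont h).
  { apply (ev_cont l (fun x w => (Derive rc (Rabs w) - x * rc (Rabs w)) * exp (- (x * Rabs w)))); intros w; ct. }
  assert (E : ev l (fun w => Derive rc (Rabs w)) = h 0).
  { apply ev_ext. intros w. rewrite !Rmult_0_l, Ropp_0, exp_0; ring. }
  rewrite E. apply limit_at_0; auto. intros x Hx. unfold h.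
  assert (Hy : 0 < x / 2) by lra.
  destruct (rk_bound (x / 2) Hy) as [M HM]. destruct (rk_der_bound (x / 2) Hy) as [M' HM'].
  assert (Bc : forall v, 0 <= v -> Rabs (rc v) <= M * exp (x / 2 * v)).
  { intros v Hv. destruct (HM v Hv) as [H1 H2]. unfold rc. eapply Rle_trans; [apply Rabs_triang|].
    rewrite Ropp_mult_distr_l_reverse, Rabs_Ropp, !Rabs_mult, (Rabs_right (/ 2)) by lra. lra. }
  set (phi := fun v => (Derive rc v - x * rc v) * exp (- (x * v))).
  assert (Cphi : cont phi) by (unfold phi; ct).
  assert (R0 : rc 0 = 0) by (unfold rc; rewrite Ropp_0; ring).
  apply (pd_of_transform phi (M' + x * M) (x / 2) Cphi Hy); auto.
  - intros v Hv. destruct (HM' v Hv) as [H1 H2]. unfold phi. rewrite Rabs_mult, (Rabs_right (exp _)) by (left; apply exp_pos).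
    rewrite <- exp_merge, <- Rmult_assoc. apply Rmult_le_compat_r; [left; apply exp_pos|].
    eapply Rle_trans; [apply Rabs_triang|]. rewrite Rabs_Ropp, Rabs_mult, (Rabs_right x) by lra.
    assert (Rabs (Derive rc v) <= M' * exp (x / 2 * v)).
    { rewrite Ed. eapply Rle_trans; [apply Rabs_triang|]. rewrite !Rabs_mult, (Rabs_right (/ 2)) by lra. lra. }
    specialize (Bc v Hv). nra.
  - intros s m Hs Hm. destruct (rk_transform x s Hx Hs) as (C & S & HC & HS & _ & T2 & _ & T4).
    assert (Ck := rk_cont). assert (Ck' := cont_neg rk Ck).
    set (A := / 2 * (exp C * sin S) + - / 2 * (exp (- C) * sin S)).
    assert (T : isI (fun v => rc v * exp (- (x * v)) * sin (s * v)) A).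
    { apply isI_ext with (fun v => / 2 * (rk v * exp (- (x * v)) * sin (s * v)) + - / 2 * (rk (- v) * exp (- (x * v)) * sin (s * v))).
      - intros v _. unfold rc; ring.
      - apply isI_plus; try apply isI_scal; auto; ct. }
    set (F := fun v => rc v * exp (- (x * v)) * cos (s * v)).
    assert (IF : isI (fun v => phi v * cos (s * v) - s * (rc v * exp (- (x * v)) * sin (s * v))) (0 - F 0)).
    { apply isI_antider.
      - intros v. unfold F. eapply der_eq.
        + apply (der_mult (fun v => rc v * exp (- (x * v))) (fun v => cos (s * v)) v (Derive rc v * exp (- (x * v)) + rc v * (- x * exp (- (x * v)))) (- s * sin (s * v))).
          * apply (der_mult rc (fun v => exp (- (x * v)))); [apply Dd|apply der_expm].
          * auto_derive; auto; ring.
        + unfold phi. ring.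
      - ct.
      - apply filterlim_locally. intros eps.
        destruct (small_exp (x / 2) M (eps / 2)) as (B & HB & H); [lra|generalize (cond_pos eps); lra|].
        exists (Rmax 0 B). intros v Hv. unfold ball; simpl; unfold AbsRing_ball, abs, minus, plus, opp; simpl.
        rewrite Ropp_0, Rplus_0_r.
        assert (Hv0 : 0 < v) by (generalize (Rmax_l 0 B); lra).
        specialize (H v ltac:(generalize (Rmax_r 0 B); lra)).
        unfold F. rewrite !Rabs_mult, (Rabs_right (exp _)) by (left; apply exp_pos).
        assert (X := exp_pos (- (x * v))). assert (K := Rabs_cos (s * v)).
        apply Rle_lt_trans with (M * exp (x / 2 * v) * exp (- (x * v)) * 1).
        + apply Rmult_le_compat; auto using Rabs_pos.
          * apply Rmult_le_pos; [apply Rabs_pos|lra].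
          * apply Rmult_le_compat_r; [lra|]. apply Bc; lra.
        + rewrite Rmult_1_r, Rmult_assoc, exp_merge.
          generalize (Rle_abs M) (exp_pos (- (x / 2 * v))) (cond_pos eps); intros. nra. }
    assert (F0 : F 0 = 0) by (unfold F; rewrite R0; ring).
    rewrite (isI_unique _ m ((0 - F 0) + s * A) Hm).
    + rewrite F0. assert (P1 : 0 <= sin S) by (apply sin_ge_0; generalize PI_RGT_0; lra).
      assert (P2 : exp (- C) <= exp C) by (apply exp_le; lra). unfold A.
      assert (0 <= / 2 * (exp C * sin S) + - / 2 * (exp (- C) * sin S)) by nra.
      rewrite Rminus_diag, Rplus_0_l. apply Rmult_le_pos; auto.
    + apply isI_ext with (fun v => (phi v * cos (s * v) - s * (rc v * exp (- (x * v)) * sin (s * v))) + s * (rc v * exp (- (x * v)) * sin (s * v))).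
      * intros v _. ring.
      * apply isI_plus; auto; try ct. apply isI_scal; auto; ct.
Qed.

(** The coefficients of the Stirling expansion of [exp mu]. *)
Definition stirling_coef (j : nat) : R := match j with O => 1 | S i => Derive_n rk i 0 end.

Lemma Dn_rs_0 i : Derive_n rs i 0 = / 2 * (1 + (-1) ^ i) * stirling_coef (S i).
Proof. rewrite Dn_rs, Ropp_0. simpl stirling_coef. ring. Qed.
Lemma Dn_rc_0 i : Derive_n rc i 0 = / 2 * (1 - (-1) ^ i) * stirling_coef (S i).
Proof. rewrite Dn_rc, Ropp_0. simpl stirling_coef. ring. Qed.

Lemma rs_taylor_bound i v : 0 <= v ->
  Rabs (rs v - taylor rs (2 * i) v) <= Rabs (stirling_coef (S (2 * i))) / INR (fact (2 * i)) * v ^ (2 * i).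
Proof.
  intros Hv.
  assert (E : Derive_n rs (2 * i) 0 = stirling_coef (S (2 * i))) by (rewrite Dn_rs_0, pow_1_even; field).
  rewrite <- E. apply taylor_bound; auto using rs_smooth.
  intros t. apply pd_derivative_bound; auto using rs_smooth, rs_pd.
Qed.
Lemma rc_taylor_bound i v : 0 <= v ->
  Rabs (rc v - taylor rc (S (2 * i)) v) <= Rabs (stirling_coef (S (S (2 * i)))) / INR (fact (S (2 * i))) * v ^ (S (2 * i)).
Proof.
  intros Hv.
  assert (E : Derive_n rc (S (2 * i)) 0 = stirling_coef (S (S (2 * i)))) by (rewrite Dn_rc_0, pow_1_odd; field).
  rewrite <- E. apply taylor_bound; auto using rc_smooth.
  intros t. rewrite !Dn_shift.
  apply pd_derivative_bound; [apply smooth_Derive; auto using open_full, rc_smooth|apply rc_der_pd].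
Qed.

(** The Taylor polynomial of [v |-> rk (sg * v)]. *)
Definition tay (sg : R) (j : nat) (v : R) : R :=
  match j with
  | O => 0
  | S n => sum_f_R0 (fun i => sg ^ i * stirling_coef (S i) / INR (fact i) * v ^ i) n
  end.
Lemma tay_S sg j v : tay sg (S j) v = tay sg j v + sg ^ j * stirling_coef (S j) / INR (fact j) * v ^ j.
Proof. destruct j; [simpl; ring|reflexivity]. Qed.

Lemma tay_split sg j v : sg = 1 \/ sg = -1 -> tay sg j v = taylor rs j v + sg * taylor rc j v.
Proof.
  intros Hs. induction j as [|j IH]; [simpl; ring|].
  rewrite tay_S, !taylor_S, IH, Dn_rs_0, Dn_rc_0.
  assert (E : sg ^ j = / 2 * (1 + (-1) ^ j) + sg * (/ 2 * (1 - (-1) ^ j))).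
  { destruct Hs as [->| ->]; [rewrite pow1; field|field]. }
  rewrite E. field. apply Rgt_not_eq, fact_pos.
Qed.

(** The even and the odd part of [rk] each contribute one of the two terms: one
    of them is truncated at order [j], the other one at order [j + 1], its
    [j]-th derivative at the origin being zero. *)
Lemma rk_remainder sg j v : sg = 1 \/ sg = -1 -> 0 <= v ->
  Rabs (rk (sg * v) - tay sg j v) <=
  Rabs (stirling_coef (S j)) / INR (fact j) * v ^ j + Rabs (stirling_coef (S (S j))) / INR (fact (S j)) * v ^ S j.
Proof.
  intros Hs Hv.
  assert (E : rk (sg * v) = rs v + sg * rc v).
  { unfold rs, rc. destruct Hs as [->| ->]; [rewrite Rmult_1_l; field|].
    replace (-1 * v) with (- v) by ring. field. }
  assert (As : Rabs sg = 1) by (destruct Hs as [->| ->]; [apply Rabs_R1|rewrite Rabs_left; lra]).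
  assert (Split : forall m n, taylor rs m v = taylor rs j v -> taylor rc n v = taylor rc j v ->
     Rabs (rk (sg * v) - tay sg j v) <= Rabs (rs v - taylor rs m v) + Rabs (rc v - taylor rc n v)).
  { intros m n Em En. rewrite E, tay_split, Em, En by auto.
    replace (rs v + sg * rc v - (taylor rs j v + sg * taylor rc j v))
      with ((rs v - taylor rs j v) + sg * (rc v - taylor rc j v)) by ring.
    eapply Rle_trans; [apply Rabs_triang|]. rewrite Rabs_mult, As. lra. }
  destruct (Nat.Even_or_Odd j) as [[i Ej]|[i Ej]]; subst j.
  - eapply Rle_trans; [apply (Split (2 * i)%nat (S (2 * i))); auto|].
    + rewrite taylor_S, Dn_rc_0, pow_1_even. unfold Rdiv; ring.
    + apply Rplus_le_compat; [apply rs_taylor_bound; auto|apply rc_taylor_bound; auto].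
  - rewrite Nat.add_1_r in *. eapply Rle_trans; [apply (Split (S (S (2 * i))) (S (2 * i))); auto|].
    + rewrite taylor_S, Dn_rs_0, pow_1_odd. unfold Rdiv; ring.
    + rewrite Rplus_comm. apply Rplus_le_compat; [apply rc_taylor_bound; auto|].
      replace (S (S (2 * i))) with (2 * S i)%nat by lia. apply rs_taylor_bound; auto.
Qed.

Lemma tay_cont sg j : cont (tay sg j).
Proof.
  induction j as [|j IH].
  - apply cont_const.
  - intros v. apply (continuous_ext (fun v => tay sg j v + sg ^ j * stirling_coef (S j) / INR (fact j) * v ^ j)).
    + intros w; symmetry; apply tay_S.
    + assert (C : cont (fun v => tay sg j v + sg ^ j * stirling_coef (S j) / INR (fact j) * v ^ j)).
      { apply cont_plus; auto. apply (cont_mult (fun _ => sg ^ j * stirling_coef (S j) / INR (fact j))); ct. }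
      apply C.
Qed.

Definition stirling (sg : R) (j : nat) (z : R) : R := sum_f_R0 (fun i => sg ^ i * stirling_coef i / z ^ i) j.

Lemma tay_isI sg j z : 0 < z -> sg = 1 \/ sg = -1 ->
  isI (fun v => sg * tay sg j v * exp (- (z * v))) (stirling sg j z - 1).
Proof.
  intros Hz Hs. induction j as [|j IH].
  - unfold stirling; simpl. replace (1 * 1 / 1 - 1) with 0 by field.
    apply isI_ext with (fun _ => 0); [intros; ring|apply isI_zero].
  - unfold stirling. rewrite tech5. fold (stirling sg j z).
    assert (Z : z ^ S j <> 0) by (apply pow_nonzero; lra).
    replace (stirling sg j z + sg ^ S j * stirling_coef (S j) / z ^ S j - 1)
      with ((stirling sg j z - 1) + sg ^ S j * stirling_coef (S j) / INR (fact j) * (INR (fact j) / z ^ S j)).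
    2: { field. split; auto. apply Rgt_not_eq, fact_pos. }
    apply isI_ext with (fun v => sg * tay sg j v * exp (- (z * v)) + sg ^ S j * stirling_coef (S j) / INR (fact j) * (v ^ j * exp (- (z * v)))).
    + intros v _. rewrite tay_S. simpl pow. unfold Rdiv; ring.
    + assert (C := tay_cont sg j). apply isI_plus; auto; try ct. apply isI_scal; [ct|]. now apply isI_powexp.
Qed.

(** The bound for the density is integrated against [exp (- z v)].  For [sg = -1] the density
    of [exp (- mu) - 1] is [v |-> - rk (- v)], which is why both signs are treated at once. *)
Theorem stirling_bound sg j z : 0 < z -> sg = 1 \/ sg = -1 ->
  Rabs (exp (sg * mu z) - stirling sg j z) <= Rabs (stirling_coef (S j)) / z ^ S j + Rabs (stirling_coef (S (S j))) / z ^ S (S j).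
Proof.
  intros Hz Hs.
  assert (Ck := rk_cont). assert (Cn := cont_neg rk Ck). assert (CK := ker_cont z). assert (CT := tay_cont sg j).
  assert (T : isI (fun v => sg * rk (sg * v) * exp (- (z * v))) (exp (sg * mu z) - 1)).
  { assert (H0 : isI (fun v => k v * exp (- (z * v)) * cos (0 * v)) (mu z)).
    { apply isI_ext with (ker z); [|now apply mu_isI]. intros v _. unfold ker. rewrite Rmult_0_l, cos_0; ring. }
    assert (H1 : isI (fun v => k v * exp (- (z * v)) * sin (0 * v)) 0).
    { apply isI_ext with (fun _ => 0); [|apply isI_zero]. intros v _. rewrite Rmult_0_l, sin_0; ring. }
    assert (H0' : isI (fun v => nk v * exp (- (z * v)) * cos (0 * v)) (- mu z)).
    { replace (- mu z) with ((-1) * mu z) by ring. apply isI_ext with (fun v => (-1) * ker z v); [|apply isI_scal; auto; now apply mu_isI].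
      intros v _. unfold ker, nk. rewrite Rmult_0_l, cos_0; ring. }
    assert (H1' : isI (fun v => nk v * exp (- (z * v)) * sin (0 * v)) 0).
    { apply isI_ext with (fun _ => 0); [|apply isI_zero]. intros v _. rewrite Rmult_0_l, sin_0; ring. }
    destruct Hs as [->| ->].
    - destruct (conv_exp_transform k (1 / 8) k_smooth k_bound z 0 _ _ Hz H0 H1) as [T _].
      rewrite cos_0, Rmult_1_r in T. rewrite Rmult_1_l. refine (isI_ext _ _ _ _ T).
      intros v _. rewrite !Rmult_0_l, cos_0, !Rmult_1_l. unfold rk. ring.
    - destruct (conv_exp_transform nk (1 / 8) nk_smooth nk_bound z 0 _ _ Hz H0' H1') as [T _].
      rewrite cos_0, Rmult_1_r in T. replace (-1 * mu z) with (- mu z) by ring. refine (isI_ext _ _ _ _ T).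
      intros v _. rewrite conv_exp_nk, Rmult_0_l, cos_0. replace (-1 * v) with (- v) by ring. ring. }
  assert (CR : cont (fun v => rk (sg * v))) by (apply (cont_comp (fun v => sg * v) rk); auto; ct).
  assert (D := isI_minus (fun v => sg * rk (sg * v) * exp (- (z * v))) (fun v => sg * tay sg j v * exp (- (z * v)))
    _ _ ltac:(ct) ltac:(ct) T (tay_isI sg j z Hz Hs)).
  replace (exp (sg * mu z) - 1 - (stirling sg j z - 1)) with (exp (sg * mu z) - stirling sg j z) in D by ring.
  set (c := Rabs (stirling_coef (S j)) / INR (fact j)). set (c' := Rabs (stirling_coef (S (S j))) / INR (fact (S j))).
  assert (G : isI (fun v => c * (v ^ j * exp (- (z * v))) + c' * (v ^ S j * exp (- (z * v))))
     (c * (INR (fact j) / z ^ S j) + c' * (INR (fact (S j)) / z ^ S (S j)))).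
  { apply isI_plus; try ct; (apply isI_scal; [ct|]; now apply isI_powexp). }
  assert (As : Rabs sg = 1) by (destruct Hs as [->| ->]; [apply Rabs_R1|rewrite Rabs_left; lra]).
  assert (Dom : forall v, 0 < v -> Rabs (sg * rk (sg * v) * exp (- (z * v)) - sg * tay sg j v * exp (- (z * v)))
     <= c * (v ^ j * exp (- (z * v))) + c' * (v ^ S j * exp (- (z * v)))).
  { intros v Hv.
    replace (sg * rk (sg * v) * exp (- (z * v)) - sg * tay sg j v * exp (- (z * v)))
      with (sg * (rk (sg * v) - tay sg j v) * exp (- (z * v))) by ring.
    rewrite !Rabs_mult, As, Rmult_1_l, (Rabs_right (exp _)) by (left; apply exp_pos).
    rewrite <- !Rmult_assoc, <- Rmult_plus_distr_r. apply Rmult_le_compat_r; [left; apply exp_pos|].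
    apply rk_remainder; auto; lra. }
  assert (C1 : cont (fun v => sg * rk (sg * v) * exp (- (z * v)) - sg * tay sg j v * exp (- (z * v)))) by ct.
  assert (C2 : cont (fun v => c * (v ^ j * exp (- (z * v))) + c' * (v ^ S j * exp (- (z * v))))) by ct.
  destruct (isI_dom _ _ _ C1 C2 Dom G) as (l & Hl & Bl).
  rewrite (isI_unique _ _ _ D Hl). eapply Rle_trans; [exact Bl|]. unfold c, c'.
  right. field. repeat split; try (apply pow_nonzero; lra); apply Rgt_not_eq, fact_pos.
Qed.
(** ** Differentiation under the integral sign *)

Lemma exp_second_order u : Rabs (exp (- u) - 1 + u) <= u ^ 2 * exp (Rabs u).
Proof.
  replace (exp (- u) - 1 + u) with ((- u) ^ 2 * E2 (- u)) by (rewrite E2_eq; ring).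
  replace ((- u) ^ 2) with (u ^ 2) by ring.
  rewrite Rabs_mult, (Rabs_right (u ^ 2)) by (apply Rle_ge, pow2_ge_0).
  apply Rmult_le_compat_l; [apply pow2_ge_0|].
  rewrite Rabs_right by (left; apply E2_pos).
  unfold E2, wexp. replace (exp (Rabs u)) with (exp (Rabs u) * (1 - 0)) by ring. rewrite <- RI_const.
  apply RI_le; [apply (wexp_cont (fun s => 1 - s)), cont_weight2|ct|lra|]. intros s Hs.
  rewrite <- (Rmult_1_l (exp (Rabs u))). apply Rmult_le_compat; try lra; [left; apply exp_pos|].
  apply exp_le. generalize (Rle_abs (- u)) (Rabs_pos u). rewrite Rabs_Ropp. intros; nra.
Qed.

Lemma quadratic_derive (F : R -> R) z m K d : 0 < d ->
  (forall h, Rabs h < d -> Rabs (F (z + h) - F z - m * h) <= K * h ^ 2) -> is_derive F z m.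
Proof.
  intros Hd H. apply is_derive_Reals. intros e He.
  assert (HK : 0 < Rabs K + 1) by (generalize (Rabs_pos K); lra).
  assert (P : 0 < Rmin d (e / (Rabs K + 1))) by (apply Rmin_pos; auto; apply Rdiv_lt_0_compat; auto).
  exists (mkposreal _ P). intros h Hh0 Hh. simpl in Hh.
  assert (H1 : Rabs h < d) by (eapply Rlt_le_trans; [exact Hh|apply Rmin_l]).
  assert (H2 : Rabs h < e / (Rabs K + 1)) by (eapply Rlt_le_trans; [exact Hh|apply Rmin_r]).
  specialize (H h H1). assert (H0 := Rabs_pos_lt h Hh0).
  replace ((F (z + h) - F z) / h - m) with ((F (z + h) - F z - m * h) / h) by (field; auto).
  unfold Rdiv at 1. rewrite Rabs_mult, Rabs_inv.
  apply Rmult_lt_reg_r with (Rabs h); auto. rewrite Rmult_assoc, Rinv_l, Rmult_1_r by lra.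
  eapply Rle_lt_trans; [exact H|]. rewrite <- (pow2_abs h).
  apply Rmult_lt_compat_r with (r := Rabs K + 1) in H2; auto.
  replace (e / (Rabs K + 1) * (Rabs K + 1)) with e in H2 by (field; lra).
  generalize (Rle_abs K); intros. nra.
Qed.

Lemma laplace_der (f g F : R -> R) z m : cont f -> cont g -> (forall v, 0 < v -> 0 <= g v) ->
  (forall w, 0 < w -> exists l, isI (fun v => Rabs (f v) * g v ^ 2 * exp (- (w * g v))) l) ->
  (forall w, 0 < w -> isI (fun v => f v * exp (- (w * g v))) (F w)) ->
  0 < z -> isI (fun v => f v * g v * exp (- (z * g v))) m -> is_derive F z (- m).
Proof.
  intros Cf Cg Pg H2 HF Hz Hm.
  destruct (H2 (z / 2)) as [K HK]; [lra|].
  apply (quadratic_derive F z (- m) K (z / 2)); [lra|].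
  intros h Hh. apply Rabs_lt_between in Hh.
  assert (Ce : forall w, cont (fun v => exp (- (w * g v)))) by (intros; ct).
  assert (Id : isI (fun v => f v * exp (- ((z + h) * g v)) - f v * exp (- (z * g v)) + h * (f v * g v * exp (- (z * g v))))
     (F (z + h) - F z + h * m)).
  { apply isI_plus; try ct; [apply isI_minus; try ct; apply HF; lra|apply isI_scal; auto; ct]. }
  replace (F (z + h) - F z - - m * h) with (F (z + h) - F z + h * m) by ring.
  assert (CG : cont (fun v => Rabs (f v) * g v ^ 2 * exp (- (z / 2 * g v)))) by ct.
  assert (IG := isI_scal (h ^ 2) _ _ CG HK).
  assert (Dom : forall v, 0 < v ->
     Rabs (f v * exp (- ((z + h) * g v)) - f v * exp (- (z * g v)) + h * (f v * g v * exp (- (z * g v))))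
     <= h ^ 2 * (Rabs (f v) * g v ^ 2 * exp (- (z / 2 * g v)))).
  { intros v Hv. specialize (Pg v Hv).
  replace (f v * exp (- ((z + h) * g v)) - f v * exp (- (z * g v)) + h * (f v * g v * exp (- (z * g v))))
    with (f v * exp (- (z * g v)) * (exp (- (h * g v)) - 1 + h * g v)).
  2: { replace (- ((z + h) * g v)) with (- (z * g v) + - (h * g v)) by ring. rewrite exp_plus; ring. }
  rewrite !Rabs_mult, (Rabs_right (exp _)) by (left; apply exp_pos).
  assert (Q := exp_second_order (h * g v)).
  apply Rle_trans with (Rabs (f v) * exp (- (z * g v)) * ((h * g v) ^ 2 * exp (Rabs (h * g v)))).
  - apply Rmult_le_compat_l; auto. apply Rmult_le_pos; [apply Rabs_pos|left; apply exp_pos].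
  - replace (Rabs (f v) * exp (- (z * g v)) * ((h * g v) ^ 2 * exp (Rabs (h * g v))))
      with (h ^ 2 * (Rabs (f v) * g v ^ 2 * (exp (- (z * g v)) * exp (Rabs (h * g v))))) by ring.
    apply Rmult_le_compat_l; [apply pow2_ge_0|].
    apply Rmult_le_compat_l; [apply Rmult_le_pos; [apply Rabs_pos|apply pow2_ge_0]|].
    rewrite <- exp_plus. apply exp_le. rewrite Rabs_mult, (Rabs_right (g v)) by lra.
    assert (Rabs h <= z / 2) by (apply Rabs_le; lra). nra. }
  assert (C1 : cont (fun v => f v * exp (- ((z + h) * g v)) - f v * exp (- (z * g v)) + h * (f v * g v * exp (- (z * g v))))) by ct.
  assert (C2 : cont (fun v => h ^ 2 * (Rabs (f v) * g v ^ 2 * exp (- (z / 2 * g v))))) by ct.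
  destruct (isI_dom _ _ _ C1 C2 Dom IG) as (l & Hl & Bl).
  rewrite (isI_unique _ _ _ Id Hl). lra.
Qed.

(** * The functional equation of Binet's function *)

(** Constant, and small at infinity. *)
Lemma zero_of_decay (h : R -> R) C : (forall z, 0 < z -> is_derive h z 0) ->
  (forall z, 1 <= z -> Rabs (h z) <= C / z) -> forall z, 0 < z -> h z = 0.
Proof.
  intros rothe_dom Bh z Hz. apply Rabs_eq_0. apply Rle_antisym; [|apply Rabs_pos].
  apply le_limit. intros e He.
  set (w := Rmax (z + 1) (Rabs C / e) + 1).
  assert (W1 : z + 1 < w) by (unfold w; generalize (Rmax_l (z + 1) (Rabs C / e)); lra).
  assert (W2 : Rabs C / e < w) by (unfold w; generalize (Rmax_r (z + 1) (Rabs C / e)); lra).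
  destruct (MVT_cor2 h (fun _ => 0) z w ltac:(lra)) as (c & E & _).
  { intros c Hc. apply is_derive_Reals, rothe_dom. lra. }
  replace (h z) with (h w) by lra. specialize (Bh w ltac:(lra)).
  assert (C / w <= e).
  { apply Rmult_le_reg_r with w; [lra|]. unfold Rdiv. rewrite Rmult_assoc, Rinv_l by lra.
    apply Rmult_lt_compat_r with (r := e) in W2; auto. replace (Rabs C / e * e) with (Rabs C) in W2 by (field; lra).
    generalize (Rle_abs C); lra. }
  lra.
Qed.

Lemma poly_exp_dom f M n w : cont f -> 0 < w -> (forall v, 0 < v -> Rabs (f v) <= M * v ^ n) ->
  exists l, isI (fun v => f v * exp (- (w * v))) l /\ Rabs l <= M * (INR (fact n) / w ^ S n).
Proof.
  intros Cf Hw Bf.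
  apply (isI_dom (fun v => f v * exp (- (w * v))) (fun v => M * (v ^ n * exp (- (w * v))))); [ct|ct| |].
  - intros v Hv. rewrite Rabs_mult, (Rabs_right (exp _)) by (left; apply exp_pos).
    rewrite <- Rmult_assoc. apply Rmult_le_compat_r; [left; apply exp_pos|auto].
  - apply isI_scal; [ct|]. now apply isI_powexp.
Qed.

Lemma mu_small z : 0 < z -> 0 <= mu z <= 1 / 8 / z.
Proof.
  intros Hz. assert (CK := ker_cont z). split.
  - apply (isI_pos (ker z)); auto; [intros; left; apply ker_pos|now apply mu_isI].
  - destruct (isI_expdec (ker z) (1 / 8) z CK Hz (ker_dec z)) as (l & Hl & Bl).
    rewrite (isI_unique _ _ _ (mu_isI z Hz) Hl). generalize (Rle_abs l); lra.
Qed.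

Definition mu1 (z : R) : R := I (fun v => k v * v * exp (- (z * v))).
Definition mu2 (z : R) : R := I (fun v => k v * v ^ 2 * exp (- (z * v))).

Lemma kpow_abs n v : 0 < v -> Rabs (k v * v ^ n) <= 1 / 8 * v ^ n.
Proof.
  intros Hv. assert (0 <= v ^ n) by (apply pow_le; lra).
  rewrite Rabs_mult, (Rabs_right (v ^ n)) by lra. apply Rmult_le_compat_r; auto. apply k_bound.
Qed.
Lemma kpow_isI n w : 0 < w -> exists l, isI (fun v => k v * v ^ n * exp (- (w * v))) l /\ Rabs l <= 1 / 8 * (INR (fact n) / w ^ S n).
Proof.
  intros Hw. assert (Ck := k_cont).
  apply (poly_exp_dom (fun v => k v * v ^ n) (1 / 8) n w); [ct|auto|]. intros; now apply kpow_abs.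
Qed.
Lemma mu1_isI z : 0 < z -> isI (fun v => k v * v * exp (- (z * v))) (mu1 z) /\ Rabs (mu1 z) <= 1 / 8 / z ^ 2.
Proof.
  intros Hz. destruct (kpow_isI 1 z Hz) as (l & Hl & Bl).
  assert (H : isI (fun v => k v * v * exp (- (z * v))) l).
  { apply isI_ext with (2 := Hl). intros v _. now rewrite pow_1. }
  unfold mu1. rewrite (I_unique _ _ H). split; auto. simpl in Bl.
  eapply Rle_trans; [exact Bl|]. right. field. lra.
Qed.
Lemma mu2_isI z : 0 < z -> isI (fun v => k v * v ^ 2 * exp (- (z * v))) (mu2 z).
Proof.
  intros Hz. destruct (kpow_isI 2 z Hz) as (l & Hl & _). unfold mu2. eapply I_spec; eauto.
Qed.

Lemma mu_der z : 0 < z -> is_derive mu z (- mu1 z).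
Proof.
  intros Hz. assert (Ck := k_cont).
  apply (laplace_der k (fun v => v) mu z); auto; try ct.
  - intros; lra.
  - intros w Hw. destruct (kpow_isI 2 w Hw) as (l & Hl & _). exists l.
    apply isI_ext with (2 := Hl). intros v _. rewrite Rabs_right; auto. left; apply k_pos.
  - intros w Hw. now apply mu_isI.
  - apply mu1_isI; auto.
Qed.
Lemma mu1_der z : 0 < z -> is_derive mu1 z (- mu2 z).
Proof.
  intros Hz. assert (Ck := k_cont).
  apply (laplace_der (fun v => k v * v) (fun v => v) mu1 z); auto; try ct.
  - intros; lra.
  - intros w Hw. destruct (kpow_isI 3 w Hw) as (l & Hl & _). exists l.
    apply isI_ext with (2 := Hl). intros v Hv. rewrite Rabs_right; [ring|].
    generalize (k_pos v); intros; nra.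
  - intros w Hw. now apply mu1_isI.
  - apply isI_ext with (2 := mu2_isI z Hz). intros; ring.
Qed.

(** The increment of Stirling's approximation of the logarithm of the Gamma function,
    compared with [ln z]. *)
Definition delta (z : R) : R := (z + 1 / 2) * ln ((z + 1) / z) - 1.

Lemma ln_ratio z : 0 < z -> / (z + 1) <= ln ((z + 1) / z) <= / z.
Proof.
  intros Hz. assert (0 < (z + 1) / z) by (apply Rdiv_lt_0_compat; lra). split.
  - assert (Q := exp_ineq1_le (- ln ((z + 1) / z))). rewrite exp_Ropp, exp_ln in Q by auto.
    replace (/ ((z + 1) / z)) with (1 - / (z + 1)) in Q by (field; lra). lra.
  - assert (Q := exp_ineq1_le (ln ((z + 1) / z))). rewrite exp_ln in Q by auto.
    replace ((z + 1) / z) with (1 + / z) in Q at 2 by (field; lra). lra.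
Qed.

(** The second derivatives of both sides are elementary and agree. *)
Lemma mu_shift z : 0 < z -> mu z - mu (z + 1) = delta z.
Proof.
  set (d1 := fun z => ln ((z + 1) / z) - (z + 1 / 2) / (z * (z + 1))).
  assert (Dd : forall z, 0 < z -> is_derive delta z (d1 z)).
  { intros w Hw. unfold delta, d1. auto_derive.
    - split; [lra|split; auto]. apply Rdiv_lt_0_compat; lra.
    - fold ((w + 1) / w). set (L := ln ((w + 1) / w)). field. lra. }
  assert (Dd1 : forall z, 0 < z -> is_derive d1 z (1 / 2 * (/ z ^ 2 - / (z + 1) ^ 2) - (/ z - / (z + 1)) + / (z + 1) ^ 2)).
  { intros w Hw. unfold d1. auto_derive.
    - repeat split; try lra. apply Rdiv_lt_0_compat; lra. nra.
    - fold ((w + 1) / w). field. lra. }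
  assert (Sh : forall (F F' : R -> R) z, is_derive F (z + 1) (F' (z + 1)) -> is_derive (fun z => F (z + 1)) z (F' (z + 1))).
  { intros F F' w H. eapply der_eq; [apply (der_comp (fun z => z + 1) F w 1); [auto_derive; auto; ring|exact H]|]. ring. }
  assert (E2 : forall z, 0 < z -> mu2 z - mu2 (z + 1) = 1 / 2 * (/ z ^ 2 - / (z + 1) ^ 2) - (/ z - / (z + 1)) + / (z + 1) ^ 2).
  { clear z. intros z Hz. assert (Ck := k_cont).
    assert (A := isI_minus (fun v => k v * v ^ 2 * exp (- (z * v))) (fun v => k v * v ^ 2 * exp (- ((z + 1) * v))) _ _
       ltac:(ct) ltac:(ct) (mu2_isI z Hz) (mu2_isI (z + 1) ltac:(lra))).
    assert (P : forall n w, 0 < w -> isI (fun v => v ^ n * exp (- (w * v))) (INR (fact n) / w ^ S n)) by (intros; now apply isI_powexp).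
    assert (B : isI (fun v => 1 / 2 * (v ^ 1 * exp (- (z * v)) - v ^ 1 * exp (- ((z + 1) * v)))
        - (v ^ 0 * exp (- (z * v)) - v ^ 0 * exp (- ((z + 1) * v))) + v ^ 1 * exp (- ((z + 1) * v)))
       (1 / 2 * (INR (fact 1) / z ^ 2 - INR (fact 1) / (z + 1) ^ 2) - (INR (fact 0) / z ^ 1 - INR (fact 0) / (z + 1) ^ 1) + INR (fact 1) / (z + 1) ^ 2)).
    { apply isI_plus; try ct; [|apply P; lra]. apply isI_minus; try ct.
      - apply isI_scal; [ct|]. apply isI_minus; try ct; apply P; lra.
      - apply isI_minus; try ct; apply P; lra. }
    replace (1 / 2 * (/ z ^ 2 - / (z + 1) ^ 2) - (/ z - / (z + 1)) + / (z + 1) ^ 2)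
      with (1 / 2 * (INR (fact 1) / z ^ 2 - INR (fact 1) / (z + 1) ^ 2) - (INR (fact 0) / z ^ 1 - INR (fact 0) / (z + 1) ^ 1) + INR (fact 1) / (z + 1) ^ 2)
      by (simpl; field; lra).
    apply (isI_unique _ _ _ A). refine (isI_ext _ _ _ _ B). intros v Hv.
    assert (K : k v * v ^ 2 = v * (1 / 2 + / (exp v - 1) - / v)) by (rewrite <- k_eq by auto; ring).
    rewrite K. replace (- ((z + 1) * v)) with (- (z * v) + - v) by ring. rewrite exp_plus, !exp_Ropp.
    assert (G := exp_gt1 v Hv). rewrite pow_1. simpl pow. field. repeat split; try (apply Rgt_not_eq, exp_pos); lra. }
  assert (E1 : forall z, 0 < z -> - mu1 z - - mu1 (z + 1) - d1 z = 0).
  { apply (zero_of_decay _ 2).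
    - intros w Hw. eapply der_eq.
      + apply (is_derive_minus (fun z => - mu1 z - - mu1 (z + 1)) d1); [|now apply Dd1].
        apply (is_derive_minus (fun z => - mu1 z) (fun z => - mu1 (z + 1))).
        * apply (is_derive_opp mu1). now apply mu1_der.
        * apply (is_derive_opp (fun z => mu1 (z + 1))). apply (Sh mu1 (fun z => - mu2 z)). apply mu1_der; lra.
      + unfold minus, plus, opp; simpl. assert (X := E2 w Hw). simpl in X. lra.
    - intros w Hw. destruct (mu1_isI w ltac:(lra)) as [_ B1]. destruct (mu1_isI (w + 1) ltac:(lra)) as [_ B2].
      assert (L := ln_ratio w ltac:(lra)).
      assert (Iw : 0 < / w) by (apply Rinv_0_lt_compat; lra).
      assert (Iw2 : / w ^ 2 <= / w) by (apply Rinv_le_contravar; nra).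
      assert (Iw3 : / (w + 1) ^ 2 <= / w) by (apply Rinv_le_contravar; nra).
      assert (Iw4 : 0 < / (w + 1)) by (apply Rinv_0_lt_compat; lra).
      assert (M : (w + 1 / 2) / (w * (w + 1)) = / 2 * (/ w + / (w + 1))) by (field; lra).
      assert (Rabs (d1 w) <= / w) by (unfold d1; rewrite M; apply Rabs_le; lra).
      unfold Rdiv in *. apply Rabs_le_between in B1. apply Rabs_le_between in B2. apply Rabs_le_between in H.
      apply Rabs_le. lra. }
  intros Hz. apply Rminus_diag_uniq. revert z Hz. apply (zero_of_decay _ 2).
  - intros w Hw. eapply der_eq.
    + apply (is_derive_minus (fun z => mu z - mu (z + 1)) delta); [|now apply Dd].
      apply (is_derive_minus mu (fun z => mu (z + 1))).
      * now apply mu_der.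
      * apply (Sh mu (fun z => - mu1 z)). apply mu_der; lra.
    + unfold minus, plus, opp; simpl. generalize (E1 w Hw). lra.
  - intros w Hw. assert (B1 := mu_small w ltac:(lra)). assert (B2 := mu_small (w + 1) ltac:(lra)).
    assert (L := ln_ratio w ltac:(lra)).
    assert (Iw : 0 < / w) by (apply Rinv_0_lt_compat; lra).
    assert (Iw4 : 0 < / (w + 1)) by (apply Rinv_0_lt_compat; lra).
    assert (Iw5 : / (w + 1) <= / w) by (apply Rinv_le_contravar; lra).
    assert (D1 : delta w <= / w).
    { unfold delta. assert ((w + 1 / 2) * ln ((w + 1) / w) <= (w + 1 / 2) * / w) by (apply Rmult_le_compat_l; lra).
      replace ((w + 1 / 2) * / w) with (1 + / 2 * / w) in H by (field; lra). lra. }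
    assert (D2 : - / w <= delta w).
    { unfold delta. assert ((w + 1 / 2) * / (w + 1) <= (w + 1 / 2) * ln ((w + 1) / w)) by (apply Rmult_le_compat_l; lra).
      replace ((w + 1 / 2) * / (w + 1)) with (1 - / 2 * / (w + 1)) in H by (field; lra). lra. }
    unfold Rdiv in *. apply Rabs_le. lra.
Qed.
(** * Inverse functions *)

Lemma strictly_increasing (f f' : R -> R) a b : a < b ->
  (forall x, a <= x <= b -> is_derive f x (f' x)) -> (forall x, a <= x <= b -> 0 < f' x) -> f a < f b.
Proof.
  intros Hab Df Pf.
  destruct (MVT_cor2 f f' a b Hab) as (c & E & Hc).
  { intros c Hc. apply is_derive_Reals, Df; auto. }
  specialize (Pf c ltac:(lra)). nra.
Qed.

(** Monotonicity of [f] confines [g y] to a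
    neighbourhood of [g y0] when [y] is near [y0]. *)
Lemma inverse_der (D Im : R -> Prop) (f f' g : R -> R) y0 :
  (forall x y z, D x -> D y -> x <= z <= y -> D z) -> openD D ->
  (forall x, D x -> is_derive f x (f' x)) -> (forall x, D x -> 0 < f' x) ->
  openD Im -> (forall y, Im y -> D (g y) /\ f (g y) = y) -> Im y0 ->
  is_derive g y0 (/ f' (g y0)).
Proof.
  intros HD OD Df Pf OI Hg Hy0.
  set (x0 := g y0). destruct (Hg y0 Hy0) as [Dx0 Ex0]. fold x0 in Dx0, Ex0.
  set (m := f' x0). assert (Hm : 0 < m) by now apply Pf.
  assert (Inc : forall x y, D x -> D y -> x < y -> f x < f y).
  { intros x y Dx Dy Hxy. apply (strictly_increasing f f'); auto; intros; [apply Df|apply Pf]; apply (HD x y); auto. }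
  apply is_derive_Reals. intros e He.
  set (eta := Rmin (m / 2) (e * m * (m / 2) / 2)).
  assert (Heta : 0 < eta).
  { apply Rmin_pos; [lra|]. repeat apply Rmult_lt_0_compat; lra. }
  assert (E1 : eta <= m / 2) by apply Rmin_l.
  assert (E2 : eta <= e * m * (m / 2) / 2) by apply Rmin_r.
  assert (Dd := Df x0 Dx0). apply is_derive_Reals in Dd. destruct (Dd eta Heta) as [d1 Hd1].
  destruct (OD x0 Dx0) as [d2 Hd2]. destruct (OI y0 Hy0) as [d3 Hd3].
  set (r := Rmin d1 d2 / 2).
  assert (Hr : 0 < r /\ r < d1 /\ r < d2).
  { generalize (Rmin_l d1 d2) (Rmin_r d1 d2) (Rmin_pos d1 d2 (cond_pos d1) (cond_pos d2)). unfold r. intros; lra. }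
  assert (Dn : forall x, Rabs (x - x0) <= r -> D x).
  { intros x Hx. apply Hd2. unfold ball; simpl; unfold AbsRing_ball, abs, minus, plus, opp; simpl.
    change (Rabs (x - x0) < d2). lra. }
  assert (DL : D (x0 - r)) by (apply Dn; rewrite Rabs_left; lra).
  assert (DR : D (x0 + r)) by (apply Dn; rewrite Rabs_right; lra).
  assert (I1 : f (x0 - r) < y0) by (rewrite <- Ex0; apply Inc; auto; lra).
  assert (I2 : y0 < f (x0 + r)) by (rewrite <- Ex0; apply Inc; auto; lra).
  assert (P : 0 < Rmin d3 (Rmin (y0 - f (x0 - r)) (f (x0 + r) - y0))).
  { apply Rmin_pos; [apply cond_pos|]. apply Rmin_pos; lra. }
  exists (mkposreal _ P). intros h Hh0 Hh. simpl in Hh.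
  assert (H3 : Rabs h < d3) by (eapply Rlt_le_trans; [exact Hh|apply Rmin_l]).
  assert (H4 : Rabs h < y0 - f (x0 - r)).
  { eapply Rlt_le_trans; [exact Hh|]. eapply Rle_trans; [apply Rmin_r|apply Rmin_l]. }
  assert (H5 : Rabs h < f (x0 + r) - y0).
  { eapply Rlt_le_trans; [exact Hh|]. eapply Rle_trans; [apply Rmin_r|apply Rmin_r]. }
  assert (Iy : Im (y0 + h)).
  { apply Hd3. unfold ball; simpl; unfold AbsRing_ball, abs, minus, plus, opp; simpl.
    replace (y0 + h + - y0) with h by ring. exact H3. }
  destruct (Hg _ Iy) as [Dx Ex]. set (x := g (y0 + h)) in *.
  apply Rabs_lt_between in H4. apply Rabs_lt_between in H5.
  assert (X1 : x0 - r < x).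
  { apply Rnot_le_lt. intros [H| H]; [apply Inc in H; auto; lra|rewrite H in Ex; lra]. }
  assert (X2 : x < x0 + r).
  { apply Rnot_le_lt. intros [H|H]; [apply Inc in H; auto; lra|rewrite <- H in Ex; lra]. }
  assert (Nx : x - x0 <> 0).
  { intros H. assert (x = x0) by lra. apply Hh0. rewrite H0, Ex0 in Ex. lra. }
  assert (Hx : Rabs (x - x0) < d1) by (apply Rabs_lt_between; lra).
  assert (Q := Hd1 (x - x0) Nx Hx). replace (x0 + (x - x0)) with x in Q by ring. rewrite Ex, Ex0 in Q.
  replace (y0 + h - y0) with h in Q by ring. fold m in Q.
  set (s := h / (x - x0)) in *.
  assert (Hs : m / 2 < s) by (apply Rabs_lt_between in Q; lra).
  change (Rabs ((x - x0) / h - / m) < e).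
  replace ((x - x0) / h - / m) with (- ((s - m) / (s * m))) by (unfold s; field; repeat split; auto; lra).
  rewrite Rabs_Ropp. unfold Rdiv. rewrite Rabs_mult, (Rabs_right (/ _)).
  2: { left; apply Rinv_0_lt_compat. apply Rmult_lt_0_compat; lra. }
  assert (Psm : 0 < s * m) by (apply Rmult_lt_0_compat; lra).
  apply Rmult_lt_reg_r with (s * m); auto. rewrite Rmult_assoc, Rinv_l, Rmult_1_r by lra.
  eapply Rlt_le_trans; [exact Q|].
  assert (e * m * (m / 2) <= e * m * s) by (apply Rmult_le_compat_l; [apply Rmult_le_pos|]; lra).
  assert (0 < e * m * (m / 2)) by (repeat apply Rmult_lt_0_compat; lra).
  lra.
Qed.

(** The inverse comes with its open domain [Im], so that it can be fed to Lagrange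
    inversion. *)
Theorem inverse_function (D : R -> Prop) (f f' : R -> R) :
  (forall x y z, D x -> D y -> x <= z <= y -> D z) -> openD D ->
  (forall x, D x -> is_derive f x (f' x)) -> (forall x, D x -> 0 < f' x) -> smooth D f' ->
  exists g Im, openD Im /\ (forall x y z, Im x -> Im y -> x <= z <= y -> Im z) /\
    (forall x, D x -> Im (f x) /\ g (f x) = x) /\
    (forall y, Im y -> D (g y) /\ f (g y) = y /\ is_derive g y (/ f' (g y))) /\ smooth Im g.
Proof.
  intros HD OD Df Pf Sf.
  set (Im := fun y => exists x, D x /\ f x = y).
  set (g := fun y => epsilon (inhabits 0) (fun x => D x /\ f x = y)).
  assert (Hg : forall y, Im y -> D (g y) /\ f (g y) = y) by (intros y Hy; apply epsilon_spec, Hy).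
  assert (Inc : forall x y, D x -> D y -> x < y -> f x < f y).
  { intros x y Dx Dy Hxy. apply (strictly_increasing f f'); auto; intros; [apply Df|apply Pf]; apply (HD x y); auto. }
  assert (IVT : forall a b y, D a -> D b -> a < b -> f a < y < f b -> Im y).
  { intros a b y Da b_dom Hab Hy.
    destruct (IVT_interv (fun x => f x - y) a b) as (z & Hz & Ez); [|auto|lra|lra|].
    - intros z Hz. apply continuity_pt_filterlim. apply (continuous_minus f (fun _ => y)); [|apply continuous_const].
      eapply der_cont, Df, (HD a b); auto.
    - exists z. split; [apply (HD a b); auto|lra]. }
  assert (OI : openD Im).
  { intros y (x0 & D0 & E0). destruct (OD x0 D0) as [d Hd]. assert (Pd := cond_pos d).
    assert (Dn : forall x, Rabs (x - x0) < d -> D x) by (intros x Hx; apply Hd; exact Hx).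
    assert (DL : D (x0 - d / 2)) by (apply Dn; rewrite Rabs_left; lra).
    assert (DR : D (x0 + d / 2)) by (apply Dn; rewrite Rabs_right; lra).
    assert (I1 := Inc _ _ DL D0 ltac:(lra)). assert (I2 := Inc _ _ D0 DR ltac:(lra)). rewrite E0 in *.
    assert (P : 0 < Rmin (y - f (x0 - d / 2)) (f (x0 + d / 2) - y)) by (apply Rmin_pos; lra).
    exists (mkposreal _ P). intros w Hw. change (Rabs (w - y) < Rmin (y - f (x0 - d / 2)) (f (x0 + d / 2) - y)) in Hw.
    generalize (Rmin_l (y - f (x0 - d / 2)) (f (x0 + d / 2) - y)) (Rmin_r (y - f (x0 - d / 2)) (f (x0 + d / 2) - y)).
    intros m1 m2. apply Rabs_lt_between in Hw. apply (IVT (x0 - d / 2) (x0 + d / 2)); auto; lra. }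
  assert (Dg : forall y, Im y -> is_derive g y (/ f' (g y))).
  { intros y Hy. now apply (inverse_der D Im f f' g y). }
  exists g, Im. split; [auto|]. split; [|split; [|split]].
  - intros x y z (a & Da & <-) (b & b_dom & <-) Hz.
    destruct (Req_dec (f a) z) as [<-|N1]; [exists a; auto|]. destruct (Req_dec (f b) z) as [<-|N2]; [exists b; auto|].
    apply (IVT a b); auto; [|lra]. destruct (Rtotal_order a b) as [H|[->|H]]; [auto|lra|].
    apply Inc in H; auto; lra.
  - intros x Dx. assert (Ix : Im (f x)) by (exists x; auto). split; auto.
    destruct (Hg _ Ix) as [D1 E1]. destruct (Rtotal_order (g (f x)) x) as [H|[H|H]]; auto; apply Inc in H; auto; lra.
  - intros y Hy. destruct (Hg y Hy). auto.
  - intros n. induction n as [|n IH].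
    + intros y Hy. eapply der_cont, Dg; auto.
    + exists (fun y => / f' (g y)). split; auto.
      apply (Cn_comp Im D n g (fun x => / f' x)); auto; [intros y Hy; now apply Hg|].
      apply Cn_inv; auto. intros x Dx. apply Rgt_not_eq, Pf; auto.
Qed.

(** * The saddle point parametrization *)

(** The function [(t^2 / (2 (exp t - t - 1)))^(1/2)]. *)
Definition saddle_psi (t : R) : R := Rpower (2 * E2 t) (- (1 / 2)).
(** The coordinate in which [exp t - t - 1] becomes [u^2 / 2]. *)
Definition saddle_coord (t : R) : R := t / saddle_psi t.

Lemma saddle_psi_pos t : 0 < saddle_psi t.
Proof. apply exp_pos. Qed.
Lemma E2x_pos t : 0 < 2 * E2 t.
Proof. generalize (E2_pos t); lra. Qed.
Lemma saddle_psi_sq t : saddle_psi t * saddle_psi t * (2 * E2 t) = 1.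
Proof.
  unfold saddle_psi. rewrite <- Rpower_plus. rewrite <- (Rpower_1 (2 * E2 t)) at 2 by apply E2x_pos.
  rewrite <- Rpower_plus. replace (- (1 / 2) + - (1 / 2) + 1) with 0 by field.
  apply Rpower_O, E2x_pos.
Qed.
Lemma E2_smooth : smooth full E2.
Proof. apply wexp_smooth, cont_weight2. Qed.
Lemma saddle_psi_smooth : smooth full saddle_psi.
Proof.
  intros n. apply Cn_Rpower; [apply Cn_mult; [apply Cn_const|apply E2_smooth]|]. intros; apply E2x_pos.
Qed.
Lemma saddle_coord_sq t : saddle_coord t ^ 2 = 2 * (exp t - t - 1).
Proof.
  unfold saddle_coord. rewrite <- E2_eq. assert (P := saddle_psi_pos t). assert (S := saddle_psi_sq t).
  replace ((t / saddle_psi t) ^ 2) with (t ^ 2 / (saddle_psi t * saddle_psi t) * (saddle_psi t * saddle_psi t * (2 * E2 t))) by (rewrite S; field; lra).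
  field. lra.
Qed.

Lemma E2_der_eq t : 2 * E2 t + t * Derive E2 t = E1 t.
Proof.
  assert (D2 : forall t, is_derive E2 t (Derive E2 t)).
  { intros u; apply (smooth_der full); auto using open_full, E2_smooth. exact Logic.I. }
  destruct (Req_dec t 0) as [->|Ht].
  - rewrite Rmult_0_l, Rplus_0_r. unfold E2, E1, wexp.
    rewrite (RI_ext (fun s => (1 - s) * exp (0 * s)) (fun s => 1 - s)) by (intros; rewrite Rmult_0_l, exp_0; ring).
    rewrite (RI_ext (fun s => 1 * exp (0 * s)) (fun _ => 1)) by (intros; rewrite Rmult_0_l, exp_0; ring).
    rewrite RI_const, (RI_ftc (fun s => s - s ^ 2 / 2)); [apply Rminus_diag_uniq; field| |ct].
    intros s; auto_derive; auto. field.
  - assert (A : is_derive (fun t => t ^ 2 * E2 t) t (2 * t * E2 t + t ^ 2 * Derive E2 t)).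
    { apply (der_mult (fun t => t ^ 2) E2); auto. auto_derive; auto; ring. }
    assert (B : is_derive (fun t => t ^ 2 * E2 t) t (exp t - 1)).
    { apply (is_derive_ext (fun t => exp t - t - 1)); [intros; now rewrite E2_eq|]. auto_derive; auto; ring. }
    assert (E : 2 * t * E2 t + t ^ 2 * Derive E2 t = exp t - 1).
    { rewrite <- (is_derive_unique _ _ _ A). apply (is_derive_unique _ _ _ B). }
    rewrite <- E1_eq in E. apply Rmult_eq_reg_l with t; auto. rewrite <- E. ring.
Qed.

Lemma saddle_coord_der t : is_derive saddle_coord t (E1 t * saddle_psi t).
Proof.
  assert (D2 : is_derive E2 t (Derive E2 t)).
  { apply (smooth_der full); auto using open_full, E2_smooth. exact Logic.I. }
  assert (P := E2x_pos t).
  assert (Dp : is_derive (fun t => Rpower (2 * E2 t) (1 / 2)) t (Rpower (2 * E2 t) (1 / 2) * (1 / 2 * (/ (2 * E2 t) * (2 * Derive E2 t))))).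
  { unfold Rpower. apply (der_comp (fun t => 1 / 2 * ln (2 * E2 t)) exp).
    - apply is_derive_scal. apply (der_comp (fun t => 2 * E2 t) ln); [now apply is_derive_scal|now apply is_derive_ln].
    - auto_derive; auto; ring. }
  assert (Ei : forall t, / saddle_psi t = Rpower (2 * E2 t) (1 / 2)).
  { intros u. unfold saddle_psi. rewrite Rpower_Ropp, Rinv_inv; auto. }
  apply (is_derive_ext (fun t => t * Rpower (2 * E2 t) (1 / 2))).
  { intros u. unfold saddle_coord, Rdiv. now rewrite Ei. }
  eapply der_eq; [apply (der_mult (fun t => t) _ t _ _ (der_id t) Dp)|].
  rewrite <- Ei, <- E2_der_eq. assert (Q := saddle_psi_pos t). assert (S := saddle_psi_sq t).
  assert (HE : 2 * E2 t = / (saddle_psi t * saddle_psi t)).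
  { apply Rmult_eq_reg_l with (saddle_psi t * saddle_psi t); [rewrite S; field|]; nra. }
  rewrite HE. cbv beta. field. lra.
Qed.

Lemma E2_ge t : 0 <= t -> 1 / 2 <= E2 t.
Proof.
  intros Ht. replace (1 / 2) with (RInt (fun s => 1 - s) 0 1).
  - apply RI_le; [ct|apply (wexp_cont (fun s => 1 - s)), cont_weight2|lra|]. intros s Hs.
    assert (1 <= exp (t * s)) by (rewrite <- exp_0; apply exp_le; nra). nra.
  - rewrite (RI_ftc (fun s => s - s ^ 2 / 2)); [apply Rminus_diag_uniq; field| |ct]. intros s; auto_derive; auto. field.
Qed.

Lemma saddle_coord_cont : cont saddle_coord.
Proof. intros t; eapply der_cont, saddle_coord_der. Qed.
Lemma saddle_coord_sign t : 0 <= t * saddle_coord t.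
Proof. unfold saddle_coord. replace (t * (t / saddle_psi t)) with (t ^ 2 / saddle_psi t) by (field; apply Rgt_not_eq, saddle_psi_pos).
  apply Rdiv_le_0_compat; [apply pow2_ge_0|apply saddle_psi_pos]. Qed.

Lemma saddle_coord_surj y : exists t, saddle_coord t = y.
Proof.
  assert (C : continuity saddle_coord) by (intros t; apply continuity_pt_filterlim, saddle_coord_cont).
  assert (U0 : saddle_coord 0 = 0) by (unfold saddle_coord, Rdiv; ring).
  assert (H : exists a, (0 <= y -> y <= saddle_coord a) /\ (y <= 0 -> saddle_coord a <= y)).
  { destruct (Rle_lt_dec 0 y) as [Hy|Hy].
    - exists y. split; [|intros Hy'; assert (y = 0) by lra; subst; lra]. intros _.
      destruct Hy as [Hy|<-]; [|lra].
      assert (S := saddle_coord_sq y). assert (G := saddle_coord_sign y). rewrite <- E2_eq in S. assert (E := E2_ge y ltac:(lra)).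
      assert (P : 0 <= saddle_coord y) by (apply Rnot_lt_le; intros H; nra).
      apply Rnot_lt_le; intros Hlt. assert (saddle_coord y ^ 2 < y ^ 2) by nra. assert (0 < y ^ 2) by nra. nra.
    - set (a := - (y ^ 2 / 2 + 1)). exists a. split; [lra|]. intros _.
      assert (S := saddle_coord_sq a). assert (G := saddle_coord_sign a). assert (X := exp_pos a).
      assert (Ha : a < 0) by (unfold a; nra).
      assert (y ^ 2 < saddle_coord a ^ 2) by (rewrite S; unfold a in *; lra).
      apply Rnot_lt_le; intros Hlt. assert (saddle_coord a <= 0) by nra. nra. }
  destruct H as (a & H1 & H2).
  destruct (IVT_gen saddle_coord 0 a y C) as (t & _ & Ht).
  - rewrite U0. destruct (Rle_lt_dec 0 y) as [Hy|Hy].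
    + rewrite Rmin_left, Rmax_right; [|specialize (H1 Hy)|specialize (H1 Hy)]; lra.
    + specialize (H2 ltac:(lra)). rewrite Rmin_right, Rmax_left; lra.
  - eauto.
Qed.

(** The inverse coordinate; it is defined on the whole line by surjectivity. *)
Definition saddle_inv (u : R) : R := epsilon (inhabits 0) (fun t => saddle_coord t = u).
Lemma saddle_inv_eq u : saddle_coord (saddle_inv u) = u.
Proof. unfold saddle_inv. apply epsilon_spec, saddle_coord_surj. Qed.
Lemma saddle_inv_saddle u : exp (saddle_inv u) - saddle_inv u - 1 = u ^ 2 / 2.
Proof. generalize (saddle_coord_sq (saddle_inv u)). rewrite saddle_inv_eq. lra. Qed.

Definition saddle_inv1 (u : R) : R := / (E1 (saddle_inv u) * saddle_psi (saddle_inv u)).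
Lemma saddle_inv_der u : is_derive saddle_inv u (saddle_inv1 u).
Proof.
  apply (inverse_der full full saddle_coord (fun t => E1 t * saddle_psi t) saddle_inv u).
  - intros; exact Logic.I.
  - apply open_full.
  - intros; apply saddle_coord_der.
  - intros; apply Rmult_lt_0_compat; [apply E1_pos|apply saddle_psi_pos].
  - apply open_full.
  - intros y _; split; [exact Logic.I|apply saddle_inv_eq].
  - exact Logic.I.
Qed.
Lemma saddle_inv_smooth : smooth full saddle_inv.
Proof.
  intros n. induction n as [|n IH].
  - intros u _. eapply der_cont, saddle_inv_der.
  - exists saddle_inv1. split; [intros u _; apply saddle_inv_der|].
    apply (Cn_comp full full n saddle_inv (fun t => / (E1 t * saddle_psi t))); auto.
    apply Cn_inv.
    + apply Cn_mult; [apply wexp_smooth, cont_weight1|apply saddle_psi_smooth].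
    + intros t _. apply Rgt_not_eq, Rmult_lt_0_compat; [apply E1_pos|apply saddle_psi_pos].
Qed.
Lemma saddle_inv1_eq u : Derive saddle_inv u = saddle_inv1 u.
Proof. apply is_derive_unique, saddle_inv_der. Qed.

Lemma a_base_eq t : a_base t = / (2 * E2 t).
Proof.
  unfold a_base. destruct (Req_EM_T t 0) as [->|Ht].
  - assert (E := E2_der_eq 0). assert (F := E1_0).
    rewrite F in E. replace (2 * E2 0) with 1 by lra. field.
  - rewrite <- E2_eq. field. split; [apply Rgt_not_eq, E2_pos|auto].
Qed.

(** Lagrange inversion for [saddle_inv u = u * saddle_psi (saddle_inv u)]. *)
Lemma a_derivative n : Derive_n (fun t => Rpower (a_base t) ((INR n + 1) / 2)) n 0 = Derive_n saddle_inv (S n) 0.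
Proof.
  assert (L := lagrange_inversion full full saddle_psi saddle_inv open_full).
  assert (SD : starD full) by (intros x t _ _; exact Logic.I).
  specialize (L SD Logic.I open_full Logic.I saddle_psi_smooth).
  specialize (L (fun t _ => Rgt_not_eq _ _ (saddle_psi_pos t)) saddle_inv_smooth).
  assert (HT : forall u, full u -> full (saddle_inv u) /\ saddle_inv u = u * saddle_psi (saddle_inv u)).
  { intros u _. split; [exact Logic.I|]. rewrite <- (saddle_inv_eq u) at 2. unfold saddle_coord. field. apply Rgt_not_eq, saddle_psi_pos. }
  specialize (L HT n (fun _ => 1) (fun m => Cn_const full m 1)).
  rewrite Dn_shift. rewrite (Derive_n_ext (Derive saddle_inv) (fun u => 1 * Derive saddle_inv u)) by (intros; ring).
  rewrite L. apply Derive_n_ext. intros t. rewrite a_base_eq.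
  assert (P := E2x_pos t). rewrite Rmult_1_l, <- Rpower_pow by apply saddle_psi_pos.
  unfold saddle_psi. rewrite Rpower_mult.
  rewrite <- (Rpower_1 (2 * E2 t)) at 1 by auto. rewrite <- Rpower_Ropp, Rpower_mult.
  f_equal. rewrite plus_INR. simpl. field.
Qed.
(** * Gaussian moments *)

Definition gauss (x : R) : R := exp (- x ^ 2).
Lemma gauss_cont : cont gauss.
Proof. unfold gauss; ct. Qed.

(** The companion of the square of the Gaussian integral: it interpolates between [PI / 4]
    and [0]. *)
Definition gaussB (x : R) : R := RInt (fun t => exp (- (x ^ 2 * (1 + t ^ 2))) / (1 + t ^ 2)) 0 1.

Lemma one_sq_pos t : 0 < 1 + t ^ 2.
Proof. generalize (pow2_ge_0 t); lra. Qed.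
Lemma gaussB_cont x : cont (fun t => exp (- (x ^ 2 * (1 + t ^ 2))) / (1 + t ^ 2)).
Proof. apply cont_div; [ct|ct|]. intros t; apply Rgt_not_eq, one_sq_pos. Qed.

(** The derivatives of the two terms cancel, after scaling the inner integral. *)
Lemma gauss_const x : RInt gauss 0 x ^ 2 + gaussB x = PI / 4.
Proof.
  set (F := fun x => RInt gauss 0 x ^ 2 + gaussB x).
  assert (DF : forall x, is_derive F x 0).
  { intros y.
    assert (DA : is_derive (fun x => RInt gauss 0 x ^ 2) y (2 * RInt gauss 0 y * gauss y)).
    { eapply der_eq; [apply (is_derive_pow (fun x => RInt gauss 0 x) 2), (RI_derive gauss gauss_cont)|]. simpl; ring. }
    assert (DB : is_derive gaussB y (RInt (fun t => - 2 * y * exp (- (y ^ 2 * (1 + t ^ 2)))) 0 1)).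
    { apply (param_der (fun x t => exp (- (x ^ 2 * (1 + t ^ 2))) / (1 + t ^ 2)) (fun x t => - 2 * x * exp (- (x ^ 2 * (1 + t ^ 2))))).
      - intros s v. auto_derive; auto. assert (P := one_sq_pos v). simpl in P |- *. field. lra.
      - apply cont2_mult; [apply (cont2_fst (fun x => - 2 * x)); ct|].
        apply (cont2_comp (fun x => exp (- x)) (fun s v => s ^ 2 * (1 + v ^ 2))); [ct|].
        apply cont2_mult; [apply (cont2_fst (fun s => s ^ 2)); ct|apply (cont2_snd (fun v => 1 + v ^ 2)); ct].
      - intros s; apply gaussB_cont. }
    eapply der_eq; [apply (der_plus _ _ _ _ _ DA DB)|].
    assert (E : RInt (fun t => y * gauss (y * t)) 0 1 = RInt gauss 0 y :> R).
    { replace (RInt gauss 0 y) with (RInt gauss (y * 0) (y * 1)) by (f_equal; ring).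
      apply (RI_subst gauss (fun t => y * t) (fun _ => y)); [apply gauss_cont|ct|]. intros t; auto_derive; auto; ring. }
    rewrite (RI_ext (fun t => - 2 * y * exp (- (y ^ 2 * (1 + t ^ 2)))) (fun t => (- 2 * gauss y) * (y * gauss (y * t)))).
    - assert (Cg := gauss_cont). rewrite (RI_scal (fun t => y * gauss (y * t)) ltac:(ct)), E. ring.
    - intros t. unfold gauss. replace (- (y ^ 2 * (1 + t ^ 2))) with (- y ^ 2 + - (y * t) ^ 2) by ring.
      rewrite exp_plus. ring. }
  assert (E : F x = F 0).
  { destruct (MVT_gen F 0 x (fun _ => 0)) as (c & _ & E).
    - intros; apply DF.
    - intros; apply continuity_pt_filterlim. eapply der_cont, DF.
    - lra. }
  change (F x = PI / 4). rewrite E. unfold F. rewrite RInt_point. unfold gaussB.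
  rewrite (RI_ftc atan).
  - rewrite atan_1, atan_0. unfold zero; simpl. ring.
  - intros t. eapply der_eq; [apply is_derive_Reals, derivable_pt_lim_atan|].
    replace (- (0 ^ 2 * (1 + t ^ 2))) with 0 by ring. rewrite exp_0. unfold Rsqr. field.
    generalize (one_sq_pos t); lra.
  - apply gaussB_cont.
Qed.

Lemma sqrtPI_pos : 0 < sqrt PI.
Proof. apply sqrt_lt_R0, PI_RGT_0. Qed.

Lemma gauss_isI : isI gauss (sqrt PI / 2).
Proof.
  apply isI_eps. intros e He. assert (S := sqrtPI_pos).
  set (B := / (e * (sqrt PI / 2))).
  assert (HB : 0 < B) by (apply Rinv_0_lt_compat, Rmult_lt_0_compat; lra).
  exists (Rmax B 1). split; [generalize (Rmax_r B 1); lra|]. intros b Hb.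
  assert (Hb1 : 1 <= b) by (generalize (Rmax_r B 1); lra).
  assert (HbB : B <= b) by (generalize (Rmax_l B 1); lra).
  assert (G := gauss_const b).
  assert (P : 0 <= gaussB b).
  { apply RI_pos; [apply gaussB_cont|lra|]. intros t _. apply Rdiv_le_0_compat; [left; apply exp_pos|apply one_sq_pos]. }
  assert (Q : gaussB b < / b).
  { apply Rle_lt_trans with (RInt (fun _ => exp (- b ^ 2)) 0 1).
    - apply RI_le; [apply gaussB_cont|ct|lra|]. intros t _. assert (O := one_sq_pos t).
      apply Rle_trans with (exp (- b ^ 2) / (1 + t ^ 2)).
      + apply Rmult_le_compat_r; [left; apply Rinv_0_lt_compat; auto|]. apply exp_le.
        generalize (pow2_ge_0 b) (pow2_ge_0 t); intros. nra.
      + rewrite <- (Rmult_1_r (exp _)) at 2. apply Rmult_le_compat_l; [left; apply exp_pos|].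
        rewrite <- Rinv_1. apply Rinv_le_contravar; generalize (pow2_ge_0 t); lra.
    - rewrite RI_const, exp_Ropp, Rminus_0_r, Rmult_1_r. apply Rinv_lt_contravar.
      + apply Rmult_lt_0_compat; [lra|apply exp_pos].
      + generalize (exp_ineq1_le (b ^ 2)); nra. }
  assert (A : 0 <= RInt gauss 0 b).
  { apply RI_pos; [apply gauss_cont|lra|]. intros; left; apply exp_pos. }
  set (X := RInt gauss 0 b) in *.
  assert (SQ : (sqrt PI / 2) ^ 2 = PI / 4).
  { replace ((sqrt PI / 2) ^ 2) with (sqrt PI * sqrt PI / 4) by field. rewrite sqrt_sqrt; [auto|left; apply PI_RGT_0]. }
  set (s := sqrt PI / 2) in *. assert (Hs : 0 < s) by (unfold s; lra).
  assert (D : (s - X) * (s + X) = gaussB b) by (rewrite <- (Rplus_minus_l (X ^ 2) (gaussB b)), G, <- SQ; ring).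
  assert (I1 : / b <= e * s).
  { rewrite <- (Rinv_inv (e * s)). apply Rinv_le_contravar; auto. }
  apply Rabs_lt_between. split; [|nra].
  apply Rnot_le_lt; intros Hc. nra.
Qed.

Lemma isI_dilate f l c : cont f -> 0 < c -> isI f l -> isI (fun x => f (c * x)) (l / c).
Proof.
  intros Cf Hc H. apply isI_eps. intros e He.
  destruct (proj1 (isI_eps f l) H (e * c)) as (B & HB0 & HB); [now apply Rmult_lt_0_compat|].
  exists (B / c). split; [now apply Rdiv_le_0_compat|]. intros b Hb.
  assert (Hb' : B <= c * b).
  { apply Rmult_le_compat_l with (r := c) in Hb; [|lra]. replace (c * (B / c)) with B in Hb by (field; lra). auto. }
  assert (E : c * RInt (fun x => f (c * x)) 0 b = RInt f 0 (c * b) :> R).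
  { rewrite <- RI_scal by ct. replace (RInt f 0 (c * b)) with (RInt f (c * 0) (c * b)) by (f_equal; ring).
    apply (RI_subst f (fun x => c * x) (fun _ => c)); auto; [ct|]. intros x; auto_derive; auto; ring. }
  specialize (HB _ Hb'). rewrite <- E in HB.
  replace (c * RInt (fun x => f (c * x)) 0 b - l) with (c * (RInt (fun x => f (c * x)) 0 b - l / c)) in HB by (field; lra).
  rewrite Rabs_mult, (Rabs_right c) in HB by lra. nra.
Qed.

(** [half_gamma k] is the value of the Gamma function at [k + 1/2]. *)
Fixpoint half_gamma (k : nat) : R := match k with O => sqrt PI | S j => (INR j + 1 / 2) * half_gamma j end.
Lemma half_gamma_pos k : 0 < half_gamma k.
Proof.
  induction k as [|k IH]; simpl; [apply sqrtPI_pos|]. apply Rmult_lt_0_compat; auto.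
  generalize (pos_INR k); lra.
Qed.

Lemma pow_gauss_limit n c : 0 < c -> filterlim (fun x => x ^ n * exp (- (c * x ^ 2))) (Rbar_locally p_infty) (locally 0).
Proof.
  intros Hc P [e HP]. assert (He := cond_pos e).
  set (D := INR (fact (S n)) / c ^ S n).
  assert (HD : 0 <= D) by (apply Rdiv_le_0_compat; [apply pos_INR|now apply pow_lt]).
  exists (1 + D / e). intros x Hx. apply HP.
  assert (0 <= D / e) by (apply Rdiv_le_0_compat; auto).
  change (Rabs (x ^ n * exp (- (c * x ^ 2)) + - 0) < e).
  assert (Hxn : 1 <= x ^ S n) by (apply pow_R1_Rle; lra).
  assert (Hn : 0 < x ^ n) by (apply pow_lt; lra).
  rewrite Ropp_0, Rplus_0_r, Rabs_right; [|apply Rle_ge, Rmult_le_pos; [lra|left; apply exp_pos]].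
  assert (X := exp_pos (c * x ^ 2)).
  assert (L := pow_le_exp (S n) (c * x ^ 2) ltac:(apply Rmult_le_pos; [lra|apply pow2_ge_0])).
  rewrite exp_Ropp. apply Rmult_lt_reg_r with (exp (c * x ^ 2)); auto.
  rewrite Rmult_assoc, Rinv_l, Rmult_1_r by lra.
  rewrite Rpow_mult_distr in L. replace ((x ^ 2) ^ S n) with (x ^ S n * x ^ S n) in L by (rewrite <- !pow_mult, <- pow_add; f_equal; lia).
  assert (L2 : x ^ S n * x ^ S n <= D * exp (c * x ^ 2)).
  { unfold D. apply Rmult_le_reg_l with (c ^ S n); [now apply pow_lt|].
    replace (c ^ S n * (INR (fact (S n)) / c ^ S n * exp (c * x ^ 2))) with (INR (fact (S n)) * exp (c * x ^ 2)); [auto|].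
    field. apply pow_nonzero; lra. }
  assert (De : D < e * x).
  { replace D with (e * (D / e)) by (field; lra). apply Rmult_lt_compat_l; lra. }
  assert (L3 : x * x ^ n <= D * exp (c * x ^ 2)) by (change (x ^ S n <= D * exp (c * x ^ 2)); nra).
  apply Rmult_lt_reg_l with x; [lra|]. eapply Rle_lt_trans; [exact L3|].
  replace (x * (e * exp (c * x ^ 2))) with (e * x * exp (c * x ^ 2)) by ring.
  apply Rmult_lt_compat_r; auto.
Qed.

(** Integration by parts raises [k]. *)
Theorem gauss_moment k c : 0 < c ->
  isI (fun x => x ^ (2 * k) * exp (- (c * x ^ 2))) (half_gamma k / (2 * c ^ k * sqrt c)).
Proof.
  intros Hc. assert (Hs : 0 < sqrt c) by now apply sqrt_lt_R0.
  induction k as [|k IH].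
  - simpl half_gamma. replace (sqrt PI / (2 * c ^ 0 * sqrt c)) with (sqrt PI / 2 / sqrt c) by (simpl; field; lra).
    refine (isI_ext _ _ _ _ (isI_dilate gauss _ (sqrt c) gauss_cont Hs gauss_isI)).
    intros x _. unfold gauss. rewrite Rpow_mult_distr. replace (sqrt c ^ 2) with c by (simpl; rewrite Rmult_1_r, sqrt_sqrt; lra).
    simpl; ring.
  - assert (Hk : 0 < c ^ k) by now apply pow_lt.
    set (f := fun x => INR (2 * k + 1) * (x ^ (2 * k) * exp (- (c * x ^ 2))) - 2 * c * (x ^ (2 * S k) * exp (- (c * x ^ 2)))).
    assert (D : isI f (0 - 0 ^ (2 * k + 1) * exp (- (c * 0 ^ 2)))).
    { apply (isI_antider (fun x => x ^ (2 * k + 1) * exp (- (c * x ^ 2)))); [|unfold f; ct|now apply pow_gauss_limit].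
      intros x. assert (D1 : is_derive (fun x => x ^ (2 * k + 1)) x (INR (2 * k + 1) * x ^ (2 * k))).
      { eapply der_eq; [apply is_derive_pow, der_id|]. replace (Init.Nat.pred (2 * k + 1)) with (2 * k)%nat by lia. ring. }
      assert (D2 : is_derive (fun x => exp (- (c * x ^ 2))) x (- (2 * c * x) * exp (- (c * x ^ 2)))) by (auto_derive; auto; simpl; ring).
      eapply der_eq; [apply (der_mult _ _ _ _ _ D1 D2)|]. unfold f.
      replace (2 * S k)%nat with (S (S (2 * k))) by lia. replace (2 * k + 1)%nat with (S (2 * k)) by lia. simpl pow. ring. }
    replace (0 - 0 ^ (2 * k + 1) * exp (- (c * 0 ^ 2))) with 0 in D by (rewrite (pow_i (2 * k + 1)) by lia; ring).
    assert (C1 : cont (fun x => INR (2 * k + 1) * (x ^ (2 * k) * exp (- (c * x ^ 2))))) by ct.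
    assert (C2 : cont f) by (unfold f; ct).
    assert (C3 : cont (fun x => x ^ (2 * k) * exp (- (c * x ^ 2)))) by ct.
    assert (R := isI_scal (/ (2 * c)) _ _ ltac:(exact (cont_minus _ _ C1 C2)) (isI_minus _ _ _ _ C1 C2 (isI_scal (INR (2 * k + 1)) _ _ C3 IH) D)).
    assert (E : half_gamma (S k) / (2 * c ^ S k * sqrt c) = / (2 * c) * (INR (2 * k + 1) * (half_gamma k / (2 * c ^ k * sqrt c)) - 0)).
    { simpl half_gamma. rewrite plus_INR, mult_INR. simpl pow. simpl INR. field. repeat split; lra. }
    rewrite E. refine (isI_ext _ _ _ _ R). intros x _. cbv beta. unfold f. field. lra.
Qed.
(** * Integrals over the whole line *)

(** The two half lines are integrated separately. *)
Definition isW (f : R -> R) (l : R) : Prop :=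
  exists l1 l2, isI f l1 /\ isI (fun x => f (- x)) l2 /\ l = l1 + l2.

Lemma isW_unique f l m : isW f l -> isW f m -> l = m.
Proof.
  intros (a & b & Ha & Hb & ->) (c & d & Hc & Hd & ->).
  now rewrite (isI_unique _ _ _ Ha Hc), (isI_unique _ _ _ Hb Hd).
Qed.
Lemma isW_ext f g l : (forall x, f x = g x) -> isW f l -> isW g l.
Proof.
  intros H (a & b & Ha & Hb & ->). exists a, b. repeat split.
  - refine (isI_ext _ _ _ _ Ha); intros; apply H.
  - refine (isI_ext _ _ _ _ Hb); intros; apply H.
Qed.
Lemma isW_scal c f l : cont f -> isW f l -> isW (fun x => c * f x) (c * l).
Proof.
  intros Cf (a & b & Ha & Hb & ->). exists (c * a), (c * b). repeat split.
  - now apply isI_scal.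
  - apply (isI_scal c (fun x => f (- x))); [ct|auto].
  - ring.
Qed.
Lemma isW_window f l e : cont f -> isW f l -> 0 < e ->
  exists A, 0 <= A /\ forall a b, a <= - A -> A <= b -> Rabs (RInt f a b - l) < e.
Proof.
  intros Cf (l1 & l2 & H1 & H2 & ->) He.
  destruct (proj1 (isI_eps _ _) H1 (e / 2) ltac:(lra)) as (A & HA0 & HA).
  destruct (proj1 (isI_eps _ _) H2 (e / 2) ltac:(lra)) as (B & HB0 & HB).
  exists (Rmax A B). split; [generalize (Rmax_l A B); lra|]. intros a b Ha Hb.
  generalize (Rmax_l A B) (Rmax_r A B); intros m1 m2.
  specialize (HA b ltac:(lra)). specialize (HB (- a) ltac:(lra)).
  rewrite RI_neg in HB by auto. rewrite Ropp_involutive, Ropp_0 in HB.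
  rewrite <- (RI_chasles f Cf a 0 b).
  replace (RInt f a 0 + RInt f 0 b - (l1 + l2)) with ((RInt f a 0 - l2) + (RInt f 0 b - l1)) by ring.
  eapply Rle_lt_trans; [apply Rabs_triang|]. lra.
Qed.

Lemma isI_subst f l g dg : cont f -> cont dg -> (forall x, is_derive g x (dg x)) -> g 0 = 0 ->
  filterlim g (Rbar_locally p_infty) (Rbar_locally p_infty) ->
  isI f l -> isI (fun x => dg x * f (g x)) l.
Proof.
  intros Cf Cd Hg G0 Lg H.
  apply filterlim_ext with (fun b => RInt f 0 (g b)).
  - intros b. rewrite (RI_subst f g dg 0 b) by auto. now rewrite G0.
  - apply (filterlim_comp _ _ _ g (fun y => RInt f 0 y) _ _ _ Lg H).
Qed.
Lemma isI_translate f l c : cont f -> isI f l -> isI (fun x => f (x + c)) (l - RInt f 0 c).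
Proof.
  intros Cf H.
  apply filterlim_ext with (fun b => minus (RInt f 0 (b + c)) (RInt f 0 c)).
  - intros b. rewrite RI_shift by auto. rewrite Rplus_0_l, <- (RI_chasles f Cf 0 c (b + c)).
    unfold minus, plus, opp; simpl. rring.
  - unfold minus. eapply filterlim_comp_2; [|apply filterlim_const|apply (filterlim_plus l (opp (RInt f 0 c)))].
    apply (filterlim_comp _ _ _ (fun b => b + c) (fun y => RInt f 0 y) _ (Rbar_locally p_infty) _); auto.
    intros P [M HM]. exists (M - c). intros x Hx. apply HM. lra.
Qed.
Lemma isW_translate f l c : cont f -> isW f l -> isW (fun x => f (x + c)) l.
Proof.
  intros Cf (l1 & l2 & H1 & H2 & ->).
  exists (l1 - RInt f 0 c), (l2 - RInt (fun x => f (- x)) 0 (- c)). repeat split.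
  - now apply isI_translate.
  - refine (isI_ext _ _ _ _ (isI_translate (fun x => f (- x)) l2 (- c) ltac:(ct) H2)).
    intros x _. cbv beta. f_equal. ring.
  - rewrite RI_neg, Ropp_involutive, Ropp_0 by auto. rewrite (RI_swap f Cf 0 c). rring.
Qed.
(** The fundamental theorem of calculus for a primitive that vanishes at both ends. *)
Lemma isW_antider F f : (forall x, is_derive F x (f x)) -> cont f ->
  filterlim F (Rbar_locally p_infty) (locally 0) ->
  filterlim (fun x => F (- x)) (Rbar_locally p_infty) (locally 0) -> isW f 0.
Proof.
  intros HF Cf L1 L2.
  exists (0 - F 0), (- 0 - - F (- 0)). repeat split.
  - now apply isI_antider.
  - apply (isI_antider (fun x => - F (- x)) (fun x => f (- x))); [|ct|].
    + intros x. eapply der_eq; [apply (is_derive_opp (fun x => F (- x)))|].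
      * apply (der_comp (fun x => - x) F x (-1)); [auto_derive; auto|apply HF].
      * unfold opp; simpl. ring.
    + change (- 0) with (opp 0). apply (filterlim_comp _ _ _ _ opp _ _ _ L2). apply (filterlim_opp 0).
  - rewrite Ropp_0. ring.
Qed.

Lemma isI_sum (f : nat -> R -> R) l n : (forall i, cont (f i)) -> (forall i, isI (f i) (l i)) ->
  isI (fun x => sum_f_R0 (fun i => f i x) n) (sum_f_R0 l n).
Proof.
  intros Cf H. induction n as [|n IH]; simpl; auto.
  apply isI_plus; auto. clear IH. induction n as [|n IH]; simpl; auto. apply cont_plus; auto.
Qed.
Lemma cont_sum (f : nat -> R -> R) n : (forall i, cont (f i)) -> cont (fun x => sum_f_R0 (fun i => f i x) n).
Proof. intros Cf. induction n as [|n IH]; simpl; auto. now apply cont_plus. Qed.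

(** * The integral of [exp (- z (exp t - t - 1))] *)

Definition pz (z t : R) : R := exp (- (z * (exp t - t - 1))).
Lemma pz_cont z : cont (pz z).
Proof. unfold pz; ct. Qed.
Lemma pz_decay z s : 0 < z -> s = 1 \/ s = -1 -> expdec (fun t => pz z (s * t)) (exp z) z.
Proof.
  intros Hz Hs t Ht. unfold pz. rewrite Rabs_right by (left; apply exp_pos). rewrite <- exp_plus. apply exp_le.
  assert (t <= exp (s * t) - s * t); [|nra].
  destruct Hs as [-> | ->].
  - rewrite !Rmult_1_l. replace t with (t - 1 + 1) at 2 by ring. rewrite exp_plus.
    generalize (exp_ineq1_le 1) (exp_ineq1_le (t - 1)); nra.
  - generalize (exp_pos (-1 * t)); lra.
Qed.
Definition Hs (z : R) : R := I (pz z) + I (fun t => pz z (- t)).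
Lemma Hs_halves z : 0 < z -> isI (pz z) (I (pz z)) /\ isI (fun t => pz z (- t)) (I (fun t => pz z (- t))).
Proof.
  intros Hz. assert (C := pz_cont z). split.
  - destruct (isI_expdec (fun t => pz z (1 * t)) (exp z) z ltac:(ct) Hz (pz_decay z 1 Hz ltac:(auto))) as (l & Hl & _).
    apply I_spec with l. refine (isI_ext _ _ _ _ Hl). intros; now rewrite Rmult_1_l.
  - destruct (isI_expdec (fun t => pz z (-1 * t)) (exp z) z ltac:(ct) Hz (pz_decay z (-1) Hz ltac:(auto))) as (l & Hl & _).
    apply I_spec with l. refine (isI_ext _ _ _ _ Hl). intros; f_equal; ring.
Qed.
Lemma Hs_isW z : 0 < z -> isW (pz z) (Hs z).
Proof. intros Hz. destruct (Hs_halves z Hz). unfold Hs. eexists; eexists; eauto. Qed.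

(** Euler's integrand after the substitution [t = exp s]. *)
Definition gz (z t : R) : R := exp (z * t - exp t).
Lemma gz_cont z : cont (gz z).
Proof. unfold gz; ct. Qed.
(** The substitution [t = s + ln z] turns Euler's integral into [pz]. *)
Lemma gz_isW z : 0 < z -> isW (gz z) (exp (z * ln z - z) * Hs z).
Proof.
  intros Hz. assert (C := pz_cont z).
  assert (C1 : cont (fun t => exp (z * ln z - z) * pz z t)) by ct.
  assert (H := isW_translate _ _ (- ln z) C1 (isW_scal (exp (z * ln z - z)) _ _ C (Hs_isW z Hz))).
  refine (isW_ext _ _ _ _ H). intros t. unfold pz, gz. rewrite <- exp_plus. f_equal.
  rewrite exp_plus, exp_Ropp, exp_ln by auto. field. lra.
Qed.

Lemma squeeze0 (f g : R -> R) : (forall x, 0 < x -> 0 <= f x <= g x) ->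
  filterlim g (Rbar_locally p_infty) (locally 0) -> filterlim f (Rbar_locally p_infty) (locally 0).
Proof.
  intros H L. apply (filterlim_le_le (fun _ => 0) f g 0).
  - exists 0. intros x Hx. now apply H.
  - apply filterlim_const.
  - exact L.
Qed.

(** Integration by parts in [gz]. *)
Lemma gz_recurrence z : 0 < z ->
  exp ((z + 1) * ln (z + 1) - (z + 1)) * Hs (z + 1) = z * (exp (z * ln z - z) * Hs z).
Proof.
  intros Hz. assert (C := gz_cont z). assert (C1 := gz_cont (z + 1)).
  apply (isW_unique (gz (z + 1))); [apply gz_isW; lra|].
  assert (Hd : isW (fun t => z * gz z t - gz (z + 1) t) 0).
  { apply (isW_antider (gz z)).
    - intros t. unfold gz. auto_derive; auto. simpl. replace ((z + 1) * t - exp t) with (t + (z * t - exp t)) by ring.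
      rewrite (exp_plus t). change (exp (z * t + - exp t)) with (exp (z * t - exp t)). ring.
    - ct.
    - apply (squeeze0 _ (fun t => exp ((z + 1) ^ 2) * exp (- (1 * t)))).
      + intros t Ht. split; [left; apply exp_pos|]. unfold gz. rewrite <- exp_plus. apply exp_le.
        assert (P := pow_le_exp 2 t ltac:(lra)). simpl fact in P. replace (INR 2) with 2 in P by (simpl; ring).
        assert (0 <= (t - (z + 1)) ^ 2) by apply pow2_ge_0.
        nra.
      + replace 0 with (scal (exp ((z + 1) ^ 2)) 0) by (unfold scal; simpl; unfold mult; simpl; ring).
        apply (filterlim_comp _ _ _ _ (fun y => scal (exp ((z + 1) ^ 2)) y) _ (locally 0)); [apply lim_exp_decay; lra|].
        apply (filterlim_scal_r (exp ((z + 1) ^ 2)) 0).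
    - apply (squeeze0 _ (fun t => exp (- (z * t)))); [|now apply lim_exp_decay].
      intros t Ht. split; [left; apply exp_pos|]. unfold gz. apply exp_le. generalize (exp_pos (- t)); lra. }
  destruct (gz_isW z Hz) as (a & b & Ha & Hb & E). destruct Hd as (c & d & Hc & Hd & E0).
  exists (z * a - c), (z * b - d). repeat split.
  - refine (isI_ext _ _ _ _ (isI_minus _ _ _ _ _ _ (isI_scal z _ _ C Ha) Hc)); [intros; simpl; ring|ct|ct].
  - refine (isI_ext _ _ _ _ (isI_minus _ _ _ _ _ _ (isI_scal z (fun x => gz z (- x)) _ _ Hb) Hd)); [intros; simpl; ring|ct|ct|ct].
  - rewrite E. lra.
Qed.
(** * The expansion of the integral at its saddle point *)

Lemma saddle_coord_incr s t : s < t -> saddle_coord s < saddle_coord t.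
Proof.
  intros H. apply (strictly_increasing saddle_coord (fun t => E1 t * saddle_psi t)); auto.
  - intros; apply saddle_coord_der.
  - intros; apply Rmult_lt_0_compat; [apply E1_pos|apply saddle_psi_pos].
Qed.
Lemma saddle_inv_0 : saddle_inv 0 = 0.
Proof.
  assert (E := saddle_inv_eq 0). destruct (Rtotal_order (saddle_inv 0) 0) as [H|[H|H]]; auto; apply saddle_coord_incr in H;
  rewrite E in H; unfold saddle_coord, Rdiv in H; lra.
Qed.
Lemma saddle_inv1_pos u : 0 < saddle_inv1 u.
Proof. apply Rinv_0_lt_compat, Rmult_lt_0_compat; [apply E1_pos|apply saddle_psi_pos]. Qed.
Lemma saddle_inv1_smooth : smooth full saddle_inv1.
Proof.
  intros n. apply (Cn_ext full n (Derive saddle_inv)); [apply open_full|intros; apply saddle_inv1_eq|].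
  apply smooth_Derive; [apply open_full|apply saddle_inv_smooth].
Qed.
Lemma saddle_inv1_cont : cont saddle_inv1.
Proof. apply smooth_full_cont, saddle_inv1_smooth. Qed.
Lemma saddle_inv1_0 : saddle_inv1 0 = 1.
Proof.
  unfold saddle_inv1. rewrite saddle_inv_0. assert (E := E2_der_eq 0). assert (P := saddle_psi_sq 0).
  assert (F := E1_0).
  rewrite F in *. assert (Q := saddle_psi_pos 0). replace (2 * E2 0) with 1 in P by lra.
  assert (saddle_psi 0 = 1) by nra. rewrite H. field.
Qed.

Lemma saddle_inv_lim : filterlim saddle_inv (Rbar_locally p_infty) (Rbar_locally p_infty).
Proof.
  intros P [M HM]. exists (saddle_coord M). intros u Hu. apply HM. apply Rnot_le_lt. intros [H|H].
  - apply saddle_coord_incr in H. rewrite saddle_inv_eq in H. lra.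
  - assert (E := saddle_inv_eq u). rewrite H in E. lra.
Qed.
Lemma saddle_inv_lim_neg : filterlim (fun u => - saddle_inv (- u)) (Rbar_locally p_infty) (Rbar_locally p_infty).
Proof.
  intros P [M HM]. exists (- saddle_coord (- M)). intros u Hu. apply HM. apply Rnot_le_lt. intros H.
  assert (H' : - M <= saddle_inv (- u)) by lra. destruct H' as [H'|H'].
  - apply saddle_coord_incr in H'. rewrite saddle_inv_eq in H'. lra.
  - assert (E := saddle_inv_eq (- u)). rewrite <- H' in E. lra.
Qed.

(** The odd part of the derivative does not contribute to the integral over the line. *)
Definition saddle_even (u : R) : R := saddle_inv1 u + saddle_inv1 (- u).

Lemma Hs_gauss z : 0 < z -> isI (fun u => saddle_even u * exp (- (z / 2 * u ^ 2))) (Hs z).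
Proof.
  intros Hz. destruct (Hs_halves z Hz) as [H1 H2]. assert (C := pz_cont z). assert (C1 := saddle_inv1_cont).
  assert (Ct : cont saddle_inv) by (apply smooth_full_cont, saddle_inv_smooth).
  assert (Key : forall u, pz z (saddle_inv u) = exp (- (z / 2 * u ^ 2))).
  { intros u. unfold pz. f_equal. rewrite saddle_inv_saddle. field. }
  assert (Cn : cont (fun u => saddle_inv1 (- u))) by ct.
  assert (A1 := isI_subst (pz z) _ saddle_inv saddle_inv1 C C1 saddle_inv_der saddle_inv_0 saddle_inv_lim H1).
  assert (A2 : isI (fun u => saddle_inv1 (- u) * pz z (- - saddle_inv (- u))) (I (fun t => pz z (- t)))).
  { apply (isI_subst (fun t => pz z (- t)) _ (fun u => - saddle_inv (- u)) (fun u => saddle_inv1 (- u))); auto; [ct| | |apply saddle_inv_lim_neg].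
    - intros u. eapply der_eq; [apply (is_derive_opp (fun u => saddle_inv (- u)))|].
      + apply (der_comp (fun u => - u) saddle_inv u (-1)); [auto_derive; auto|apply saddle_inv_der].
      + unfold opp; simpl. ring.
    - rewrite Ropp_0, saddle_inv_0. apply Ropp_0. }
  refine (isI_ext _ _ _ _ (isI_plus _ _ _ _ _ _ A1 A2)); [|ct|ct].
  intros u _. cbv beta. rewrite Ropp_involutive, !Key. unfold saddle_even. replace ((- u) ^ 2) with (u ^ 2) by ring. cbv beta. ring.
Qed.

Lemma E1_ge t : 0 <= t -> 1 <= E1 t.
Proof.
  intros Ht. replace 1 with (RInt (fun _ => 1) 0 1) by (rewrite RI_const; rring).
  apply RI_le; [ct|apply (wexp_cont (fun _ => 1)), cont_weight1|lra|]. intros s Hs.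
  assert (1 <= exp (t * s)) by (rewrite <- exp_0; apply exp_le; nra). lra.
Qed.
Lemma E2_le_E1 t : E2 t <= E1 t.
Proof.
  apply RI_le; [apply (wexp_cont (fun s => 1 - s)), cont_weight2|apply (wexp_cont (fun _ => 1)), cont_weight1|lra|].
  intros s Hs. assert (X := exp_pos (t * s)). nra.
Qed.
Lemma E2_le_half t : t <= 0 -> E2 t <= 1 / 2.
Proof.
  intros Ht. replace (1 / 2) with (RInt (fun s => 1 - s) 0 1).
  - apply RI_le; [apply (wexp_cont (fun s => 1 - s)), cont_weight2|ct|lra|]. intros s Hs.
    assert (exp (t * s) <= 1) by (rewrite <- exp_0; apply exp_le; nra). nra.
  - rewrite (RI_ftc (fun s => s - s ^ 2 / 2)); [apply Rminus_diag_uniq; field| |ct]. intros s; auto_derive; auto. field.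
Qed.
Lemma saddle_inv1_sq u : saddle_inv1 u ^ 2 * E1 (saddle_inv u) ^ 2 = 2 * E2 (saddle_inv u).
Proof.
  assert (P := saddle_psi_pos (saddle_inv u)). assert (Q := E1_pos (saddle_inv u)). assert (S := saddle_psi_sq (saddle_inv u)).
  unfold saddle_inv1. set (x := saddle_psi (saddle_inv u)) in *. set (e := E1 (saddle_inv u)) in *.
  apply Rmult_eq_reg_l with (x * x); [|nra]. rewrite S. field. lra.
Qed.
(** Left of the saddle [saddle_inv1 u <= 1 - saddle_inv u], and [- saddle_inv u] is at most
    [1 + u^2 / 2] by [saddle_inv_saddle]; on the right the derivative is bounded. *)
Lemma saddle_inv1_growth u : saddle_inv1 u <= 2 + u ^ 2 / 2.
Proof.
  assert (S := saddle_inv1_sq u). assert (P := saddle_inv1_pos u). assert (Q := E1_pos (saddle_inv u)). assert (U := pow2_ge_0 u).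
  destruct (Rle_lt_dec 0 (saddle_inv u)) as [Ht|Ht].
  - assert (G := E1_ge _ Ht). assert (L := E2_le_E1 (saddle_inv u)).
    apply Rle_trans with 2; [|lra]. apply Rnot_lt_le. intros H.
    assert (4 < saddle_inv1 u ^ 2) by nra. assert (1 <= E1 (saddle_inv u) ^ 2) by nra.
    assert (4 * E1 (saddle_inv u) ^ 2 < saddle_inv1 u ^ 2 * E1 (saddle_inv u) ^ 2) by (apply Rmult_lt_compat_r; lra). nra.
  - assert (L := E2_le_half (saddle_inv u) ltac:(lra)). assert (Sa := saddle_inv_saddle u). assert (X := exp_pos (saddle_inv u)).
    assert (A : saddle_inv1 u * E1 (saddle_inv u) <= 1).
    { apply Rnot_lt_le. intros H. assert (1 < (saddle_inv1 u * E1 (saddle_inv u)) ^ 2) by nra. rewrite Rpow_mult_distr in H0. lra. }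
    assert (B : 1 <= (1 - saddle_inv u) * E1 (saddle_inv u)).
    { assert (E := E1_eq (saddle_inv u)). assert (Y := exp_ineq1_le (- saddle_inv u)). rewrite exp_Ropp in Y.
      assert (Y2 : exp (saddle_inv u) * (1 - saddle_inv u) <= 1).
      { apply Rmult_le_compat_l with (r := exp (saddle_inv u)) in Y; [|lra]. rewrite Rinv_r in Y by lra. lra. }
      apply Rmult_le_reg_l with (- saddle_inv u); [lra|].
      replace (- saddle_inv u * ((1 - saddle_inv u) * E1 (saddle_inv u))) with (- ((1 - saddle_inv u) * (saddle_inv u * E1 (saddle_inv u)))) by ring. rewrite E. lra. }
    assert (saddle_inv1 u <= 1 - saddle_inv u).
    { apply Rmult_le_reg_r with (E1 (saddle_inv u)); auto. lra. }
    lra.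
Qed.

Lemma saddle_even_smooth : smooth full saddle_even.
Proof.
  intros n. apply Cn_plus; [apply saddle_inv1_smooth|]. apply (Cn_comp full full); [now intros| |apply saddle_inv1_smooth].
  apply Cn_opp, Cn_id.
Qed.
Lemma locally_smooth f n x : smooth full f -> locally x (fun y => forall k, (k <= n)%nat -> ex_derive_n f k y).
Proof.
  intros H. exists (mkposreal 1 Rlt_0_1). intros y _ k _. apply (smooth_ex full); auto using open_full. exact Logic.I.
Qed.
Lemma saddle_even_Dn n : Derive_n saddle_even n 0 = (1 + (-1) ^ n) * Derive_n saddle_inv1 n 0.
Proof.
  unfold saddle_even. assert (S : smooth full (fun u => saddle_inv1 (- u))).
  { intros m. apply (Cn_comp full full); [now intros|apply Cn_opp, Cn_id|apply saddle_inv1_smooth]. }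
  rewrite Derive_n_plus by (apply locally_smooth; auto using saddle_inv1_smooth).
  rewrite Derive_n_comp_opp by (apply locally_smooth; auto using saddle_inv1_smooth).
  rewrite Ropp_0. ring.
Qed.

(** The coefficients of the even part of [saddle_inv1]. *)
Definition even_coef (k : nat) : R := 2 * Derive_n saddle_inv1 (2 * k) 0 / INR (fact (2 * k)).

Lemma saddle_even_taylor_sum n u :
  sum_f_R0 (fun m => (u - 0) ^ m / INR (fact m) * Derive_n saddle_even m 0) (2 * n + 1) = sum_f_R0 (fun k => even_coef k * u ^ (2 * k)) n.
Proof.
  induction n as [|n IH].
  - change (2 * 0 + 1)%nat with 1%nat. unfold sum_f_R0. rewrite !saddle_even_Dn. unfold even_coef. change (2 * 0)%nat with O.
    simpl pow. simpl fact. simpl INR. field.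
  - replace (2 * S n + 1)%nat with (S (S (2 * n + 1))) by lia. rewrite !tech5, IH.
    rewrite !saddle_even_Dn. replace (S (S (2 * n + 1))) with (S (2 * S n)) by lia. rewrite pow_1_odd.
    replace (S (2 * n + 1)) with (2 * S n)%nat by lia. rewrite pow_1_even. unfold even_coef.
    rewrite Rminus_0_r. field. split; apply INR_fact_neq_0.
Qed.

Lemma sum_pow_bound (f : nat -> R) n u : 1 <= u ->
  Rabs (sum_f_R0 (fun k => f k * u ^ (2 * k)) n) <= sum_f_R0 (fun k => Rabs (f k)) n * u ^ (2 * n).
Proof.
  intros Hu. eapply Rle_trans; [apply Rsum_abs|]. rewrite (Rmult_comm _ (u ^ (2 * n))), scal_sum.
  apply sum_Rle. intros k Hk. rewrite Rabs_mult. apply Rmult_le_compat_l; [apply Rabs_pos|].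
  rewrite Rabs_right by (apply Rle_ge, pow_le; lra). apply Rle_pow; auto. lia.
Qed.

(** Taylor's formula on the unit interval; beyond it every term is dominated by the first
    omitted power. *)
Lemma saddle_even_expansion n : exists C, forall u, 0 < u ->
  Rabs (saddle_even u - sum_f_R0 (fun k => even_coef k * u ^ (2 * k)) n) <= C * u ^ (2 * S n).
Proof.
  set (D := Derive_n saddle_even (2 * S n)).
  assert (CD : cont (fun u => Rabs (D u))).
  { apply cont_abs, smooth_full_cont, smooth_Dn; [apply open_full|apply saddle_even_smooth]. }
  destruct (continuity_ab_maj (fun u => Rabs (D u)) 0 1 ltac:(lra)) as (x & Hx & _).
  { intros c _. apply continuity_pt_filterlim, CD. }
  set (S0 := sum_f_R0 (fun k => Rabs (even_coef k)) n).
  exists (Rabs (D x) + (5 + S0)). intros u Hu.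
  assert (Pu : 0 < u ^ (2 * S n)) by now apply pow_lt.
  assert (S0p : 0 <= S0) by (apply cond_pos_sum; intros; apply Rabs_pos).
  assert (Dp := Rabs_pos (D x)).
  destruct (Rle_lt_dec u 1) as [H1|H1].
  - destruct (Taylor_Lagrange saddle_even (2 * n + 1) 0 u Hu) as (c & Hc & E).
    { intros; apply (smooth_ex full); auto using open_full, saddle_even_smooth. exact Logic.I. }
    rewrite E, saddle_even_taylor_sum. replace (S (2 * n + 1)) with (2 * S n)%nat by lia. fold D.
    match goal with |- Rabs ?a <= _ => replace a with (u ^ (2 * S n) / INR (fact (2 * S n)) * D c) by (rewrite Rminus_0_r; ring) end.
    assert (Df : Rabs (D c) <= Rabs (D x)) by (apply Hx; lra).
    rewrite Rabs_mult, Rabs_right.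
    2:{ apply Rle_ge, Rdiv_le_0_compat; [lra|apply fact_pos]. }
    assert (F : 1 <= INR (fact (2 * S n))) by (change 1 with (INR 1); apply le_INR, lt_O_fact).
    assert (u ^ (2 * S n) / INR (fact (2 * S n)) <= u ^ (2 * S n)).
    { rewrite <- (Rmult_1_r (u ^ (2 * S n))) at 2. apply Rmult_le_compat_l; [lra|]. rewrite <- Rinv_1. apply Rinv_le_contravar; lra. }
    assert (0 <= u ^ (2 * S n) / INR (fact (2 * S n))) by (apply Rdiv_le_0_compat; lra).
    assert (u ^ (2 * S n) / INR (fact (2 * S n)) * Rabs (D c) <= u ^ (2 * S n) * Rabs (D x)).
    { apply Rmult_le_compat; auto using Rabs_pos. }
    nra.
  - assert (B := sum_pow_bound even_coef n u ltac:(lra)). fold S0 in B.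
    assert (u ^ (2 * n) <= u ^ (2 * S n)) by (apply Rle_pow; [lra|lia]).
    assert (u ^ 2 <= u ^ (2 * S n)) by (apply Rle_pow; [lra|lia]).
    assert (G1 := saddle_inv1_growth u). assert (G2 := saddle_inv1_growth (- u)). replace ((- u) ^ 2) with (u ^ 2) in G2 by ring.
    assert (P1 := saddle_inv1_pos u). assert (P2 := saddle_inv1_pos (- u)).
    assert (Rabs (saddle_even u) <= 5 * u ^ (2 * S n)).
    { rewrite Rabs_right by (unfold saddle_even; lra). unfold saddle_even. assert (1 <= u ^ 2) by (apply pow_R1_Rle; lra). lra. }
    unfold Rminus. eapply Rle_trans; [apply Rabs_triang|]. rewrite Rabs_Ropp.
    assert (S0 * u ^ (2 * n) <= S0 * u ^ (2 * S n)) by (apply Rmult_le_compat_l; auto).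
    nra.
Qed.

(** [sqrt (z / (2 PI))]. *)
Definition sq2pi (z : R) : R := exp ((ln z - ln (2 * PI)) / 2).
Lemma twopi_pos : 0 < 2 * PI.
Proof. generalize PI_RGT_0; lra. Qed.
Lemma sq2pi_eq z : 0 < z -> sq2pi z = sqrt (z / 2) / sqrt PI.
Proof.
  intros Hz. assert (P := PI_RGT_0). rewrite <- sqrt_div by lra.
  apply Rsqr_inj; [left; apply exp_pos|apply sqrt_pos|].
  rewrite Rsqr_sqrt by (apply Rdiv_le_0_compat; lra).
  unfold Rsqr, sq2pi. rewrite <- exp_plus.
  replace ((ln z - ln (2 * PI)) / 2 + (ln z - ln (2 * PI)) / 2) with (ln z + - ln (2 * PI)) by field.
  rewrite exp_plus, exp_Ropp, !exp_ln by (try apply twopi_pos; auto). field. lra.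
Qed.
Lemma half_gamma_fact k : half_gamma k * (4 ^ k * INR (fact k)) = sqrt PI * INR (fact (2 * k)).
Proof.
  induction k as [|k IH]; [simpl; ring|]. simpl half_gamma. replace (2 * S k)%nat with (S (S (2 * k))) by lia.
  rewrite !fact_S, !S_INR, mult_INR. simpl pow. change (INR 2) with 2.
  replace ((INR k + 1 / 2) * half_gamma k * (4 * 4 ^ k * ((INR k + 1) * INR (fact k))))
    with ((INR k + 1 / 2) * 4 * (INR k + 1) * (half_gamma k * (4 ^ k * INR (fact k)))) by ring. rewrite IH. field.
Qed.

Definition saddle_coef (k : nat) : R := Derive_n saddle_inv (2 * k + 1) 0 / (2 ^ k * INR (fact k)).

Lemma even_coef_gamma k z : 0 < z -> sq2pi z * (even_coef k * (half_gamma k / (2 * (z / 2) ^ k * sqrt (z / 2)))) = saddle_coef k / z ^ k.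
Proof.
  intros Hz. rewrite sq2pi_eq by auto. assert (P := sqrtPI_pos).
  assert (Q : 0 < sqrt (z / 2)) by (apply sqrt_lt_R0; lra).
  assert (Zk : 0 < z ^ k) by now apply pow_lt. assert (Tk : 0 < 2 ^ k) by (apply pow_lt; lra).
  assert (F1 := fact_pos k). assert (F2 := fact_pos (2 * k)). assert (G := half_gamma_fact k).
  unfold even_coef, saddle_coef. replace (2 * k + 1)%nat with (S (2 * k)) by lia. rewrite Dn_shift.
  rewrite (Derive_n_ext (Derive saddle_inv) saddle_inv1) by apply saddle_inv1_eq.
  replace (4 ^ k) with (2 ^ k * 2 ^ k) in G by (rewrite <- Rpow_mult_distr; f_equal; ring).
  unfold Rdiv at 5. rewrite Rpow_mult_distr, pow_inv.
  replace (half_gamma k) with (sqrt PI * INR (fact (2 * k)) / (2 ^ k * 2 ^ k * INR (fact k))) by (rewrite <- G; field; lra).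
  field. repeat split; lra.
Qed.

(** Watson's lemma for the saddle point: the expansion of [saddle_even] is integrated against
    the Gaussian. *)
Theorem Hs_expansion n : exists C, forall z, 0 < z ->
  Rabs (sq2pi z * Hs z - sum_f_R0 (fun k => saddle_coef k / z ^ k) n) <= C / z ^ S n.
Proof.
  destruct (saddle_even_expansion n) as [C HC].
  set (c' := sqrt PI / sqrt PI * (half_gamma (S n) * 2 ^ S n / (2 * sqrt PI))).
  exists (C * c'). intros z Hz. assert (P := sqrtPI_pos).
  assert (Q : 0 < sqrt (z / 2)) by (apply sqrt_lt_R0; lra).
  assert (Ce : cont saddle_even) by apply smooth_full_cont, saddle_even_smooth.
  set (w := fun u => exp (- (z / 2 * u ^ 2))).
  assert (Cw : cont w) by (unfold w; ct).
  set (f := fun k u => even_coef k * (u ^ (2 * k) * w u)).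
  assert (Cf : forall k, cont (f k)) by (intros; unfold f; ct).
  set (l := fun k => even_coef k * (half_gamma k / (2 * (z / 2) ^ k * sqrt (z / 2)))).
  assert (Hf : forall k, isI (f k) (l k)).
  { intros k. apply isI_scal; [ct|]. apply gauss_moment; lra. }
  assert (HS := isI_sum f l n Cf Hf).
  assert (HD := isI_minus _ _ _ _ (cont_mult _ _ Ce Cw) (cont_sum f n Cf) (Hs_gauss z Hz) HS).
  set (m := C * (half_gamma (S n) / (2 * (z / 2) ^ S n * sqrt (z / 2)))).
  assert (HM : isI (fun u => C * (u ^ (2 * S n) * w u)) m).
  { apply isI_scal; [ct|]. apply gauss_moment; lra. }
  assert (B : Rabs (Hs z - sum_f_R0 l n) <= m).
  { destruct (isI_dom (fun u => saddle_even u * w u - sum_f_R0 (fun i => f i u) n) (fun u => C * (u ^ (2 * S n) * w u)) m) as (l' & Hl' & Bl'); auto.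
    - apply cont_minus; [ct|now apply cont_sum].
    - ct.
    - intros u Hu. replace (sum_f_R0 (fun i => f i u) n) with (w u * sum_f_R0 (fun k => even_coef k * u ^ (2 * k)) n).
      + replace (saddle_even u * w u - w u * sum_f_R0 (fun k => even_coef k * u ^ (2 * k)) n)
          with ((saddle_even u - sum_f_R0 (fun k => even_coef k * u ^ (2 * k)) n) * w u) by ring.
        rewrite Rabs_mult, (Rabs_right (w u)) by (left; apply exp_pos). rewrite <- Rmult_assoc.
        apply Rmult_le_compat_r; [left; apply exp_pos|auto].
      + rewrite scal_sum. apply sum_eq. intros; unfold f. ring.
    - now rewrite (isI_unique _ _ _ HD Hl'). }
  assert (Pz : 0 < sq2pi z) by apply exp_pos.
  replace (sum_f_R0 (fun k => saddle_coef k / z ^ k) n) with (sq2pi z * sum_f_R0 l n).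
  - rewrite <- Rmult_minus_distr_l, Rabs_mult, (Rabs_right (sq2pi z)) by lra.
    apply Rle_trans with (sq2pi z * m); [apply Rmult_le_compat_l; lra|]. right.
    unfold m, c'. rewrite sq2pi_eq by auto. unfold Rdiv at 4. rewrite Rpow_mult_distr, pow_inv.
    assert (0 < 2 ^ S n) by (apply pow_lt; lra). assert (0 < z ^ S n) by now apply pow_lt. field. repeat split; lra.
  - rewrite scal_sum. apply sum_eq. intros k _. unfold l. rewrite Rmult_comm. now apply even_coef_gamma.
Qed.
(** * Binet's formula *)

Lemma saddle_coef_0 : saddle_coef 0 = 1.
Proof.
  unfold saddle_coef. change (Derive_n saddle_inv (2 * 0 + 1) 0) with (Derive saddle_inv 0). rewrite saddle_inv1_eq, saddle_inv1_0. simpl. field.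
Qed.

(** The recurrences of both sides make their quotient periodic, and it tends to [1]. *)
Theorem binet z : 0 < z -> sq2pi z * Hs z = exp (mu z).
Proof.
  set (Q := fun z => sq2pi z * Hs z * exp (- mu z)).
  assert (Per : forall z, 0 < z -> Q (z + 1) = Q z).
  { intros w Hw. assert (R := gz_recurrence w Hw). assert (D := mu_shift w Hw). unfold delta in D.
    rewrite ln_div in D by lra.
    assert (R' : Hs (w + 1) = exp (ln w + w * ln w - w - ((w + 1) * ln (w + 1) - (w + 1))) * Hs w).
    { apply Rmult_eq_reg_l with (exp ((w + 1) * ln (w + 1) - (w + 1))); [|apply Rgt_not_eq, exp_pos].
      rewrite R, <- !Rmult_assoc. f_equal.
      rewrite <- (exp_ln w) at 1 by auto. rewrite <- !exp_plus. f_equal. ring. }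
    unfold Q, sq2pi. rewrite R'. set (H := Hs w).
    replace (exp ((ln (w + 1) - ln (2 * PI)) / 2) * (exp (ln w + w * ln w - w - ((w + 1) * ln (w + 1) - (w + 1))) * H) * exp (- mu (w + 1)))
      with (exp ((ln (w + 1) - ln (2 * PI)) / 2) * exp (ln w + w * ln w - w - ((w + 1) * ln (w + 1) - (w + 1))) * exp (- mu (w + 1)) * H) by ring.
    replace (exp ((ln w - ln (2 * PI)) / 2) * H * exp (- mu w)) with (exp ((ln w - ln (2 * PI)) / 2) * exp (- mu w) * H) by ring.
    rewrite <- !exp_plus. f_equal. f_equal. replace (mu (w + 1)) with (mu w - ((w + 1 / 2) * (ln (w + 1) - ln w) - 1)) by lra. field. }
  assert (PerN : forall n z, 0 < z -> Q (z + INR n) = Q z).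
  { intros n w Hw. induction n as [|n IH]; [simpl; f_equal; ring|].
    rewrite S_INR, <- IH, <- (Per (w + INR n)) by (generalize (pos_INR n); lra). f_equal. ring. }
  destruct (Hs_expansion 0) as [C HC].
  assert (Lim : forall z, 0 < z -> Rabs (Q z - 1) <= (Rabs C + 1 / 8) / z).
  { intros w Hw. specialize (HC w Hw). unfold sum_f_R0 in HC. rewrite saddle_coef_0, pow_1 in HC. simpl pow in HC.
    destruct (mu_small w Hw) as [m0 m1].
    assert (e1 : exp (- mu w) <= 1) by now apply exp_neg_le1.
    assert (e2 := exp_ineq1_le (- mu w)). assert (e3 := exp_pos (- mu w)).
    unfold Q. replace (sq2pi w * Hs w * exp (- mu w) - 1) with ((sq2pi w * Hs w - 1 / 1) * exp (- mu w) + (exp (- mu w) - 1)) by field.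
    eapply Rle_trans; [apply Rabs_triang|]. rewrite Rabs_mult, (Rabs_right (exp _)) by lra.
    rewrite (Rabs_left1 (exp _ - 1)) by lra.
    assert (C / w <= Rabs C / w).
    { apply Rmult_le_compat_r; [left; now apply Rinv_0_lt_compat|apply Rle_abs]. }
    assert (X := Rabs_pos (sq2pi w * Hs w - 1 / 1)).
    unfold Rdiv at 2. rewrite Rmult_plus_distr_r. unfold Rdiv in *. nra. }
  intros Hz.
  assert (Q1 : Q z = 1).
  { apply Rminus_diag_uniq, Rabs_eq_0, Rle_antisym; [|apply Rabs_pos]. apply le_limit. intros e He.
    set (K := Rabs C + 1 / 8) in *. assert (HK : 0 < K) by (unfold K; generalize (Rabs_pos C); lra).
    destruct (nfloor_ex (K / e)) as [n Hn]; [apply Rdiv_le_0_compat; lra|].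
    assert (L := Lim (z + INR (S n)) ltac:(generalize (pos_INR (S n)); lra)). rewrite PerN in L by auto.
    assert (KS : K / e < z + INR (S n)) by (rewrite S_INR; lra).
    assert (K / (z + INR (S n)) <= e); [|lra].
    apply Rmult_le_reg_r with (z + INR (S n)); [generalize (pos_INR (S n)); lra|].
    unfold Rdiv at 1. rewrite Rmult_assoc, Rinv_l, Rmult_1_r by (generalize (pos_INR (S n)); lra).
    apply Rmult_lt_compat_l with (r := e) in KS; auto. replace (e * (K / e)) with K in KS by (field; lra). lra. }
  unfold Q in Q1. rewrite exp_Ropp in Q1. assert (X := exp_pos (mu z)).
  apply Rmult_eq_reg_r with (/ exp (mu z)); [|apply Rinv_neq_0_compat; lra]. rewrite Q1. field. lra.
Qed.

(** Both sides of Binet's formula are expanded in powers of [1/z]; the coefficients of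
    such an expansion are unique. *)
Theorem stirling_saddle_coef n : stirling_coef n = saddle_coef n.
Proof.
  induction n as [n IH] using (well_founded_induction Nat.lt_wf_0).
  destruct (Hs_expansion n) as [C HC].
  set (A := Rabs (stirling_coef (S n)) + Rabs (stirling_coef (S (S n))) + Rabs C).
  assert (HA : 0 <= A) by (unfold A; generalize (Rabs_pos (stirling_coef (S n))) (Rabs_pos (stirling_coef (S (S n)))) (Rabs_pos C); lra).
  assert (B : forall z, 1 <= z -> Rabs (stirling_coef n - saddle_coef n) <= A / z).
  { intros z Hz. assert (Zn : 0 < z ^ n) by (apply pow_lt; lra).
    assert (Z1 : 0 < z ^ S n) by (apply pow_lt; lra).
    assert (S1 := stirling_bound 1 n z ltac:(lra) ltac:(auto)). specialize (HC z ltac:(lra)).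
    rewrite binet in HC by lra. rewrite Rmult_1_l in S1.
    assert (E : sum_f_R0 (fun k => saddle_coef k / z ^ k) n - stirling 1 n z = (saddle_coef n - stirling_coef n) / z ^ n).
    { unfold stirling. destruct n as [|n]; [simpl; field|]. rewrite !tech5.
      rewrite (sum_eq (fun i => 1 ^ i * stirling_coef i / z ^ i) (fun k => saddle_coef k / z ^ k)).
      - rewrite pow1. field. lra.
      - intros i Hi. rewrite pow1, IH by lia. field. apply pow_nonzero; lra. }
    assert (D : Rabs ((saddle_coef n - stirling_coef n) / z ^ n) <= A / z ^ S n).
    { rewrite <- E.
      replace (sum_f_R0 (fun k => saddle_coef k / z ^ k) n - stirling 1 n z)
        with ((exp (mu z) - stirling 1 n z) - (exp (mu z) - sum_f_R0 (fun k => saddle_coef k / z ^ k) n)) by ring.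
      unfold Rminus at 1. eapply Rle_trans; [apply Rabs_triang|]. rewrite Rabs_Ropp.
      assert (I1 : / z ^ S (S n) <= / z ^ S n).
      { apply Rinv_le_contravar; auto. simpl. simpl in Z1. nra. }
      assert (Rabs (stirling_coef (S (S n))) / z ^ S (S n) <= Rabs (stirling_coef (S (S n))) / z ^ S n) by (apply Rmult_le_compat_l; auto using Rabs_pos).
      assert (C / z ^ S n <= Rabs C / z ^ S n).
      { apply Rmult_le_compat_r; [left; now apply Rinv_0_lt_compat|apply Rle_abs]. }
      unfold A, Rdiv in *. rewrite !Rmult_plus_distr_r. lra. }
    rewrite Rabs_minus_sym. unfold Rdiv in D. rewrite Rabs_mult, (Rabs_right (/ _)) in D.
    2:{ apply Rle_ge; left; now apply Rinv_0_lt_compat. }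
    apply Rmult_le_reg_r with (/ z ^ n); [now apply Rinv_0_lt_compat|]. eapply Rle_trans; [exact D|].
    right. simpl. field. split; lra. }
  apply Rminus_diag_uniq, Rabs_eq_0, Rle_antisym; [|apply Rabs_pos]. apply le_limit. intros e He.
  assert (M1 := Rmax_l 1 (A / e)). assert (M2 := Rmax_r 1 (A / e)).
  specialize (B (Rmax 1 (A / e)) M1). set (z := Rmax 1 (A / e)) in *.
  assert (A / z <= e); [|lra].
  apply Rmult_le_reg_r with z; [lra|]. unfold Rdiv at 1. rewrite Rmult_assoc, Rinv_l, Rmult_1_r by lra.
  apply Rmult_le_compat_l with (r := e) in M2; [|lra]. replace (e * (A / e)) with A in M2 by (field; lra). lra.
Qed.

(** * The Gamma function *)

Definition lnGam (z : R) : R := z * ln z - z - (ln z - ln (2 * PI)) / 2 + mu z.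
(** The Gamma function in the form given by Binet's formula; see [Gamma_Gam]. *)
Definition Gam (z : R) : R := exp (lnGam z).
Lemma Gam_Hs z : 0 < z -> Gam z = exp (z * ln z - z) * Hs z.
Proof.
  intros Hz. apply Rmult_eq_reg_l with (sq2pi z); [|apply Rgt_not_eq, exp_pos].
  replace (sq2pi z * (exp (z * ln z - z) * Hs z)) with (exp (z * ln z - z) * (sq2pi z * Hs z)) by ring.
  rewrite binet by auto. unfold sq2pi, Gam, lnGam. rewrite <- !exp_plus. f_equal. field.
Qed.
Lemma Gam_isW z : 0 < z -> isW (gz z) (Gam z).
Proof. intros Hz. rewrite Gam_Hs by auto. now apply gz_isW. Qed.
Lemma Gam_S z : 0 < z -> Gam (z + 1) = z * Gam z.
Proof. intros Hz. rewrite !Gam_Hs by lra. now apply gz_recurrence. Qed.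

Lemma exp_limit0 (f : R -> R) : filterlim f (Rbar_locally p_infty) (locally 0) ->
  filterlim (fun x => exp (f x)) (Rbar_locally p_infty) (locally 1).
Proof.
  intros H. apply (filterlim_comp _ _ _ f exp _ (locally 0)); auto. rewrite <- exp_0.
  apply (ex_derive_continuous exp 0). auto_derive; auto.
Qed.
Lemma Gam_1 : Gam 1 = 1.
Proof.
  apply (isW_unique (gz 1)); [apply Gam_isW; lra|]. assert (C := gz_cont 1).
  exists (0 - - exp (- exp 0)), (1 - exp (- exp (- 0))). repeat split.
  - apply (isI_antider (fun t => - exp (- exp t))); auto.
    + intros t. unfold gz, Rminus. rewrite Rmult_1_l, exp_plus. auto_derive; auto; ring.
    + rewrite <- Ropp_0. change (- 0) with (opp 0).
      apply (filterlim_comp _ _ _ (fun t => exp (- exp t)) opp _ (locally 0)); [|apply (filterlim_opp 0)].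
      apply (squeeze0 _ (fun t => exp (- (1 * t)))); [|apply lim_exp_decay; lra].
      intros t Ht. split; [left; apply exp_pos|]. apply exp_le. generalize (exp_ineq1_le t); lra.
  - apply (isI_antider (fun t => exp (- exp (- t)))); [|ct|].
    + intros t. unfold gz, Rminus. rewrite Rmult_1_l, exp_plus. auto_derive; auto; ring.
    + apply exp_limit0. rewrite <- Ropp_0. change (- 0) with (opp 0).
      apply (filterlim_comp _ _ _ (fun t => exp (- t)) opp _ (locally 0)); [|apply (filterlim_opp 0)].
      apply filterlim_ext with (fun t => exp (- (1 * t))); [intros; now rewrite Rmult_1_l|apply lim_exp_decay; lra].
  - rewrite Ropp_0. ring.
Qed.
(** The substitution [s = exp (t/2)] gives the Gaussian integral. *)
Lemma Gam_half : Gam (1 / 2) = sqrt PI.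
Proof.
  apply (isW_unique (gz (1 / 2))); [apply Gam_isW; lra|]. assert (C := gz_cont (1 / 2)). assert (Cg := gauss_cont).
  exists (2 * (sqrt PI / 2 - RInt gauss 0 1)), (2 * RInt gauss 0 1). repeat split.
  - refine (isI_ext (fun t => 2 * (exp (t / 2) / 2 * gauss (exp (t / 2)))) _ _ _ _).
    { intros t _. unfold gauss, gz. replace (2 * (exp (t / 2) / 2 * exp (- exp (t / 2) ^ 2))) with (exp (t / 2) * exp (- exp (t / 2) ^ 2)) by field.
      rewrite <- exp_plus. f_equal. replace (exp (t / 2) ^ 2) with (exp (t / 2) * exp (t / 2)) by ring. rewrite <- exp_plus.
      replace (t / 2 + t / 2) with t by field. field. }
    assert (Ch : cont (fun t => exp (t / 2))) by (unfold Rdiv; ct).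
    apply isI_scal; [unfold Rdiv in *; ct|].
    apply filterlim_ext with (fun b => minus (RInt gauss 0 (exp (b / 2))) (RInt gauss 0 1)).
    + intros b. rewrite (RI_subst gauss (fun t => exp (t / 2)) (fun t => exp (t / 2) / 2)); auto.
      * replace (0 / 2) with 0 by field. rewrite exp_0. rewrite <- (RI_chasles gauss Cg 0 1 (exp (b / 2))).
        unfold minus, plus, opp; simpl. rring.
      * unfold Rdiv in *; ct.
      * intros t. auto_derive; auto. change (t * / 2) with (t / 2). field.
    + unfold minus. eapply filterlim_comp_2; [|apply filterlim_const|apply (filterlim_plus (sqrt PI / 2) (opp (RInt gauss 0 1)))].
      apply (filterlim_comp _ _ _ (fun b => exp (b / 2)) (fun y => RInt gauss 0 y) _ (Rbar_locally p_infty)); [|exact gauss_isI].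
      intros P [M HM]. exists (2 * M). intros t Ht. apply HM. generalize (exp_ineq1_le (t / 2)); lra.
  - refine (isI_ext (fun t => (-2) * (- (exp (- (1 / 2 * t)) / 2) * gauss (exp (- (1 / 2 * t))))) _ _ _ _).
    { intros t _. unfold gauss, gz. replace (-2 * (- (exp (- (1 / 2 * t)) / 2) * exp (- exp (- (1 / 2 * t)) ^ 2))) with (exp (- (1 / 2 * t)) * exp (- exp (- (1 / 2 * t)) ^ 2)) by field.
      rewrite <- exp_plus. f_equal. replace (exp (- (1 / 2 * t)) ^ 2) with (exp (- (1 / 2 * t)) * exp (- (1 / 2 * t))) by ring. rewrite <- exp_plus.
      replace (- (1 / 2 * t) + - (1 / 2 * t)) with (- t) by field. field. }
    assert (Ch : cont (fun t => exp (- (1 / 2 * t)))) by ct.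
    replace (2 * RInt gauss 0 1) with ((-2) * RInt gauss 1 0) by (rewrite (RI_swap gauss Cg 0 1); rring).
    apply isI_scal; [unfold Rdiv in *; ct|].
    apply filterlim_ext with (fun b => RInt gauss 1 (exp (- (1 / 2 * b)))).
    + intros b. rewrite (RI_subst gauss (fun t => exp (- (1 / 2 * t))) (fun t => - (exp (- (1 / 2 * t)) / 2))); auto.
      * now rewrite Rmult_0_r, Ropp_0, exp_0.
      * unfold Rdiv in *; ct.
      * intros t. auto_derive; auto. field.
    + apply (filterlim_comp _ _ _ (fun b => exp (- (1 / 2 * b))) (fun y => RInt gauss 1 y) _ (locally 0)); [apply lim_exp_decay; lra|].
      apply (continuous_ext (fun y => RInt gauss 0 y - RInt gauss 0 1)).
      * intros y. rewrite <- (RI_chasles gauss Cg 0 1 y). rring.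
      * apply (continuous_minus (fun y => RInt gauss 0 y) (fun _ => RInt gauss 0 1)); [|apply continuous_const].
        eapply der_cont, RI_derive; auto.
  - field.
Qed.

Lemma Gam_fact n : Gam (INR n + 1) = INR (fact n).
Proof.
  induction n as [|n IH]; [simpl; rewrite Rplus_0_l; apply Gam_1|].
  rewrite S_INR, Gam_S, IH, fact_S, S_INR by (generalize (pos_INR n); lra). reflexivity.
Qed.
Lemma Gam_half_gamma n : Gam (INR n + 1 / 2) = half_gamma n.
Proof.
  induction n as [|n IH]; [simpl; rewrite Rplus_0_l; apply Gam_half|].
  rewrite S_INR. replace (INR n + 1 + 1 / 2) with (INR n + 1 / 2 + 1) by ring.
  rewrite Gam_S, IH by (generalize (pos_INR n); lra). reflexivity.
Qed.

(** The substitution [t = exp s] leads to the integral of [gz] over the line. *)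
Theorem Gamma_Gam x : 0 < x -> Gamma x = Gam x.
Proof.
  intros Hx. apply is_RInt_gen_unique. intros P [e HP]. assert (C := gz_cont x).
  destruct (isW_window (gz x) (Gam x) e C (Gam_isW x Hx) (cond_pos e)) as (A & HA0 & HA).
  apply (Filter_prod _ _ _ (fun a => 0 < a < exp (- A)) (fun b => exp A < b)).
  - exists (mkposreal _ (exp_pos (- A))). intros a Ha Ha0. split; auto.
    unfold ball in Ha; simpl in Ha; unfold AbsRing_ball, abs, minus, plus, opp in Ha; simpl in Ha.
    apply Rabs_lt_between in Ha. lra.
  - exists (exp A). auto.
  - intros a b [Ha1 Ha2] Hb. simpl.
    assert (la : ln a <= - A) by (rewrite <- (ln_exp (- A)); left; apply ln_increasing; auto).
    assert (lb : A <= ln b) by (rewrite <- (ln_exp A); left; apply ln_increasing; auto using exp_pos).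
    assert (Hab : a <= b).
    { assert (exp (- A) <= exp A) by (apply exp_le; lra). lra. }
    exists (RInt (gz x) (ln a) (ln b)). split; [|apply HP, HA; auto].
    apply (is_RInt_ext (fun y => scal (/ y) (gz x (ln y)))).
    + rewrite Rmin_left, Rmax_right by auto. intros t Ht. unfold scal; simpl; unfold mult; simpl.
      unfold gz, Rpower. rewrite exp_ln by lra. rewrite <- (exp_ln t) at 1 by lra. rewrite <- exp_Ropp, <- !exp_plus.
      f_equal. ring.
    + apply (is_RInt_comp (V := R_CompleteNormedModule) (gz x) ln Rinv a b); rewrite Rmin_left, Rmax_right by auto.
      * intros t _. apply C.
      * intros t Ht. split; [apply is_derive_ln; lra|]. apply (ex_derive_continuous Rinv). auto_derive; lra.
Qed.

(** Both are the same derivative of [saddle_inv], in different normalizations. *)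
Theorem a_even k : a (2 * k) = saddle_coef k.
Proof.
  unfold a. rewrite a_derivative. unfold saddle_coef. replace (2 * k + 1)%nat with (S (2 * k)) by lia.
  rewrite mult_INR. change (INR 2) with 2. replace (2 * INR k / 2) with (INR k) by field.
  rewrite Rpower_pow by lra. rewrite Gamma_Gam by (generalize (pos_INR k); lra). rewrite Gam_fact.
  unfold Rdiv. ring.
Qed.
(** * The Laplace transform of [z ^ z exp (- z) / Gamma (z + 1)] *)

(** In the variable [x = sqrt z] the integrand is the continuous function
    [exp (- v x ^ 2) * Phi x], up to a constant. *)
Definition Phi (x : R) : R := if Req_EM_T x 0 then 0 else exp (- mu (x ^ 2)).

(** The function [z ^ z * exp (- z) / Gamma (z + 1)]; see [Gz_Gam]. *)
Definition Gz (z : R) : R := exp (- mu z - (ln z + ln (2 * PI)) / 2).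

Lemma Gz_Gam z : 0 < z -> Gz z * Gam (z + 1) = exp (z * ln z - z).
Proof.
  intros Hz. rewrite Gam_S by auto. unfold Gz, Gam, lnGam.
  rewrite <- (exp_ln z) at 3 by auto. rewrite <- !exp_plus. f_equal. field.
Qed.

(** The functional equation controls [mu] near [0]. *)
Lemma mu_lower z : 0 < z -> - mu z - ln z / 2 <= 1.
Proof.
  intros Hz. assert (D := mu_shift z Hz). assert (M := mu_small (z + 1) ltac:(lra)). assert (L := ln_ratio z Hz).
  unfold delta in D. rewrite ln_div in * by lra.
  assert (0 < / (z + 1)) by (apply Rinv_0_lt_compat; lra).
  assert (0 <= z * (ln (z + 1) - ln z)) by (apply Rmult_le_pos; lra).
  assert (0 <= ln (z + 1)) by (rewrite <- ln_1; apply Rlt_le, ln_increasing; lra). nra.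
Qed.
Lemma Gz_le z : 0 < z -> Gz z <= exp 1.
Proof.
  intros Hz. apply exp_le. assert (L := mu_lower z Hz).
  assert (0 <= ln (2 * PI)); [|lra]. rewrite <- ln_1. apply Rlt_le, ln_increasing; [lra|]. generalize PI2_1; lra.
Qed.

Lemma mu1_le z : 0 < z -> mu1 z <= / 2 * / z.
Proof.
  intros Hz. destruct (mu1_isI z Hz) as [H _]. assert (Ck := k_cont).
  apply (isI_le (fun v => k v * v * exp (- (z * v))) (fun v => / 2 * exp (- (z * v)))); [ct|ct| |auto|].
  - intros v Hv. apply Rmult_le_compat_r; [left; apply exp_pos|]. generalize (k_half v Hv); lra.
  - apply isI_scal; [ct|]. now apply isI_exp.
Qed.
(** The logarithmic derivative is [mu1 z - 1 / (2 z)]. *)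
Lemma Gz_decr x y : 0 < x -> x <= y -> Gz y <= Gz x.
Proof.
  intros Hx [Hxy|<-]; [|lra]. apply exp_le.
  destruct (MVT_cor2 (fun z => - mu z - (ln z + ln (2 * PI)) / 2) (fun z => mu1 z - / 2 * / z) x y Hxy) as (c & E & Hc).
  - intros c Hc. apply is_derive_Reals.
    apply (is_derive_ext (fun z => - mu z + (- / 2) * (ln z + ln (2 * PI)))); [intros; simpl; field|].
    eapply der_eq; [apply der_plus|].
    + apply (is_derive_opp mu). apply mu_der; lra.
    + apply is_derive_scal. apply der_plus; [apply is_derive_ln; lra|apply is_derive_const].
    + unfold opp, zero; simpl. ring.
  - assert (M := mu1_le c ltac:(lra)). nra.
Qed.

Lemma Phi_pos_eq x : 0 < x -> Phi x = exp (- mu (x ^ 2)).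
Proof. intros Hx. unfold Phi. destruct (Req_EM_T x 0); [lra|auto]. Qed.
Lemma Phi_bounds x : 0 <= Phi x <= 1.
Proof.
  unfold Phi. destruct (Req_EM_T x 0) as [->|H]; [lra|]. split; [left; apply exp_pos|].
  apply exp_neg_le1. apply mu_small. apply pow2_gt_0; auto.
Qed.
Lemma Phi_linear x : Phi x <= exp 1 * Rabs x.
Proof.
  unfold Phi. destruct (Req_EM_T x 0) as [->|H]; [rewrite Rabs_R0; lra|].
  assert (P : 0 < Rabs x) by now apply Rabs_pos_lt.
  rewrite <- (exp_ln (Rabs x)) by auto. rewrite <- exp_plus. apply exp_le.
  assert (M := mu_lower (x ^ 2) ltac:(now apply pow2_gt_0)).
  replace (ln (x ^ 2)) with (2 * ln (Rabs x)) in M; [lra|].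
  rewrite <- (pow2_abs x). simpl. rewrite Rmult_1_r, ln_mult by auto. ring.
Qed.
Lemma Phi_cont : cont Phi.
Proof.
  intros x. destruct (Req_EM_T x 0) as [->|Hx].
  - intros P [e HP]. assert (E := exp_pos 1).
    assert (Hd : 0 < e / exp 1) by (apply Rdiv_lt_0_compat; [apply cond_pos|auto]).
    exists (mkposreal _ Hd). intros y Hy. apply HP.
    unfold ball in *; simpl in *; unfold AbsRing_ball, abs, minus, plus, opp in *; simpl in *.
    replace (Phi 0) with 0 by (unfold Phi; destruct (Req_EM_T 0 0); [auto|contradiction]).
    rewrite Ropp_0, Rplus_0_r in *. rewrite Rabs_right by (apply Rle_ge, Phi_bounds).
    eapply Rle_lt_trans; [apply Phi_linear|]. apply Rmult_lt_compat_l with (r := exp 1) in Hy; auto.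
    replace (exp 1 * (e / exp 1)) with (pos e) in Hy by (field; lra). auto.
  - apply (continuous_ext_loc _ (fun x => exp (- mu (x ^ 2))) x).
    + exists (mkposreal _ (Rabs_pos_lt x Hx)). intros y Hy. unfold Phi. destruct (Req_EM_T y 0) as [->|H]; auto.
      exfalso. unfold ball in Hy; simpl in Hy; unfold AbsRing_ball, abs, minus, plus, opp in Hy; simpl in Hy.
      rewrite Rplus_0_l, Rabs_Ropp in Hy. lra.
    + eapply der_cont. apply (der_comp (fun x => - mu (x ^ 2)) exp); [|apply is_derive_Reals, derivable_pt_lim_exp].
      apply (is_derive_opp (fun x => mu (x ^ 2))). apply (der_comp (fun x => x ^ 2) mu).
      * apply is_derive_pow, der_id.
      * apply mu_der, pow2_gt_0; auto.
Qed.

(** Up to sign the derivative of order [n] of the case [n = 0]. *)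
Definition Phi_moment (n : nat) (v : R) : R := I (fun x => x ^ (2 * n) * Phi x * exp (- (v * x ^ 2))).
Lemma Phi_moment_cont n v : cont (fun x => x ^ (2 * n) * Phi x * exp (- (v * x ^ 2))).
Proof. assert (C := Phi_cont). ct. Qed.
Lemma Phi_moment_isI n v : 0 < v -> isI (fun x => x ^ (2 * n) * Phi x * exp (- (v * x ^ 2))) (Phi_moment n v).
Proof.
  intros Hv.
  destruct (isI_dom (fun x => x ^ (2 * n) * Phi x * exp (- (v * x ^ 2))) (fun x => x ^ (2 * n) * exp (- (v * x ^ 2))) (half_gamma n / (2 * v ^ n * sqrt v))) as (l & Hl & _).
  - apply Phi_moment_cont.
  - ct.
  - intros x Hx. assert (P := Phi_bounds x). assert (0 < x ^ (2 * n)) by now apply pow_lt.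
    rewrite !Rabs_mult, (Rabs_right (exp _)), (Rabs_right (Phi x)), (Rabs_right (x ^ _)) by (try lra; left; apply exp_pos).
    apply Rmult_le_compat_r; [left; apply exp_pos|]. nra.
  - now apply gauss_moment.
  - now apply I_spec with l.
Qed.
Lemma Phi_moment_der n v : 0 < v -> is_derive (Phi_moment n) v (- Phi_moment (S n) v).
Proof.
  intros Hv. assert (C := Phi_cont).
  apply (laplace_der (fun x => x ^ (2 * n) * Phi x) (fun x => x ^ 2) (Phi_moment n)); auto; try ct.
  - intros; apply pow2_ge_0.
  - intros w Hw. exists (Phi_moment (S (S n)) w). refine (isI_ext _ _ _ _ (Phi_moment_isI _ w Hw)). intros x Hx.
    rewrite Rabs_right.
    + replace (2 * S (S n))%nat with (2 * n + 4)%nat by lia. rewrite pow_add. ring.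
    + apply Rle_ge, Rmult_le_pos; [apply pow_le; lra|apply Phi_bounds].
  - intros w Hw. now apply Phi_moment_isI.
  - refine (isI_ext _ _ _ _ (Phi_moment_isI (S n) v Hv)). intros x Hx.
    replace (2 * S n)%nat with (2 * n + 2)%nat by lia. rewrite pow_add. ring.
Qed.
Lemma Phi_moment_Dn n v : 0 < v -> Derive_n (Phi_moment 0) n v = (-1) ^ n * Phi_moment n v.
Proof.
  revert v. induction n as [|n IH]; intros v Hv; [simpl; ring|]. simpl Derive_n.
  rewrite (Derive_ext_loc _ (fun v => (-1) ^ n * Phi_moment n v)).
  - apply is_derive_unique. eapply der_eq; [apply is_derive_scal, Phi_moment_der; auto|]. simpl; ring.
  - exists (mkposreal v Hv). intros y Hy. apply IH.
    unfold ball in Hy; simpl in Hy; unfold AbsRing_ball, abs, minus, plus, opp in Hy; simpl in Hy.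
    apply Rabs_lt_between in Hy. lra.
Qed.

(** [sqrt (2 / PI)]; see [gauss_norm_eq]. *)
Definition gauss_norm : R := 2 * exp (- (ln (2 * PI) / 2)).
Definition L_integrand (v x : R) : R := gauss_norm * (x ^ (2 * 0) * Phi x * exp (- (v * x ^ 2))).
(** The Laplace transform of [Gz]. *)
Definition L (v : R) : R := gauss_norm * Phi_moment 0 v.
Lemma gauss_norm_pos : 0 < gauss_norm.
Proof. unfold gauss_norm. generalize (exp_pos (- (ln (2 * PI) / 2))); lra. Qed.
Lemma L_integrand_cont v : cont (L_integrand v).
Proof. assert (C := Phi_moment_cont 0 v). unfold L_integrand. apply cont_mult; [apply cont_const|auto]. Qed.
Lemma L_isI v : 0 < v -> isI (L_integrand v) (L v).
Proof. intros Hv. apply isI_scal; [apply Phi_moment_cont|now apply Phi_moment_isI]. Qed.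
Lemma L_integrand_pos v x : 0 <= L_integrand v x.
Proof.
  unfold L_integrand. simpl pow. rewrite Rmult_1_l. apply Rmult_le_pos; [left; apply gauss_norm_pos|].
  apply Rmult_le_pos; [apply Phi_bounds|left; apply exp_pos].
Qed.
Lemma L_decr v w : 0 < v -> v <= w -> L w <= L v.
Proof.
  intros Hv Hw. apply (isI_le (L_integrand w) (L_integrand v)); auto using L_integrand_cont; try (apply L_isI; lra).
  intros x Hx. unfold L_integrand. apply Rmult_le_compat_l; [left; apply gauss_norm_pos|].
  apply Rmult_le_compat_l; [simpl pow; rewrite Rmult_1_l; apply Phi_bounds|]. apply exp_le.
  generalize (pow2_ge_0 x); nra.
Qed.

Definition phi (v z : R) : R := exp (- (v * z)) * Gz z.
Lemma phi_decr v x y : 0 < v -> 0 < x -> x <= y -> phi v y <= phi v x.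
Proof.
  intros Hv Hx Hy. apply Rmult_le_compat; try (left; apply exp_pos).
  - apply exp_le. nra.
  - now apply Gz_decr.
Qed.
Lemma phi_le v z : 0 < v -> 0 < z -> phi v z <= exp 1.
Proof.
  intros Hv Hz. rewrite <- (Rmult_1_l (exp 1)). apply Rmult_le_compat; try (left; apply exp_pos).
  - apply exp_neg_le1. nra.
  - now apply Gz_le.
Qed.
Lemma L_integrand_phi v x : 0 < x -> L_integrand v x = 2 * x * phi v (x ^ 2).
Proof.
  intros Hx. unfold L_integrand, phi, gauss_norm, Gz. rewrite Phi_pos_eq by auto. simpl (x ^ (2 * 0)).
  replace (ln (x ^ 2)) with (2 * ln x) by (simpl; rewrite Rmult_1_r, ln_mult by auto; ring).
  replace (- mu (x ^ 2) - (2 * ln x + ln (2 * PI)) / 2) with (- mu (x ^ 2) + (- ln x + - (ln (2 * PI) / 2))) by field.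
  rewrite !exp_plus, (exp_Ropp (ln x)), exp_ln by auto. field. lra.
Qed.

Lemma cell_lin p q c : 0 <= p <= q -> RInt (fun x => c * (2 * x)) (sqrt p) (sqrt q) = c * (q - p) :> R.
Proof.
  intros H. rewrite (RI_ftc (fun x => c * x ^ 2)); [| |ct].
  - replace (sqrt q ^ 2) with q by (simpl; rewrite Rmult_1_r, sqrt_sqrt; lra).
    replace (sqrt p ^ 2) with p by (simpl; rewrite Rmult_1_r, sqrt_sqrt; lra). ring.
  - intros x. auto_derive; auto. ring.
Qed.
Lemma sqrt_cell p q x : 0 <= p -> sqrt p < x < sqrt q -> 0 < x /\ p <= x ^ 2 <= q.
Proof.
  intros Hp [H1 H2]. assert (P := sqrt_pos p). assert (S := sqrt_sqrt p Hp). assert (0 < x) by lra.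
  assert (0 < q) by (apply sqrt_lt_0_alt; rewrite sqrt_0; lra).
  assert (S' := sqrt_sqrt q ltac:(lra)). nra.
Qed.
(** The function [phi v] decreases, so its Riemann sums are compared with the integral
    cell by cell, in the variable [x = sqrt z]. *)
Lemma cell_lower v p q : 0 < v -> 0 <= p < q -> phi v q * (q - p) <= RInt (L_integrand v) (sqrt p) (sqrt q).
Proof.
  intros Hv H. rewrite <- cell_lin by lra. apply RI_le; [ct|apply L_integrand_cont|apply sqrt_le_1; lra|].
  intros x Hx. destruct (sqrt_cell p q x ltac:(lra) Hx) as [Hx0 Hx2]. rewrite L_integrand_phi by auto.
  rewrite (Rmult_comm (2 * x)). apply Rmult_le_compat_r; [lra|]. apply phi_decr; nra.
Qed.
Lemma cell_upper v p q B : 0 < v -> 0 <= p < q -> (forall z, 0 < z -> p <= z -> phi v z <= B) ->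
  RInt (L_integrand v) (sqrt p) (sqrt q) <= B * (q - p).
Proof.
  intros Hv H HB. rewrite <- cell_lin by lra. apply RI_le; [apply L_integrand_cont|ct|apply sqrt_le_1; lra|].
  intros x Hx. destruct (sqrt_cell p q x ltac:(lra) Hx) as [Hx0 Hx2]. rewrite L_integrand_phi by auto.
  rewrite (Rmult_comm (2 * x)). apply Rmult_le_compat_r; [lra|]. apply HB; nra.
Qed.

Lemma riemann_lower v h n : 0 < v -> 0 < h ->
  h * sum_f_R0 (fun j => phi v (INR (S j) * h)) n <= L v.
Proof.
  intros Hv Hh.
  apply Rle_trans with (RInt (L_integrand v) 0 (sqrt (INR (S n) * h))).
  - induction n as [|n IH].
    + rewrite <- sqrt_0. unfold sum_f_R0. eapply Rle_trans; [|apply (cell_lower v 0 (INR 1 * h)); auto; simpl; lra].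
      right. simpl INR. ring.
    + rewrite <- (RI_chasles (L_integrand v) (L_integrand_cont v) 0 (sqrt (INR (S n) * h))), tech5, Rmult_plus_distr_l.
      apply Rplus_le_compat; auto. rewrite (S_INR (S n)).
      assert (0 <= INR (S n) * h) by (apply Rmult_le_pos; [apply pos_INR|lra]).
      eapply Rle_trans; [|apply cell_lower; auto; lra]. right. ring.
  - apply isI_part; auto using L_integrand_cont, L_isI, sqrt_pos. intros; apply L_integrand_pos.
Qed.
Lemma riemann_upper v h B : 0 < v -> 0 < h ->
  (forall n, sum_f_R0 (fun j => phi v (INR (S j) * h)) n <= B) -> L v <= exp 1 * h + h * B.
Proof.
  intros Hv Hh HB.
  assert (C : forall n, RInt (L_integrand v) 0 (sqrt (INR (S (S n)) * h)) <=
     RInt (L_integrand v) 0 (sqrt (INR (S n) * h)) + h * phi v (INR (S n) * h)).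
  { intros n. rewrite <- (RI_chasles (L_integrand v) (L_integrand_cont v) 0 (sqrt (INR (S n) * h)) (sqrt (INR (S (S n)) * h))).
    assert (P : 0 < INR (S n) * h) by (apply Rmult_lt_0_compat; [apply lt_0_INR; lia|lra]).
    assert (C := cell_upper v (INR (S n) * h) (INR (S (S n)) * h) (phi v (INR (S n) * h)) Hv).
    rewrite (S_INR (S n)) in *. specialize (C ltac:(lra) ltac:(intros; apply phi_decr; lra)).
    replace (phi v (INR (S n) * h) * ((INR (S n) + 1) * h - INR (S n) * h)) with (h * phi v (INR (S n) * h)) in C by ring.
    lra. }
  assert (U : forall n, RInt (L_integrand v) 0 (sqrt (INR (S (S n)) * h)) <= exp 1 * h + h * sum_f_R0 (fun j => phi v (INR (S j) * h)) n).
  { induction n as [|n IH].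
    - eapply Rle_trans; [apply C|]. unfold sum_f_R0.
      assert (A := cell_upper v 0 (INR 1 * h) (exp 1) Hv ltac:(simpl; lra) ltac:(intros; now apply phi_le)).
      rewrite sqrt_0 in A. replace (INR 1 * h - 0) with h in A by (simpl; ring). lra.
    - eapply Rle_trans; [apply C|]. rewrite tech5. lra. }
  apply Rnot_lt_le. intros Hlt.
  destruct (proj1 (isI_eps _ _) (L_isI v Hv) (L v - (exp 1 * h + h * B)) ltac:(lra)) as (A & HA0 & HA).
  destruct (nfloor_ex (A ^ 2 / h)) as [n Hn]; [apply Rdiv_le_0_compat; [apply pow2_ge_0|auto]|].
  assert (Hs : A <= sqrt (INR (S (S n)) * h)).
  { rewrite <- (sqrt_pow2 A) by auto. apply sqrt_le_1_alt. rewrite !S_INR.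
    replace (A ^ 2) with (A ^ 2 / h * h) by (field; lra). apply Rmult_le_compat_r; lra. }
  specialize (HA _ Hs). apply Rabs_lt_between in HA. specialize (U n). specialize (HB n). nra.
Qed.
(** * Absolutely monotone functions *)

Lemma taylor_at_0 f m : taylor f (S m) 0 = f 0.
Proof.
  induction m as [|m IH]; rewrite taylor_S; [simpl; field|]. rewrite IH. simpl pow. ring.
Qed.
Lemma taylor_der f m x : is_derive (taylor f (S m)) x (taylor (Derive f) m x).
Proof.
  induction m as [|m IH].
  - apply (is_derive_ext (fun _ => f 0)); [intros; rewrite taylor_S; simpl; field|]. apply (is_derive_const (f 0) x).
  - apply (is_derive_ext (fun x => taylor f (S m) x + Derive_n f (S m) 0 / INR (fact (S m)) * x ^ S m)); [intros; now rewrite (taylor_S f (S m))|].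
    rewrite taylor_S. apply der_plus; auto. eapply der_eq; [apply is_derive_scal, is_derive_pow, der_id|].
    rewrite <- Dn_shift, fact_S. simpl Init.Nat.pred. field. split; [apply INR_fact_neq_0|apply not_0_INR; lia].
Qed.
Lemma nonneg_by_der (q q' : R -> R) x : 0 <= x -> (forall y, 0 <= y <= x -> is_derive q y (q' y)) ->
  (forall y, 0 <= y <= x -> 0 <= q' y) -> q 0 <= q x.
Proof.
  intros [Hx|<-] D P; [|lra]. destruct (MVT_cor2 q q' 0 x Hx) as (c & E & Hc).
  - intros c Hc. apply is_derive_Reals, D; auto.
  - specialize (P c ltac:(lra)). nra.
Qed.

(** The remainder divided by the power that it omits is nondecreasing; passing from [f] to
    its derivative lowers the order of the remainder. *)
Lemma bernstein D f w1 m x t : openD D -> smooth D f -> (forall y, 0 <= y <= w1 -> D y) ->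
  (forall n y, 0 <= y <= w1 -> 0 <= Derive_n f n y) -> 0 <= x <= w1 -> 0 <= t <= 1 ->
  0 <= f (t * x) - taylor f m (t * x) <= t ^ m * (f x - taylor f m x).
Proof.
  intros OD. revert f x t. induction m as [|m IH]; intros f x t Sf HI Pf Hx Ht.
  - simpl. assert (P0 := Pf O). simpl in P0. assert (tx : 0 <= t * x <= w1) by nra. specialize (P0 _ tx).
    rewrite !Rminus_0_r, Rmult_1_l. split; auto.
    replace x with (t * x + (x - t * x)) at 2 by ring.
    replace (f (t * x)) with (f (t * x + 0)) by (f_equal; ring).
    apply (nonneg_by_der (fun y => f (t * x + y)) (fun y => Derive f (t * x + y))); [nra| |].
    + intros y Hy. eapply der_eq; [apply (der_comp (fun y => t * x + y) f y 1); [auto_derive; auto|]|].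
      * apply (smooth_der D); auto. apply HI; nra.
      * ring.
    + intros y Hy. apply (Pf 1%nat). nra.
  - assert (P' : forall n y, 0 <= y <= w1 -> 0 <= Derive_n (Derive f) n y) by (intros n y Hy; rewrite <- Dn_shift; auto).
    assert (IH1 : forall y s, 0 <= y <= w1 -> 0 <= s <= 1 ->
      0 <= Derive f (s * y) - taylor (Derive f) m (s * y) <= s ^ m * (Derive f y - taylor (Derive f) m y)).
    { intros y s Hy Hs. apply IH; auto. now apply smooth_Derive. }
    assert (Dr : forall y, 0 <= y <= w1 -> is_derive (fun y => f y - taylor f (S m) y) y (Derive f y - taylor (Derive f) m y)).
    { intros y Hy. apply (is_derive_minus f (taylor f (S m))); [apply (smooth_der D); auto|apply taylor_der]. }
    assert (Pr : forall y, 0 <= y <= w1 -> 0 <= f y - taylor f (S m) y).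
    { intros y Hy. replace 0 with (f 0 - taylor f (S m) 0) by (rewrite taylor_at_0; ring).
      apply (nonneg_by_der (fun y => f y - taylor f (S m) y) (fun y => Derive f y - taylor (Derive f) m y)); [lra| |].
      - intros z Hz. apply Dr; lra.
      - intros z Hz. specialize (IH1 z 1 ltac:(lra) ltac:(lra)). rewrite Rmult_1_l in IH1. lra. }
    split; [apply Pr; nra|].
    set (q := fun y => t ^ S m * (f y - taylor f (S m) y) + (-1) * (f (t * y) - taylor f (S m) (t * y))).
    assert (Q : q 0 <= q x).
    { apply (nonneg_by_der q (fun y => t ^ S m * (Derive f y - taylor (Derive f) m y) + (-1) * ((Derive f (t * y) - taylor (Derive f) m (t * y)) * t))); [lra| |].
      - intros y Hy. apply der_plus; apply is_derive_scal; [apply Dr; lra|].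
        apply (der_comp (fun y => t * y) (fun y => f y - taylor f (S m) y)); [auto_derive; auto; ring|apply Dr; nra].
      - intros y Hy. specialize (IH1 y t ltac:(lra) Ht). simpl pow. nra. }
    unfold q in Q. rewrite Rmult_0_r, taylor_at_0 in Q. lra.
Qed.

Lemma bernstein_bounds D f w1 w m : openD D -> smooth D f -> (forall y, 0 <= y <= w1 -> D y) ->
  (forall n y, 0 <= y <= w1 -> 0 <= Derive_n f n y) -> 0 <= w < w1 ->
  0 <= f w - taylor f m w <= (w / w1) ^ m * f w1.
Proof.
  intros OD Sf HI Pf Hw.
  assert (Q : 0 <= w / w1 <= 1).
  { split; [apply Rdiv_le_0_compat; lra|]. apply Rmult_le_reg_r with w1; [lra|]. unfold Rdiv. rewrite Rmult_assoc, Rinv_l; lra. }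
  assert (B := bernstein D f w1 m w1 (w / w1) OD Sf HI Pf ltac:(lra) Q).
  replace (w / w1 * w1) with w in B by (field; lra). split; [lra|].
  eapply Rle_trans; [apply B|]. apply Rmult_le_compat_l; [apply pow_le; lra|].
  assert (0 <= taylor f m w1); [|lra].
  clear -Pf Hw. induction m as [|m IH]; [simpl; lra|]. rewrite taylor_S. apply Rplus_le_le_0_compat; auto.
  apply Rmult_le_pos; [|apply pow_le; lra]. apply Rdiv_le_0_compat; [apply Pf; lra|apply fact_pos].
Qed.
(** Bernstein: an absolutely monotone function is the sum of its Taylor series. *)
Lemma bernstein_limit D f w1 w e : openD D -> smooth D f -> (forall y, 0 <= y <= w1 -> D y) ->
  (forall n y, 0 <= y <= w1 -> 0 <= Derive_n f n y) -> 0 <= w < w1 -> 0 < e ->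
  exists m0, forall m, (m0 <= m)%nat -> f w - e <= taylor f m w.
Proof.
  intros OD Sf HI Pf Hw He.
  assert (F1 : 0 <= f w1) by (apply (Pf O); lra).
  assert (Q : Rabs (w / w1) < 1).
  { rewrite Rabs_right by (apply Rle_ge, Rdiv_le_0_compat; lra). apply Rmult_lt_reg_r with w1; [lra|].
    unfold Rdiv. rewrite Rmult_assoc, Rinv_l; lra. }
  destruct (pow_lt_1_zero (w / w1) Q (e / (f w1 + 1))) as [m0 Hm0]; [apply Rdiv_lt_0_compat; lra|].
  exists m0. intros m Hm. specialize (Hm0 m Hm). apply Rabs_lt_between in Hm0.
  destruct (bernstein_bounds D f w1 w m OD Sf HI Pf Hw) as [_ B].
  assert ((w / w1) ^ m * f w1 <= e / (f w1 + 1) * f w1) by (apply Rmult_le_compat_r; lra).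
  assert (e / (f w1 + 1) * f w1 <= e).
  { replace (e / (f w1 + 1) * f w1) with (e - e / (f w1 + 1)) by (field; lra).
    assert (0 < e / (f w1 + 1)) by (apply Rdiv_lt_0_compat; lra). lra. }
  lra.
Qed.

(** * A generating function of Rothe *)

(** The cone of nonnegative combinations of the functions
    [(1 + x) ^ p * (1 - h x) ^ (- q)] with [p, q >= 0]. *)
Inductive cone (h : R) : (R -> R) -> Prop :=
| cone_mono c p q : 0 <= c -> 0 <= p -> 0 <= q ->
    cone h (fun x => c * (Rpower (1 + x) p * Rpower (1 - h * x) (- q)))
| cone_plus f g : cone h f -> cone h g -> cone h (fun x => f x + g x).

Definition rothe_dom (h x : R) : Prop := 0 < 1 + x /\ 0 < 1 - h * x.

Lemma cone_pos h f x : cone h f -> 0 <= f x.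
Proof.
  induction 1; [|lra]. apply Rmult_le_pos; auto. left; apply Rmult_lt_0_compat; apply exp_pos.
Qed.
Lemma Rpower_der (u : R -> R) du s x : is_derive u x du -> 0 < u x ->
  is_derive (fun x => Rpower (u x) s) x (s * du * Rpower (u x) (s - 1)).
Proof.
  intros Du Pu. unfold Rpower at 1. eapply der_eq.
  - apply (der_comp (fun x => s * ln (u x)) exp); [|apply is_derive_Reals, derivable_pt_lim_exp].
    apply is_derive_scal. apply (der_comp u ln); [exact Du|now apply is_derive_ln].
  - fold (Rpower (u x) s). unfold Rminus. rewrite Rpower_plus, Rpower_Ropp, Rpower_1 by auto. ring.
Qed.

(** The variable of the generating function, as a function of its inverse [x]. *)
Definition rothe_var (h x : R) : R := x * Rpower (1 + x) (- (1 + h)).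
Definition rothe_var1 (h x : R) : R := Rpower (1 + x) (- (1 + h) - 1) * (1 - h * x).
Lemma rothe_var_der h x : rothe_dom h x -> is_derive (rothe_var h) x (rothe_var1 h x).
Proof.
  intros [P Q]. eapply der_eq.
  - apply der_mult; [apply der_id|]. apply (Rpower_der (fun x => 1 + x) 1); auto. auto_derive; auto.
  - unfold rothe_var1. replace (- (1 + h)) with (- (1 + h) - 1 + 1) at 1 by ring. rewrite Rpower_plus, Rpower_1 by auto. ring.
Qed.
Lemma rothe_var1_pos h x : rothe_dom h x -> 0 < rothe_var1 h x.
Proof. intros [P Q]. apply Rmult_lt_0_compat; auto. apply exp_pos. Qed.

(** Differentiation with respect to [rothe_var h x] preserves the cone. *)
Lemma cone_der h f : 0 <= h -> cone h f -> exists g, cone h g /\ forall x, rothe_dom h x -> is_derive f x (g x * rothe_var1 h x).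
Proof.
  intros Hh. induction 1 as [c p q Hc Hp Hq|f g _ (f1 & C1 & D1) _ (g1 & C2 & D2)].
  - exists (fun x => c * p * (Rpower (1 + x) (p + (1 + h)) * Rpower (1 - h * x) (- (q + 1)))
                 + c * q * h * (Rpower (1 + x) (p + (1 + h) + 1) * Rpower (1 - h * x) (- (q + 2)))).
    split.
    + apply cone_plus; apply cone_mono; try lra; repeat apply Rmult_le_pos; lra.
    + intros x [P Q]. eapply der_eq.
      * apply is_derive_scal, der_mult.
        -- apply (Rpower_der (fun x => 1 + x) 1); auto. auto_derive; auto.
        -- apply (Rpower_der (fun x => 1 - h * x) (- h)); auto. auto_derive; auto; ring.
      * unfold rothe_var1. set (u := 1 + x) in *. set (v := 1 - h * x) in *.
        assert (Uu : forall s, Rpower u s <> 0) by (intros; apply Rgt_not_eq, exp_pos).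
        assert (Vv : forall s, Rpower v s <> 0) by (intros; apply Rgt_not_eq, exp_pos).
        unfold Rminus. rewrite !Rpower_plus, !Rpower_Ropp, !Rpower_plus, !Rpower_1 by auto.
        replace (Rpower v 2) with (v * v) by (replace 2 with (1 + 1) by ring; rewrite Rpower_plus, Rpower_1; auto).
        field. repeat split; auto; lra.
  - exists (fun x => f1 x + g1 x). split; [now apply cone_plus|].
    intros x Hx. eapply der_eq; [apply der_plus; auto|]. ring.
Qed.

(** The falling factorial. *)
Fixpoint fall (s : R) (m : nat) : R := match m with O => 1 | S i => fall s i * (s - INR i) end.
Lemma Dn_Rpower s m t : 0 < 1 + t -> Derive_n (fun t => Rpower (1 + t) s) m t = fall s m * Rpower (1 + t) (s - INR m).
Proof.
  revert t; induction m as [|m IH]; intros t Ht.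
  - simpl. rewrite Rminus_0_r. ring.
  - simpl Derive_n. rewrite (Derive_ext_loc _ (fun t => fall s m * Rpower (1 + t) (s - INR m))).
    + apply is_derive_unique. eapply der_eq.
      * apply is_derive_scal. apply (Rpower_der (fun t => 1 + t) 1); auto. auto_derive; auto.
      * rewrite S_INR. simpl fall. replace (s - (INR m + 1)) with (s - INR m - 1) by ring. ring.
    + exists (mkposreal _ Ht). intros y Hy. apply IH. change (Rabs (y - t) < 1 + t) in Hy. apply Rabs_lt_between in Hy. lra.
Qed.
Lemma fall_Gam z m : 0 <= z -> fall (INR m + z) m * Gam (z + 1) = Gam (INR m + z + 1).
Proof.
  intros Hz. assert (H : forall i, (i <= m)%nat -> fall (INR m + z) i * Gam (INR m + z - INR i + 1) = Gam (INR m + z + 1)).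
  { induction i as [|i IH]; intros Hi.
    - simpl. rewrite Rminus_0_r. ring.
    - rewrite <- IH by lia. assert (INR (S i) <= INR m) by now apply le_INR.
      rewrite S_INR in *. replace (INR m + z - INR i + 1) with ((INR m + z - INR i) + 1) by ring.
      rewrite (Gam_S (INR m + z - INR i)) by lra. simpl fall.
      replace (INR m + z - (INR i + 1) + 1) with (INR m + z - INR i) by ring. ring. }
  rewrite <- (H m) by lia. do 2 f_equal. ring.
Qed.

(** The sum of the series in terms of [x]; it has the shape of a generator of the cone. *)
Definition rothe_fun (h x : R) : R := 1 * (Rpower (1 + x) 1 * Rpower (1 - h * x) (- (1))).

(** The binomial coefficient of [(1 + h) m] over [m], times a power of the variable. *)
Definition rothe_term (h N : R) (m : nat) : R :=
  Gam (INR m + INR m * h + 1) / Gam (INR m * h + 1) / INR (fact m) * rothe_var h N ^ m.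

(** By Lagrange inversion the Taylor coefficients of the sum are binomial, and by the cone
    the sum is absolutely monotone, so that its Taylor series converges to it. *)
Lemma rothe h N : 0 < h -> 0 < N -> h * N < 1 ->
  (forall n, sum_f_R0 (rothe_term h N) n <= (1 + N) / (1 - h * N)) /\
  (forall e, 0 < e -> exists n0, forall n, (n0 <= n)%nat -> (1 + N) / (1 - h * N) - e <= sum_f_R0 (rothe_term h N) n).
Proof.
  intros Hh HN HhN.
  assert (OD : openD (rothe_dom h)).
  { intros x [P Q]. assert (Pd : 0 < Rmin (1 + x) ((1 - h * x) / h)).
    { apply Rmin_pos; auto. now apply Rdiv_lt_0_compat. }
    exists (mkposreal _ Pd). intros y Hy. change (Rabs (y - x) < Rmin (1 + x) ((1 - h * x) / h)) in Hy.
    generalize (Rmin_l (1 + x) ((1 - h * x) / h)) (Rmin_r (1 + x) ((1 - h * x) / h)). intros m1 m2.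
    apply Rabs_lt_between in Hy. split; [lra|]. assert (h * (y - x) < h * ((1 - h * x) / h)) by (apply Rmult_lt_compat_l; lra).
    replace (h * ((1 - h * x) / h)) with (1 - h * x) in H by (field; lra). lra. }
  assert (CD : forall x y z, rothe_dom h x -> rothe_dom h y -> x <= z <= y -> rothe_dom h z).
  { intros x y z [A B] [A' B'] Hz. split; [lra|nra]. }
  assert (Sw : smooth (rothe_dom h) (rothe_var1 h)).
  { intros n. apply Cn_mult.
    - apply Cn_Rpower; [apply Cn_plus; [apply Cn_const|apply Cn_id]|intros x Hx; apply Hx].
    - apply Cn_minus; [apply Cn_const|]. apply Cn_mult; [apply Cn_const|apply Cn_id]. }
  destruct (inverse_function (rothe_dom h) (rothe_var h) (rothe_var1 h) CD OD (rothe_var_der h) (rothe_var1_pos h) Sw) as (T & Im & OI & CI & H1 & H2 & ST).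
  set (F := fun u => rothe_fun h (T u)).
  assert (SF : smooth Im F).
  { intros n. apply (Cn_comp Im (rothe_dom h) n T (rothe_fun h)); [intros y Hy; now apply H2|apply ST|].
    apply Cn_mult; [apply Cn_const|]. apply Cn_mult; apply Cn_Rpower.
    - apply Cn_plus; [apply Cn_const|apply Cn_id].
    - intros x Hx; apply Hx.
    - apply Cn_minus; [apply Cn_const|]. apply Cn_mult; [apply Cn_const|apply Cn_id].
    - intros x Hx; apply Hx. }
  assert (PF : forall n, exists g, cone h g /\ forall u, Im u -> Derive_n F n u = g (T u)).
  { induction n as [|n (g & Cg & Hg)].
    - exists (rothe_fun h). split; [apply cone_mono; lra|reflexivity].
    - destruct (cone_der h g ltac:(lra) Cg) as (g1 & C1 & D1). exists g1. split; auto.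
      intros u Hu. simpl Derive_n. rewrite (Derive_ext_loc _ (fun u => g (T u))).
      + apply is_derive_unique. destruct (H2 u Hu) as (DT & ET & DerT).
        eapply der_eq; [apply (der_comp T g); [exact DerT|apply D1; auto]|].
        field. apply Rgt_not_eq, rothe_var1_pos; auto.
      + apply (filter_imp Im); auto. }
  assert (D0 : rothe_dom h 0) by (split; lra).
  assert (DN : rothe_dom h N) by (split; lra).
  set (N1 := (N + / h) / 2).
  assert (hN1 : h * N1 = (h * N + 1) / 2) by (unfold N1; field; lra).
  assert (DN1 : rothe_dom h N1).
  { split; [|lra]. unfold N1. assert (0 < / h) by now apply Rinv_0_lt_compat. lra. }
  assert (NN1 : N < N1) by nra.
  assert (E0 : rothe_var h 0 = 0) by (unfold rothe_var; ring).
  destruct (H1 0 D0) as [I0 T0]. rewrite E0 in I0, T0.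
  destruct (H1 N DN) as [IN TN]. destruct (H1 N1 DN1) as [IN1 TN1].
  assert (W0 : 0 < rothe_var h N) by (apply Rmult_lt_0_compat; [auto|apply exp_pos]).
  assert (W1 : rothe_var h N < rothe_var h N1).
  { apply (strictly_increasing (rothe_var h) (rothe_var1 h)); auto; intros; [apply rothe_var_der|apply rothe_var1_pos]; apply (CD N N1); auto. }
  assert (HI : forall y, 0 <= y <= rothe_var h N1 -> Im y) by (intros y Hy; apply (CI 0 (rothe_var h N1)); auto).
  assert (HP : forall n y, 0 <= y <= rothe_var h N1 -> 0 <= Derive_n F n y).
  { intros n y Hy. destruct (PF n) as (g & Cg & Hg). rewrite Hg by auto. now apply (cone_pos h). }
  assert (Coef : forall m, Derive_n F m 0 = Gam (INR m + INR m * h + 1) / Gam (INR m * h + 1)).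
  { intros m. assert (LI := lagrange_inversion (rothe_dom h) Im (fun t => Rpower (1 + t) (1 + h)) T OD).
    assert (SD : starD (rothe_dom h)).
    { intros x t Hx Ht. apply (CD (Rmin 0 x) (Rmax 0 x)).
      - unfold Rmin; destruct (Rle_dec 0 x); auto.
      - unfold Rmax; destruct (Rle_dec 0 x); auto.
      - unfold Rmin, Rmax; destruct (Rle_dec 0 x); split; nra. }
    assert (Sp : forall s, smooth (rothe_dom h) (fun t => Rpower (1 + t) s)).
    { intros s n. apply Cn_Rpower; [apply Cn_plus; [apply Cn_const|apply Cn_id]|intros x Hx; apply Hx]. }
    specialize (LI SD D0 OI I0 (Sp _) (fun t _ => Rgt_not_eq _ _ (exp_pos _)) ST).
    assert (HT : forall u, Im u -> rothe_dom h (T u) /\ T u = u * Rpower (1 + T u) (1 + h)).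
    { intros u Hu. destruct (H2 u Hu) as (DT & ET & _). split; auto. rewrite <- ET at 2. unfold rothe_var.
      rewrite Rmult_assoc, <- Rpower_plus. replace (- (1 + h) + (1 + h)) with 0 by ring. rewrite Rpower_O by apply DT. ring. }
    specialize (LI HT m (fun t => Rpower (1 + t) (- (1 + h))) (Sp _)).
    rewrite (Dn_ext_open Im F (fun u => Rpower (1 + T u) (- (1 + h)) * Derive T u) m 0 OI I0).
    - rewrite LI. rewrite (Dn_ext_open (rothe_dom h) _ (fun t => Rpower (1 + t) (INR m + INR m * h)) m 0 OD D0).
      + rewrite Dn_Rpower by lra. replace (INR m + INR m * h - INR m) with (INR m * h) by ring.
        replace (Rpower (1 + 0) (INR m * h)) with 1 by (unfold Rpower; rewrite Rplus_0_r, ln_1, Rmult_0_r, exp_0; auto).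
        rewrite <- (fall_Gam (INR m * h)) by (apply Rmult_le_pos; [apply pos_INR|lra]). field. apply Rgt_not_eq, exp_pos.
      + intros t Ht. rewrite <- Rpower_pow by apply exp_pos. rewrite Rpower_mult, <- Rpower_plus. f_equal.
        rewrite plus_INR. simpl. ring.
    - intros u Hu. destruct (H2 u Hu) as ([P Q] & ET & DerT). rewrite (is_derive_unique _ _ _ DerT).
      unfold F, rothe_fun, rothe_var1. rewrite Rpower_Ropp, !Rpower_1 by auto. unfold Rminus at 2. rewrite Rpower_plus, !Rpower_Ropp, Rpower_1 by auto.
      field. repeat split; try lra. apply Rgt_not_eq, exp_pos. }
  assert (Tay : forall n, taylor F (S n) (rothe_var h N) = sum_f_R0 (rothe_term h N) n).
  { intros n. unfold taylor. apply sum_eq. intros i _. now rewrite Coef. }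
  assert (FN : F (rothe_var h N) = (1 + N) / (1 - h * N)).
  { unfold F, rothe_fun. rewrite TN. rewrite Rpower_Ropp, !Rpower_1 by lra. unfold Rdiv; ring. }
  rewrite <- FN. split.
  - intros n. rewrite <- Tay. destruct (bernstein_bounds Im F (rothe_var h N1) (rothe_var h N) (S n) OI SF HI HP); lra.
  - intros e He. destruct (bernstein_limit Im F (rothe_var h N1) (rothe_var h N) e OI SF HI HP) as [m0 Hm0]; [lra|auto|].
    exists m0. intros n Hn. rewrite <- Tay. apply Hm0. lia.
Qed.
(** * The value of the Laplace transform *)

Lemma lnGam_der z : 0 < z -> is_derive lnGam z (ln z - / 2 * / z - mu1 z).
Proof.
  intros Hz. apply (is_derive_ext (fun z => (z * ln z + (-1) * z) + ((- / 2) * ln z + (ln (2 * PI) / 2 + mu z)))).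
  { intros t. unfold lnGam. simpl. field. }
  assert (Dl := is_derive_ln z Hz). eapply der_eq.
  - apply der_plus; [apply der_plus|apply der_plus; [|apply der_plus]].
    + apply (der_mult (fun z => z) ln); [apply der_id|exact Dl].
    + apply is_derive_scal, der_id.
    + apply is_derive_scal, Dl.
    + apply (is_derive_const (ln (2 * PI) / 2) z).
    + apply (mu_der z Hz).
  - unfold zero; simpl. field. lra.
Qed.
Lemma mu1_pos z : 0 < z -> 0 <= mu1 z.
Proof.
  intros Hz. destruct (mu1_isI z Hz) as [H _]. assert (Ck := k_cont).
  apply (isI_pos (fun v => k v * v * exp (- (z * v)))); [ct| |auto].
  intros v Hv. assert (P := k_pos v). apply Rmult_le_pos; [apply Rmult_le_pos; lra|left; apply exp_pos].
Qed.
(** The derivative of [lnGam] lies between [ln (x - 1)] and [ln x]. *)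
Lemma lnGam_growth m z : 0 < m -> 0 < z ->
  z * ln m <= lnGam (m + 1 + z) - lnGam (m + 1) <= z * ln (m + 1 + z).
Proof.
  intros Hm Hz.
  destruct (MVT_cor2 lnGam (fun z => ln z - / 2 * / z - mu1 z) (m + 1) (m + 1 + z) ltac:(lra)) as (c & E & Hc).
  { intros c Hc. apply is_derive_Reals, lnGam_der. lra. }
  rewrite E. replace (m + 1 + z - (m + 1)) with z by ring. rewrite (Rmult_comm _ z).
  assert (P := mu1_pos c ltac:(lra)). assert (Q := mu1_le c ltac:(lra)).
  assert (Ic : 0 < / c) by (apply Rinv_0_lt_compat; lra).
  split; apply Rmult_le_compat_l; try lra.
  - assert (R := ln_ratio (c - 1) ltac:(lra)). replace (c - 1 + 1) with c in R by ring. rewrite ln_div in R by lra.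
    assert (ln m <= ln (c - 1)) by (apply Rlt_le, ln_increasing; lra). lra.
  - assert (ln c <= ln (m + 1 + z)) by (apply Rlt_le, ln_increasing; lra). lra.
Qed.

Lemma Gz_eq z : 0 < z -> Gz z = exp (z * ln z - z - lnGam (z + 1)).
Proof.
  intros Hz. assert (P : 0 < Gam (z + 1)) by apply exp_pos. apply Rmult_eq_reg_r with (Gam (z + 1)); [|lra].
  rewrite Gz_Gam by auto. unfold Gam. rewrite <- exp_plus. f_equal. ring.
Qed.

(** The terms of Rothe's series are close to the values of the integrand at the points
    [m h] of a mesh of size [h = 1 / (lambda N)]. *)
Lemma rothe_term_bounds lambda N m : 1 < lambda -> 0 < N -> (1 <= m)%nat ->
  let h := / (lambda * N) in
  phi (lambda - 1 - ln lambda + / N) (INR m * h) <= rothe_term h N m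
    <= exp h * phi (lambda - 1 - ln lambda - (lambda + 1) / N) (INR m * h).
Proof.
  intros Hl HN Hm h. set (M := INR m). set (z := M * h).
  assert (HM : 0 < M) by (apply lt_0_INR; lia).
  assert (lN : 0 < lambda * N) by (apply Rmult_lt_0_compat; lra).
  assert (Hh : 0 < h) by now apply Rinv_0_lt_compat.
  assert (Hz : 0 < z) by now apply Rmult_lt_0_compat.
  assert (EM : M = z * (lambda * N)) by (unfold z, h; field; lra).
  assert (Hh1 : h <= / N) by (apply Rinv_le_contravar; nra).
  destruct (lnGam_growth M z HM Hz) as [G1 G2].
  assert (Lq := ln_ratio N HN). rewrite ln_div in Lq by lra. set (q := ln (N + 1) - ln N) in *.
  assert (LM : ln M = ln z + ln lambda + ln N).
  { rewrite EM, !ln_mult by lra. ring. }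
  assert (LM2 : ln (M + 1 + z) <= ln M + (1 + z) / M).
  { replace (M + 1 + z) with (M * (1 + (1 + z) / M)) by (field; lra).
    assert (0 < (1 + z) / M) by (apply Rdiv_lt_0_compat; lra).
    rewrite ln_mult by lra. assert (X := exp_ineq1_le ((1 + z) / M)). apply Rplus_le_compat_l.
    rewrite <- (ln_exp ((1 + z) / M)) at 2. destruct X as [X|X]; [apply Rlt_le, ln_increasing; lra|rewrite X; lra]. }
  assert (ET : rothe_term h N m = exp (lnGam (M + 1 + z) - lnGam (M + 1) - lnGam (z + 1) + (z * ln N + M * ln N - (M + z) * ln (N + 1) - z * ln N))).
  { unfold rothe_term. fold M. fold z. rewrite <- Gam_fact. fold M. replace (M + z + 1) with (M + 1 + z) by ring.
    assert (Ew : rothe_var h N ^ m = exp (M * (ln N + - (1 + h) * ln (N + 1)))).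
    { unfold rothe_var, Rpower. rewrite (Rplus_comm 1 N). rewrite <- (exp_ln N) at 1 by auto. rewrite <- exp_plus.
      rewrite <- Rpower_pow by apply exp_pos. unfold Rpower. now rewrite ln_exp. }
    rewrite Ew. unfold Gam, Rdiv. rewrite <- !exp_Ropp, <- !exp_plus. f_equal. unfold z. ring. }
  rewrite ET. unfold phi. rewrite !Gz_eq by auto. rewrite <- !exp_plus.
  assert (Q1 : (M + z) * q <= z * lambda + z * / N).
  { replace (z * lambda + z * / N) with ((M + z) * / N) by (rewrite EM; field; lra). apply Rmult_le_compat_l; lra. }
  assert (Q2 : z * lambda - z * lambda * / N <= (M + z) * q).
  { apply Rle_trans with (M * / (N + 1)).
    - replace (M * / (N + 1)) with (z * lambda - z * lambda * / (N + 1)) by (rewrite EM; field; lra).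
      assert (/ (N + 1) <= / N) by (apply Rinv_le_contravar; lra).
      assert (0 <= z * lambda) by (apply Rmult_le_pos; lra). nra.
    - assert (0 < / (N + 1)) by (apply Rinv_0_lt_compat; lra). nra. }
  unfold q in Q1, Q2. split; apply exp_le.
  - rewrite LM in G1. nra.
  - assert (z * ln (M + 1 + z) <= z * (ln M + (1 + z) / M)) by (apply Rmult_le_compat_l; lra).
    replace (z * (ln M + (1 + z) / M)) with (z * ln M + h * (1 + z)) in H by (unfold z; field; lra).
    rewrite LM in H. assert (h * z <= / N * z) by (apply Rmult_le_compat_r; lra). unfold Rdiv. nra.
Qed.

(** Rothe's series times [h] is [(1 + 1 / N) / (lambda - 1)] and lies between Riemann sums
    of two neighbouring Laplace integrals. *)
Lemma L_bounds lambda N : 1 < lambda -> 0 < N ->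
  let v := lambda - 1 - ln lambda in
  (0 < v -> L (v + / N) <= exp 1 * / N + (1 + / N) / (lambda - 1)) /\
  (0 < v - (lambda + 1) / N -> (1 + / N) / (lambda - 1) <= / N + exp (/ N) * L (v - (lambda + 1) / N)).
Proof.
  intros Hl HN v. set (h := / (lambda * N)).
  assert (IN : 0 < / N) by now apply Rinv_0_lt_compat.
  assert (lN : 0 < lambda * N) by (apply Rmult_lt_0_compat; lra).
  assert (Hh : 0 < h) by now apply Rinv_0_lt_compat.
  assert (Hh1 : h <= / N) by (apply Rinv_le_contravar; nra).
  assert (HhN : h * N = / lambda) by (unfold h; field; lra).
  assert (Hil : / lambda < 1) by (rewrite <- Rinv_1; apply Rinv_lt_contravar; lra).
  destruct (rothe h N Hh HN ltac:(lra)) as [R1 R2].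
  set (F := (1 + N) / (1 - h * N)) in *.
  assert (EF : h * F = (1 + / N) / (lambda - 1)).
  { unfold F. rewrite HhN. unfold h. field. repeat split; lra. }
  assert (T0 : rothe_term h N 0 = 1).
  { unfold rothe_term. simpl. rewrite !Rmult_0_l, !Rplus_0_l, Gam_1. field. }
  assert (Sp : forall n, sum_f_R0 (rothe_term h N) (S n) = 1 + sum_f_R0 (fun j => rothe_term h N (S j)) n).
  { intros n. rewrite <- T0. rewrite (decomp_sum (rothe_term h N) (S n)) by lia. reflexivity. }
  split.
  - intros Hv. rewrite <- EF. eapply Rle_trans; [apply (riemann_upper (v + / N) h F); [lra|auto|]|].
    + intros n. apply Rle_trans with (sum_f_R0 (rothe_term h N) (S n)); auto. rewrite Sp.
      assert (sum_f_R0 (fun j => phi (v + / N) (INR (S j) * h)) n <= sum_f_R0 (fun j => rothe_term h N (S j)) n); [|lra].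
      apply sum_Rle. intros j _. apply (rothe_term_bounds lambda N (S j)); auto; lia.
    + assert (exp 1 * h <= exp 1 * / N) by (apply Rmult_le_compat_l; [left; apply exp_pos|auto]). lra.
  - intros Hv. rewrite <- EF. apply le_limit. intros e He.
    destruct (R2 (e / h)) as [n0 Hn0]; [now apply Rdiv_lt_0_compat|]. specialize (Hn0 (S n0) ltac:(lia)).
    rewrite Sp in Hn0.
    assert (A : sum_f_R0 (fun j => rothe_term h N (S j)) n0 <= exp h * sum_f_R0 (fun j => phi (v - (lambda + 1) / N) (INR (S j) * h)) n0).
    { rewrite scal_sum. apply sum_Rle. intros j _. rewrite Rmult_comm. apply (rothe_term_bounds lambda N (S j)); auto; lia. }
    assert (B := riemann_lower (v - (lambda + 1) / N) h n0 Hv Hh).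
    set (S0 := sum_f_R0 (fun j => phi (v - (lambda + 1) / N) (INR (S j) * h)) n0) in *.
    assert (Ph : 0 < exp h) by apply exp_pos.
    assert (Hn1 : h * (F - e / h) <= h * (1 + exp h * S0)) by (apply Rmult_le_compat_l; lra).
    replace (h * (F - e / h)) with (h * F - e) in Hn1 by (field; lra).
    assert (exp h * (h * S0) <= exp h * L (v - (lambda + 1) / N)) by (apply Rmult_le_compat_l; lra).
    assert (LP : 0 <= L (v - (lambda + 1) / N)).
    { apply (isI_pos (L_integrand (v - (lambda + 1) / N))); [apply L_integrand_cont|intros; apply L_integrand_pos|now apply L_isI]. }
    assert (exp h * L (v - (lambda + 1) / N) <= exp (/ N) * L (v - (lambda + 1) / N)) by (apply Rmult_le_compat_r; [auto|now apply exp_le]).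
    nra.
Qed.

Lemma excess_pos lambda : 1 < lambda -> 0 < lambda - 1 - ln lambda.
Proof.
  intros Hl. assert (lambda < exp (lambda - 1)); [|assert (ln lambda < lambda - 1); [|lra]].
  - assert (X := exp_ineq1 (lambda - 1) ltac:(lra)). lra.
  - rewrite <- (ln_exp (lambda - 1)). apply ln_increasing; lra.
Qed.
Lemma excess_incr l1 l2 : 1 < l1 -> l1 < l2 -> l1 - 1 - ln l1 < l2 - 1 - ln l2.
Proof.
  intros H1 H2. apply (strictly_increasing (fun l => l - 1 - ln l) (fun l => 1 - / l)); auto.
  - intros x Hx. auto_derive; [lra|]. ring.
  - intros x Hx. assert (/ x < 1) by (rewrite <- Rinv_1; apply Rinv_lt_contravar; lra). lra.
Qed.

Lemma large_N e : 0 < e -> exists N, 0 < N /\ / N <= e.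
Proof. intros He. exists (/ e). split; [now apply Rinv_0_lt_compat|]. rewrite Rinv_inv. lra. Qed.

(** The mesh is refined; the shifts of the argument are absorbed by comparison with
    neighbouring values of the parameter, [L] being monotone. *)
Theorem L_value lambda : 1 < lambda -> L (lambda - 1 - ln lambda) = / (lambda - 1).
Proof.
  intros Hl. assert (Hv := excess_pos lambda Hl). set (v := lambda - 1 - ln lambda) in *.
  assert (LP : 0 <= L v).
  { apply (isI_pos (L_integrand v)); [apply L_integrand_cont|intros; apply L_integrand_pos|now apply L_isI]. }
  assert (Up : forall l, 1 < l < lambda -> L v <= / (l - 1)).
  { intros l Hll. assert (Hd := excess_incr l lambda ltac:(lra) ltac:(lra)). assert (Hp := excess_pos l ltac:(lra)).
    fold v in Hd. set (w := l - 1 - ln l) in *. apply le_limit. intros e He.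
    set (K := exp 1 + / (l - 1)).
    assert (Il : 0 < / (l - 1)) by (apply Rinv_0_lt_compat; lra).
    assert (HK : 0 < K) by (unfold K; generalize (exp_pos 1); lra).
    destruct (large_N (Rmin (v - w) (e / K))) as (N & HN & HNe); [apply Rmin_pos; [lra|now apply Rdiv_lt_0_compat]|].
    assert (m1 := Rmin_l (v - w) (e / K)). assert (m2 := Rmin_r (v - w) (e / K)).
    destruct (L_bounds l N ltac:(lra) HN) as [B _]. fold w in B. specialize (B Hp).
    assert (IN : 0 < / N) by now apply Rinv_0_lt_compat.
    assert (D := L_decr (w + / N) v ltac:(lra) ltac:(lra)).
    assert (/ N * K <= e).
    { apply Rle_trans with (e / K * K); [apply Rmult_le_compat_r; lra|]. right; field; lra. }
    unfold K in H. unfold Rdiv in B. lra. }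
  assert (Low : forall l, lambda < l -> / (l - 1) <= L v).
  { intros l Hll. assert (Hd := excess_incr lambda l ltac:(lra) ltac:(lra)).
    fold v in Hd. set (w := l - 1 - ln l) in *. apply le_limit. intros e He.
    set (K := 1 + exp 1 * L v).
    assert (HK : 0 < K) by (unfold K; generalize (exp_pos 1); nra).
    destruct (large_N (Rmin ((w - v) / (l + 1)) (Rmin 1 (e / K)))) as (N & HN & HNe).
    { repeat apply Rmin_pos; try lra; apply Rdiv_lt_0_compat; lra. }
    assert (m1 := Rmin_l ((w - v) / (l + 1)) (Rmin 1 (e / K))). assert (m2 := Rmin_r ((w - v) / (l + 1)) (Rmin 1 (e / K))).
    assert (m3 := Rmin_l 1 (e / K)). assert (m4 := Rmin_r 1 (e / K)).
    assert (IN : 0 < / N) by now apply Rinv_0_lt_compat.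
    assert (HN2 : (l + 1) / N <= w - v).
    { apply Rle_trans with ((l + 1) * ((w - v) / (l + 1))); [apply Rmult_le_compat_l; lra|]. right; field; lra. }
    destruct (L_bounds l N ltac:(lra) HN) as [_ B]. fold w in B. specialize (B ltac:(lra)).
    assert (D := L_decr v (w - (l + 1) / N) ltac:(lra) ltac:(lra)).
    assert (H : / N * K <= e).
    { apply Rle_trans with (e / K * K); [apply Rmult_le_compat_r; lra|]. right; field; lra. }
    (* the mean value theorem on the unit interval *)
    assert (X : exp (/ N) <= 1 + exp 1 * / N).
    { destruct (MVT_cor2 exp exp 0 (/ N) IN) as (c & E & Hc); [intros; apply derivable_pt_lim_exp|].
      rewrite exp_0 in E. assert (exp c <= exp 1) by (apply exp_le; lra). nra. }
    assert (X2 : exp (/ N) * L (w - (l + 1) / N) <= (1 + exp 1 * / N) * L v).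
    { assert (0 <= L (w - (l + 1) / N)).
      { apply (isI_pos (L_integrand (w - (l + 1) / N))); [apply L_integrand_cont|intros; apply L_integrand_pos|apply L_isI; lra]. }
      apply Rmult_le_compat; auto. left; apply exp_pos. }
    assert (0 < / (l - 1)) by (apply Rinv_0_lt_compat; lra).
    unfold K in H. unfold Rdiv in B. nra. }
  assert (Il : 0 < / (lambda - 1)) by (apply Rinv_0_lt_compat; lra).
  apply Rle_antisym.
  - apply Rnot_lt_le. intros H.
    (* a parameter for which the bound is the mean of the two sides *)
    set (m := (L v + / (lambda - 1)) / 2). assert (Hm : / (lambda - 1) < m < L v) by (unfold m; lra).
    assert (Im : 0 < / m) by (apply Rinv_0_lt_compat; lra).
    assert (/ m < lambda - 1) by (rewrite <- (Rinv_inv (lambda - 1)); apply Rinv_lt_contravar; nra).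
    specialize (Up (1 + / m) ltac:(lra)). replace (1 + / m - 1) with (/ m) in Up by ring. rewrite Rinv_inv in Up. lra.
  - apply Rnot_lt_le. intros H.
    set (m := (L v + / (lambda - 1)) / 2). assert (Hm : L v < m < / (lambda - 1)) by (unfold m; lra).
    assert (lambda - 1 < / m) by (rewrite <- (Rinv_inv (lambda - 1)); apply Rinv_lt_contravar; nra).
    specialize (Low (1 + / m) ltac:(lra)). replace (1 + / m - 1) with (/ m) in Low by ring. rewrite Rinv_inv in Low. lra.
Qed.
(** * The coefficients and their expansion *)

Lemma E1_ge_exp t : t <= 0 -> exp t <= E1 t.
Proof.
  intros Ht. replace (exp t) with (RInt (fun _ => exp t) 0 1) by (rewrite RI_const; rring).
  apply RI_le; [ct|apply (wexp_cont (fun _ => 1)), cont_weight1|lra|]. intros s Hs.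
  rewrite Rmult_1_l. apply exp_le. nra.
Qed.

(** [b_base lambda t / (lambda - 1)], without the singularity at [0]. *)
Definition b_psi (lambda t : R) : R := / (lambda * E1 t - 1).

Definition b_dom (lambda t : R) : Prop := - ln lambda < t.
Lemma b_dom_exp lambda t : 1 < lambda -> b_dom lambda t -> 1 < lambda * exp t.
Proof.
  intros Hl Ht. unfold b_dom in Ht. rewrite <- (exp_ln lambda) at 1 by lra. rewrite <- exp_plus, <- exp_0. apply exp_increasing. lra.
Qed.
Lemma b_dom_E1 lambda t : 1 < lambda -> b_dom lambda t -> 0 < lambda * E1 t - 1.
Proof.
  intros Hl Ht. destruct (Rle_lt_dec 0 t) as [H|H].
  - assert (G := E1_ge t H). nra.
  - assert (G := E1_ge_exp t ltac:(lra)). assert (X := b_dom_exp lambda t Hl Ht). nra.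
Qed.
Lemma b_dom_0 lambda : 1 < lambda -> b_dom lambda 0.
Proof. intros Hl. unfold b_dom. rewrite <- (Ropp_0), <- ln_1. apply Ropp_lt_contravar, ln_increasing; lra. Qed.

Lemma b_base_eq lambda t : 1 < lambda -> b_dom lambda t -> b_base lambda t = (lambda - 1) * b_psi lambda t.
Proof.
  intros Hl Ht. assert (P := b_dom_E1 lambda t Hl Ht). unfold b_base, b_psi. destruct (Req_EM_T t 0) as [->|H0].
  - assert (F := E1_0).
    rewrite F, Rmult_1_r. field. lra.
  - replace (lambda * exp t - t - lambda) with (t * (lambda * E1 t - 1)).
    + field. split; lra.
    + assert (E := E1_eq t). replace (t * (lambda * E1 t - 1)) with (lambda * (t * E1 t) - t) by ring. rewrite E. ring.
Qed.

(** The inverse [T] of [t / b_psi t] satisfies [T' (u) = 1 / (lambda exp (T u) - 1)], which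
    is a value of [L] at a point that moves linearly with [u]. *)
Theorem b_Phi_moment lambda n : 1 < lambda ->
  b n lambda = (lambda - 1) ^ (2 * n + 1) * (gauss_norm * Phi_moment n (lambda - ln lambda - 1)).
Proof.
  intros Hl. set (c := lambda - ln lambda - 1).
  assert (Hc : 0 < c) by (generalize (excess_pos lambda Hl); unfold c; lra).
  set (D := b_dom lambda).
  assert (OD : openD D).
  { intros x Hx. unfold D, b_dom in *. assert (P : 0 < x + ln lambda) by lra. exists (mkposreal _ P). intros y Hy.
    change (Rabs (y - x) < x + ln lambda) in Hy. apply Rabs_lt_between in Hy. lra. }
  assert (D0 : D 0) by now apply b_dom_0.
  assert (CD : forall x y z, D x -> D y -> x <= z <= y -> D z) by (unfold D, b_dom; intros; lra).
  set (f := fun t => lambda * (exp t - 1) - t). set (f' := fun t => lambda * exp t - 1).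
  assert (Df : forall x, D x -> is_derive f x (f' x)) by (intros; unfold f, f'; auto_derive; auto; ring).
  assert (Pf : forall x, D x -> 0 < f' x) by (intros x Hx; generalize (b_dom_exp lambda x Hl Hx); unfold f'; lra).
  assert (Sf : smooth D f').
  { intros m. apply Cn_minus; [|apply Cn_const]. apply Cn_mult; [apply Cn_const|]. apply Cn_exp, Cn_id. }
  destruct (inverse_function D f f' CD OD Df Pf Sf) as (T & Im & OI & CI & H1 & H2 & ST).
  assert (I0 : Im 0).
  { destruct (H1 0 D0) as [H _]. replace (f 0) with 0 in H by (unfold f; rewrite exp_0; ring). auto. }
  assert (Sp : smooth D (b_psi lambda)).
  { intros m. apply Cn_inv.
    - apply Cn_minus; [|apply Cn_const]. apply Cn_mult; [apply Cn_const|].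
      apply (Cn_sub D full); [intros; exact Logic.I|apply wexp_smooth, cont_weight1].
    - intros x Hx. apply Rgt_not_eq. now apply b_dom_E1. }
  assert (Np : forall t, D t -> b_psi lambda t <> 0).
  { intros t Ht. apply Rgt_not_eq, Rinv_0_lt_compat. now apply b_dom_E1. }
  assert (SD : starD D).
  { intros x t Hx Ht. unfold D, b_dom in *. unfold D, b_dom in D0. destruct (Rle_lt_dec 0 x); nra. }
  assert (HT : forall u, Im u -> D (T u) /\ T u = u * b_psi lambda (T u)).
  { intros u Hu. destruct (H2 u Hu) as (DT & ET & _). split; auto. unfold b_psi.
    assert (P := b_dom_E1 lambda (T u) Hl DT). rewrite <- ET at 2. unfold f.
    rewrite <- E1_eq. field. lra. }
  assert (LI := lagrange_inversion D Im (b_psi lambda) T OD SD D0 OI I0 Sp Np ST HT n (fun _ => 1) (fun m => Cn_const D m 1)).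
  assert (EL : Derive_n (fun u => 1 * Derive T u) n 0 = (-1) ^ n * (gauss_norm * Phi_moment n c)).
  { rewrite (Dn_ext_open Im _ (fun u => L (u + c)) n 0 OI I0).
    - rewrite (Derive_n_comp_trans L n 0 c). rewrite Rplus_0_l. unfold L. rewrite Derive_n_scal_l, Phi_moment_Dn by auto. ring.
    - intros u Hu. destruct (H2 u Hu) as (DT & ET & DerT). rewrite (is_derive_unique _ _ _ DerT), Rmult_1_l.
      assert (P := b_dom_exp lambda (T u) Hl DT). assert (V := L_value (lambda * exp (T u)) P).
      unfold f'. rewrite <- V. f_equal. rewrite ln_mult, ln_exp by (try apply exp_pos; lra).
      unfold f in ET. unfold c. lra. }
  unfold b. rewrite (Dn_ext_open D _ (fun t => (lambda - 1) ^ (n + 1) * (1 * b_psi lambda t ^ (n + 1))) n 0 OD D0).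
  - rewrite Derive_n_scal_l, <- LI, EL.
    replace ((-1) ^ n * (lambda - 1) ^ n * ((lambda - 1) ^ (n + 1) * ((-1) ^ n * (gauss_norm * Phi_moment n c))))
      with (((-1) ^ n * (-1) ^ n) * ((lambda - 1) ^ n * (lambda - 1) ^ (n + 1)) * (gauss_norm * Phi_moment n c)) by ring.
    rewrite <- Rpow_mult_distr, <- pow_add. replace (-1 * -1) with 1 by ring. rewrite pow1.
    replace (n + (n + 1))%nat with (2 * n + 1)%nat by lia. ring.
  - intros t Ht. rewrite b_base_eq by auto. rewrite Rpow_mult_distr. ring.
Qed.

(** The value of [gauss_moment]. *)
Definition moment (c : R) (m : nat) : R := half_gamma m / (2 * c ^ m * sqrt c).

(** The bound for [exp (- mu z)] at [z = x^2], integrated against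
    [x ^ (2 n) * exp (- c x^2)]; the negative powers of [x] are absorbed because
    [j + 2 <= n]. *)
Theorem Phi_moment_bound n j c : 0 < c -> (j + 2 <= n)%nat ->
  Rabs (Phi_moment n c - sum_f_R0 (fun i => (-1) ^ i * stirling_coef i * moment c (n - i)) j)
  <= Rabs (stirling_coef (S j)) * moment c (n - S j) + Rabs (stirling_coef (S (S j))) * moment c (n - S (S j)).
Proof.
  intros Hc Hj.
  set (w := fun x => exp (- (c * x ^ 2))). assert (Cw : cont w) by (unfold w; ct).
  set (mo := fun m x => x ^ (2 * m) * w x).
  assert (Cm : forall m, cont (mo m)) by (intros; unfold mo; ct).
  assert (Hm : forall m, isI (mo m) (moment c m)) by (intros; now apply gauss_moment).
  set (f := fun i x => (-1) ^ i * stirling_coef i * mo (n - i)%nat x).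
  assert (Cf : forall i, cont (f i)) by (intros i; specialize (Cm (n - i)%nat); unfold f; ct).
  assert (HS := isI_sum f (fun i => (-1) ^ i * stirling_coef i * moment c (n - i)) j Cf (fun i => isI_scal _ _ _ (Cm _) (Hm _))).
  assert (HD := isI_minus _ _ _ _ (Phi_moment_cont n c) (cont_sum f j Cf) (Phi_moment_isI n c Hc) HS).
  assert (C1 := Cm (n - S j)%nat). assert (C2 := Cm (n - S (S j))%nat).
  set (a1 := Rabs (stirling_coef (S j))). set (a2 := Rabs (stirling_coef (S (S j)))).
  assert (HB : isI (fun x => a1 * mo (n - S j)%nat x + a2 * mo (n - S (S j))%nat x)
                   (a1 * moment c (n - S j) + a2 * moment c (n - S (S j)))).
  { apply isI_plus; [ct|ct|now apply isI_scal|now apply isI_scal]. }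
  assert (Csum := cont_sum f j Cf).
  assert (CB : cont (fun x => a1 * mo (n - S j)%nat x + a2 * mo (n - S (S j))%nat x)) by ct.
  set (d := fun x => x ^ (2 * n) * Phi x * exp (- (c * x ^ 2)) - sum_f_R0 (fun i => f i x) j).
  assert (Cd : cont d) by (apply (cont_minus _ _ (Phi_moment_cont n c) Csum)).
  assert (Dom : forall x, 0 < x -> Rabs (d x) <= a1 * mo (n - S j)%nat x + a2 * mo (n - S (S j))%nat x).
  { intros x Hx. assert (Px : forall m, 0 < x ^ m) by (intros; now apply pow_lt).
    assert (Pow : forall i, (i <= n)%nat -> x ^ (2 * n) / (x ^ 2) ^ i = x ^ (2 * (n - i))).
    { intros i Hi. rewrite <- pow_mult. replace (2 * n)%nat with (2 * (n - i) + 2 * i)%nat by lia.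
      rewrite pow_add. field. apply Rgt_not_eq, Px. }
    assert (SB := stirling_bound (-1) j (x ^ 2) (Px 2%nat) (or_intror eq_refl)).
    replace (-1 * mu (x ^ 2)) with (- mu (x ^ 2)) in SB by ring. rewrite <- Phi_pos_eq in SB by auto.
    fold a1 a2 in SB.
    assert (Wx : 0 < w x) by apply exp_pos.
    assert (ES : sum_f_R0 (fun i => f i x) j = x ^ (2 * n) * w x * stirling (-1) j (x ^ 2)).
    { unfold stirling. rewrite scal_sum. apply sum_eq. intros i Hi. unfold f, mo. rewrite <- Pow by lia. unfold Rdiv. ring. }
    unfold d. rewrite ES. fold (w x). replace (x ^ (2 * n) * Phi x * w x - x ^ (2 * n) * w x * stirling (-1) j (x ^ 2))
        with (x ^ (2 * n) * w x * (Phi x - stirling (-1) j (x ^ 2))) by ring.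
      assert (0 < x ^ (2 * n) * w x) by (apply Rmult_lt_0_compat; auto).
      rewrite Rabs_mult, (Rabs_right (x ^ (2 * n) * w x)) by lra.
      eapply Rle_trans; [apply Rmult_le_compat_l; [lra|exact SB]|]. right. unfold mo.
      rewrite <- !Pow by lia. unfold Rdiv. ring. }
  destruct (isI_dom d _ _ Cd CB Dom HB) as (l & Hl & Bl).
  now rewrite (isI_unique _ _ _ HD Hl).
Qed.

Lemma gauss_norm_eq : gauss_norm * sqrt (2 * PI) = 2.
Proof.
  assert (P := twopi_pos). unfold gauss_norm.
  assert (S : sqrt (2 * PI) = exp (ln (2 * PI) / 2)).
  { apply sqrt_lem_1; [lra|left; apply exp_pos|]. rewrite <- exp_plus.
    replace (ln (2 * PI) / 2 + ln (2 * PI) / 2) with (ln (2 * PI)) by field. now apply exp_ln. }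
  rewrite S, Rmult_assoc, <- exp_plus. replace (- (ln (2 * PI) / 2) + ln (2 * PI) / 2) with 0 by ring. rewrite exp_0. ring.
Qed.
Lemma Gamma_half n : Gamma (INR n + 1 / 2) = half_gamma n.
Proof. rewrite Gamma_Gam by (generalize (pos_INR n); lra). apply Gam_half_gamma. Qed.

Theorem mainTheorem9 (lambda : R) (n K : nat)
  (hlambda : 1 < lambda) (hn : (2 <= n)%nat)
  (hK1 : (1 <= K)%nat) (hKn : (K <= n - 1)%nat) :
  exists A : R,
    b n lambda =
      Gamma (INR n + 1 / 2) * (lambda - 1) ^ (2 * n + 1) /
      (sqrt (2 * PI * (lambda - ln lambda - 1)) * (lambda - ln lambda - 1) ^ n) *
      (sum_n (fun k : nat =>
                (-1) ^ k * (lambda - ln lambda - 1) ^ k * a (2 * k) *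
                (Gamma (INR n - INR k + 1 / 2) / Gamma (INR n + 1 / 2))) (K - 1)
       + A) /\
    Rabs A <=
      (lambda - ln lambda - 1) ^ K * Rabs (a (2 * K)) *
        (Gamma (INR n - INR K + 1 / 2) / Gamma (INR n + 1 / 2)) +
      (lambda - ln lambda - 1) ^ (K + 1) * Rabs (a (2 * K + 2)) *
        (Gamma (INR n - INR K - 1 / 2) / Gamma (INR n + 1 / 2)).
Proof.
  set (c := lambda - ln lambda - 1).
  assert (Hc : 0 < c) by (generalize (excess_pos lambda hlambda); unfold c; lra).
  assert (Ga : forall k, (k <= n)%nat -> Gamma (INR n - INR k + 1 / 2) = half_gamma (n - k)).
  { intros k Hk. rewrite <- minus_INR by auto. apply Gamma_half. }
  assert (G0 := Gamma_half n).
  assert (G1 : Gamma (INR n - INR K - 1 / 2) = half_gamma (n - S K)).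
  { rewrite <- Ga by lia. f_equal. rewrite S_INR. field. }
  set (W := sum_n _ (K - 1)).
  assert (Gp := half_gamma_pos n). assert (Sc : 0 < sqrt c) by now apply sqrt_lt_R0.
  assert (Cn0 : forall i, 0 < c ^ i) by (intros; now apply pow_lt).
  assert (Pl : 0 < (lambda - 1) ^ (2 * n + 1)) by (apply pow_lt; lra).
  assert (Tp : 0 < sqrt (2 * PI)) by (apply sqrt_lt_R0, twopi_pos).
  (* the factor that turns the integral into the normalized coefficient *)
  set (s := 2 * sqrt c * c ^ n / half_gamma n).
  assert (Hs : 0 < s) by (unfold s; apply Rdiv_lt_0_compat; auto; repeat apply Rmult_lt_0_compat; auto; lra).
  assert (Mom : forall i, (i <= n)%nat -> s * moment c (n - i) = c ^ i * (half_gamma (n - i) / half_gamma n)).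
  { intros i Hi. unfold s, moment. replace (c ^ n) with (c ^ (n - i) * c ^ i) by (rewrite <- pow_add; f_equal; lia).
    generalize (Cn0 (n - i)%nat). intros. field. repeat split; lra. }
  assert (HW : W = s * sum_f_R0 (fun i => (-1) ^ i * stirling_coef i * moment c (n - i)) (K - 1)).
  { unfold W. rewrite sum_n_Reals, scal_sum. apply sum_eq. intros i Hi.
    rewrite G0, Ga, a_even, <- stirling_saddle_coef by lia. generalize (Mom i ltac:(lia)). intros M.
    replace ((-1) ^ i * c ^ i * stirling_coef i * (half_gamma (n - i) / half_gamma n)) with ((-1) ^ i * stirling_coef i * (c ^ i * (half_gamma (n - i) / half_gamma n))) by ring.
    rewrite <- M. ring. }
  exists (s * Phi_moment n c - W). split.
  - rewrite b_Phi_moment by auto. fold c. rewrite G0, sqrt_mult by (try apply Rlt_le, twopi_pos; lra).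
    replace (W + (s * Phi_moment n c - W)) with (s * Phi_moment n c) by ring. unfold s.
    replace gauss_norm with (2 / sqrt (2 * PI)) by (apply Rmult_eq_reg_r with (sqrt (2 * PI)); [rewrite gauss_norm_eq; field|]; lra).
    generalize (Cn0 n). intros. field. repeat split; lra.
  - rewrite HW, <- Rmult_minus_distr_l, Rabs_mult, (Rabs_right s) by lra.
    assert (B := Phi_moment_bound n (K - 1) c Hc ltac:(lia)).
    replace (S (K - 1)) with K in B by lia.
    apply Rmult_le_compat_l with (r := s) in B; [|lra]. eapply Rle_trans; [exact B|]. right.
    rewrite G0, G1, Ga by lia. replace (2 * K + 2)%nat with (2 * S K)%nat by lia. rewrite !a_even, <- !stirling_saddle_coef.
    rewrite Rmult_plus_distr_l. replace (K + 1)%nat with (S K) by lia.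
    replace (s * (Rabs (stirling_coef K) * moment c (n - K))) with (Rabs (stirling_coef K) * (s * moment c (n - K))) by ring.
    replace (s * (Rabs (stirling_coef (S K)) * moment c (n - S K))) with (Rabs (stirling_coef (S K)) * (s * moment c (n - S K))) by ring.
    rewrite !Mom by lia. ring.
Qed.
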